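(* For each of the groups $G$ below, every admissible value of the parameters, every listed value $\bar t$, and every lattice $\Gamma=\Gamma_{\bar t}$ in $G$ (in the sense of the context), the following hold. (A) The solvmanifold $G/\Gamma$ is formal for (1) $G=G_{6.8}^{p=0}$, $\bar t\in\{2\pi,\pi,\frac{\pi}{2},\frac{\pi}{3}\}$; (2) $G=G_{6.11}^{p=0}$, $\bar t\in\{2\pi,\pi,\frac{\pi}{2},\frac{\pi}{3}\}$; (3) $G=G_{5.17}^{p,-p,r}\times\mathbb{R}$ with $p\in\mathbb{R}$, $r\in\mathbb{Q}\setminus\{0\}$, where either $\bar t=2\pi r_2$ with $r=\frac{r_1}{r_2}$ ($r_1,r_2$ integers, $r_2>0$); or $r$ is an integer and $\bar t=\pi$; or $r$ is an integer and $\bar t=\frac{\pi}{2}$ (where $p=0$ if $r$ is even); (4) $G=G_{3.5}^{0}\times\mathbb{R}^3$, $\bar t\in\{2\pi,\pi,\frac{\pi}{2},\frac{\pi}{3}\}$. (B) The solvmanifold $G/\Gamma$ is not formal for (5) $G=G_{6.10}^{a=0}$, $\bar t\in\{2\pi,\pi,\frac{\pi}{2},\frac{\pi}{3}\}$; (6) $G=G_{5.14}^{0}\times\mathbb{R}$, $\bar t\in\{2\pi,\pi,\frac{\pi}{2},\frac{\pi}{3}\}$; (7) $G=G_{5.18}^{0}\times\mathbb{R}$, $\bar t\in\{2\pi,\pi,\frac{\pi}{2},\frac{\pi}{3}\}$.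
   Context: A solvmanifold is a compact quotient $G/\Gamma$ of a connected and simply connected solvable Lie group $G$ by a lattice (discrete cocompact subgroup) $\Gamma$. Groups. Each group $G$ is the connected and simply connected six-dimensional Lie group whose Lie algebra has basis $X_1,\dots,X_6$ and the following nonzero brackets (up to antisymmetry); $X_*$ denotes the indicated basis vector, and the other five basis vectors span an abelian ideal $\mathbb{R}^5$. - $G_{6.8}^{p=0}$, $X_*=X_6$: $[X_1,X_6]=aX_1$, $[X_2,X_6]=bX_2$, $[X_3,X_6]=cX_3$, $[X_4,X_6]=-X_5$, $[X_5,X_6]=X_4$, with real $a,b,c$, $a+b+c=0$, $0<|c|\le|b|\le|a|$. - $G_{6.10}^{a=0}$, $X_*=X_6$: $[X_2,X_6]=X_1$, $[X_3,X_6]=X_2$, $[X_4,X_6]=-X_5$, $[X_5,X_6]=X_4$. - $G_{6.11}^{p=0}$, $X_*=X_6$: $[X_1,X_6]=aX_1$, $[X_2,X_6]=-X_3$, $[X_3,X_6]=X_2$, $[X_4,X_6]=qX_4-sX_5$, $[X_5,X_6]=sX_4+qX_5$, with real $a,q,s$, $a+2q=0$, $as\ne0$, $s$ irrational. - $G_{5.14}^{0}\times\mathbb{R}$, $X_*=X_5$: $[X_2,X_5]=X_1$, $[X_3,X_5]=-X_4$, $[X_4,X_5]=X_3$. - $G_{5.17}^{p,-p,r}\times\mathbb{R}$, $X_*=X_5$: $[X_1,X_5]=pX_1-X_2$, $[X_2,X_5]=X_1+pX_2$, $[X_3,X_5]=-pX_3-rX_4$, $[X_4,X_5]=rX_3-pX_4$,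 with $r\neq0$. - $G_{5.18}^{0}\times\mathbb{R}$, $X_*=X_5$: $[X_1,X_5]=-X_2$, $[X_2,X_5]=X_1$, $[X_3,X_5]=X_1-X_4$, $[X_4,X_5]=X_2+X_3$. - $G_{3.5}^{0}\times\mathbb{R}^3$, $X_*=X_3$: $[X_1,X_3]=-X_2$, $[X_2,X_3]=X_1$. Lattices. Let $B:\mathbb{R}^5\to\mathbb{R}^5$ be $B(X)=[X,X_*]$ and $\varphi(t)=\exp(tB)$. Then $G=\mathbb{R}\ltimes_\varphi\mathbb{R}^5$, with product $(t,x)(t',x')=(t+t',x+\varphi(t)x')$. For $\bar t\neq0$, $\Gamma_{\bar t}$ denotes a lattice $\bar t\,\mathbb{Z}\ltimes_\varphi\Lambda$, where $\Lambda\subset\mathbb{R}^5$ is a lattice with $\varphi(\bar t)\Lambda=\Lambda$. Such a $\Lambda$ exists if and only if $\varphi(\bar t)$ is conjugate to an integer matrix. The parameters are called admissible for $\bar t$ when they satisfy the constraints above and such a $\Lambda$ exists. Formality. A manifold is formal if its (Sullivan) minimal model $\mathcal{M}$ over $\mathbb{R}$ is formal, i.e. there is a morphism of commutative differential graded algebras $\psi:\mathcal{M}\to (H^*(\mathcal{M}),0)$ inducing the identity in cohomology. *)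

(* Defs.v *)
From HB Require Import structures.
From mathcomp Require Import all_boot all_order all_algebra.
From mathcomp Require Import all_classical all_reals all_analysis.
Import Order.TTheory GRing.Theory Num.Theory numFieldNormedType.Exports.

Set Implicit Arguments.
Unset Strict Implicit.
Unset Printing Implicit Defensive.

Local Open Scope classical_set_scope.
Local Open Scope ring_scope.
Local Open Scope quotient_scope.

Section QuotientModule.
Variables (K : fieldType) (V : lmodType K).

Inductive lspan (S : set V) : V -> Prop :=
| lspan0 : lspan S 0
| lspanD (a : K) (x y : V) : S x -> lspan S y -> lspan S (a *: x + y).

Definition in_lspan (S : set V) : {pred V} := [pred x | `[< lspan S x >]].

Variable S : set V.

Let lspan_add x y : lspan S x -> lspan S y -> lspan S (x + y).
Proof.
move=> + Sy; elim=> [|a u v Su _ IH]; first by rewrite add0r.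
by rewrite -addrA; apply: lspanD.
Qed.

Let lspan_scale a x : lspan S x -> lspan S (a *: x).
Proof.
elim=> [|b u v Su _ IH]; first by rewrite scaler0; apply: lspan0.
by rewrite scalerDr scalerA; apply: lspanD.
Qed.

Let in_lspan_zmod_closed : zmod_closed (in_lspan S).
Proof.
split; first by apply/asboolP; apply: lspan0.
move=> x y /asboolP Sx /asboolP Sy; apply/asboolP.
by rewrite -scaleN1r; apply: lspan_add => //; apply: lspan_scale.
Qed.

HB.instance Definition _ :=
  GRing.isZmodClosed.Build V (in_lspan S) in_lspan_zmod_closed.

Definition quotmod : Type := Quotient.quot (in_lspan S).

HB.instance Definition _ := GRing.Zmodule.on quotmod.
HB.instance Definition _ : EqQuotient V (Quotient.equiv (in_lspan S)) quotmod :=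
  EqQuotient.on quotmod.

Definition class_of (x : V) : quotmod := \pi x.

Lemma class_ofE x y : class_of x = class_of y <-> lspan S (x - y).
Proof.
split=> [/eqP|h]; first by rewrite piE Quotient.equivE => /asboolP.
by apply/eqP; rewrite piE Quotient.equivE; apply/asboolP.
Qed.

Lemma class_ofD x y : class_of (x + y) = class_of x + class_of y.
Proof. exact: Quotient.pi_add. Qed.

Definition quot_scale (a : K) (u : quotmod) : quotmod := class_of (a *: repr u).

Lemma quot_scaleE a x : quot_scale a (class_of x) = class_of (a *: x).
Proof.
apply/class_ofE; rewrite -scalerBr; apply: lspan_scale; apply/class_ofE.
exact: reprK.
Qed.

Let class_of_surj (u : quotmod) : u = class_of (repr u).
Proof. by rewrite /class_of reprK. Qed.

Let quot_scaleA a b u : quot_scale a (quot_scale b u) = quot_scale (a * b) u.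
Proof. by rewrite (class_of_surj u) !quot_scaleE scalerA. Qed.

Let quot_scale1 : left_id 1 quot_scale.
Proof. by move=> u; rewrite (class_of_surj u) quot_scaleE scale1r. Qed.

Let quot_scaleDr : right_distributive quot_scale +%R.
Proof.
move=> a u v; rewrite (class_of_surj u) (class_of_surj v).
by rewrite -class_ofD !quot_scaleE scalerDr class_ofD.
Qed.

Let quot_scaleDl u : {morph quot_scale^~ u : a b / a + b}.
Proof.
by move=> a b; rewrite (class_of_surj u) !quot_scaleE scalerDl class_ofD.
Qed.

HB.instance Definition _ := GRing.Zmodule_isLmodule.Build K quotmod
  quot_scaleA quot_scale1 quot_scaleDr quot_scaleDl.

Lemma class_of_linear : linear class_of.
Proof. by move=> a x y; rewrite class_ofD -quot_scaleE. Qed.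

End QuotientModule.

Section CDGA.
Variable K : fieldType.

(** The operations of a differential graded algebra, without axioms; [dghom n] is
    the subspace of elements of degree [n].  The algebra described is the sum of
    the [dghom n], which may be smaller than the ambient space: [deRham] below is
    carried by a space containing non-smooth forms. *)
Record dgdata := DGData {
  dgcar :> lmodType K;
  dghom : nat -> set dgcar;
  dgone : dgcar;
  dgmul : dgcar -> dgcar -> dgcar;
  dgdiff : dgcar -> dgcar
}.

(** Here the ambient space has to be the direct sum of the [dghom n]. *)
Record is_graded (A : dgdata) : Prop := IsGraded {
  hom0 : forall n, @dghom A n 0;
  homD : forall n (a : K) x y, @dghom A n x -> dghom n y -> dghom n (a *: x + y);
  hom_span : forall x : A, exists (n : nat) (c : nat -> A),
    (forall i, dghom i (c i)) /\ x = \sum_(i < n) c i;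
  hom_direct : forall (n : nat) (c : nat -> A), (forall i, dghom i (c i)) ->
    \sum_(i < n) c i = 0 -> forall i, (i < n)%N -> c i = 0
}.

Record is_cga (A : dgdata) : Prop := IsCGA {
  cga_graded : is_graded A;
  cga_one : dghom 0 (dgone A);
  cga_mul : forall p q (x y : A), dghom p x -> dghom q y -> dghom (p + q) (dgmul x y);
  cga_linl : forall y : A, linear (fun x => dgmul x y);
  cga_linr : forall x : A, linear (dgmul x);
  cga_assoc : forall x y z : A, dgmul x (dgmul y z) = dgmul (dgmul x y) z;
  cga_mul1 : forall x : A, dgmul (dgone A) x = x;
  cga_comm : forall p q (x y : A), dghom p x -> dghom q y ->
    dgmul x y = (-1) ^+ (p * q) *: dgmul y x
}.

Record is_cdga (A : dgdata) : Prop := IsCDGA {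
  cdga_cga : is_cga A;
  cdga_lin : linear (@dgdiff A);
  cdga_deg : forall n (x : A), dghom n x -> dghom n.+1 (dgdiff x);
  cdga_dd : forall x : A, dgdiff (dgdiff x) = 0;
  cdga_leibniz : forall p (x y : A), dghom p x ->
    dgdiff (dgmul x y) = dgmul (dgdiff x) y + (-1) ^+ p *: dgmul x (dgdiff y)
}.

Record alg_morphism (A B : dgdata) (f : A -> B) : Prop := AlgMorphism {
  mor_lin : linear f;
  mor_hom : forall n x, dghom n x -> dghom n (f x);
  mor_one : f (dgone A) = dgone B;
  mor_mul : forall x y, f (dgmul x y) = dgmul (f x) (f y)
}.

Definition dg_morphism (A B : dgdata) (f : A -> B) : Prop :=
  alg_morphism f /\ forall x, f (dgdiff x) = dgdiff (f x).

Definition cocycle (A : dgdata) (n : nat) : set A :=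
  [set z | dghom n z /\ dgdiff z = 0].

Definition coboundary (A : dgdata) (n : nat) : set A :=
  if n is m.+1 then @dgdiff A @` dghom m else [set 0].

(** [f] induces a bijection [H^n A -> H^n B] for every [n]. *)
Definition quasi_iso (A B : dgdata) (f : A -> B) : Prop :=
  forall n,
    (forall z, cocycle n z -> coboundary n (f z) -> coboundary n z) /\
    (forall w, cocycle n w -> exists2 z, cocycle n z & coboundary n (w - f z)).

(** [(H^* A, 0)].  Its ambient space is the quotient of all of [A] by the
    coboundaries, and its elements are the classes of cocycles. *)
Definition cohomology (A : dgdata) : dgdata :=
  let cls := @class_of K A (\bigcup_n @coboundary A n) in
  @DGData (quotmod (\bigcup_n @coboundary A n))
    (fun n => cls @` cocycle n)
    (cls (dgone A))
    (fun u v => cls (dgmul (repr u) (repr v)))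
    (fun _ => 0).

Definition coh_class (A : dgdata) (z : A) : cohomology A :=
  class_of (\bigcup_n @coboundary A n) z.

Definition well_order (I : Type) (lt : I -> I -> Prop) : Prop :=
  [/\ well_founded lt,
      forall i j k, lt i j -> lt j k -> lt i k &
      forall i j, [\/ lt i j, i = j | lt j i]].

(** [A], without its differential, is the free graded-commutative algebra
    on the generators [a i] of degree [deg i]. *)
Definition free_cga_on (A : dgdata) (I : Type) (deg : I -> nat) (a : I -> A) :
    Prop :=
  [/\ is_cga A, forall i, dghom (deg i) (a i) &
      forall B : dgdata, is_cga B ->
      forall b : I -> B, (forall i, dghom (deg i) (b i)) ->
      exists! f : A -> B, alg_morphism f /\ forall i, f (a i) = b i].

Inductive subalg (A : dgdata) (S : set A) : A -> Prop :=
| subalg_gen x : S x -> subalg S x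
| subalg_one : subalg S (dgone A)
| subalg_lin (c : K) x y : subalg S x -> subalg S y -> subalg S (c *: x + y)
| subalg_mul x y : subalg S x -> subalg S y -> subalg S (dgmul x y).

Definition minimal_cdga (M : dgdata) : Prop :=
  is_cdga M /\
  exists (I : Type) (lt : I -> I -> Prop) (deg : I -> nat) (a : I -> M),
    [/\ well_order lt,
        forall i, (0 < deg i)%N,
        forall i j, lt i j -> (deg i <= deg j)%N,
        free_cga_on deg a &
        forall i, subalg (a @` [set j | lt j i]) (dgdiff (a i))].

Definition minimal_model (M A : dgdata) : Prop :=
  minimal_cdga M /\ exists f : M -> A, dg_morphism f /\ quasi_iso f.

(** Since the differential of [cohomology M] is zero, the map induced by [psi] in
    cohomology is [[z] |-> psi z], up to [H^*(H^* M, 0) = H^* M]. *)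
Definition formal_cdga (M : dgdata) : Prop :=
  exists psi : M -> cohomology M,
    dg_morphism psi /\ forall n (z : M), cocycle n z -> psi z = coh_class z.

Definition formal (A : dgdata) : Prop :=
  exists M : dgdata, minimal_model M A /\ formal_cdga M.

End CDGA.

Section Forms.
Variables (R : realType) (V : normedModType R).

Fixpoint Ck (k : nat) (f : V -> R^o) : Prop :=
  continuous f /\
  if k is k'.+1 then
    forall v, (forall p, derivable f p v) /\ Ck k' (fun p => 'D_v f p)
  else True.

Definition smooth (f : V -> R^o) : Prop := forall k, Ck k f.

(** [w p [:: v1; ..; vk]] is the value at [p] of the degree [k] component of [w]
    on the tangent vectors [v1, .., vk]. *)
Definition dform : lmodType R := V -> seq V -> R^o.

Record is_form (k : nat) (w : dform) : Prop := IsForm {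
  form_deg : forall p s, size s <> k -> w p s = 0;
  form_lin : forall p s1 s2 (a : R) u v,
    w p (s1 ++ (a *: u + v) :: s2) = a * w p (s1 ++ u :: s2) + w p (s1 ++ v :: s2);
  form_alt : forall p s1 s2 s3 u, w p (s1 ++ u :: s2 ++ u :: s3) = 0;
  form_smooth : forall s, smooth (fun p => w p s)
}.

Definition form1 : dform := fun _ s => (size s == 0)%:R.

(** Number of inversions of the shuffle listing first the positions selected by
    [m] and then the others. *)
Definition shuffle_inv n (m : n.-tuple bool) : nat :=
  #|[set ij : 'I_n * 'I_n |
      [&& (ij.1 < ij.2)%N, ~~ tnth m ij.1 & tnth m ij.2]]%SET|.

Definition wedge_form (w1 w2 : dform) : dform := fun p s =>
  \sum_(m : (size s).-tuple bool)
    (-1) ^+ shuffle_inv m * (w1 p (mask m s) * w2 p (mask (map negb m) s)).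

Definition extd (w : dform) : dform := fun p s =>
  \sum_(i < size s)
    (-1) ^+ i * 'D_(s`_i) (fun q => w q (take i s ++ drop i.+1 s) : R^o) p.

Definition pullback (F : V -> V) (w : dform) : dform := fun p s =>
  w (F p) [seq 'D_v F p | v <- s].

(** For a set [T] of diffeomorphisms of [V] which form a group acting freely and
    properly discontinuously, forms on the quotient manifold are identified, by
    pulling back along the covering map, with the [T]-invariant forms on [V]. *)
Definition deRham (T : set (V -> V)) : dgdata R :=
  @DGData R dform
    (fun k => [set w | is_form k w /\ forall F, T F -> pullback F w = w])
    form1 wedge_form extd.

End Forms.

Section Solvmanifold.
Variable R : realType.

Definition expmx (A : 'M[R]_5) : 'M[R]_5 :=
  limn (series (fun k : nat => (k`!%:R)^-1 *: A ^+ k)).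

(** Vectors are rows, so the [i]-th row of the matrix [B] of [X |-> [X, X_*]] is
    [[X_i, X_*]], and [B] acts on the right. *)
Definition flow (B : 'M[R]_5) (t : R) (x : 'rV[R]_5) : 'rV[R]_5 :=
  x *m expmx (t *: B).

Definition Gtype : normedModType R := (R^o * 'rV[R]_5)%type.

Definition Gmul (B : 'M[R]_5) (g h : Gtype) : Gtype :=
  (g.1 + h.1, g.2 + flow B g.1 h.2).

Definition is_lattice (L : set 'rV[R]_5) : Prop :=
  [/\ L 0 /\ (forall x y, L x -> L y -> L (x - y)),
      exists2 e : R, 0 < e & forall x, L x -> `|x| < e -> x = 0 &
      exists2 C : set 'rV[R]_5, compact C & forall x, exists2 l, L l & C (x - l)].

Definition Gamma (tbar : R) (L : set 'rV[R]_5) : set Gtype :=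
  [set g | (exists n : int, g.1 = tbar *~ n) /\ L g.2].

(** [G / Gamma] is the space of cosets [g Gamma], so [Gamma] acts on [G] by right
    translations. *)
Definition solvmanifold_deRham (B : 'M[R]_5) (tbar : R) (L : set 'rV[R]_5) :
    dgdata R :=
  @deRham R Gtype [set (fun g : Gtype => Gmul B g c) | c in Gamma tbar L].

Definition solvmanifold_formal (B : 'M[R]_5) (tbar : R) (L : set 'rV[R]_5) :
    Prop :=
  formal (solvmanifold_deRham B tbar L).

Definition lattice_for (B : 'M[R]_5) (tbar : R) (L : set 'rV[R]_5) : Prop :=
  is_lattice L /\ flow B tbar @` L = L.

Definition mx_of_rows (l : seq (seq R)) : 'M[R]_5 :=
  \matrix_(i < 5, j < 5) (nth [::] l i)`_j.

(** The matrices of [X |-> [X, X_*]], in the basis [X_1, .., X_6] with [X_*]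
    left out. *)

Definition B6_8 (a b c : R) := mx_of_rows
  [:: [:: a; 0; 0; 0; 0];
      [:: 0; b; 0; 0; 0];
      [:: 0; 0; c; 0; 0];
      [:: 0; 0; 0; 0; -1];
      [:: 0; 0; 0; 1; 0]].

Definition B6_10 := mx_of_rows
  [:: [:: 0; 0; 0; 0; 0];
      [:: 1; 0; 0; 0; 0];
      [:: 0; 1; 0; 0; 0];
      [:: 0; 0; 0; 0; -1];
      [:: 0; 0; 0; 1; 0]].

Definition B6_11 (a q s : R) := mx_of_rows
  [:: [:: a; 0; 0; 0; 0];
      [:: 0; 0; -1; 0; 0];
      [:: 0; 1; 0; 0; 0];
      [:: 0; 0; 0; q; - s];
      [:: 0; 0; 0; s; q]].

Definition B5_14xR := mx_of_rows
  [:: [:: 0; 0; 0; 0; 0];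
      [:: 1; 0; 0; 0; 0];
      [:: 0; 0; 0; -1; 0];
      [:: 0; 0; 1; 0; 0];
      [:: 0; 0; 0; 0; 0]].

Definition B5_17xR (p r : R) := mx_of_rows
  [:: [:: p; -1; 0; 0; 0];
      [:: 1; p; 0; 0; 0];
      [:: 0; 0; - p; - r; 0];
      [:: 0; 0; r; - p; 0];
      [:: 0; 0; 0; 0; 0]].

Definition B5_18xR := mx_of_rows
  [:: [:: 0; -1; 0; 0; 0];
      [:: 1; 0; 0; 0; 0];
      [:: 1; 0; 0; -1; 0];
      [:: 0; 1; 1; 0; 0];
      [:: 0; 0; 0; 0; 0]].

Definition B3_5xR3 := mx_of_rows
  [:: [:: 0; -1; 0; 0; 0];
      [:: 1; 0; 0; 0; 0];
      [:: 0; 0; 0; 0; 0];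
      [:: 0; 0; 0; 0; 0];
      [:: 0; 0; 0; 0; 0]].

Definition listed_times : seq R := [:: 2 * pi; pi; pi / 2; pi / 3].

End Solvmanifold.

(* Main.v *)
From HB Require Import structures.
Require Import Defs.
From mathcomp Require Import all_boot all_order all_algebra.
From mathcomp Require Import all_classical all_reals all_analysis.
From mathcomp Require Import ring lra.
Import Order.TTheory GRing.Theory Num.Theory numFieldNormedType.Exports.

Set Implicit Arguments.
Unset Strict Implicit.
Unset Printing Implicit Defensive.

Local Open Scope classical_set_scope.
Local Open Scope ring_scope.

(** In the coordinates (t, y) of [Psi], right translation by the lattice becomes y -> y + l for l in
    L together with the monodromy [tau tbar], (t, y) -> (t + tbar, y exp(-tbar B)). So G/Gamma is
    the mapping torus of a linear automorphism of the torus R^5/L, and formality may be tested on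
    the algebra [Om] of forms invariant under these maps ([Om_formal_iff]). Every closed form of
    [Om] is cohomologous to one whose coefficients depend on t only: it is averaged over the fibre,
    and since the averaging homotopy does not respect the monodromy it is patched with a partition
    of unity in t ([fiberize]).

    In the four cases of (A) the matrix B commutes with its transpose. The monodromy then acts on
    constant forms by a normal operator, so D = pullback minus identity satisfies ker D^2 = ker D,
    and every constant form is a fixed one plus an element of the image of D ([ker_sq], [fitting]).
    Integration in t shows that the constant invariant forms represent every class
    ([yconst_cocycle]) and that only 0 among them is exact ([exact_const0]). They form a subalgebra
    with zero differential that maps isomorphically onto cohomology, which gives formality
    ([qi_formal]). The definition speaks of a minimal model, so one is constructed. Pairwise
    orthogonal vectors fixed by the monodromy split the constant invariants into an exterior algebra
    on closed one-forms and a factor S vanishing in degree one ([good_max], [SE_cons]); S has a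
    model built degree by degree ([minimal_model_exists]), to which the one-forms are adjoined as
    closed generators ([adjoin_odd]).

    For (B), the map psi from a formal minimal model to its cohomology allows primitives to be
    chosen in the kernel of psi, and closed expressions built from them are then exact. For G_6.10
    and G_5.14 x R, a Jordan block of B with eigenvalue 0 gives one-forms with d a1 = 0 and d a2 =
    dt a1, and the triple Massey product of a1, a1, dt would vanish ([formal_massey1]); going once
    around the base circle refutes this ([massey1_contradiction]). For G_5.18 x R a suitable Jordan
    chain appears in degree two: d b1 = 0, d X0 = b1 dt, d Y0 = X0 dt. Formality would make x x - 2
    a y exact for some a, t, x, y with d x = a t and d y = x t, where a and t represent the classes
    of b1 and dt ([formal_massey2]). In a moving frame this becomes a system of differential
    equations with periodic unknowns, which forces a periodic function to have derivative 3/2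
    ([massey2_not_formal]). *)

Notation "a ∧ b" := (wedge_form a b) (at level 40, left associativity).

(** * Directional derivatives and smooth functions *)

Lemma is_derive_cvgP (R : realType) (V : normedModType R) (f : V -> R^o) p v (l : R) :
  is_derive p v f l <-> (h^-1 * (f (p + h *: v) - f p) @[h --> 0^'] --> l).
Proof.
have E : (fun h : R => h^-1 *: ((f \o shift p) (h *: v) - f p)) =
    (fun h : R => h^-1 * (f (p + h *: v) - f p)).
  by apply/funext => h /=; rewrite [h *: v + p]addrC.
split=> [[+ <-]|H]; first by rewrite /derivable /derive E.
have H' : h^-1 *: ((f \o shift p) (h *: v) - f p) @[h --> 0^'] --> l by rewrite E.
by split; [apply/cvg_ex; exists l|apply/cvg_lim].
Qed.

Lemma is_deriveP (R : realType) (V : normedModType R) (f : V -> R^o) p v (l : R) :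
  is_derive p v f l <->
  forall e : R, 0 < e -> exists2 d : R, 0 < d &
    forall h : R, h != 0 -> `|h| < d -> `|h^-1 * (f (p + h *: v) - f p) - l| <= e.
Proof.
rewrite is_derive_cvgP; split=> [/cvgrPdist_le H e e0|H].
  have [d /= d0 dP] := H e e0; exists d => // h h0 hd.
  by rewrite distrC; apply: dP => //=; rewrite sub0r normrN.
apply/cvgrPdist_le => e /H[d d0 dP]; exists d => //= h /=.
by rewrite sub0r normrN distrC => hd h0; exact: dP.
Qed.

Section DirectionalCalculus.
Variables (R : realType) (V : normedModType R).
Implicit Types (f g : V -> R^o) (p u v : V).

Lemma is_derive_line f p v (h : R) (l : R) : is_derive (p + h *: v) v f l ->
  is_derive (h : R^o) (1 : R^o) (fun s : R^o => f (p + s *: v)) l.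
Proof.
move=> /is_deriveP df; apply/is_deriveP => e /df[d d0 dP]; exists d => // k k0 kd.
by rewrite [k *: (1 : R^o)]mulr1 scalerDl addrA; exact: dP.
Qed.

Lemma is_derive_lineP f p v (l : R) :
  is_derive (0 : R^o) (1 : R^o) (fun s : R^o => f (p + s *: v)) l <->
  is_derive p v f l.
Proof.
split=> /is_deriveP df; apply/is_deriveP => e /df[d d0 dP]; exists d => // k k0 kd;
  by have := dP _ k0 kd; rewrite [k *: (1 : R^o)]mulr1 add0r scale0r addr0.
Qed.

Lemma is_derive_dirZ f p v (a l : R) : is_derive p v f l ->
  is_derive p (a *: v) f (a * l).
Proof.
have [->|a0] := eqVneq a 0.
  by rewrite scale0r mul0r => _; apply: is_derive0.
move=> /is_deriveP df; apply/is_deriveP => e e0.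
have na : 0 < `|a| by rewrite normr_gt0.
have [d d0 dP] := df (e / `|a|) (divr_gt0 e0 na).
exists (d / `|a|) => [|h h0 hd]; first exact: divr_gt0.
have := dP (h * a) (mulf_neq0 h0 a0).
rewrite normrM -ltr_pdivlMr // => /(_ hd); rewrite ler_pdivlMr // -normrM.
rewrite scalerA; set X := f _ - f p => H.
by have -> : h^-1 * X - a * l = ((h * a)^-1 * X - l) * a by field; rewrite h0 a0.
Qed.

Lemma MVT_line f p v : (forall q, derivable f q v) ->
  exists2 c : R, 0 <= c <= 1 & f (p + v) - f p = 'D_v f (p + c *: v).
Proof.
move=> df.
have D (x : R) : is_derive (x : R^o) (1 : R^o) (fun s : R^o => f (p + s *: v))
    ('D_v f (p + x *: v)).
  by apply: is_derive_line; exact: derivableP.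
have C : {within `[0, 1], continuous (fun s : R => f (p + s *: v) : R)}.
  apply: continuous_subspaceT => y.
  apply/differentiable_continuous/derivable1_diffP.
  by case: (D y).
have [c] := @MVT_segment R (fun s : R => f (p + s *: v) : R)
    (fun s => 'D_v f (p + s *: v)) 0 1 ler01 (fun x _ => D x) C.
rewrite in_itv /= => c01; rewrite scale1r scale0r addr0 subr0 mulr1 => ->.
by exists c.
Qed.

(* Additivity in the direction needs continuity of one of the two partials. *)
Lemma is_derive_dirD f p u v : (forall q, derivable f q u) ->
  (forall q, derivable f q v) -> {for p, continuous (fun q => 'D_v f q : R^o)} ->
  is_derive p (u + v) f ('D_u f p + 'D_v f p).
Proof.
move=> du dv cv; apply/is_deriveP => e e0.
have e20 : 0 < e / 2 by lra.
have [d d0 dP] := proj1 (is_deriveP _ _ _ _) (derivableP (du p)) _ e20.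
move/cvgrPdist_le: cv => /(_ _ e20)/nbhs_normP[r /= r0 rP].
pose K := 1 + `|u| + `|v|; have K0 : 0 < K.
  by rewrite /K; have := normr_ge0 u; have := normr_ge0 v; lra.
exists (Num.min d (r / K)) => [|h h0]; first by rewrite lt_min d0 divr_gt0.
rewrite lt_min => /andP[hd hr].
(* The increment along u + v is a step along u, governed by the derivative at p, followed by a step
   along v, governed by the mean value theorem and continuity of the v-derivative. *)
have [|c /andP[c0 c1]] := @MVT_line f (p + h *: u) (h *: v).
  by move=> q; have [] := is_derive_dirZ h (derivableP (dv q)).
rewrite (derive_val (is_derive := is_derive_dirZ h (derivableP (dv _)))) => E.
have -> : f (p + h *: (u + v)) - f p =
   (f (p + h *: u + h *: v) - f (p + h *: u)) + (f (p + h *: u) - f p).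
  by rewrite scalerDr !addrA subrK.
rewrite E mulrDr mulKf //.
set A := 'D_v f _ ; set B := 'D_u f p; set C := h^-1 * _; set D := 'D_v f p.
have -> : A + C - (B + D) = (C - B) + (A - D) by ring.
apply: le_trans (ler_normD _ _) _; rewrite (splitr e); apply: lerD; first exact: dP.
rewrite distrC; apply: rP => /=.
rewrite -addrA opprD addrA subrr sub0r scalerA [c * h]mulrC -scalerA -scalerDr.
rewrite normrN normrZ.
have : `|u + c *: v| < K.
  apply: le_lt_trans (ler_normD _ _) _; rewrite normrZ ger0_norm // /K.
  have : c * `|v| <= 1 * `|v| by rewrite ler_wpM2r.
  by have := normr_ge0 u; lra.
move=> uvK; apply: le_lt_trans (ler_wpM2l (normr_ge0 _) (ltW uvK)) _.
by rewrite -ltr_pdivlMr.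
Qed.

(* Mean values along the diagonals of a parallelogram. *)
Lemma Schwarz f u v :
  (forall q w, derivable f q w) ->
  (forall q, derivable ('D_u f) q v) -> (forall q, derivable ('D_v f) q u) ->
  continuous (fun q => 'D_v ('D_u f) q : R^o) ->
  continuous (fun q => 'D_u ('D_v f) q : R^o) ->
  'D_v ('D_u f) = 'D_u ('D_v f).
Proof.
(* [S] compares the second difference over a small parallelogram with D_b D_a f. The second
   difference is symmetric in a and b, so using [S] both ways brings the two mixed derivatives
   arbitrarily close. *)
suff S (a b : V) p (e : R) : 0 < e ->
    (forall q w, derivable f q w) ->
    (forall q, derivable ('D_a f) q b) ->
    continuous (fun q => 'D_b ('D_a f) q : R^o) ->
    exists2 d : R, 0 < d & forall h : R, 0 < h -> h < d ->
    `| (f (p + h *: a + h *: b) - f (p + h *: b) - f (p + h *: a) + f p) / h ^+ 2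
       - 'D_b ('D_a f) p | <= e.
  move=> df duv dvu cuv cvu; apply/funext => p; apply/eqP; rewrite -subr_eq0 -normr_le0.
  apply/ler_addgt0Pl => e e0; rewrite addr0.
  have e20 : 0 < e / 2 by lra.
  have [d1 d10 H1] := S u v p _ e20 df duv cuv.
  have [d2 d20 H2] := S v u p _ e20 df dvu cvu.
  pose h := Num.min d1 d2 / 2.
  have m0 : 0 < Num.min d1 d2 by rewrite lt_min d10.
  have h0 : 0 < h by rewrite /h; lra.
  have hm : h < Num.min d1 d2 by rewrite /h; lra.
  move: hm; rewrite lt_min => /andP[/(H1 _ h0) K1 /(H2 _ h0)].
  rewrite (addrAC p (h *: v)) [_ - f (p + h *: u) - _]addrAC.
  move: K1; set A := _ / h ^+ 2 => K1 K2.
  rewrite (splitr e); apply: le_trans (ler_distD A _ _) _.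
  by apply: lerD; [rewrite distrC; exact: K1|exact: K2].
move=> e0 df dab cab.
move: (cab p) => /cvgrPdist_le/(_ _ e0)/nbhs_normP[r /= r0 rP].
pose K := 1 + `|a| + `|b|; have K0 : 0 < K.
  by rewrite /K; have := normr_ge0 a; have := normr_ge0 b; lra.
exists (r / K) => [|h h0 hr]; first by rewrite divr_gt0.
(* The mean value theorem is used twice: for the difference g in the direction a, then for D_a f in
   the direction b. *)
pose g q := f (q + h *: b) - f q.
have dg q (w : V) : is_derive q w g ('D_w f (q + h *: b) - 'D_w f q).
  apply: is_deriveB; last exact: derivableP.
  apply/is_deriveP => e' e'0.
  have [d' d'0 dP'] := proj1 (is_deriveP _ _ _ _) (derivableP (df (q + h *: b) w)) _ e'0.
  by exists d' => // k k0 kd; rewrite addrAC; apply: dP'.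
have [|c1 /andP[c10 c11] E1] := @MVT_line g p (h *: a).
  by move=> q; case: (dg q (h *: a)).
have [|c2 /andP[c20 c21] E2] := @MVT_line ('D_a f) (p + c1 *: (h *: a)) (h *: b).
  by move=> q; have [] := is_derive_dirZ h (derivableP (dab q)).
have Ea q : 'D_(h *: a) f q = h * 'D_a f q.
  exact: (derive_val (is_derive := is_derive_dirZ h (derivableP (df _ _)))).
move: E1; rewrite (derive_val (is_derive := dg _ _)) !Ea -mulrBr E2.
rewrite (derive_val (is_derive := is_derive_dirZ h (derivableP (dab _)))) /g.
set X := f _; set Y := f _; set Z := f _; set W := f _ => E1.
have -> : X - Z - Y + W = X - Y - (Z - W) by ring.
rewrite E1 mulrA -expr2 mulrAC divff ?mul1r; last by rewrite expf_neq0 // gt_eqF.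
rewrite distrC; apply: rP => /=.
rewrite -addrA opprD addrA subrr sub0r normrN !scalerA ![_ * h]mulrC -!scalerA -scalerDr.
rewrite normrZ gtr0_norm //.
have abK : `|c1 *: a + c2 *: b| < K.
  apply: le_lt_trans (ler_normD _ _) _; rewrite !normrZ !ger0_norm // /K.
  by rewrite -addrA ltr_pwDl // lerD // ler_piMl.
apply: le_lt_trans (ler_wpM2l (ltW h0) (ltW abK)) _.
by rewrite -ltr_pdivlMr.
Qed.

End DirectionalCalculus.

Section Smooth.
Variables (R : realType) (V : normedModType R).
Implicit Types (f g : V -> R^o) (p u v : V).

Lemma smoothP f : smooth f <->
  continuous f /\ forall v, (forall p, derivable f p v) /\ smooth (fun p => 'D_v f p).
Proof.
split=> [sf|[cf df] [|k]]; last first.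
- by split=> // v; have [dv sv] := df v.
- by [].
split=> [|v]; first by have [] := sf 0%N.
split=> [|k]; first by have [_ /(_ v)[]] := sf 1%N.
by have [_ /(_ v)[]] := sf k.+1.
Qed.

Lemma smooth_continuous f : smooth f -> continuous f.
Proof. by move=> /smoothP[]. Qed.

Lemma smooth_derivable f p v : smooth f -> derivable f p v.
Proof. by move=> /smoothP[_ /(_ v)[]]. Qed.

Lemma smooth_derive f v : smooth f -> smooth (fun p => 'D_v f p).
Proof. by move=> /smoothP[_ /(_ v)[]]. Qed.

Lemma smooth_is_derive f p v : smooth f -> is_derive p v f ('D_v f p).
Proof. by move=> sf; apply/derivableP/smooth_derivable. Qed.

(** Coinduction principle: [Ck k] is proved by induction on k for the whole class at once, so a
    smoothness proof only has to exhibit a class of continuous functions closed under directional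
    derivatives. *)
Lemma smooth_coind (C : (V -> R^o) -> Prop) :
  (forall f, C f -> continuous f /\
     forall v, exists2 g, C g & forall p, is_derive p v f (g p)) ->
  forall f, C f -> smooth f.
Proof.
move=> H f Cf k; elim: k f Cf => [|k IH] f /H[cf df]; first by split.
split=> // v; have [g Cg fg] := df v; split=> [p|]; first by case: (fg p).
suff -> : (fun p => 'D_v f p) = g by exact: IH.
by apply/funext => p; exact: (derive_val (is_derive := fg p)).
Qed.

Lemma smooth_cst (c : R) : smooth (fun _ : V => c : R^o).
Proof.
apply: (@smooth_coind (fun f => exists c : R, f = fun=> c)); last by exists c.
move=> _ [{}c ->]; split=> [|v]; first by move=> p; exact: cvg_cst.
by exists (fun=> 0) => [|p]; [exists 0|exact: is_derive_cst].
Qed.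

(** Generated by smooth functions and inverses of nowhere vanishing ones; the sum, product and
    quotient rules keep derivatives inside, so [smooth_coind] applies. *)
Inductive smooth_alg : (V -> R^o) -> Prop :=
| smooth_alg_of f : smooth f -> smooth_alg f
| smooth_algD f g : smooth_alg f -> smooth_alg g -> smooth_alg (fun p => f p + g p)
| smooth_algM f g : smooth_alg f -> smooth_alg g -> smooth_alg (fun p => f p * g p)
| smooth_algV f : smooth f -> (forall p, f p != 0) -> smooth_alg (fun p => (f p)^-1).

Lemma smooth_alg_smooth f : smooth_alg f -> smooth f.
Proof.
apply: smooth_coind => {}f; elim=> {f} [f sf|f g _ [cf df] _ [cg dg]|f g Cf [cf df] Cg [cg dg]|f sf f0].
- split=> [|v]; first exact: smooth_continuous.
  exists (fun p => 'D_v f p) => [|p]; first exact/smooth_alg_of/smooth_derive.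
  exact: smooth_is_derive.
- split=> [|v]; first by move=> p; apply: cvgD; [exact: cf|exact: cg].
  have [f' Cf' df'] := df v; have [g' Cg' dg'] := dg v.
  exists (fun p => f' p + g' p) => [|p]; first exact: smooth_algD.
  exact: (@is_deriveD _ _ _ f g).
- split=> [|v]; first by move=> p; apply: cvgM; [exact: cf|exact: cg].
  have [f' Cf' df'] := df v; have [g' Cg' dg'] := dg v.
  exists (fun p => f p * g' p + g p * f' p) => [|p].
    by apply: smooth_algD; exact: smooth_algM.
  exact: (@is_deriveM _ _ f g).
- split=> [p|v]; first by apply: cvgV => //; exact: smooth_continuous.
  exists (fun p => (- 1 * 'D_v f p) * ((f p)^-1 * (f p)^-1)) => [|p].
    apply: smooth_algM; last by apply: smooth_algM; exact: smooth_algV.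
    by apply: smooth_algM; apply: smooth_alg_of; [exact: smooth_cst|exact: smooth_derive].
  split; first exact/derivableV/smooth_derivable.
  rewrite deriveV ?f0 //; last exact: smooth_derivable.
  by rewrite scaleNr mulN1r mulNr -invfM -expr2 [_ *: _]mulrC.
Qed.

Lemma smoothD f g : smooth f -> smooth g -> smooth (fun p => f p + g p : R^o).
Proof.
by move=> sf sg; apply/smooth_alg_smooth/smooth_algD; exact: smooth_alg_of.
Qed.

Lemma smoothM f g : smooth f -> smooth g -> smooth (fun p => f p * g p : R^o).
Proof.
by move=> sf sg; apply/smooth_alg_smooth/smooth_algM; exact: smooth_alg_of.
Qed.

Lemma smoothZ (c : R) f : smooth f -> smooth (fun p => c * f p : R^o).
Proof. by apply: smoothM; exact: smooth_cst. Qed.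

Lemma smoothN f : smooth f -> smooth (fun p => - f p : R^o).
Proof.
by move=> /(smoothZ (-1)); congr smooth; apply/funext => p; rewrite mulN1r.
Qed.

Lemma smoothB f g : smooth f -> smooth g -> smooth (fun p => f p - g p : R^o).
Proof. by move=> sf /smoothN; exact: smoothD. Qed.

Lemma smooth_sum I (r : seq I) (P : pred I) (F : I -> V -> R^o) :
  (forall i, P i -> smooth (F i)) -> smooth (fun p => \sum_(i <- r | P i) F i p : R^o).
Proof.
move=> sF; elim: r => [|i r IH].
  rewrite (_ : (fun _ => _) = fun=> 0); first exact: smooth_cst.
  by apply/funext => p; rewrite big_nil.
case Pi: (P i); last first.
  rewrite (_ : (fun _ => _) = fun p => \sum_(j <- r | P j) F j p) //.
  by apply/funext => p; rewrite big_cons Pi.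
rewrite (_ : (fun _ => _) = fun p => F i p + \sum_(j <- r | P j) F j p).
  by apply: smoothD IH; exact: sF.
by apply/funext => p; rewrite big_cons Pi.
Qed.

Lemma smooth_local f : (forall p, exists2 g, smooth g & \forall q \near p, f q = g q) ->
  smooth f.
Proof.
apply: (@smooth_coind (fun f => forall p, exists2 g, smooth g & \forall q \near p, f q = g q)).
move=> {}f H; split=> [p|v].
  have [g sg fg] := H p; rewrite /continuous_at (nbhs_singleton fg).
  apply: cvg_trans (smooth_continuous sg (x := p)).
  by apply: near_eq_cvg; near do apply/esym.
have D p : derivable f p v.
  have [g sg fg] := H p; apply: (@near_eq_derivable _ _ _ g f).
    by near do apply/esym.
  exact: smooth_derivable.
exists (fun p => 'D_v f p) => [p|p]; last exact: derivableP.
have [g sg fg] := H p; exists (fun q => 'D_v g q); first exact: smooth_derive.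
have fg' := near_join fg.
by near=> q; apply: near_eq_derive; near: q.
Unshelve. all: by end_near. Qed.

Lemma smooth_deriveC f u v : smooth f -> 'D_v ('D_u f) = 'D_u ('D_v f).
Proof.
move=> sf; apply: Schwarz => [q w|q|q||]; try exact: smooth_derivable.
- exact/smooth_derivable/smooth_derive.
- exact/smooth_derivable/smooth_derive.
- exact/smooth_continuous/smooth_derive/smooth_derive.
- exact/smooth_continuous/smooth_derive/smooth_derive.
Qed.

Lemma smoothV f : (forall p, f p != 0) -> smooth f -> smooth (fun p => (f p)^-1 : R^o).
Proof. by move=> f0 sf; apply/smooth_alg_smooth/smooth_algV. Qed.

End Smooth.

Lemma cvg_sum_fin (R : realType) (V : normedModType R) T (F : set_system T)
    (FF : Filter F) I (r : seq I) (f : I -> T -> V) (l : I -> V) :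
  (forall i, f i x @[x --> F] --> l i) ->
  \sum_(i <- r) f i x @[x --> F] --> \sum_(i <- r) l i.
Proof.
move=> H; elim: r => [|i r IH].
  by rewrite big_nil; under eq_fun do rewrite big_nil; exact: cvg_cst.
by rewrite big_cons; under eq_fun do rewrite big_cons; exact: cvgD.
Qed.

Section SmoothLinear.
Variables (R : realType) (V : normedModType R).
Implicit Types (f : V -> R^o).

Lemma smooth_is_derive_dir_sum f p I (r : seq I) (a : I -> R) (e : I -> V) : smooth f ->
  is_derive p (\sum_(i <- r) a i *: e i) f (\sum_(i <- r) a i * 'D_(e i) f p).
Proof.
move=> sf; elim: r => [|i r IH]; first by rewrite !big_nil; exact: is_derive0.
rewrite !big_cons -(derive_val (is_derive := IH)).
rewrite -(derive_val (is_derive := is_derive_dirZ (a i) (smooth_is_derive p (e i) sf))).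
apply: is_derive_dirD => [q|q|]; try exact: smooth_derivable.
exact/smooth_continuous/smooth_derive.
Qed.

Lemma smooth_derive_lin f p (a : R) u v : smooth f ->
  'D_(a *: u + v) f p = a * 'D_u f p + 'D_v f p.
Proof.
move=> sf; have := @smooth_is_derive_dir_sum f p bool [:: true; false]
  (fun b => if b then a else 1) (fun b => if b then u else v) sf.
rewrite 2!big_cons big_nil addr0 scale1r => H.
rewrite (derive_val (is_derive := H)).
by rewrite 2!big_cons big_nil addr0 mul1r.
Qed.

End SmoothLinear.

(** * Coordinates on the group and the chain rule *)

Section Coordinates.
Variable R : realType.
Local Notation G := (Gtype R).
Implicit Types (v p : G) (i : option 'I_5).

Definition gb i : G := if i is Some j then (0, delta_mx 0 j) else (1, 0).
Definition gc i v : R := if i is Some j then v.2 0 j else v.1.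

Lemma gc_lin i : linear (gc i : G -> R^o).
Proof. by case: i => [j|] a u v //=; rewrite !mxE. Qed.

Lemma gcD i u v : gc i (u + v) = gc i u + gc i v.
Proof. by have := gc_lin i 1 u v; rewrite !scale1r. Qed.

Lemma gcZ i (a : R) v : gc i (a *: v) = a * gc i v.
Proof.
have g0 : gc i 0 = 0 by case: i => [j|]; rewrite /gc //= mxE.
by have := gc_lin i a v 0; rewrite !addr0 g0 addr0.
Qed.

Lemma gcN i v : gc i (- v) = - gc i v.
Proof. by rewrite -scaleN1r gcZ mulN1r. Qed.

Lemma g_decomp v : v = \sum_i gc i v *: gb i.
Proof.
rewrite (bigD1 None) //=.
rewrite (reindex_omap (@Some 'I_5) id) /=; last by case.
have -> : (\sum_(j < 5 | true && (Some j == Some j)) v.2 0 j *: ((0, delta_mx 0 j) : G)) =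
    (0, v.2) :> G.
  rewrite {2}[v.2]row_sum_delta; under eq_bigl do rewrite eqxx.
  elim/big_rec2: _ => // j y w _ ->.
  by congr pair => /=; rewrite ?scaler0 ?addr0.
case: v => a b /=; congr pair => /=; first by rewrite addr0 [_ *: 1]mulr1.
by rewrite scaler0 add0r.
Qed.

Lemma gc_continuous i : continuous (gc i : G -> R^o).
Proof.
case: i => [j|] /= v; last exact: cvg_fst.
apply: (@continuous_comp _ _ _ snd (fun m : 'rV[R]_5 => m 0 j)); first exact: cvg_snd.
exact: coord_continuous.
Qed.

Lemma gc_eqP u v : (forall i, gc i u = gc i v) -> u = v.
Proof. by move=> H; rewrite (g_decomp u) (g_decomp v); apply: eq_bigr => i _; rewrite H. Qed.

Lemma smooth_gc i : smooth (gc i : G -> R^o).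
Proof.
apply: (@smooth_coind _ _ (fun f => f = gc i \/ exists c : R, f = fun=> c)); last by left.
move=> f [->|[c ->]]; split=> [|v].
- exact: gc_continuous.
- exists (fun=> gc i v); first by right; exists (gc i v).
  move=> p; apply/is_deriveP => e e0; exists 1 => // h h0 _.
  by rewrite gcD gcZ [gc i p + _]addrC addrK mulKf // subrr normr0 ltW.
- by move=> p; exact: cvg_cst.
- by exists (fun=> 0); [right; exists 0|move=> p; exact: is_derive_cst].
Qed.

Lemma cvg_gc T (F : set_system T) (FF : Filter F) (g : T -> G) (l : G) :
  (forall i, gc i (g x) @[x --> F] --> gc i l) -> g x @[x --> F] --> l.
Proof.
move=> H; rewrite (g_decomp l).
have -> : g = (fun x => \sum_i gc i (g x) *: gb i) by apply/funext => x; exact: g_decomp.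
apply: cvg_sum_fin => i.
by apply: cvgZl; exact: H.
Qed.

Lemma derive_decomp (f : G -> R^o) p v : smooth f ->
  'D_v f p = \sum_i gc i v * 'D_(gb i) f p.
Proof.
move=> sf; rewrite {1}(g_decomp v).
exact: (derive_val (is_derive := smooth_is_derive_dir_sum _ _ _ _ sf)).
Qed.

Lemma is_derive_comp (W : normedModType R) (g : W -> G) q w (dg : option 'I_5 -> R)
    (f : G -> R^o) : smooth f ->
  (forall i, is_derive q w (fun x => gc i (g x) : R^o) (dg i)) ->
  is_derive q w (fun x => f (g x) : R^o) (\sum_i dg i * 'D_(gb i) f (g q)).
Proof.
move=> sf Hg; apply/is_derive_cvgP.
have Hr i : h^-1 * (gc i (g (q + h *: w)) - gc i (g q)) @[h --> (0 : R)^'] --> dg i.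
  exact/is_derive_cvgP.
pose u (h : R) : G := g (q + h *: w) - g q.
(* The increment of f between g q and g (q + h w) is a derivative at an intermediate point of the
   segment. The point is chosen as a function of h and tends to g q because its parameter stays in
   [0, 1]. *)
have Ec (h : R) : {c : R | 0 <= c <= 1 & f (g q + u h) - f (g q) = 'D_(u h) f (g q + c *: u h)}.
  by apply/cid2/MVT_line => q'; exact: smooth_derivable.
pose c h := s2val (Ec h).
have -> : (fun h : R => h^-1 * (f (g (q + h *: w)) - f (g q))) =
  fun h => \sum_i (h^-1 * (gc i (g (q + h *: w)) - gc i (g q))) *
                 'D_(gb i) f (g q + c h *: u h).
  apply/funext => h; have := s2valP' (Ec h); rewrite /= -/(c h).
  have -> : g q + u h = g (q + h *: w) by rewrite /u addrC subrK.
  move=> ->; rewrite (derive_decomp _ _ sf) mulr_sumr; apply: eq_bigr => i _.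
  by rewrite mulrA /u gcD gcN.
have u0 : u h @[h --> (0 : R)^'] --> (0 : G).
  apply: cvg_gc => i.
  rewrite (_ : (fun h => _) = (fun h => h * (h^-1 * (gc i (g (q + h *: w)) - gc i (g q))))); last first.
    apply/funext => h; have [->|h0] := eqVneq h 0; last by rewrite mulVKf // /u gcD gcN.
    by rewrite mul0r /u scale0r addr0 subrr; case: (i) => [j|] //=; rewrite mxE.
  rewrite (_ : gc i 0 = 0 * dg i); last by rewrite mul0r; case: (i) => [j|] //=; rewrite mxE.
  by apply: cvgM (Hr i); apply: cvg_within.
have xi : g q + c h *: u h @[h --> (0 : R)^'] --> g q.
  rewrite -[X in _ --> X]addr0; apply: cvgD; first exact: cvg_cst.
  apply/cvgr0Pnorm_le => e e0.
  move/cvgr0Pnorm_le: u0 => /(_ e e0); apply: filterS => h /=.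
  apply: le_trans; rewrite normrZ.
  have /= /andP[c0 c1] := s2valP (Ec h).
  by rewrite ger0_norm // ler_piMl.
apply: (@cvg_sum_fin R R^o) => i; apply: cvgM; first exact: Hr.
exact: cvg_comp xi (smooth_continuous (smooth_derive (gb i) sf) (x := g q)).
Qed.

(** Finite sums of products a_k (b_k o g), with a_k and b_k smooth, are closed under differentiation
    by the product and chain rules, so [smooth_coind] applies to this class. *)
Lemma smooth_comp (f : G -> R^o) (g : G -> G) : smooth f ->
  (forall i, smooth (fun p => gc i (g p) : R^o)) -> smooth (fun p => f (g p) : R^o).
Proof.
move=> sf sg.
apply: (@smooth_coind _ _ (fun h => exists n, exists (a b : 'I_n -> G -> R^o),
    [/\ forall k, smooth (a k), forall k, smooth (b k) &
        h = fun p => \sum_(k < n) a k p * b k (g p)])); last first.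
  exists 1%N, (fun _ _ => 1), (fun=> f); split=> // [_|]; first exact: smooth_cst.
  by apply/funext => p; rewrite big_ord1 mul1r.
move=> _ [n [a [b [sa sb ->]]]]; split=> [p|v].
  apply: (@cvg_sum_fin R R^o) => k; apply: cvgM; first exact: smooth_continuous.
  apply: (continuous_comp (g := b k)); last exact: smooth_continuous.
  by apply: cvg_gc => j; exact: smooth_continuous (sg j) p.
have D p : is_derive p v (fun p => \sum_(k < n) a k p * b k (g p) : R^o)
  (\sum_(k < n) (a k p * (\sum_j 'D_v (fun q => gc j (g q) : R^o) p * 'D_(gb j) (b k) (g p))
       + b k (g p) * 'D_v (a k) p)).
  have -> : (fun p => \sum_(k < n) a k p * b k (g p)) =
     \sum_(k < n) (fun p => a k p * b k (g p)) :> (G -> R^o).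
    by apply/funext => q; rewrite fct_sumE.
  apply: is_derive_sum => k.
  apply: (@is_deriveM _ _ (a k) (fun q => b k (g q))); first exact: smooth_is_derive.
  by apply: is_derive_comp => // j; exact: smooth_is_derive.
eexists; last exact: D.
(* The terms of the derivative are indexed by pairs: (k, None) differentiates a_k, and (k, Some j)
   differentiates b_k o g through the coordinate j of g. *)
exists (#|{: 'I_n * option (option 'I_5)}|).
pose e (k : 'I_(#|{: 'I_n * option (option 'I_5)}|)) := enum_val k.
exists (fun k => if (e k).2 is Some j then
           (fun p => a (e k).1 p * 'D_v (fun q => gc j (g q) : R^o) p)
         else 'D_v (a (e k).1)).
exists (fun k => if (e k).2 is Some j then 'D_(gb j) (b (e k).1) else b (e k).1).
split=> [k|k|].
- case: (e k).2 => [j|]; last exact: smooth_derive.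
  by apply: smoothM => //; exact: smooth_derive.
- by case: (e k).2 => [j|] //; exact: smooth_derive.
apply/funext => p.
rewrite [RHS](reindex (@enum_rank {: 'I_n * option (option 'I_5)})) /=; last first.
  by apply: onW_bij; exact: enum_rank_bij.
under [RHS]eq_bigr do rewrite /e enum_rankK.
rewrite -(pair_bigA _ (fun (i : 'I_n) (o : option (option 'I_5)) =>
  (if o is Some j then (fun p => a i p * 'D_v (fun q => gc j (g q) : R^o) p) else 'D_v (a i)) p *
  (if o is Some j then 'D_(gb j) (b i) else b i) (g p))) /=.
apply: eq_bigr => i _; rewrite [RHS](bigD1 None) //= [LHS]addrC; congr (_ + _); first exact: (@mulrC R).
rewrite mulr_sumr [RHS](reindex_omap (@Some _) id) /=; last by case.
by apply: eq_big => [j|j _]; rewrite ?eqxx // mulrA.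
Qed.

End Coordinates.

(** * Integrals over the unit interval, with parameters *)

Section Primitive.
Variable R : realType.
Implicit Types (g F : R -> R).

Lemma primitive_right g (n : R) : continuous g ->
  exists F, forall x : R, - n < x -> is_derive x (1 : R) F (g x).
Proof.
move=> cg; exists (fun x => \int[lebesgue_measure]_(t in [set` `[- n, x]]) (g t))%R => x nx.
have [||||] := @continuous_FTC1_closed R g (- n) x (x + 1).
- by rewrite ltrDl.
- apply: continuous_compact_integrable; first exact: segment_compact.
  exact: continuous_subspaceT.
- exact: nx.
- exact: cg.
by move=> dF F'; split; [exact: dF|rewrite -derive1E; exact: F'].
Qed.

Lemma eq_primitive g (a : R) F1 F2 :
  (forall x : R, a < x -> is_derive x (1 : R) F1 (g x)) ->
  (forall x : R, a < x -> is_derive x (1 : R) F2 (g x)) ->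
  forall x y : R, a < x -> a < y -> F1 x - F1 y = F2 x - F2 y.
Proof.
move=> d1 d2.
suff H (x y : R) : a < x -> a < y -> x <= y -> F1 x - F1 y = F2 x - F2 y.
  move=> x y ax ay; have [xy|/ltW yx] := leP x y; first exact: H.
  by apply: oppr_inj; rewrite !opprB; exact: H.
move=> ax ay xy; pose h := F1 - F2.
have dh (z : R) : a < z -> is_derive z (1 : R) h 0.
  by move=> az; rewrite -(subrr (g z)); apply: is_deriveB; [exact: d1|exact: d2].
have [||c _] := @MVT_segment R h (fun=> 0) x y xy.
- by move=> z; rewrite in_itv /= => /andP[xz _]; apply: dh; exact: lt_trans xz.
- apply: derivable_within_continuous => z; rewrite in_itv /= => /andP[xz _].
  by case: (dh z (lt_le_trans ax xz)).
rewrite mul0r /h => /eqP; rewrite subr_eq0 => /eqP.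
rewrite -[(F1 - F2) y]/(F1 y - F2 y) -[(F1 - F2) x]/(F1 x - F2 x) => E.
by move: (F1 x) (F1 y) (F2 x) (F2 y) E; clear => b c d e E; lra.
Qed.

(** [primitive_right] works only to the right of -n. Normalised to vanish at 0, these primitives
    agree where they overlap, so the value at x may be read from any large enough n, and one n
    serves near a given point. *)
Lemma primitive_exists g : continuous g ->
  exists F, forall x, is_derive x (1 : R) F (g x).
Proof.
move=> cg; pose P n := cid (primitive_right n%:R cg).
pose FF n x := projT1 (P n) x - projT1 (P n) 0.
have dFF n (x : R) : - n%:R < x -> is_derive x (1 : R) (FF n) (g x).
  move=> nx; rewrite -[g x]subr0; apply: is_deriveB.
  exact: (projT2 (P n)).
have FFn n m (x : R) : (0 < n <= m)%N -> - n%:R < x -> FF n x = FF m x.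
  case/andP=> n0 nm nx.
  have FF0 k : FF k 0 = 0 by rewrite /FF subrr.
  have mn : - m%:R <= - n%:R :> R by rewrite lerN2 ler_nat.
  have := @eq_primitive g (- n%:R) (FF n) (FF m) (dFF n) _ x 0 nx.
  rewrite !FF0 !subr0; apply; last by rewrite oppr_lt0 ltr0n.
  by move=> z nz; apply: dFF; exact: le_lt_trans nz.
pose N (x : R) := (Num.trunc `|x|).+1.
have NP x : - (N x)%:R < x.
  by rewrite ltrNl (le_lt_trans (ler_norm _)) // normrN truncnS_gt.
exists (fun x => FF (N x) x) => x.
pose m := (N x).+1.
apply: (@near_eq_is_derive _ _ _ (FF m)).
  near=> y.
  have my : - m%:R < y.
    near: y; apply: lt_nbhsr.
    by apply: le_lt_trans (NP x); rewrite lerN2 ler_nat.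
  have [Nm|/ltnW mN] := leqP (N y) m; first by rewrite (@FFn (N y) m) // NP.
  by rewrite (@FFn m (N y)).
by apply: dFF; apply: le_lt_trans (NP x); rewrite lerN2 ler_nat.
Unshelve. all: by end_near. Qed.

(** The integral is the increment of any primitive, so that its rules reduce to rules for
    derivatives; the default 0 is met only when there is no primitive. *)
Definition int01 g : R :=
  xget 0 [set c | exists2 F, (forall x, is_derive x (1 : R) F (g x)) & c = F 1 - F 0].

Lemma int01E g F : (forall x, is_derive x (1 : R) F (g x)) -> int01 g = F 1 - F 0.
Proof.
move=> dF; rewrite /int01; case: xgetP => [c _ [F' dF' ->]|/(_ (F 1 - F 0))[]]; last by exists F.
have [l1 l0] : (- 1 < 1 :> R) /\ (- 1 < 0 :> R) by split; lra.
by apply: (@eq_primitive g (- 1)) => // x _.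
Qed.

Lemma int01D g h : continuous g -> continuous h ->
  int01 (fun s => g s + h s) = int01 g + int01 h.
Proof.
move=> /primitive_exists[F dF] /primitive_exists[H dH].
have D x : is_derive x (1 : R) (F + H) (g x + h x) by exact: is_deriveD.
by rewrite (int01E dF) (int01E dH) (int01E D) !fctE opprD addrACA.
Qed.

Lemma int01Z (c : R) g : continuous g -> int01 (fun s => c * g s) = c * int01 g.
Proof.
move=> /primitive_exists[F dF].
have H x : is_derive x (1 : R) (c \*: F) (c * g x) by exact: is_deriveZ.
by rewrite (int01E dF) (int01E H) /= mulrBr.
Qed.

Lemma int01_cst (c : R) : int01 (fun=> c) = c.
Proof.
have H x : is_derive x (1 : R) (c \*: id) c.
  by rewrite -[X in is_derive _ _ _ X]mulr1; exact: is_deriveZ.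
by rewrite (int01E H) /= [_ *: _]mulr1 [_ *: _]mulr0 subr0.
Qed.

Lemma int01_norm_le g (M : R) : continuous g -> (forall s, 0 <= s <= 1 -> `|g s| <= M) ->
  `|int01 g| <= M.
Proof.
move=> /primitive_exists[F dF] gM; rewrite (int01E dF).
have C : {within `[0, 1], continuous F}.
  by apply: derivable_within_continuous => z _; case: (dF z).
have [c] := @MVT_segment R F g 0 1 ler01 (fun x _ => dF x) C.
by rewrite in_itv /= subr0 mulr1 => c01 ->; exact: gM.
Qed.

Lemma int01B g h : continuous g -> continuous h ->
  int01 (fun s => g s - h s) = int01 g - int01 h.
Proof.
move=> cg ch; rewrite -mulN1r -int01Z // -int01D //.
  by congr int01; apply/funext => s; rewrite mulN1r.
by move=> x; apply: cvgM; [exact: cvg_cst|exact: ch].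
Qed.

End Primitive.

Section ParameterIntegral.
Variables (R : realType) (V : normedModType R).
Variables (th : R -> R) (l : V).
Hypothesis cth : continuous th.
Implicit Types (f : V -> R^o) (p q v : V).

Definition pint f p : R^o := int01 (fun s => th s * f (p + s *: l)).

Lemma continuous_line f p : continuous f -> continuous (fun s : R => f (p + s *: l) : R).
Proof.
move=> cf s; apply: (continuous_comp (f := fun s : R => p + s *: l)); last exact: cf.
by apply: cvgD; [exact: cvg_cst|apply: cvgZl; exact: cvg_id].
Qed.

Lemma continuous_pint_integrand f p : continuous f ->
  continuous (fun s : R => th s * f (p + s *: l) : R).
Proof. by move=> cf s; apply: cvgM; [exact: cth|exact: continuous_line]. Qed.

(** Joint continuity of (s, q) -> f (q + s l) and compactness of [0, 1], in the form of
    near-coverings. *)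
Lemma uniform_on_segment f p (e : R) : continuous f -> 0 < e ->
  \forall q \near p, forall s, 0 <= s <= 1 -> `|f (p + s *: l) - f (q + s *: l)| <= e.
Proof.
move=> cf e0.
have /compact_near_coveringP K : compact (`[0, 1] : set R) by exact: segment_compact.
suff H : forall s : R, `[0, 1]%classic s -> \forall s' \near s & q \near p,
    `|f (p + s' *: l) - f (q + s' *: l)| <= e.
  have Hn := K V (nbhs p) (fun q s => `|f (p + s *: l) - f (q + s *: l)| <= e)
    (nbhs_filter p) H.
  apply: (filterS _ Hn) => q Hq s s01; apply: (Hq s).
  by rewrite /mkset in_itv.
move=> s _ /=.
have e20 : 0 < e / 2 by lra.
have l1 : (fun x : R * V => x.2 + x.1 *: l) @ ((s, p) : R * V) --> p + s *: l.
  by apply: cvgD; [exact: cvg_snd|apply: cvgZl; exact: cvg_fst].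
have l2 : (fun x : R * V => p + x.1 *: l) @ ((s, p) : R * V) --> p + s *: l.
  by apply: cvgD; [exact: cvg_cst|apply: cvgZl; exact: cvg_fst].
have c1 := cvg_comp _ _ l1 (cf (p + s *: l)).
have c2 := cvg_comp _ _ l2 (cf (p + s *: l)).
move/cvgrPdist_le: c1 => /(_ _ e20) c1; move/cvgrPdist_le: c2 => /(_ _ e20) c2.
near=> x.
rewrite (splitr e); apply: le_trans (ler_distD (f (p + s *: l)) _ _) _.
apply: lerD; last by near: x; exact: c1.
by rewrite distrC; near: x; exact: c2.
Unshelve. all: by end_near. Qed.

Lemma th_bound : exists2 M : R, 0 < M & forall s, 0 <= s <= 1 -> `|th s| <= M.
Proof.
have C : {within `[0, 1], continuous (fun s => `|th s|)}.
  apply: continuous_subspaceT => s; apply: (continuous_comp (g := fun x : R => `|x|)).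
    exact: cth.
  exact: norm_continuous.
have [c _ H] := EVT_max ler01 C.
exists (`|th c| + 1) => [|s s01]; first by rewrite ltr_wpDl.
by apply: le_trans (H s _) _; rewrite ?in_itv // lerDl.
Qed.

Lemma continuous_pint f : continuous f -> continuous (pint f).
Proof.
move=> cf p; apply/cvgrPdist_le => e e0.
have [M M0 MP] := th_bound.
have := @uniform_on_segment f p (e / M) cf (divr_gt0 e0 M0).
apply: filterS => q H.
rewrite /pint -int01B; try exact: continuous_pint_integrand.
apply: int01_norm_le => [|s s01].
  by move=> x; apply: cvgB; exact: continuous_pint_integrand.
rewrite -mulrBr normrM.
have -> : e = M * (e / M) by rewrite mulrC divfK // gt_eqF.
by apply: ler_pM; [exact: normr_ge0|exact: normr_ge0|exact: MP|exact: H].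
Qed.

(** Differentiation under the integral: for each s the difference quotient is a derivative at an
    intermediate point, uniformly close to the derivative at p + s l. *)
Lemma is_derive_pint f p v : smooth f -> is_derive p v (pint f) (pint (fun q => 'D_v f q) p).
Proof.
move=> sf; apply/is_deriveP => e e0.
have [M M0 MP] := th_bound.
have cf := smooth_continuous sf.
have cdf := smooth_continuous (smooth_derive v sf).
have := @uniform_on_segment (fun q => 'D_v f q) p (e / M) cdf (divr_gt0 e0 M0).
move=> /nbhs_normP[d /= d0 dP].
(* For |h| below this bound the points p + c h v with c in [0, 1] stay within d of p; the summand 1
   allows v = 0. *)
exists (d / (1 + `|v|)) => [|h h0 hd].
  by rewrite divr_gt0 // ltr_pwDl.
have i1 := continuous_pint_integrand cf (p := p + h *: v).
have i2 := continuous_pint_integrand cf (p := p).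
have i3 := continuous_pint_integrand cdf (p := p).
have i4 : continuous (fun s => th s * f (p + h *: v + s *: l) - th s * f (p + s *: l)).
  by move=> x; apply: cvgB; [exact: i1|exact: i2].
have i5 : continuous (fun s => h^-1 * (th s * f (p + h *: v + s *: l) - th s * f (p + s *: l))).
  by move=> x; apply: cvgM; [exact: cvg_cst|exact: i4].
rewrite /pint -(int01B i1 i2) -(int01Z _ i4) -(int01B i5 i3).
apply: int01_norm_le => [x|s s01].
  by apply: cvgB; [exact: i5|exact: i3].
have [c /andP[c0 c1] E] := @MVT_line _ _ f (p + s *: l) (h *: v)
  (fun q => smooth_derivable (p := q) (v := h *: v) sf).
rewrite -mulrBr (addrAC p) E.
rewrite (derive_val (is_derive := is_derive_dirZ h (smooth_is_derive _ v sf))).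
rewrite mulrCA mulKf // -mulrBr normrM.
have -> : e = M * (e / M) by rewrite mulrC divfK // gt_eqF.
apply: ler_pM; [exact: normr_ge0|exact: normr_ge0|exact: MP|].
rewrite distrC addrAC; apply: dP => //=.
rewrite opprD addrA subrr sub0r normrN normrZ ger0_norm // normrZ.
apply: (@le_lt_trans _ _ (1 * (`|h| * (1 + `|v|)))).
  by apply: ler_pM; [exact: c0|rewrite mulr_ge0|exact: c1|rewrite ler_wpM2l // lerDr].
by rewrite mul1r -ltr_pdivlMr // ltr_pwDl.
Qed.

Lemma smooth_pint f : smooth f -> smooth (pint f).
Proof.
move=> sf; apply: (@smooth_coind _ _ (fun g => exists2 f, smooth f & g = pint f)); last by exists f.
move=> _ [{}f {}sf ->]; split=> [|v]; first exact/continuous_pint/smooth_continuous.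
exists (pint (fun q => 'D_v f q)); last by move=> p; exact: is_derive_pint.
by exists (fun q => 'D_v f q) => //; exact: smooth_derive.
Qed.

End ParameterIntegral.

(** * The algebra of forms: wedge product, contraction and exterior derivative *)

Lemma shuffle_inv_sum n (m : n.-tuple bool) :
  shuffle_inv m = (\sum_(i < n) \sum_(j < n) ((i < j) && ~~ tnth m i && tnth m j))%N.
Proof.
rewrite /shuffle_inv pair_bigA -sum1_card big_mkcond /=; apply: eq_bigr => -[i j] _ /=.
by rewrite inE /= andbA; case: ifP.
Qed.

(** A leading unselected position is inverted with each selected position after it, a leading
    selected one with none. This is the source of the sign in [wedge_cons]. *)
Lemma shuffle_inv_cons n b (m : n.-tuple bool) :
  shuffle_inv [tuple of b :: m] = ((if b then 0 else count id m) + shuffle_inv m)%N.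
Proof.
rewrite !shuffle_inv_sum big_ord_recl; congr (_ + _)%N.
  rewrite big_ord_recl /= add0n.
  under eq_bigr do rewrite tnth0 tnthS /=.
  case: b; first by rewrite big1.
  rewrite -sum1_count [RHS]big_mkcond big_tuple.
  by apply: eq_bigr => i _ /=; case: (tnth m i).
apply: eq_bigr => i _; rewrite big_ord_recl /= add0n.
by apply: eq_bigr => j _; rewrite !tnthS /= /bump /= !add1n ltnS.
Qed.

Section FormAlgebra.
Variables (R : realType) (V : normedModType R).
Local Notation dform := (dform V).
Implicit Types (w : dform) (p v : V) (s : seq V).

Local Notation one_f := (@form1 R V).
(** Contraction with the constant field v. Identities between forms are proved by induction on the
    list of arguments, through the Leibniz rule [ins_wedge] and Cartan's formula [ins_extd]. *)
Definition ins v w : dform := fun p s => w p (v :: s).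
(** The degree involution, read off from the length of the list so that it is defined on
    inhomogeneous elements too. *)
Definition sgn w : dform := fun p s => (-1) ^+ size s * w p s.
Definition dird v w : dform := fun p s => 'D_v (fun q => w q s : R^o) p.
Definition sform w := forall s, smooth (fun p => w p s : R^o).

Lemma dform_eqP w1 w2 : (forall p s, w1 p s = w2 p s) -> w1 = w2.
Proof. by move=> H; apply/funext => p; apply/funext => s. Qed.

Lemma dformDE w1 w2 p s : (w1 + w2) p s = w1 p s + w2 p s. Proof. by []. Qed.
Lemma dformNE w p s : (- w) p s = - w p s. Proof. by []. Qed.
Lemma dformZE (a : R) w p s : (a *: w) p s = a * w p s. Proof. by []. Qed.
Lemma dform0E p s : (0 : dform) p s = 0. Proof. by []. Qed.
Definition dformE := (dformDE, dformNE, dformZE, dform0E).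

Lemma wedge_nil w1 w2 p : (w1 ∧ w2) p [::] = w1 p [::] * w2 p [::].
Proof.
rewrite /wedge_form (bigD1 [tuple]) //= big1 ?addr0 => [|m /eqP nm]; last first.
  by case: nm; exact: tuple0.
by rewrite shuffle_inv_sum big_ord0 expr0 mul1r.
Qed.

Lemma wedge_cons w1 w2 p v s :
  (w1 ∧ w2) p (v :: s) = (ins v w1 ∧ w2) p s + (sgn w1 ∧ ins v w2) p s.
Proof.
rewrite /wedge_form /=.
(* A mask of v :: s is a first bit, deciding which factor receives v, together with a mask of s. *)
pose h (x : bool * (size s).-tuple bool) : (size s).+1.-tuple bool := [tuple of x.1 :: x.2].
have hb : bijective h.
  exists (fun m => (thead m, [tuple of behead m])) => [[b m]|m] /=.
    by rewrite theadE; congr pair; apply: val_inj.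
  by rewrite /h /= -tuple_eta.
rewrite (reindex h) /=; last exact: onW_bij.
rewrite -(pair_bigA _ (fun b (m : (size s).-tuple bool) =>
  (-1) ^+ shuffle_inv (h (b, m)) *
  (w1 p (mask (h (b, m)) (v :: s)) * w2 p (mask (map negb (h (b, m))) (v :: s))))) /=.
rewrite big_bool /=; congr (_ + _); apply: eq_bigr => m _; rewrite /h /= shuffle_inv_cons //=.
by rewrite /sgn /ins exprD size_mask ?size_tuple // -!mulrA mulrCA.
Qed.

Lemma extd_nil w p : extd w p [::] = 0.
Proof. by rewrite /extd big_ord0. Qed.

Lemma extd_cons w p v s : extd w p (v :: s) = dird v w p s - extd (ins v w) p s.
Proof.
rewrite /extd big_ord_recl /= expr0 mul1r drop0; congr (_ + _).
rewrite -sumrN; apply: eq_bigr => i _.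
by rewrite exprS mulN1r mulNr.
Qed.

Lemma ins_wedge v w1 w2 : ins v (w1 ∧ w2) = ins v w1 ∧ w2 + sgn w1 ∧ ins v w2.
Proof. by apply: dform_eqP => p s; rewrite [LHS]wedge_cons. Qed.

(** Cartan's formula: for a constant field the Lie derivative is the coefficientwise derivative
    [dird]. *)
Lemma ins_extd v w : ins v (extd w) = dird v w - extd (ins v w).
Proof. by apply: dform_eqP => p s; rewrite [LHS]extd_cons. Qed.

Lemma ins_lin v : linear (ins v). Proof. by []. Qed.
Lemma insD v w1 w2 : ins v (w1 + w2) = ins v w1 + ins v w2. Proof. by []. Qed.
Lemma insN v w : ins v (- w) = - ins v w. Proof. by []. Qed.
Lemma insZ v (a : R) w : ins v (a *: w) = a *: ins v w. Proof. by []. Qed.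

Lemma sgnK w : sgn (sgn w) = w.
Proof.
by apply: dform_eqP => p s; rewrite /sgn mulrA -exprMn mulrNN mulr1 expr1n mul1r.
Qed.

Lemma ins_sgn v w : ins v (sgn w) = - sgn (ins v w).
Proof. by apply: dform_eqP => p s; rewrite /ins /sgn /= exprS mulN1r mulNr. Qed.

Lemma sgn_lin : linear sgn.
Proof. by move=> a w1 w2; apply: dform_eqP => p s; rewrite /sgn !dformE; ring. Qed.

Lemma sgnD w1 w2 : sgn (w1 + w2) = sgn w1 + sgn w2.
Proof. by have := sgn_lin 1 w1 w2; rewrite !scale1r. Qed.

(* Induction on the list of arguments, peeling off the first one with [ins]. *)
Lemma wedge_linr w1 : linear (wedge_form w1).
Proof.
move=> a w2 w3; apply: dform_eqP => p s; elim: s w1 w2 w3 => [|v s IH] w1 w2 w3.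
  by rewrite !dformE !wedge_nil !dformE; ring.
by rewrite !dformE !wedge_cons ins_lin !IH !dformE; ring.
Qed.

Lemma wedge_linl w2 : linear (fun w1 => w1 ∧ w2).
Proof.
move=> a w1 w3; apply: dform_eqP => p s; elim: s w1 w2 w3 => [|v s IH] w1 w2 w3.
  by rewrite !dformE !wedge_nil !dformE; ring.
by rewrite !dformE !wedge_cons ins_lin sgn_lin !IH !dformE; ring.
Qed.

Lemma wedgeDl w1 w2 w3 : (w1 + w2) ∧ w3 = w1 ∧ w3 + w2 ∧ w3.
Proof. by have := wedge_linl w3 1 w1 w2; rewrite !scale1r. Qed.
Lemma wedgeDr w1 w2 w3 : w1 ∧ (w2 + w3) = w1 ∧ w2 + w1 ∧ w3.
Proof. by have := wedge_linr w1 1 w2 w3; rewrite !scale1r. Qed.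
Lemma wedge0l w : 0 ∧ w = 0.
Proof. by have := wedge_linl w (-1) 0 0; rewrite scaler0 addr0 scaleN1r addNr. Qed.
Lemma wedge0r w : w ∧ 0 = 0.
Proof. by have := wedge_linr w (-1) 0 0; rewrite scaler0 addr0 scaleN1r addNr. Qed.
Lemma wedgeZl (a : R) w1 w2 : (a *: w1) ∧ w2 = a *: (w1 ∧ w2).
Proof. by have := wedge_linl w2 a w1 0; rewrite wedge0l !addr0. Qed.
Lemma wedgeZr (a : R) w1 w2 : w1 ∧ (a *: w2) = a *: (w1 ∧ w2).
Proof. by have := wedge_linr w1 a w2 0; rewrite wedge0r !addr0. Qed.
Lemma wedgeNl w1 w2 : (- w1) ∧ w2 = - (w1 ∧ w2).
Proof. by rewrite -(scaleN1r w1) wedgeZl scaleN1r. Qed.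
Lemma wedgeNr w1 w2 : w1 ∧ (- w2) = - (w1 ∧ w2).
Proof. by rewrite -(scaleN1r w2) wedgeZr scaleN1r. Qed.

Lemma sgn_wedge w1 w2 : sgn (w1 ∧ w2) = sgn w1 ∧ sgn w2.
Proof.
apply: dform_eqP => p s; elim: s w1 w2 => [|v s IH] w1 w2.
  by rewrite /sgn !wedge_nil /= !expr0 !mul1r.
rewrite [RHS]wedge_cons !ins_sgn wedgeNl wedgeNr !dformE -!IH.
by rewrite /sgn /= wedge_cons exprS; ring.
Qed.

Lemma wedgeA w1 w2 w3 : w1 ∧ (w2 ∧ w3) = w1 ∧ w2 ∧ w3.
Proof.
apply: dform_eqP => p s; elim: s w1 w2 w3 => [|v s IH] w1 w2 w3.
  by rewrite !wedge_nil mulrA.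
rewrite !wedge_cons !ins_wedge wedgeDr wedgeDl !dformE !IH sgn_wedge.
by rewrite addrA.
Qed.

Lemma ins_form1 v : ins v (one_f) = 0. Proof. by []. Qed.
Lemma sgn_form1 : sgn (one_f) = one_f.
Proof.
by apply: dform_eqP => p [|v s]; rewrite /sgn /form1 /= ?expr0 ?mul1r ?mulr0.
Qed.

Lemma wedge1l w : one_f ∧ w = w.
Proof.
apply: dform_eqP => p s; elim: s w => [|v s IH] w; first by rewrite wedge_nil /form1 mul1r.
by rewrite wedge_cons ins_form1 wedge0l sgn_form1 IH dformE add0r.
Qed.

Lemma wedge1r w : w ∧ one_f = w.
Proof.
apply: dform_eqP => p s; elim: s w => [|v s IH] w; first by rewrite wedge_nil /form1 mulr1.
by rewrite wedge_cons ins_form1 wedge0r dformE IH addr0.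
Qed.

Definition ofdeg k w := forall p s, size s <> k -> w p s = 0.

Lemma ofdeg_ins k v w : ofdeg k.+1 w -> ofdeg k (ins v w).
Proof. by move=> dw p s sk; apply: dw => /= -[]. Qed.

Lemma ofdeg0_ins v w : ofdeg 0 w -> ins v w = 0.
Proof. by move=> dw; apply: dform_eqP => p s; apply: dw. Qed.

Lemma ofdeg_sgn k w : ofdeg k w -> sgn w = (-1) ^+ k *: w.
Proof.
move=> dw; apply: dform_eqP => p s; rewrite /sgn !dformE.
by have [->//|sk] := eqVneq (size s) k; rewrite dw ?mulr0 //; apply/eqP.
Qed.

Lemma wedgeC k l w1 w2 : ofdeg k w1 -> ofdeg l w2 ->
  w1 ∧ w2 = (-1) ^+ (k * l) *: (w2 ∧ w1).
Proof.
move=> d1 d2; apply: dform_eqP => p s.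
elim: s k l w1 w2 d1 d2 => [|v s IH] k l w1 w2 d1 d2.
  rewrite dformE !wedge_nil mulrC.
  case: k d1 => [|k] d1; first by rewrite mul0n expr0 mul1r.
  by rewrite d1 // !mulr0.
rewrite !dformE !wedge_cons (ofdeg_sgn d1) (ofdeg_sgn d2) !wedgeZl !dformE.
have -> : (ins v w1 ∧ w2) p s = (-1) ^+ (k.-1 * l) * (w2 ∧ ins v w1) p s.
  case: k d1 => [|k] d1; first by rewrite (ofdeg0_ins v d1) wedge0l wedge0r mulr0.
  by rewrite (IH k l) //; exact: ofdeg_ins.
have -> : (w1 ∧ ins v w2) p s = (-1) ^+ (k * l.-1) * (ins v w2 ∧ w1) p s.
  case: l d2 => [|l] d2; first by rewrite (ofdeg0_ins v d2) wedge0l wedge0r mulr0.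
  by rewrite (IH k l) //; exact: ofdeg_ins.
(* For k = 0 the exponent with k.-1 would be wrong, but then the contraction of w1 vanishes;
   likewise for l in the next claim. *)
have E1 : k = 0%N \/ (-1) ^+ (k.-1 * l) = (-1) ^+ (k * l) * (-1) ^+ l :> R.
  case: (k) => [|k']; [by left|right].
  by rewrite -exprD mulSn addnAC addnn exprD -mul2n (exprM _ 2 l) sqrrN !expr1n mul1r.
have E2 : l = 0%N \/ (-1) ^+ k * (-1) ^+ (k * l.-1) = (-1) ^+ (k * l) :> R.
  by case: (l) => [|l']; [left|right; rewrite mulnS exprD].
rewrite mulrDr !mulrA addrC; congr (_ + _).
  case: E2 => [l0|->//].
  by rewrite l0 in d2; rewrite (ofdeg0_ins v d2) wedge0l !mulr0.
case: E1 => [k0|->//].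
by rewrite k0 in d1; rewrite (ofdeg0_ins v d1) wedge0r !mulr0.
Qed.

Lemma sform_ins v w : sform w -> sform (ins v w).
Proof. by move=> sw s; exact: (sw (v :: s)). Qed.

Lemma sform_dird v w : sform w -> sform (dird v w).
Proof. by move=> sw s; exact: smooth_derive. Qed.

Lemma sform_sgn w : sform w -> sform (sgn w).
Proof. by move=> sw s; exact: smoothZ. Qed.

Lemma sformD w1 w2 : sform w1 -> sform w2 -> sform (w1 + w2).
Proof. by move=> s1 s2 s; exact: smoothD. Qed.

Lemma sformZ (a : R) w : sform w -> sform (a *: w).
Proof. by move=> sw s; exact: smoothZ. Qed.

Lemma sformN w : sform w -> sform (- w).
Proof. by move=> sw s; exact: smoothN. Qed.

Lemma sformB w1 w2 : sform w1 -> sform w2 -> sform (w1 - w2).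
Proof. by move=> s1 s2; apply: sformD => //; exact: sformN. Qed.

Lemma sform0 : sform 0.
Proof. by move=> s; exact: smooth_cst. Qed.

Lemma sform_wedge w1 w2 : sform w1 -> sform w2 -> sform (w1 ∧ w2).
Proof.
move=> s1 s2 s; apply: smooth_sum => m _.
by apply: smoothZ; apply: smoothM.
Qed.

Lemma sform_extd w : sform w -> sform (extd w).
Proof.
by move=> sw s; apply: smooth_sum => i _; apply: smoothZ; exact: smooth_derive.
Qed.

Lemma dirdD v w1 w2 : sform w1 -> sform w2 -> dird v (w1 + w2) = dird v w1 + dird v w2.
Proof.
move=> s1 s2; apply: dform_eqP => p s.
by apply: deriveD; apply: smooth_derivable.
Qed.

Lemma dirdZ v (a : R) w : sform w -> dird v (a *: w) = a *: dird v w.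
Proof.
by move=> sw; apply: dform_eqP => p s; apply: deriveZ; exact: smooth_derivable.
Qed.

Lemma dirdN v w : sform w -> dird v (- w) = - dird v w.
Proof. by move=> sw; rewrite -(scaleN1r w) dirdZ // scaleN1r. Qed.

Lemma dird_sgn v w : sform w -> dird v (sgn w) = sgn (dird v w).
Proof.
by move=> sw; apply: dform_eqP => p s; apply: deriveZ; exact: smooth_derivable.
Qed.

Lemma dird0 v : dird v 0 = 0.
Proof. by apply: dform_eqP => p s; exact: derive_cst. Qed.

Lemma ins_dird u v w : ins u (dird v w) = dird v (ins u w). Proof. by []. Qed.

Lemma dird_wedge v w1 w2 : sform w1 -> sform w2 ->
  dird v (w1 ∧ w2) = dird v w1 ∧ w2 + w1 ∧ dird v w2.
Proof.
move=> s1 s2; apply: dform_eqP => p s.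
elim: s w1 w2 s1 s2 => [|u s IH] w1 w2 s1 s2; rewrite dformE.
  rewrite !wedge_nil /dird.
  have -> : (fun q => (w1 ∧ w2) q [::]) = (fun q => w1 q [::] : R^o) * (fun q => w2 q [::] : R^o).
    by apply/funext => q; rewrite wedge_nil.
  rewrite deriveM; try exact: smooth_derivable.
  by rewrite addrC [X in X + _]mulrC.
transitivity (dird v (ins u w1 ∧ w2 + sgn w1 ∧ ins u w2) p s).
  by rewrite -ins_wedge.
rewrite dirdD; try by apply: sform_wedge => //; exact: sform_ins || exact: sform_sgn.
rewrite dformE !IH //; try exact: sform_ins; try exact: sform_sgn.
rewrite !wedge_cons !dformE dird_sgn // !ins_dird.
by rewrite addrACA.
Qed.

Lemma extdD w1 w2 : sform w1 -> sform w2 -> extd (w1 + w2) = extd w1 + extd w2.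
Proof.
move=> s1 s2; apply: dform_eqP => p s.
elim: s w1 w2 s1 s2 => [|v s IH] w1 w2 s1 s2; rewrite !dformE.
  by rewrite !extd_nil addr0.
rewrite !extd_cons dirdD // insD IH; try exact: sform_ins.
by rewrite !dformE opprD addrACA.
Qed.

Lemma extdZ (a : R) w : sform w -> extd (a *: w) = a *: extd w.
Proof.
move=> sw; apply: dform_eqP => p s.
elim: s w sw => [|v s IH] w sw; rewrite !dformE; first by rewrite !extd_nil mulr0.
by rewrite !extd_cons dirdZ // insZ IH ?mulrBr //; exact: sform_ins.
Qed.

Lemma extdN w : sform w -> extd (- w) = - extd w.
Proof. by move=> sw; rewrite -(scaleN1r w) extdZ // scaleN1r. Qed.

Lemma extdB w1 w2 : sform w1 -> sform w2 -> extd (w1 - w2) = extd w1 - extd w2.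
Proof. by move=> s1 s2; rewrite extdD ?extdN //; exact: sformN. Qed.

Lemma extd0 : extd (0 : dform) = 0.
Proof. by have := extdZ 0 sform0; rewrite !scale0r. Qed.

Lemma extd_sgn w : sform w -> extd (sgn w) = - sgn (extd w).
Proof.
move=> sw; apply: dform_eqP => p s; elim: s w sw => [|v s IH] w sw.
  by rewrite !dformE /sgn !extd_nil mulr0 oppr0.
rewrite extd_cons ins_sgn extdN; last exact/sform_sgn/sform_ins.
rewrite !dformE IH; last exact: sform_ins.
rewrite dird_sgn // /sgn !dformE /= extd_cons exprS; ring.
Qed.

Lemma extd_wedge w1 w2 : sform w1 -> sform w2 ->
  extd (w1 ∧ w2) = extd w1 ∧ w2 + sgn w1 ∧ extd w2.
Proof.
move=> s1 s2; apply: dform_eqP => p s.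
elim: s w1 w2 s1 s2 => [|v s IH] w1 w2 s1 s2.
  by rewrite dformE !wedge_nil !extd_nil mulr0 mul0r addr0.
have i1 := sform_ins v s1; have i2 := sform_ins v s2; have g1 := sform_sgn s1.
rewrite extd_cons dird_wedge // ins_wedge extdD; try exact: sform_wedge.
rewrite !dformE !IH // !wedge_cons !ins_extd !ins_sgn sgnK extd_sgn // .
rewrite !wedgeDl !wedgeDr !wedgeNl !wedgeNr !dformE.
set A := (dird v w1 ∧ w2) p s; set B := (w1 ∧ dird v w2) p s.
set C := (extd (ins v w1) ∧ w2) p s; set D := (sgn (ins v w1) ∧ extd w2) p s.
set E := (sgn (extd w1) ∧ ins v w2) p s; set F := (w1 ∧ extd (ins v w2)) p s.
by move: A B C D E F => A B C D E F; ring.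
Qed.

(** Rests on the symmetry of second derivatives; with Cartan's formula it yields d d = 0. *)
Lemma dird_extd v w : sform w -> dird v (extd w) = extd (dird v w).
Proof.
move=> sw; apply: dform_eqP => p s.
elim: s w sw => [|u s IH] w sw.
  rewrite extd_nil /dird; rewrite (_ : (fun _ => _) = fun=> 0) ?derive_cst //.
  by apply/funext => q; rewrite extd_nil.
have iw := sform_ins u sw.
transitivity (dird v (dird u w - extd (ins u w)) p s); first by rewrite -ins_extd.
rewrite dirdD; [|exact: sform_dird|exact/sformN/sform_extd].
rewrite dirdN; last exact: sform_extd.
rewrite extd_cons ins_dird -(IH _ iw).
transitivity (dird v (dird u w) p s - dird v (extd (ins u w)) p s); first by [].
have E : dird v (dird u w) p s = dird u (dird v w) p s.
  exact: (congr1 (fun f => f p) (smooth_deriveC u v (sw s))).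
by rewrite E.
Qed.

Lemma extd_extd w : sform w -> extd (extd w) = 0.
Proof.
move=> sw; apply: dform_eqP => p s; elim: s w sw => [|v s IH] w sw; first by rewrite extd_nil.
have iw := sform_ins v sw.
rewrite extd_cons ins_extd extdB ?dird_extd //; try exact: sform_dird; try exact: sform_extd.
by rewrite !dformE IH // subr0 subrr.
Qed.

End FormAlgebra.

(** * Alternating forms and pullback *)

Section Alternating.
Variables (R : realType) (V : normedModType R).
Local Notation dform := (dform V).
Implicit Types (w : dform) (p u v : V) (s : seq V).

(** The alternating multilinear conditions are phrased recursively through contraction, so that
    induction on the degree combines with [ins]; [is_formP] reconciles this with [is_form]. *)
Fixpoint altf k w : Prop :=
  if k is k'.+1 then
    [/\ forall p, w p [::] = 0,
        forall (a : R) u v, ins (a *: u + v) w = a *: ins u w + ins v w,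
        forall v, ins v (ins v w) = 0 &
        forall v, altf k' (ins v w)]
  else ofdeg 0 w.

Lemma altf_ins k v w : altf k.+1 w -> altf k (ins v w).
Proof. by case=> _ _ _; apply. Qed.

Lemma altf_deg k w : altf k w -> ofdeg k w.
Proof.
elim: k w => [|k IH] w //= [w0 _ _ aw] p [|v s] sk; first exact: w0.
by apply: (IH _ (aw v)) => sk'; apply: sk; rewrite /= sk'.
Qed.

Lemma altf_lin k w (a : R) u v : altf k w -> ins (a *: u + v) w = a *: ins u w + ins v w.
Proof.
case: k => [d|k [_ H _ _]]; last exact: H.
by rewrite !(ofdeg0_ins _ d) scaler0 addr0.
Qed.

Lemma altf_insD k w u v : altf k w -> ins (u + v) w = ins u w + ins v w.
Proof. by move=> aw; have := altf_lin 1 u v aw; rewrite !scale1r. Qed.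

Lemma altf_ins0 k w : altf k w -> ins 0 w = 0.
Proof. by move=> aw; have := altf_lin (-1) 0 0 aw; rewrite scaler0 addr0 scaleN1r addNr. Qed.

Lemma altf_insZ k w (a : R) u : altf k w -> ins (a *: u) w = a *: ins u w.
Proof.
by move=> aw; have := altf_lin a u 0 aw; rewrite (altf_ins0 aw) !addr0.
Qed.

Lemma altf_insN k w u : altf k w -> ins (- u) w = - ins u w.
Proof. by move=> aw; rewrite -(scaleN1r u) (altf_insZ _ _ aw) scaleN1r. Qed.

Lemma altf_ins_sum k w I (r : seq I) (a : I -> R) (e : I -> V) : altf k w ->
  ins (\sum_(i <- r) a i *: e i) w = \sum_(i <- r) a i *: ins (e i) w.
Proof.
move=> aw; elim: r => [|i r IH]; first by rewrite !big_nil (altf_ins0 aw).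
by rewrite !big_cons (altf_lin _ _ _ aw) IH.
Qed.

Lemma altf_insins k w v : altf k w -> ins v (ins v w) = 0.
Proof. by case: k => [d|k [_ _ H _]]; [rewrite (ofdeg0_ins _ d)|exact: H]. Qed.

Lemma altf_swap k w u v : altf k w -> ins u (ins v w) = - ins v (ins u w).
Proof.
case: k => [|k] aw; first by rewrite !(ofdeg0_ins _ aw) oppr0.
have H : ins (u + v) (ins (u + v) w) = 0 by exact: (altf_insins _ aw).
move: H; rewrite (altf_insD _ _ aw) insD !(altf_insD _ _ (altf_ins _ aw)).
rewrite !(altf_insins _ aw) add0r addr0 addrC => H.
by apply/eqP; rewrite -addr_eq0; apply/eqP; exact: H.
Qed.

Lemma altf0 k : altf k 0.
Proof.
elim: k => [|k IH] /=; first by move=> p s.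
by split=> // a u v; rewrite scaler0 addr0.
Qed.

Lemma altf_comb k (a : R) w1 w2 : altf k w1 -> altf k w2 -> altf k (a *: w1 + w2).
Proof.
elim: k w1 w2 => [|k IH] w1 w2 /=.
  by move=> d1 d2 p s ps; rewrite !dformE d1 // d2 // mulr0 addr0.
move=> [z1 l1 i1 a1] [z2 l2 i2 a2]; split=> [p|b u v|v|v].
- by rewrite !dformE z1 z2 mulr0 addr0.
- rewrite !insD !insZ l1 l2 !scalerDr !scalerA [a * b]mulrC -!addrA; congr (_ + _).
  by rewrite addrCA.
- by rewrite !insD !insZ i1 i2 scaler0 addr0.
- by apply: (IH (ins v w1) (ins v w2)); [exact: a1|exact: a2].
Qed.

Lemma altfD k w1 w2 : altf k w1 -> altf k w2 -> altf k (w1 + w2).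
Proof. by move=> a1 a2; rewrite -(scale1r w1); exact: altf_comb. Qed.

Lemma altfZ k (a : R) w : altf k w -> altf k (a *: w).
Proof. by move=> aw; rewrite -[_ *: _]addr0; apply: altf_comb => //; exact: altf0. Qed.

Lemma altfN k w : altf k w -> altf k (- w).
Proof. by move=> aw; rewrite -(scaleN1r w); exact: altfZ. Qed.

Lemma altf_sgn k w : altf k w -> altf k (sgn w).
Proof. by move=> aw; rewrite (ofdeg_sgn (altf_deg aw)); exact: altfZ. Qed.

Lemma altf_wedge k l w1 w2 : altf k w1 -> altf l w2 -> altf (k + l) (w1 ∧ w2).
Proof.
move En : (k + l)%N => n a1 a2; elim: n k l En w1 w2 a1 a2 => [|n IH] k l En w1 w2 a1 a2.
  move: En a1 a2; case: k => // /eqP; rewrite add0n => /eqP-> d1 d2 p [|v s] // _.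
  by rewrite wedge_cons (ofdeg0_ins _ d1) (ofdeg0_ins _ d2) wedge0l wedge0r dformE addr0.
split=> [p|a u v|v|v].
- rewrite wedge_nil; case: k a1 En => [|k] a1 En; last by case: a1 => -> _ _ _; rewrite mul0r.
  by move: En a2; rewrite add0n => -> -[-> _ _ _]; rewrite mulr0.
- rewrite !ins_wedge (altf_lin _ _ _ a1) (altf_lin _ _ _ a2) wedgeDl wedgeDr wedgeZl wedgeZr.
  by rewrite scalerDr -!addrA; congr (_ + _); rewrite addrCA.
- rewrite ins_wedge insD !ins_wedge (altf_insins _ a1) (altf_insins _ a2) wedge0l wedge0r.
  by rewrite add0r addr0 ins_sgn wedgeNl subrr.
- rewrite ins_wedge; apply: altfD.
    case: k a1 En => [|k] a1 En; first by rewrite (ofdeg0_ins _ a1) wedge0l; exact: altf0.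
    by apply: (IH k l); [case: En|exact: altf_ins|].
  case: l a2 En => [|l] a2 En; first by rewrite (ofdeg0_ins _ a2) wedge0r; exact: altf0.
  by apply: (IH k l); [move: En; rewrite addnS => -[]|exact: altf_sgn|exact: altf_ins].
Qed.

Lemma is_formP k w : is_form k w <-> altf k w /\ sform w.
Proof.
split=> [|[aw sw]].
  elim: k w => [|k IH] w [dw lw tw sw]; split=> //.
  split=> [p|a u v|v|v].
  - by rewrite dw.
  - by apply: dform_eqP => p s; exact: (lw p [::] s).
  - by apply: dform_eqP => p s; exact: (tw p [::] [::] s).
  - case: (IH (ins v w)) => //; split=> [p s sk|p s1 s2 a u u'|p s1 s2 s3 u|s].
    + by apply: dw => /= -[].
    + exact: (lw p (v :: s1)).
    + exact: (tw p (v :: s1)).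
    + exact: (sw (v :: s)).
split=> //; first exact: altf_deg.
- move=> p s1 s2 a u v.
  elim: s1 k w aw {sw} => [|x s1 IH] k w aw.
    exact: (congr1 (fun f : dform => f p s2) (altf_lin a u v aw)).
  case: k aw => [|k] aw; first by rewrite !aw //= mulr0 addr0.
  exact: (IH k (ins x w) (altf_ins x aw)).
- move=> p s1 s2 s3 u.
  elim: s1 k w aw {sw} => [|x s1 IH] k w aw; last first.
    case: k aw => [|k] aw; first by rewrite aw.
    exact: (IH k (ins x w) (altf_ins x aw)).
  elim: s2 k w aw => [|x s2 IH] k w aw /=.
    exact: (congr1 (fun f : dform => f p s3) (altf_insins u aw)).
  case: k aw => [|k] aw; first by rewrite aw.
  have E := congr1 (fun f : dform => f p (s2 ++ u :: s3)) (altf_swap x u aw).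
  transitivity (- ins x w p (u :: s2 ++ u :: s3)); first exact: E.
  by rewrite (IH k (ins x w) (altf_ins x aw)) oppr0.
Qed.

Definition covf (xi : V -> R) : dform :=
  fun _ s => if s is [:: v] then xi v else 0.

Lemma ins_covf xi v : ins v (covf xi) = xi v *: @form1 R V.
Proof.
apply: dform_eqP => p [|u s]; rewrite !dformE /form1 /=; first by rewrite mulr1.
by rewrite mulr0.
Qed.

Lemma altf_form1 : altf 0 (@form1 R V).
Proof. by move=> p [|v s]. Qed.

Lemma altf_covf xi : (forall (a : R) u v, xi (a *: u + v) = a * xi u + xi v) ->
  altf 1 (covf xi).
Proof.
move=> lxi; split=> [p|a u v|v|v] //.
- by rewrite !ins_covf lxi scalerDl scalerA.
- by rewrite ins_covf; apply: (@altfZ 0); exact: altf_form1.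
Qed.

Lemma sform_covf xi : sform (covf xi).
Proof. by case=> [|v [|u s]]; exact: smooth_cst. Qed.

Lemma dird_const w v : (forall p q, w p = w q) -> dird v w = 0.
Proof.
move=> wc; apply: dform_eqP => p s; rewrite /dird.
rewrite (_ : (fun q => _) = fun=> w p s); first exact: derive_cst.
by apply/funext => q; rewrite (wc q p).
Qed.

Lemma extd_const w : (forall p q, w p = w q) -> extd w = 0.
Proof.
move=> wc; apply: dform_eqP => p s; elim: s w wc => [|v s IH] w wc; first by rewrite extd_nil.
rewrite extd_cons dird_const // IH ?subrr // => p' q'.
by apply/funext => s'; rewrite /ins (wc p' q').
Qed.

Lemma extd_covf xi : extd (covf xi) = 0.
Proof. exact: extd_const. Qed.

Lemma ofdeg_extd k w : ofdeg k w -> ofdeg k.+1 (extd w).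
Proof.
move=> dw p s; elim: s k w dw => [|v s IH] k w dw sk; first by rewrite extd_nil.
rewrite extd_cons.
have sk' : size s <> k by move=> sk'; apply: sk; rewrite /= sk'.
case: k dw sk sk' => [|k] dw sk sk'.
  rewrite (ofdeg0_ins _ dw) extd0 dform0E subr0.
  rewrite /dird (_ : (fun q => _) = fun=> 0); first exact: derive_cst.
  by apply/funext => q; rewrite dw.
rewrite (IH k) ?subr0 //; last exact: ofdeg_ins.
rewrite /dird (_ : (fun q => _) = fun=> 0); first exact: derive_cst.
by apply/funext => q; rewrite dw.
Qed.

(** The wedge at a point uses only values at that point. With an arbitrary map f of vectors this
    gives naturality under pullback; with the identity it transports constancy and invariance to
    products. *)
Lemma wedge_at w1 w2 w1' w2' p q (f : V -> V) s :
  (forall s, w1' p s = w1 q (map f s)) -> (forall s, w2' p s = w2 q (map f s)) ->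
  (w1' ∧ w2') p s = (w1 ∧ w2) q (map f s).
Proof.
elim: s w1 w2 w1' w2' => [|v s IH] w1 w2 w1' w2' H1 H2.
  by rewrite /= !wedge_nil H1 H2.
rewrite map_cons !wedge_cons; congr (_ + _); apply: IH => s'; rewrite /ins ?H1 ?H2 //.
by rewrite /sgn H1 size_map.
Qed.

Lemma pullback_wedge F w1 w2 : pullback F (w1 ∧ w2) = pullback F w1 ∧ pullback F w2.
Proof. by apply: dform_eqP => p s; apply/esym; exact: wedge_at. Qed.

Lemma pullback_lin F : linear (pullback F : dform -> dform). Proof. by []. Qed.
Lemma pullbackD F w1 w2 : pullback F (w1 + w2) = pullback F w1 + pullback F w2.
Proof. by []. Qed.
Lemma pullbackN F w : pullback F (- w) = - pullback F w. Proof. by []. Qed.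
Lemma pullbackZ F (a : R) w : pullback F (a *: w) = a *: pullback F w. Proof. by []. Qed.
Lemma pullback0 F : pullback F 0 = 0 :> dform. Proof. by []. Qed.

Lemma pullback_form1 F : pullback F (@form1 R V) = @form1 R V.
Proof. by apply: dform_eqP => p s; rewrite /pullback /form1 size_map. Qed.

Definition affine_with (A : V -> V) (F : V -> V) :=
  forall p v (h : R), F (p + h *: v) = F p + h *: A v.

Section Affine.
Variables (A F : V -> V).
Hypothesis FA : affine_with A F.

Lemma derive_affine p v : 'D_v F p = A v.
Proof.
apply/cvg_lim => //; apply: cvg_near_cst.
near=> h; rewrite /= [h *: v + p]addrC FA [F p + _]addrC addrK scalerA mulVf ?scale1r //.
by near: h; exact: nbhs_dnbhs_neq.
Unshelve. all: by end_near. Qed.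

Lemma pullback_affineE w p s : pullback F w p s = w (F p) (map A s).
Proof. by rewrite /pullback; congr (w _ _); apply: eq_map => v; rewrite derive_affine. Qed.

Lemma derive_comp_affine (f : V -> R^o) p v : smooth f ->
  'D_v (fun q => f (F q)) p = 'D_(A v) f (F p).
Proof.
move=> sf; have H : is_derive p v (fun q => f (F q) : R^o) ('D_(A v) f (F p)).
  have /is_deriveP dF := smooth_is_derive (F p) (A v) sf.
  apply/is_deriveP => e e0; have [d d0 dP] := dF _ e0.
  by exists d => // h h0 hd; rewrite FA; exact: dP.
exact: (derive_val (is_derive := H)).
Qed.

Lemma ins_pullback_affine v w : ins v (pullback F w) = pullback F (ins (A v) w).
Proof. by apply: dform_eqP => p s; rewrite /ins !pullback_affineE. Qed.

Lemma dird_pullback_affine v w : sform w ->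
  dird v (pullback F w) = pullback F (dird (A v) w).
Proof.
move=> sw; apply: dform_eqP => p s; rewrite pullback_affineE /dird.
rewrite (_ : (fun q => _) = (fun q => w (F q) (map A s))).
  exact: (@derive_comp_affine (fun q => w q (map A s))).
by apply/funext => q; rewrite pullback_affineE.
Qed.

Lemma extd_pullback_affine w : sform w -> extd (pullback F w) = pullback F (extd w).
Proof.
move=> sw; apply: dform_eqP => p s; elim: s w sw => [|v s IH] w sw.
  by rewrite /pullback /= !extd_nil.
rewrite extd_cons ins_pullback_affine IH; last exact: sform_ins.
by rewrite dird_pullback_affine // !pullback_affineE /= extd_cons.
Qed.

End Affine.

End Alternating.

Section FormsOnG.
Variable R : realType.
Local Notation G := (Gtype R).
Local Notation dform := (dform G).
Implicit Types (w : dform) (p u v : G) (s : seq G) (i : option 'I_5).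

Lemma gc0 i : gc i (0 : G) = 0.
Proof. by case: i => [j|] //=; rewrite mxE. Qed.

Lemma gc_comb i (a : R) u v : gc i (a *: u + v) = a * gc i u + gc i v.
Proof. by rewrite gcD gcZ. Qed.

Lemma gc_gb i j : gc i (gb R j) = (i == j)%:R.
Proof.
case: i j => [i|] [j|] //=; rewrite ?mxE //=.
Qed.

Lemma gc_sum i (a : option 'I_5 -> R) : gc i (\sum_j a j *: gb R j) = a i.
Proof.
rewrite (big_morph (gc i) (@gcD _ i) (gc0 i)) (bigD1 i) //= big1 ?addr0 => [|j ji].
  by rewrite gcZ gc_gb eqxx mulr1.
by rewrite gcZ gc_gb eq_sym (negbTE ji) mulr0.
Qed.

(** Euler's identity: wedging dx^i with the contraction by the i-th basis vector and summing counts
    the degree. It expresses a form of degree k + 1 through one-forms and forms of degree k, which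
    drives later inductions on the degree. *)
Lemma Euler k w : altf k w ->
  k%:R *: w = \sum_i covf (gc i) ∧ ins (gb R i) w.
Proof.
move=> aw; apply: dform_eqP => p s; elim: s k w aw => [|v s IH] k w aw.
  have -> : (k%:R *: w) p [::] = 0.
    by rewrite dformE; case: k aw => [|k] aw; [rewrite mul0r|case: aw => -> _ _ _; rewrite mulr0].
  elim/big_rec: _ => // i y _ E.
  by rewrite dformDE wedge_nil mul0r add0r -E.
have E1 : ins v (\sum_i covf (gc i) ∧ ins (gb R i) w) =
   ins v w - \sum_i covf (gc i) ∧ ins v (ins (gb R i) w).
  rewrite {2}(g_decomp v) (altf_ins_sum _ _ _ aw) -sumrB.
  rewrite (big_morph (ins v) (@insD _ _ v) (erefl : ins v 0 = 0)).
  apply: eq_bigr => i _; rewrite ins_wedge ins_covf wedgeZl wedge1l.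
  by rewrite (ofdeg_sgn (altf_deg (altf_covf (gc_comb i)))) expr1 scaleN1r wedgeNl.
transitivity ((ins v w - \sum_i covf (gc i) ∧ ins v (ins (gb R i) w)) p s); last first.
  exact: (congr1 (fun f : dform => f p s) (esym E1)).
case: k aw => [|k] aw.
  rewrite dformZE mul0r (ofdeg0_ins _ aw) big1 ?subr0 // => i _.
  by rewrite (ofdeg0_ins _ aw) wedge0r.
have -> : \sum_i covf (gc i) ∧ ins v (ins (gb R i) w) =
    - \sum_i covf (gc i) ∧ ins (gb R i) (ins v w).
  rewrite -sumrN; apply: eq_bigr => i _.
  by rewrite (altf_swap _ _ aw) wedgeNr.
rewrite opprK dformDE -(IH k (ins v w)); last exact: altf_ins.
by rewrite !dformZE -[in LHS]natr1 mulrDl mul1r addrC.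
Qed.

Section SmoothPullback.
Variable F : G -> G.
Hypothesis sF : forall i, smooth (fun p => gc i (F p) : R^o).

Lemma is_derive_gc p v : is_derive p v F (\sum_i 'D_v (fun q => gc i (F q) : R^o) p *: gb R i).
Proof.
set l := \sum_i _.
suff H : h^-1 *: ((F \o shift p) (h *: v) - F p) @[h --> 0^'] --> l.
  by split; [apply/cvg_ex; exists l|apply/cvg_lim].
apply: cvg_gc => i; rewrite gc_sum.
have /is_derive_cvgP := smooth_is_derive p v (sF i).
apply: cvg_trans; apply: near_eq_cvg; near=> h => /=.
by rewrite gcZ gcD gcN [h *: v + p]addrC.
Unshelve. all: by end_near. Qed.

Lemma gc_derive i p v : gc i ('D_v F p) = 'D_v (fun q => gc i (F q) : R^o) p.
Proof. by rewrite (derive_val (is_derive := is_derive_gc p v)) gc_sum. Qed.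

Lemma derive_pull (f : G -> R^o) p v : smooth f ->
  'D_v (fun q => f (F q) : R^o) p = 'D_('D_v F p) f (F p).
Proof.
move=> sf; have H := is_derive_comp sf (fun i => smooth_is_derive p v (sF i)).
rewrite (derive_val (is_derive := H)) (derive_decomp _ _ sf).
by apply: eq_bigr => i _; rewrite gc_derive.
Qed.

Lemma derive_F_lin p (a : R) u v : 'D_(a *: u + v) F p = a *: 'D_u F p + 'D_v F p.
Proof.
apply: gc_eqP => i.
rewrite (gc_comb i a ('D_u F p) ('D_v F p)).
have [E1 E2 E3] := And3 (gc_derive i p (a *: u + v)) (gc_derive i p u) (gc_derive i p v).
apply: (etrans E1); apply: (etrans (smooth_derive_lin p a u v (sF i))).
exact: (esym (congr2 (fun x y => a * x + y) E2 E3)).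
Qed.

Definition fun0 (f : G -> R) : dform := fun p s => if s is [::] then f p else 0.

Lemma sform_fun0 (f : G -> R) : smooth (f : G -> R^o) -> sform (fun0 f).
Proof. by move=> sf [|v s] //; exact: smooth_cst. Qed.

Lemma extd_fun0_cons (f : G -> R) p v : extd (fun0 f) p [:: v] = 'D_v (f : G -> R^o) p.
Proof. by rewrite extd_cons extd_nil subr0. Qed.

Lemma ofdeg_fun0 (f : G -> R) : ofdeg 0 (fun0 f).
Proof. by move=> p []. Qed.

Lemma pullback_cov i : pullback F (covf (gc i)) = extd (fun0 (fun p => gc i (F p))).
Proof.
apply: dform_eqP => p [|v [|u s]]; rewrite /pullback /=; first by rewrite extd_nil.
  by rewrite extd_fun0_cons gc_derive.
by rewrite (ofdeg_extd (k := 0)) //; exact: ofdeg_fun0.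
Qed.

(** In degree zero this is the chain rule. In higher degree [Euler] reduces to products: pullback is
    multiplicative, and the pullback of a coordinate form is the exact form d of a component of
    F. *)
Lemma pullback_form_extd k w : altf k w -> sform w ->
  [/\ altf k (pullback F w), sform (pullback F w) &
      extd (pullback F w) = pullback F (extd w)].
Proof.
move=> aw sw.
suff [sp ep] : sform (pullback F w) /\ extd (pullback F w) = pullback F (extd w).
  split=> //; have /is_formP [dw lw tw _] : altf k w /\ sform w by [].
  suff /is_formP[] : is_form k (pullback F w) by [].
  split=> [p s sk|p s1 s2 a u v|p s1 s2 s3 u|//]; rewrite /pullback.
  - by apply: dw; rewrite size_map.
  - by rewrite !map_cat !map_cons derive_F_lin lw.
  - by rewrite !map_cat !map_cons !map_cat !map_cons tw.
elim: k w aw sw => [|k IH] w aw sw.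
  have E : pullback F w = fun0 (fun p => w (F p) [::]).
    by apply: dform_eqP => p [|v s] //; rewrite /pullback aw.
  have sf : smooth (fun p => w (F p) [::] : R^o).
    by apply: (smooth_comp (f := fun q => w q [::])).
  split; first by rewrite E; exact: sform_fun0.
  apply: dform_eqP => p [|v [|u s]].
  - by rewrite /pullback !extd_nil.
  - rewrite extd_cons extd_nil subr0 /pullback /= extd_cons extd_nil subr0 /dird.
    exact: (derive_pull (f := fun q => w q [::])).
  - rewrite (ofdeg_extd (k := 0)) ?E //; last exact: ofdeg_fun0.
    by rewrite /pullback (ofdeg_extd (k := 0)).
have E : w = k.+1%:R^-1 *: \sum_i covf (gc i) ∧ ins (gb R i) w.
  by rewrite -(Euler aw) scalerA mulVf ?scale1r // pnatr_eq0.
have H i : sform (pullback F (covf (gc i)) ∧ pullback F (ins (gb R i) w)) /\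
    extd (pullback F (covf (gc i)) ∧ pullback F (ins (gb R i) w)) =
    pullback F (extd (covf (gc i) ∧ ins (gb R i) w)).
  have [s1 e1] := IH _ (altf_ins (gb R i) aw) (sform_ins (gb R i) sw).
  have s0 := sform_fun0 (sF i).
  rewrite pullback_cov; split; first by apply: sform_wedge => //; exact: sform_extd.
  rewrite extd_wedge //; last exact: sform_extd.
  rewrite extd_extd // wedge0l add0r e1 -pullback_cov.
  rewrite extd_wedge ?extd_covf ?wedge0l ?add0r; [|exact: sform_covf|exact: sform_ins].
  rewrite pullback_wedge; congr (_ ∧ _).
  by apply: dform_eqP => p s; rewrite /sgn /pullback size_map.
have sc i : sform (covf (gc i) ∧ ins (gb R i) w).
  by apply: sform_wedge; [exact: sform_covf|exact: sform_ins].
have pS : pullback F (\sum_i covf (gc i) ∧ ins (gb R i) w) =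
   \sum_i pullback F (covf (gc i)) ∧ pullback F (ins (gb R i) w).
  rewrite (big_morph (pullback F) (@pullbackD _ _ F) (@pullback0 _ _ F)).
  by apply: eq_bigr => i _; rewrite pullback_wedge.
have [S1 S2 S3] : [/\ sform (\sum_i pullback F (covf (gc i)) ∧ pullback F (ins (gb R i) w)),
    sform (\sum_i covf (gc i) ∧ ins (gb R i) w) &
    extd (\sum_i pullback F (covf (gc i)) ∧ pullback F (ins (gb R i) w)) =
    pullback F (extd (\sum_i covf (gc i) ∧ ins (gb R i) w))].
  elim/big_rec2: _ => [|i y z _ [sy sz e]]; first by rewrite !extd0; split=> //; exact: sform0.
  have [s1 e1] := H i; split; try exact: sformD.
  by rewrite !extdD // pullbackD e e1.
move: S1 S2 S3; rewrite -pS; set Z := \sum_i _ => S1 S2 S3.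
by rewrite E pullbackZ !extdZ // pullbackZ S3; split=> //; exact: sformZ.
Qed.

End SmoothPullback.
End FormsOnG.

(** * The one-parameter group exp(tB) *)

Lemma cvg_mx (R : realType) m n T (F : set_system T) (FF : Filter F)
    (g : T -> 'M[R]_(m.+1, n.+1)) (l : 'M[R]_(m.+1, n.+1)) :
  (forall i j, g x i j @[x --> F] --> l i j) -> g x @[x --> F] --> l.
Proof.
move=> H; rewrite (matrix_sum_delta l).
have -> : g = fun x => \sum_i \sum_j g x i j *: delta_mx i j.
  by apply/funext => x; exact: matrix_sum_delta.
by do 2!apply: cvg_sum_fin => ?; apply: cvgZl; exact: H.
Qed.

Lemma is_derive_fst (R : realType) (h : R -> R) (p v : Gtype R) (l : R) :
  is_derive p.1 (1 : R) h l -> is_derive p v (fun q : Gtype R => h q.1 : R^o) (v.1 * l).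
Proof.
move=> dh; have /is_deriveP H := is_derive_dirZ v.1 (dh : is_derive (p.1 : R^o) (1 : R^o) (h : R^o -> R^o) l).
apply/is_deriveP => e e0; have [d d0 dP] := H e e0; exists d => // k k0 kd.
by have := dP k k0 kd; rewrite [v.1 *: (1 : R^o)]mulr1.
Qed.

Section MatrixExponential.
Variables (R : realType) (B : 'M[R]_5).

Definition expc i j (k : nat) : R := (B ^+ k) i j / k`!%:R.

Lemma expc_bound : exists2 M : R, 0 < M & forall k i j, `|(B ^+ k) i j| <= M ^+ k.
Proof.
pose m := \sum_i \sum_j `|B i j|.
have m0 : 0 <= m by apply: sumr_ge0 => i _; exact: sumr_ge0.
(* m bounds every entry of B, so a further factor B multiplies the bound on entries by at most 5 m;
   the summand 1 keeps the constant positive. *)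
exists (5 * m + 1) => [|k]; first by rewrite ltr_wpDl ?mulr_ge0.
have Bm i j : `|B i j| <= m.
  rewrite /m (bigD1 i) //= (bigD1 j) //= -addrA lerDl addr_ge0 ?sumr_ge0 // => *.
  exact: sumr_ge0.
elim: k => [|k IH] i j; first by rewrite !expr0 mxE; case: (i == j); rewrite ?normr1 ?normr0.
rewrite !exprS mxE; apply: le_trans (ler_norm_sum _ _ _) _.
have : \sum_(l < 5) `|B i l * (B ^+ k) l j| <= \sum_(l < 5) m * (5 * m + 1) ^+ k.
  by apply: ler_sum => l _; rewrite normrM ler_pM.
move/le_trans; apply; rewrite sumr_const card_ord.
set X := (5 * m + 1) ^+ k; have X0 : 0 <= X by rewrite exprn_ge0 // addr_ge0 ?mulr_ge0.
have -> : m * X *+ 5 = 5 * m * X by rewrite -mulr_natl mulrA.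
by rewrite ler_wpM2r // lerDl.
Qed.

Lemma cvg_expc i j x : cvgn (pseries (expc i j) x).
Proof.
have [M M0 HM] := expc_bound; apply: normed_cvg.
apply: (@series_le_cvg _ _ (exp_coeff (M * `|x|))) => [n|n|n|].
- exact: normr_ge0.
- by rewrite /exp_coeff divr_ge0 // exprn_ge0 // mulr_ge0 // ltW.
- rewrite /exp_coeff /expc /= normrM normrX normrM normfV (ger0_norm (ler0n _ _)).
  by rewrite exprMn mulrAC ler_wpM2r ?invr_ge0 // ler_wpM2r ?exprn_ge0.
- exact: is_cvg_series_exp_coeff.
Qed.

Lemma pseries_sum (a : 'I_5 -> R) (c : 'I_5 -> nat -> R) x :
  (forall l, cvgn (pseries (c l) x)) ->
  pseries (fun k => \sum_l a l * c l k) x @ \oo --> \sum_l a l * limn (pseries (c l) x).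
Proof.
move=> cc.
have -> : pseries (fun k => \sum_l a l * c l k) x = (fun n => \sum_l a l * pseries (c l) x n).
  apply/funext => n; rewrite /pseries /series /=.
  under eq_bigr do rewrite mulr_suml; rewrite exchange_big /=.
  by apply: eq_bigr => l _; rewrite mulr_sumr; apply: eq_bigr => k _; rewrite mulrA.
by apply: (@cvg_sum_fin R R^o) => l; apply: cvgM; [exact: cvg_cst|exact: cc].
Qed.

Lemma expc_diffs i j : pseries_diffs (expc i j) = fun k => \sum_l B i l * expc l j k.
Proof.
apply/funext => k; rewrite /pseries_diffs /expc exprS mxE factS natrM invfM.
rewrite mulrCA mulVKf ?pnatr_eq0 // mulr_suml.
by apply: eq_bigr => l _; rewrite mulrA.
Qed.

Definition phi (t : R) : 'M[R]_5 := expmx (t *: B).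

Lemma phi_cvg t : series (fun k : nat => (k`!%:R)^-1 *: (t *: B) ^+ k) @ \oo -->
  \matrix_(i, j) limn (pseries (expc i j) t).
Proof.
apply: cvg_mx => i j; rewrite mxE.
have -> : (fun n => (series (fun k : nat => (k`!%:R)^-1 *: (t *: B) ^+ k) n) i j) =
    pseries (expc i j) t.
  apply/funext => n; rewrite /series /pseries /= summxE; apply: eq_bigr => k _.
  by rewrite exprZn !mxE /expc mulrCA mulrC [_^-1 * _]mulrC.
exact: cvg_expc.
Qed.

Lemma phiE t i j : phi t i j = limn (pseries (expc i j) t).
Proof. by rewrite /phi /expmx (cvg_lim _ (@phi_cvg t)) ?mxE. Qed.

Lemma is_derive_phi t i j : is_derive t (1 : R) (fun x => phi x i j) ((B *m phi t) i j).
Proof.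
have -> : (fun x => phi x i j) = (fun x => limn (pseries (expc i j) x)).
  by apply/funext => x; rewrite phiE.
have -> : (B *m phi t) i j = limn (pseries (pseries_diffs (expc i j)) t).
  rewrite expc_diffs (cvg_lim _ (@pseries_sum (B i) (expc^~ j) t _)) //.
    by rewrite mxE; apply: eq_bigr => l _; rewrite phiE.
  by move=> l; exact: cvg_expc.
have cd i' j' x : cvgn (pseries (pseries_diffs (expc i' j')) x).
  rewrite expc_diffs; apply/cvg_ex; eexists; apply: pseries_sum => l.
  exact: cvg_expc.
apply: (@pseries_snd_diffs _ _ (`|t| + 1)).
- exact: cvg_expc.
- exact: cd.
- rewrite expc_diffs.
  have -> : pseries_diffs (fun k => \sum_l B i l * expc l j k) =
      fun k => \sum_l B i l * pseries_diffs (expc l j) k.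
    apply/funext => k; rewrite /pseries_diffs mulr_sumr; apply: eq_bigr => l _.
    by rewrite mulrCA.
  by apply/cvg_ex; eexists; apply: pseries_sum => l; exact: cd.
- by rewrite (ger0_norm (addr_ge0 _ _)) // ltrDl.
Qed.

Lemma phi0 : phi 0 = 1%:M.
Proof.
apply/matrixP => i j; rewrite phiE.
apply/cvg_lim => //; apply: cvg_near_cst; exists 1%N => // n /= n1.
rewrite /pseries /series /= -(prednK n1) big_nat_recl //= big1 ?addr0 => [|k _].
  by rewrite expr0 mulr1 /expc expr0 fact0 divr1.
by rewrite expr0n mulr0.
Qed.

Lemma comm_phi (C : 'M[R]_5) t : C *m B = B *m C -> C *m phi t = phi t *m C.
Proof.
move=> CB; have CBk k : C *m B ^+ k = B ^+ k *m C.
  elim: k => [|k IH]; first by rewrite expr0 mulmx1 mul1mx.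
  by rewrite exprS -[B * _]/(B *m _) mulmxA CB -mulmxA IH mulmxA.
apply/matrixP => i j; rewrite !mxE.
under eq_bigr do rewrite phiE; under [RHS]eq_bigr do rewrite phiE mulrC.
rewrite -(cvg_lim _ (@pseries_sum (C i) (expc^~ j) t _)) //; last by move=> l; exact: cvg_expc.
rewrite -(cvg_lim _ (@pseries_sum (C^~ j) (expc i) t _)) //; last by move=> l; exact: cvg_expc.
congr (limn (pseries _ _)); apply/funext => k; rewrite /expc.
under eq_bigr do rewrite mulrA; under [RHS]eq_bigr do rewrite mulrA [C _ _ * _]mulrC.
rewrite -!mulr_suml; congr (_ / _).
by have /matrixP/(_ i j) := CBk k; rewrite !mxE.
Qed.

Lemma phiB t : phi t *m B = B *m phi t.
Proof. by rewrite comm_phi. Qed.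

(** The function x -> phi (s + x) phi (-x) has derivative zero because B commutes with phi. Stated
    with a factor phi (-t), it gives inverses first and the group law [phiD] afterwards. *)
Lemma phi_addN s t : phi (s + t) *m phi (- t) = phi s.
Proof.
apply/matrixP => i j.
have dS (x : R) : is_derive x (1 : R) (fun x => s + x) 1.
  by rewrite -[X in is_derive _ _ _ X]add0r; apply: is_deriveD.
have dN (x : R) : is_derive x (1 : R) (fun x => - x) (-1) by apply: is_deriveN.
have D (x : R) : is_derive x (1 : R) (fun x => (phi (s + x) *m phi (- x)) i j) 0.
  have -> : (fun x => (phi (s + x) *m phi (- x)) i j) =
      \sum_(l < 5) (fun x => phi (s + x) i l) * (fun x => phi (- x) l j).
    by apply/funext => y; rewrite fct_sumE mxE.
  have -> : 0 = \sum_(l < 5) (phi (s + x) i l * ((B *m phi (- x)) l j * -1) +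
       phi (- x) l j * ((B *m phi (s + x)) i l * 1)) :> R.
    rewrite big_split /= -(phiB (s + x)).
    have /matrixP/(_ i j) : (phi (s + x) *m B) *m phi (- x) = phi (s + x) *m (B *m phi (- x)).
      by rewrite mulmxA.
    rewrite mxE [RHS]mxE => E.
    under [X in _ + X]eq_bigr do rewrite mulr1 mulrC.
    rewrite E -big_split big1 //= => l _.
    by rewrite mulrN1 mulrN addNr.
  apply: is_derive_sum => l; apply: is_deriveM.
    exact: (is_derive1_comp (f := fun x => phi x i l) (g := fun x => s + x) (is_derive_phi _ _ _) (dS x)).
  exact: (is_derive1_comp (f := fun x => phi x l j) (g := fun x => - x) (is_derive_phi _ _ _) (dN x)).
have := is_derive_0_is_cst t 0 D.
by rewrite addr0 oppr0 phi0 mulmx1.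
Qed.

Lemma phiVN t : phi t *m phi (- t) = 1%:M.
Proof. by have := phi_addN 0 t; rewrite add0r phi0. Qed.

Lemma phiD s t : phi (s + t) = phi s *m phi t.
Proof.
have := phi_addN s t => /(congr1 (mulmx^~ (phi t))); rewrite -mulmxA.
by have := phiVN (- t); rewrite opprK => ->; rewrite mulmx1.
Qed.

Lemma phiNV t : phi (- t) *m phi t = 1%:M.
Proof. by rewrite -phiD addNr phi0. Qed.

Lemma is_derive_phi_mul (C D : 'M[R]_5) t i j :
  is_derive t (1 : R) (fun x => (C *m phi x *m D) i j) ((C *m B *m phi t *m D) i j).
Proof.
have E x : (C *m phi x *m D) i j = \sum_l \sum_k D l j * C i k * phi x k l.
  rewrite mxE; apply: eq_bigr => l _; rewrite mxE mulr_suml; apply: eq_bigr => k _.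
  by rewrite mulrC mulrA.
have -> : (fun x => (C *m phi x *m D) i j) =
   \sum_l \sum_k ((D l j * C i k) \*: (fun x => phi x k l)).
  by apply/funext => x; rewrite E fct_sumE; apply: eq_bigr => l _; rewrite fct_sumE.
have -> : (C *m B *m phi t *m D) i j = \sum_l \sum_k (D l j * C i k) *: (B *m phi t) k l.
  rewrite -(mulmxA C) mxE; apply: eq_bigr => l _; rewrite mxE mulr_suml; apply: eq_bigr => k _.
  by rewrite mulrC mulrA.
apply: is_derive_sum => l; apply: is_derive_sum => k.
exact: is_deriveZ (is_derive_phi _ _ _).
Qed.

(** The factor C makes the class stable: differentiation replaces C by C B and multiplies by the
    time component of the direction. *)
Lemma smooth_phi (C D : 'M[R]_5) i j :
  smooth (fun p : Gtype R => (C *m phi p.1 *m D) i j : R^o).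
Proof.
apply: (@smooth_coind _ _ (fun f => exists C a, f = fun p : Gtype R => a * (C *m phi p.1 *m D) i j)).
  move=> _ [{}C [a ->]]; split=> [p|v].
    apply: cvgM; first exact: cvg_cst.
    apply: (@continuous_comp _ _ _ (fun p : Gtype R => p.1) (fun x : R => (C *m phi x *m D) i j)).
      exact: cvg_fst.
    apply/differentiable_continuous/derivable1_diffP.
    by case: (is_derive_phi_mul C D p.1 i j).
  exists (fun p => a * v.1 * (C *m B *m phi p.1 *m D) i j).
    by exists (C *m B), (a * v.1).
  move=> p; rewrite -mulrA; apply: is_deriveZ.
  exact: is_derive_fst (is_derive_phi_mul C D p.1 i j).
by exists C, 1; apply/funext => p; rewrite mul1r.
Qed.

End MatrixExponential.

(** * Spans, bases and graded algebras *)

Lemma linear0E (K : fieldType) (U V : lmodType K) (f : U -> V) : linear f -> f 0 = 0.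
Proof. by move=> lf; have := lf (-1) 0 0; rewrite scaler0 addr0 scaleN1r addNr. Qed.

Lemma linearDE (K : fieldType) (U V : lmodType K) (f : U -> V) x y :
  linear f -> f (x + y) = f x + f y.
Proof. by move=> lf; have := lf 1 x y; rewrite !scale1r. Qed.

Lemma linearZE (K : fieldType) (U V : lmodType K) (f : U -> V) a x :
  linear f -> f (a *: x) = a *: f x.
Proof. by move=> lf; have := lf a x 0; rewrite (linear0E lf) !addr0. Qed.

Lemma linearNE (K : fieldType) (U V : lmodType K) (f : U -> V) x :
  linear f -> f (- x) = - f x.
Proof. by move=> lf; rewrite -(scaleN1r x) (linearZE _ _ lf) scaleN1r. Qed.

Lemma linearBE (K : fieldType) (U V : lmodType K) (f : U -> V) x y :
  linear f -> f (x - y) = f x - f y.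
Proof. by move=> lf; rewrite (linearDE _ _ lf) (linearNE _ lf). Qed.

Lemma linear_sumE (K : fieldType) (U V : lmodType K) (f : U -> V) I (r : seq I) P F :
  linear f -> f (\sum_(i <- r | P i) F i) = \sum_(i <- r | P i) f (F i).
Proof.
by move=> lf; rewrite (big_morph f (fun x y => linearDE x y lf) (linear0E lf)).
Qed.

Section Span.
Variables (K : fieldType) (V : lmodType K).
Implicit Types (S T : set V).

Definition subsp S := S 0 /\ forall (a : K) x y, S x -> S y -> S (a *: x + y).

Lemma subspD S x y : subsp S -> S x -> S y -> S (x + y).
Proof. by move=> [_ H] Sx Sy; rewrite -(scale1r x); exact: H. Qed.

Lemma subspZ S (a : K) x : subsp S -> S x -> S (a *: x).
Proof. by move=> [S0 H] Sx; rewrite -[_ *: _]addr0; exact: H. Qed.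

Lemma subspN S x : subsp S -> S x -> S (- x).
Proof. by move=> sS Sx; rewrite -(scaleN1r x); exact: subspZ. Qed.

Lemma subspB S x y : subsp S -> S x -> S y -> S (x - y).
Proof. by move=> sS Sx Sy; apply: subspD => //; exact: subspN. Qed.

Lemma subsp_sum S I (r : seq I) (P : pred I) (F : I -> V) :
  subsp S -> (forall i, P i -> S (F i)) -> S (\sum_(i <- r | P i) F i).
Proof.
by move=> sS SF; elim/big_ind: _ => //; [case: sS|move=> x y; exact: subspD].
Qed.

Lemma lspan_sub S T x : subsp T -> S `<=` T -> lspan S x -> T x.
Proof. by move=> [T0 TD] ST; elim=> // a y z /ST Ty _ Tz; exact: TD. Qed.

Lemma lspan_gen S x : S x -> lspan S x.
Proof. by move=> Sx; rewrite -[x]scale1r -[_ *: _]addr0; apply: lspanD => //; exact: lspan0. Qed.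

Lemma subsp_lspan S : subsp (lspan S).
Proof.
split=> [|a x y + Sy]; first exact: lspan0.
elim=> [|b u v Su _ IH]; first by rewrite scaler0 add0r.
by rewrite scalerDr scalerA -addrA; apply: lspanD.
Qed.

Definition fspan (e : nat -> V) n : set V :=
  [set x | exists a : nat -> K, x = \sum_(i < n) a i *: e i].

Lemma subsp_fspan e n : subsp (fspan e n).
Proof.
split=> [|a _ _ [b ->] [c ->]].
  by exists (fun=> 0); rewrite big1 // => i _; rewrite scale0r.
exists (fun i => a * b i + c i); rewrite scaler_sumr -big_split /=.
by apply: eq_bigr => i _; rewrite scalerA scalerDl.
Qed.

Lemma fspan_widen e n m : (n <= m)%N -> fspan e n `<=` fspan e m.
Proof.
move=> nm _ [a ->]; exists (fun i => if (i < n)%N then a i else 0).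
rewrite (big_ord_widen_cond m (fun=> true) (fun i => a i *: e i) nm) /= big_mkcond /=.
by apply: eq_bigr => i _; case: ifP => // _; rewrite scale0r.
Qed.

Lemma fspan_gen e n i : (i < n)%N -> fspan e n (e i).
Proof.
move=> ni; exists (fun j => (j == i)%:R); rewrite (bigD1 (Ordinal ni)) //= eqxx scale1r.
rewrite big1 ?addr0 // => j ji; rewrite (_ : (j == i :> nat) = false) ?scale0r //.
by apply: contraNF ji => /eqP ji; apply/eqP/val_inj.
Qed.

Lemma lspan_range (e : nat -> V) x : lspan (range e) x -> exists n, fspan e n x.
Proof.
elim=> [|a _ z [i _ <-] _ [n nz]]; first by exists 0%N; case: (subsp_fspan e 0).
have [_ H] := subsp_fspan e (maxn n i.+1).
exists (maxn n i.+1); apply: H; first by apply: fspan_gen; rewrite leq_max leqnn orbT.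
by apply: fspan_widen nz; rewrite leq_maxl.
Qed.

Section CountableBasis.
Variables (e : nat -> V) (Z N : set V).
Hypotheses (sZ : subsp Z) (sN : subsp N) (Ze : forall z, Z z -> exists n, fspan e n z).

Let new j z := [/\ Z z, fspan e j.+1 z & ~ exists2 y, Z y /\ fspan e j y & N (z - y)].

(* Greedy choice: the [j]-th vector is taken in the span of [e 0 .. e j], when
   that span contains something new modulo [N]. *)
Lemma countable_basis : exists (U : nat -> Prop) (b : nat -> V),
  [/\ forall j, Z (b j), forall j, ~ U j -> b j = 0,
      forall n (a : nat -> K), N (\sum_(j < n) a j *: b j) ->
        forall j, (j < n)%N -> U j -> a j = 0 &
      forall z, Z z -> exists n (a : nat -> K), N (z - \sum_(j < n) a j *: b j)].
Proof.
pose U j := exists z, new j z.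
pose b j := if pselect (U j) is left h then projT1 (cid h) else 0.
have bU j : U j -> new j (b j).
  by rewrite /b; case: pselect => // h _; exact: (projT2 (cid h)).
have b0 j : ~ U j -> b j = 0 by rewrite /b; case: pselect.
have Zb j : Z (b j).
  by have [/bU[]//|/b0->] := pselect (U j); case: sZ.
have Fb j : fspan e j.+1 (b j).
  by have [/bU[]//|/b0->] := pselect (U j); case: (subsp_fspan e j.+1).
exists U, b; split=> //.
- elim=> [|n IH] a //; rewrite big_ord_recr /= => H.
  have Han : U n -> a n = 0.
    move=> Un; apply: contrapT => /eqP an0; have [_ _] := bU _ Un; apply.
    (* A nonzero coefficient of b n would make b n congruent modulo N to this element of Z in the
       earlier span, contrary to the choice of b n. *)
    exists (- ((a n)^-1 *: \sum_(j < n) a j *: b j)).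
      split; [apply: subspN => //; apply: subspZ => //|].
        by apply: subsp_sum => // i _; exact: subspZ.
      apply: subspN; first exact: subsp_fspan.
      apply: subspZ; first exact: subsp_fspan.
      apply: subsp_sum => [|i _]; first exact: subsp_fspan.
      apply: subspZ; first exact: subsp_fspan.
      exact: fspan_widen (Fb i).
    have := subspZ (a n)^-1 sN H; rewrite scalerDr scalerA mulVf // scale1r.
    by rewrite addrC opprK.
  have an0 : a n *: b n = 0.
    by have [/Han->|/b0->] := pselect (U n); rewrite ?scale0r ?scaler0.
  move=> j; rewrite ltnS leq_eqVlt => /orP[/eqP-> /Han //|jn].
  by apply: IH jn; move: H; rewrite an0 addr0.
move=> z Zz; have [n nz] := Ze Zz; exists n.
elim: n z Zz nz => [|n IH] z Zz nz.
  move: nz => [a ->]; exists (fun=> 0); rewrite !big_ord0 subr0; by case: sN.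
have fin y (a : K) : Z y -> fspan e n y -> N (z - a *: b n - y) ->
    exists a : nat -> K, N (z - \sum_(j < n.+1) a j *: b j).
  move=> Zy ny Nzy; have [c Hc] := IH y Zy ny.
  exists (fun j => if j == n then a else c j); rewrite big_ord_recr /= eqxx.
  under eq_bigr => i _ do rewrite (ltn_eqF (ltn_ord i)).
  have := subspD sN Nzy Hc; rewrite addrA subrK.
  by rewrite opprD -!addrA [- _ + - _]addrC.
have [[y [Zy ny] Nzy]|Hz] := pselect (exists2 y, Z y /\ fspan e n y & N (z - y)).
  by apply: (fin y 0) => //; rewrite scale0r subr0.
have Un : U n by exists z.
have [_ [c Hc] nbn] := bU _ Un; move: nz => [d Hd].
have cn0 : c n != 0.
  apply/eqP => cn0; apply: nbn; exists (b n).
    split=> //; exists c.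
    by rewrite Hc big_ord_recr /= cn0 scale0r addr0.
  by rewrite subrr; case: sN.
(* This multiple of b n removes e n from z, because b n has the nonzero coefficient c n there. *)
apply: (fin (z - (d n / c n) *: b n) (d n / c n)).
- by apply: subspB => //; exact: subspZ.
- exists (fun i => d i - d n / c n * c i).
  rewrite {1}Hd Hc !big_ord_recr /= scalerDr scalerA divfK // opprD addrACA subrr addr0.
  rewrite scaler_sumr -sumrB; apply: eq_bigr => i _.
  by rewrite scalerBl scalerA.
- by rewrite subrr; case: sN.
Qed.

End CountableBasis.
End Span.

Section Graded.
Variables (K : fieldType) (A : dgdata K).
Hypothesis gA : is_graded A.

Lemma subsp_hom n : subsp (@dghom K A n).
Proof. by split; [exact: hom0|exact: homD]. Qed.

Lemma graded_sum_scale (a : nat -> K) n m (c d : nat -> A) :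
  (forall i, dghom i (c i)) -> (forall i, dghom i (d i)) ->
  \sum_(i < n) c i = \sum_(i < m) d i -> \sum_(i < n) a i *: c i = \sum_(i < m) a i *: d i.
Proof.
move=> hc hd; pose N := maxn n m.
pose c' i := if (i < n)%N then c i else 0; pose d' i := if (i < m)%N then d i else 0.
have hcd i : dghom i (c' i - d' i).
  apply: subspB; [exact: subsp_hom|rewrite /c'|rewrite /d']; case: ifP => // _; exact: hom0.
have widen (f : nat -> A) k : (k <= N)%N ->
    \sum_(i < k) f i = \sum_(i < N) (if (i < k)%N then f i else 0).
  by move=> kN; rewrite (big_ord_widen_cond N (fun=> true) f kN) /= big_mkcond.
rewrite (widen c n (leq_maxl _ _)) (widen d m (leq_maxr _ _)) => E.
rewrite (widen (fun i => a i *: c i) n (leq_maxl _ _)).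
rewrite (widen (fun i => a i *: d i) m (leq_maxr _ _)).
apply: eq_bigr => i _; have : \sum_(i < N) (c' i - d' i) = 0.
  by rewrite sumrB E subrr.
move=> /(hom_direct gA hcd)/(_ _ (ltn_ord i))/eqP; rewrite subr_eq0 /c' /d' => /eqP.
have iff_ (b : bool) (x : A) : (if b then a i *: x else 0) = a i *: (if b then x else 0).
  by case: b; rewrite ?scaler0.
by rewrite !iff_ => ->.
Qed.

(** Well defined by uniqueness of the homogeneous decomposition. Kronecker deltas for a give the
    projections, and a n = (-1)^n gives the degree involution. *)
Lemma graded_scale (a : nat -> K) :
  exists2 g : A -> A, linear g & forall n x, dghom n x -> g x = a n *: x.
Proof.
have H x : {nc : nat * (nat -> A) | (forall i, dghom i (nc.2 i)) & x = \sum_(i < nc.1) nc.2 i}.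
  by apply: cid2; have [n [c [hc ->]]] := hom_span gA x; exists (n, c).
pose g x := let nc := s2val (H x) in \sum_(i < nc.1) a i *: nc.2 i.
have gE x n (c : nat -> A) : (forall i, dghom i (c i)) -> x = \sum_(i < n) c i ->
    g x = \sum_(i < n) a i *: c i.
  move=> hc xc; apply: graded_sum_scale => //; first exact: (s2valP (H x)).
  by rewrite -xc -(s2valP' (H x)).
have hs n (x : A) (k : nat) : dghom n x -> dghom k (if k == n then x else 0).
  by case: eqP => [->//|_ _]; exact: hom0.
exists g => [b x y|n x hx]; last first.
  rewrite (gE x n.+1 (fun i => if i == n then x else 0)) => [|i|]; last 2 first.
  - exact: hs.
  - rewrite big_ord_recr /= eqxx big1 ?add0r // => i _.
    by rewrite (ltn_eqF (ltn_ord i)).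
  rewrite big_ord_recr /= eqxx big1 ?add0r // => i _.
  by rewrite (ltn_eqF (ltn_ord i)) scaler0.
have [n [c [hc xc]]] := hom_span gA x; have [m [d [hd yd]]] := hom_span gA y.
pose N := maxn n m.
have wd k (f : nat -> A) : (k <= N)%N ->
    \sum_(i < k) f i = \sum_(i < N) (if (i < k)%N then f i else 0).
  by move=> kN; rewrite (big_ord_widen_cond N (fun=> true) f kN) /= big_mkcond.
have hif k (f : nat -> A) : (forall i, dghom i (f i)) ->
    forall i, dghom i (if (i < k)%N then f i else 0).
  by move=> hf i; case: ifP => // _; exact: hom0.
pose c' i := if (i < n)%N then c i else 0; pose d' i := if (i < m)%N then d i else 0.
have [xc' yd'] : x = \sum_(i < N) c' i /\ y = \sum_(i < N) d' i.
  by rewrite xc yd (wd n) ?leq_maxl // (wd m) ?leq_maxr.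
rewrite (gE x N c') ?(gE y N d') //; try exact: hif.
rewrite (gE _ N (fun i => b *: c' i + d' i)).
- rewrite scaler_sumr -big_split /=; apply: eq_bigr => i _.
  by rewrite scalerDr !scalerA mulrC.
- by move=> i; apply: (homD gA); exact: hif.
- by rewrite big_split /= -scaler_sumr -xc' -yd'.
Qed.

Lemma graded_proj : exists p : nat -> A -> A,
  [/\ forall k, linear (p k), forall k x, dghom k (p k x),
      forall k x, dghom k x -> p k x = x,
      forall j k x, dghom j x -> j != k -> p k x = 0 &
      forall x, exists n, x = \sum_(i < n) p i x].
Proof.
have H k := cid2 (graded_scale (fun j => (j == k)%:R)).
exists (fun k => s2val (H k)).
have lp k : linear (s2val (H k)) := s2valP (H k).
have pk k x : dghom k x -> s2val (H k) x = x.
  by move=> hx; rewrite (s2valP' (H k) _ _ hx) eqxx scale1r.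
have pj j k x : dghom j x -> j != k -> s2val (H k) x = 0.
  by move=> hx jk; rewrite (s2valP' (H k) _ _ hx) (negbTE jk) scale0r.
have psum k n (c : nat -> A) : (forall i, dghom i (c i)) ->
    s2val (H k) (\sum_(i < n) c i) = if (k < n)%N then c k else 0.
  move=> hc; rewrite (linear_sumE _ _ _ (lp k)); case: ifP => kn.
    rewrite (bigD1 (Ordinal kn)) //= pk // big1 ?addr0 // => i ik.
    by apply: pj (hc i) _; apply: contraNneq ik => ik; apply/eqP/val_inj.
  rewrite big1 // => i _; apply: pj (hc i) _; apply: contraFneq kn => <-.
  exact: ltn_ord.
split=> // [k x|x].
  have [n [c [hc ->]]] := hom_span gA x; rewrite psum //; case: ifP => // _.
  exact: hom0.
have [n [c [hc xc]]] := hom_span gA x; exists n; rewrite {1}xc.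
by apply: eq_bigr => i _; rewrite xc psum // ltn_ord.
Qed.

End Graded.

(** The associative structure alone. Differential forms live in an ambient space that is not the sum
    of its homogeneous parts, so they satisfy this but not [is_cga]. *)
Record is_alg (K : fieldType) (A : dgdata K) : Prop := IsAlg {
  alg_linl : forall y : A, linear (fun x => dgmul x y);
  alg_linr : forall x : A, linear (dgmul x);
  alg_assoc : forall x y z : A, dgmul x (dgmul y z) = dgmul (dgmul x y) z;
  alg_mul1 : forall x : A, dgmul (dgone A) x = x;
  alg_1mul : forall x : A, dgmul x (dgone A) = x
}.

Section AlgTheory.
Variables (K : fieldType) (A : dgdata K).
Hypothesis aA : is_alg A.
Implicit Types x y z : A.

Lemma algDl x y z : dgmul (x + y) z = dgmul x z + dgmul y z.
Proof. exact: linearDE (alg_linl aA z). Qed.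
Lemma algDr x y z : dgmul x (y + z) = dgmul x y + dgmul x z.
Proof. exact: linearDE (alg_linr aA x). Qed.
Lemma algZl a x y : dgmul (a *: x) y = a *: dgmul x y.
Proof. exact: (linearZE _ _ (alg_linl aA y)). Qed.
Lemma algZr a x y : dgmul x (a *: y) = a *: dgmul x y.
Proof. exact: linearZE (alg_linr aA x). Qed.
Lemma alg0l x : dgmul 0 x = 0.
Proof. exact: (linear0E (alg_linl aA x)). Qed.
Lemma alg0r x : dgmul x 0 = 0.
Proof. exact: linear0E (alg_linr aA x). Qed.
Lemma algNl x y : dgmul (- x) y = - dgmul x y.
Proof. by rewrite -(scaleN1r x) algZl scaleN1r. Qed.
Lemma algNr x y : dgmul x (- y) = - dgmul x y.
Proof. by rewrite -(scaleN1r y) algZr scaleN1r. Qed.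
Lemma algBl x y z : dgmul (x - y) z = dgmul x z - dgmul y z.
Proof. by rewrite algDl algNl. Qed.
Lemma algBr x y z : dgmul x (y - z) = dgmul x y - dgmul x z.
Proof. by rewrite algDr algNr. Qed.
End AlgTheory.

Lemma graded_ind (K : fieldType) (A : dgdata K) (P : A -> Prop) : is_graded A ->
  P 0 -> (forall n x y, dghom n x -> P y -> P (x + y)) -> forall x, P x.
Proof.
move=> gA P0 PD x; have [n [c [hc ->]]] := hom_span gA x.
elim: n => [|n IH]; first by rewrite big_ord0.
by rewrite big_ord_recr /= addrC; exact: PD IH.
Qed.

Lemma cga_alg (K : fieldType) (A : dgdata K) : is_cga A -> is_alg A.
Proof.
move=> cA; split; try by case: cA.
apply: (@graded_ind _ A); first exact: cga_graded.
  exact: linear0E (cga_linl cA _).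
move=> n x y hx IH; rewrite (linearDE _ _ (cga_linl cA _)) IH.
by rewrite (cga_comm cA hx (cga_one cA)) muln0 expr0 scale1r (cga_mul1 cA).
Qed.

(** * The free graded-commutative algebra and its derivations *)

Section FreeAlgebra.
Local Open Scope quotient_scope.
Variables (K : realFieldType) (I : Type) (deg : I -> nat).

(** Formal terms, whose quotient by [teq] is the free graded-commutative algebra. Graded
    commutativity is imposed on generators only; [fhom_comm] extends it to homogeneous elements. *)
Inductive tm : Type :=
| Gen of I | One | Zero | Add of tm & tm | Scale of K & tm | Mul of tm & tm.

Inductive teq : tm -> tm -> Prop :=
| teq_refl x : teq x x
| teq_sym x y : teq x y -> teq y x
| teq_trans x y z : teq x y -> teq y z -> teq x z
| teq_add x x' y y' : teq x x' -> teq y y' -> teq (Add x y) (Add x' y')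
| teq_scale a x x' : teq x x' -> teq (Scale a x) (Scale a x')
| teq_mul x x' y y' : teq x x' -> teq y y' -> teq (Mul x y) (Mul x' y')
| teq_addA x y z : teq (Add x (Add y z)) (Add (Add x y) z)
| teq_addC x y : teq (Add x y) (Add y x)
| teq_add0 x : teq (Add Zero x) x
| teq_addN x : teq (Add (Scale (-1) x) x) Zero
| teq_scaleA a b x : teq (Scale a (Scale b x)) (Scale (a * b) x)
| teq_scale1 x : teq (Scale 1 x) x
| teq_scaleDr a x y : teq (Scale a (Add x y)) (Add (Scale a x) (Scale a y))
| teq_scaleDl a b x : teq (Scale (a + b) x) (Add (Scale a x) (Scale b x))
| teq_mulA x y z : teq (Mul x (Mul y z)) (Mul (Mul x y) z)
| teq_1mul x : teq (Mul One x) x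
| teq_mul1 x : teq (Mul x One) x
| teq_mulDl x y z : teq (Mul (Add x y) z) (Add (Mul x z) (Mul y z))
| teq_mulDr x y z : teq (Mul x (Add y z)) (Add (Mul x y) (Mul x z))
| teq_mulZl a x y : teq (Mul (Scale a x) y) (Scale a (Mul x y))
| teq_mulZr a x y : teq (Mul x (Scale a y)) (Scale a (Mul x y))
| teq_genC i j :
    teq (Mul (Gen i) (Gen j)) (Scale ((-1) ^+ (deg i * deg j)) (Mul (Gen j) (Gen i))).

HB.instance Definition _ := gen_eqMixin tm.
HB.instance Definition _ := gen_choiceMixin tm.

Definition teqb : rel tm := fun x y => `[< teq x y >].

Lemma teqb_refl : reflexive teqb. Proof. by move=> x; apply/asboolP; exact: teq_refl. Qed.
Lemma teqb_sym : symmetric teqb.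
Proof. by move=> x y; apply/asboolP/asboolP; exact: teq_sym. Qed.
Lemma teqb_trans : transitive teqb.
Proof. by move=> y x z /asboolP + /asboolP yz => xy; apply/asboolP; exact: teq_trans yz. Qed.

Canonical teqb_equiv := EquivRel teqb teqb_refl teqb_sym teqb_trans.

Definition fr : Type := {eq_quot teqb_equiv}.
HB.instance Definition _ := Choice.on fr.
HB.instance Definition _ : EqQuotient tm teqb_equiv fr := EqQuotient.on fr.

Definition cl (t : tm) : fr := \pi t.

Lemma cl_eq x y : teq x y -> cl x = cl y.
Proof. by move=> xy; apply/eqmodP/asboolP. Qed.

Lemma cl_eqP x y : cl x = cl y -> teq x y.
Proof. by move/eqmodP/asboolP. Qed.

Lemma cl_surj (u : fr) : u = cl (repr u). Proof. by rewrite /cl reprK. Qed.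

Definition fr_add (u v : fr) := cl (Add (repr u) (repr v)).
Definition fr_scale a (u : fr) := cl (Scale a (repr u)).
Definition fr_mul (u v : fr) := cl (Mul (repr u) (repr v)).

Lemma teq_repr x : teq (repr (cl x)) x.
Proof. by apply: cl_eqP; rewrite -cl_surj. Qed.

Lemma fr_addE x y : fr_add (cl x) (cl y) = cl (Add x y).
Proof. by apply/cl_eq/teq_add; exact: teq_repr. Qed.
Lemma fr_scaleE a x : fr_scale a (cl x) = cl (Scale a x).
Proof. by apply/cl_eq/teq_scale; exact: teq_repr. Qed.
Lemma fr_mulE x y : fr_mul (cl x) (cl y) = cl (Mul x y).
Proof. by apply/cl_eq/teq_mul; exact: teq_repr. Qed.

Let fr_addA : associative fr_add.
Proof.
move=> u v w; rewrite (cl_surj u) (cl_surj v) (cl_surj w) !fr_addE.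
exact/cl_eq/teq_addA.
Qed.
Let fr_addC : commutative fr_add.
Proof. by move=> u v; rewrite (cl_surj u) (cl_surj v) !fr_addE; exact/cl_eq/teq_addC. Qed.
Let fr_add0 : left_id (cl Zero) fr_add.
Proof. by move=> u; rewrite (cl_surj u) !fr_addE; exact/cl_eq/teq_add0. Qed.
Let fr_addN : left_inverse (cl Zero) (fr_scale (-1)) fr_add.
Proof. by move=> u; rewrite (cl_surj u) !fr_scaleE !fr_addE; exact/cl_eq/teq_addN. Qed.

HB.instance Definition _ := GRing.isZmodule.Build fr fr_addA fr_addC fr_add0 fr_addN.

Let fr_scaleA a b u : fr_scale a (fr_scale b u) = fr_scale (a * b) u.
Proof. by rewrite (cl_surj u) !fr_scaleE; exact/cl_eq/teq_scaleA. Qed.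
Let fr_scale1 : left_id 1 fr_scale.
Proof. by move=> u; rewrite (cl_surj u) !fr_scaleE; exact/cl_eq/teq_scale1. Qed.
Let fr_scaleDr : right_distributive fr_scale +%R.
Proof.
move=> a u v; rewrite (cl_surj u) (cl_surj v) /GRing.add /= fr_addE !fr_scaleE fr_addE.
exact/cl_eq/teq_scaleDr.
Qed.
Let fr_scaleDl u : {morph fr_scale^~ u : a b / a + b}.
Proof.
move=> a b; rewrite (cl_surj u) [RHS]/GRing.add /= !fr_scaleE fr_addE.
exact/cl_eq/teq_scaleDl.
Qed.

HB.instance Definition _ := GRing.Zmodule_isLmodule.Build K fr
  fr_scaleA fr_scale1 fr_scaleDr fr_scaleDl.

Lemma clD x y : cl (Add x y) = cl x + cl y. Proof. by rewrite -fr_addE. Qed.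
Lemma clZ a x : cl (Scale a x) = a *: cl x. Proof. by rewrite -fr_scaleE. Qed.
Lemma cl0 : cl Zero = 0. Proof. by []. Qed.

Definition fgen i : fr := cl (Gen i).

Inductive fhom : nat -> fr -> Prop :=
| fhom0 n : fhom n 0
| fhom_lin n (a : K) x y : fhom n x -> fhom n y -> fhom n (a *: x + y)
| fhom_gen i : fhom (deg i) (fgen i)
| fhom_one : fhom 0 (cl One)
| fhom_mul p q x y : fhom p x -> fhom q y -> fhom (p + q) (fr_mul x y).

(** The zero differential is a placeholder; [free_cga_onP] keeps the algebra and accepts any other
    differential. *)
Definition free_dg : dgdata K := @DGData K fr fhom (cl One) fr_mul (fun=> 0).

Lemma free_alg : is_alg free_dg.
Proof.
split=> [w|w|u v w|u|u] /=.
- move=> a u v; rewrite (cl_surj u) (cl_surj v) (cl_surj w) -clZ -clD !fr_mulE -clZ -clD.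
  apply/cl_eq; apply: teq_trans (teq_mulDl _ _ _) _; apply: teq_add; last exact: teq_refl.
  exact: teq_mulZl.
- move=> a u v; rewrite (cl_surj u) (cl_surj v) (cl_surj w) -clZ -clD !fr_mulE -clZ -clD.
  apply/cl_eq; apply: teq_trans (teq_mulDr _ _ _) _; apply: teq_add; last exact: teq_refl.
  exact: teq_mulZr.
- by rewrite (cl_surj u) (cl_surj v) (cl_surj w) !fr_mulE; exact/cl_eq/teq_mulA.
- by rewrite (cl_surj u) !fr_mulE; exact/cl_eq/teq_1mul.
- by rewrite (cl_surj u) !fr_mulE; exact/cl_eq/teq_mul1.
Qed.

Lemma free_ind (P : free_dg -> Prop) :
  (forall i, P (fgen i)) -> P (dgone free_dg) ->
  (forall (a : K) x y, P x -> P y -> P (a *: x + y)) -> P 0 ->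
  (forall x y, P x -> P y -> P (dgmul x y)) -> forall x, P x.
Proof.
move=> Pg P1 Pl P0 Pm x; rewrite (cl_surj x); elim: (repr x) => //=.
- by move=> t Pt u Pu; rewrite clD -(scale1r (cl t)); exact: Pl.
- by move=> a t Pt; rewrite clZ -[_ *: _]addr0; exact: Pl.
- by move=> t Pt u Pu; rewrite -fr_mulE; exact: Pm.
Qed.

Section Universal.
Variables (B : dgdata K) (b : I -> B).
Hypotheses (aB : is_alg B)
  (bC : forall i j, dgmul (b i) (b j) = (-1) ^+ (deg i * deg j) *: dgmul (b j) (b i)).

Fixpoint ev (t : tm) : B :=
  match t with
  | Gen i => b i | One => dgone B | Zero => 0
  | Add x y => ev x + ev y | Scale a x => a *: ev x | Mul x y => dgmul (ev x) (ev y)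
  end.

Lemma ev_teq x y : teq x y -> ev x = ev y.
Proof.
elim=> {x y} //=; do ?by move=> *; congruence.
- by move=> x y z; rewrite addrA.
- by move=> x y; rewrite addrC.
- by move=> x; rewrite add0r.
- by move=> x; rewrite scaleN1r addNr.
- by move=> a c x; rewrite scalerA.
- by move=> x; rewrite scale1r.
- by move=> a x y; rewrite scalerDr.
- by move=> a c x; rewrite scalerDl.
- by move=> x y z; rewrite (alg_assoc aB).
- by move=> x; rewrite (alg_mul1 aB).
- by move=> x; rewrite (alg_1mul aB).
- by move=> x y z; rewrite (algDl aB).
- by move=> x y z; rewrite (algDr aB).
- by move=> a x y; rewrite (algZl aB).
- by move=> a x y; rewrite (algZr aB).
Qed.

(** The target need only be associative, with images of generators commuting up to sign. This covers
    the double [dbl], which yields derivations, and the algebra of forms. *)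
Lemma free_map_exists : exists f : free_dg -> B,
  [/\ linear f, f (dgone free_dg) = dgone B,
      forall x y, f (dgmul x y) = dgmul (f x) (f y) & forall i, f (fgen i) = b i].
Proof.
have evE t : ev (repr (cl t)) = ev t by apply/ev_teq/teq_repr.
exists (fun u => ev (repr u)); split=> [a u v||u v|i] /=.
- by rewrite (cl_surj u) (cl_surj v) -clZ -clD !evE.
- by rewrite evE.
- by rewrite (cl_surj u) (cl_surj v) fr_mulE !evE.
- by rewrite evE.
Qed.

End Universal.

Local Notation F := free_dg.

Lemma free_map_eq (B : dgdata K) (f g : F -> B) : is_alg B -> linear f -> linear g ->
  f (dgone F) = g (dgone F) ->
  (forall x y, f (dgmul x y) = dgmul (f x) (f y)) ->
  (forall x y, g (dgmul x y) = dgmul (g x) (g y)) ->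
  (forall i, f (fgen i) = g (fgen i)) -> f =1 g.
Proof.
move=> aB lf lg fg1 fM gM fg; apply: free_ind => //.
- by move=> a x y fx fy; rewrite lf lg fx fy.
- by rewrite (linear0E lf) (linear0E lg).
- by move=> x y fx fy; rewrite fM gM fx fy.
Qed.

Lemma fhom_comm p q (x y : F) : fhom p x -> fhom q y ->
  dgmul x y = (-1) ^+ (p * q) *: dgmul y x.
Proof.
have aF := free_alg.
move=> hx; elim: hx q y => {p x} [n|n a x x' _ IH _ IH'|i||p r x x' _ IH _ IH'] q y hy.
- by rewrite (alg0l aF) (alg0r aF) scaler0.
- rewrite (algDl aF) (algZl aF) (algDr aF) (algZr aF) (IH _ _ hy) (IH' _ _ hy).
  by rewrite scalerDr !scalerA mulrC.
- elim: hy => {q y} [n|n a y y' _ IH _ IH'|j||p r y y' _ IH _ IH'].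
  + by rewrite (alg0l aF) (alg0r aF) scaler0.
  + rewrite (algDl aF) (algZl aF) (algDr aF) (algZr aF) IH IH'.
    by rewrite scalerDr !scalerA mulrC.
  + by rewrite /= /fgen !fr_mulE -clZ; apply/cl_eq/teq_genC.
  + by rewrite muln0 expr0 scale1r (alg_mul1 aF) (alg_1mul aF).
  + rewrite (alg_assoc aF) IH (algZl aF) -(alg_assoc aF) IH' (algZr aF) (alg_assoc aF).
    by rewrite scalerA -exprD mulnDr.
- by rewrite mul0n expr0 scale1r (alg_mul1 aF) (alg_1mul aF).
- rewrite -(alg_assoc aF) (IH' _ _ hy) (algZr aF) (alg_assoc aF) (IH _ _ hy) (algZl aF).
  by rewrite (alg_assoc aF) scalerA -exprD mulnDl addnC.
Qed.

Lemma free_scaling (c : K) : exists f : F -> F,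
  [/\ linear f, f (dgone F) = dgone F, forall x y, f (dgmul x y) = dgmul (f x) (f y),
      forall i, f (fgen i) = c ^+ deg i *: fgen i &
      forall n x, fhom n x -> f x = c ^+ n *: x].
Proof.
have aF := free_alg.
have [|f [lf f1 fM fg]] := @free_map_exists F (fun i => c ^+ deg i *: fgen i) aF.
  move=> i j; rewrite !(algZl aF) !(algZr aF) (fhom_comm (fhom_gen i) (fhom_gen j)).
  by rewrite !scalerA; congr (_ *: _); rewrite mulrC mulrA [X in _ = _ * X]mulrC mulrA.
exists f; split=> // n x; elim=> {n x}.
- by move=> n; rewrite (linear0E lf) scaler0.
- by move=> n a x y _ IH _ IH'; rewrite lf IH IH' scalerDr !scalerA mulrC.
- by move=> i; rewrite fg.
- by rewrite expr0 scale1r f1.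
- by move=> p q x y _ IH _ IH'; rewrite fM IH IH' (algZl aF) (algZr aF) scalerA exprD.
Qed.

(* The degree-[n] part is an eigenspace, for the eigenvalue [2 ^+ n], of the
   automorphism rescaling each generator [x] by [2 ^+ deg x]. *)
Lemma free_graded : is_graded F.
Proof.
split=> [n|n a x y|x|n c hc].
- exact: fhom0.
- exact: fhom_lin.
- suff : lspan (\bigcup_n fhom n) x.
    elim=> [|a y z [k _ ky] _ [n [c [hc zc]]]].
      by exists 0%N, (fun=> 0); split=> [i|]; [exact: fhom0|rewrite big_ord0].
    exists (maxn n k.+1), (fun i => (if i == k then a else 0) *: y + (if (i < n)%N then c i else 0)).
    split=> [i|].
      case: eqP => [->|_]; last rewrite scale0r add0r.
        by apply: fhom_lin => //; case: ifP => _; [exact: hc|exact: fhom0].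
      by case: ifP => _; [exact: hc|exact: fhom0].
    rewrite big_split /=; congr (_ + _).
      have kn : (k < maxn n k.+1)%N by rewrite leq_max ltnSn orbT.
      rewrite (bigD1 (Ordinal kn)) //= eqxx big1 ?addr0 // => i ik.
      rewrite (_ : (i == k :> nat) = false) ?scale0r //.
      by apply: contraNF ik => /eqP ik; apply/eqP/val_inj.
    rewrite zc (big_ord_widen_cond _ (fun=> true) c (leq_maxl n k.+1)) /=.
    by rewrite big_mkcond.
  have [l0 lD] := subsp_lspan (\bigcup_n fhom n : set F).
  move: x; apply: free_ind => //.
  + by move=> i; apply: lspan_gen; exists (deg i) => //; exact: fhom_gen.
  + by apply: lspan_gen; exists 0%N => //; exact: fhom_one.
  + move=> x y Sx Sy; elim: Sx => [|a u v [p _ hu] _ IH]; first by rewrite (alg0l free_alg).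
    rewrite (algDl free_alg) (algZl free_alg); apply: lD IH.
    elim: Sy => [|c u' v' [q _ hu'] _ IH]; first by rewrite (alg0r free_alg).
    rewrite (algDr free_alg) (algZr free_alg); apply: lspanD IH.
    by exists (p + q)%N => //; exact: fhom_mul.
have [f [lf _ _ _ fh]] := free_scaling 2.
elim: n c hc => [|n IH] c hc // Sc i.
have E : \sum_(j < n) (2 ^+ j - 2 ^+ n) *: c j = 0.
  transitivity (f (\sum_(j < n.+1) c j) - 2 ^+ n *: \sum_(j < n.+1) c j); last first.
    by rewrite Sc (linear0E lf) scaler0 subrr.
  rewrite (linear_sumE _ _ _ lf) !big_ord_recr /= scalerDr opprD addrACA.
  rewrite (fh n _ (hc n)) subrr addr0 scaler_sumr -sumrB.
  by apply: eq_bigr => j _; rewrite (fh j _ (hc j)) scalerBl.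
have cj j : (j < n)%N -> c j = 0.
  move=> jn; have hc' k : fhom k ((2 ^+ k - 2 ^+ n) *: c k).
    by rewrite -[_ *: _]addr0; apply: fhom_lin; [exact: hc|exact: fhom0].
  have /eqP := IH _ hc' E j jn; rewrite scaler_eq0 => /orP[|/eqP //].
  have : (2 : K) ^+ j < 2 ^+ n by rewrite ltr_eXn2l // ltr1n.
  by rewrite subr_eq0 lt_neqAle => /andP[/negbTE->].
rewrite ltnS leq_eqVlt => /orP[/eqP->|/cj //].
by move: Sc; rewrite big_ord_recr /= big1 ?add0r // => j _; exact: cj.
Qed.

Lemma free_cga : is_cga F.
Proof.
split; try by case: free_alg.
- exact: free_graded.
- exact: fhom_one.
- exact: fhom_mul.
- exact: fhom_comm.
Qed.

Lemma free_cga_onP (d : F -> F) :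
  free_cga_on (A := @DGData K fr fhom (cl One) fr_mul d) deg fgen.
Proof.
split.
- by case: free_cga => *; split=> //; case: free_graded => *; split.
- exact: fhom_gen.
move=> B cB b hb; have aB := cga_alg cB.
have [|f [lf f1 fM fg]] := @free_map_exists B b aB.
  by move=> i j; apply: cga_comm.
exists f; split.
  split=> //; split=> // n x; elim=> {n x} [n|n a x y _ IH _ IH'|i||p q x y _ IH _ IH'].
  - by rewrite (linear0E lf); apply: hom0; exact: cga_graded.
  - by rewrite lf; apply: homD => //; exact: cga_graded.
  - by rewrite fg.
  - by rewrite f1; exact: cga_one.
  - by rewrite fM; exact: cga_mul.
move=> g [[lg _ g1 gM] gg]; apply/funext => x.
apply: (@free_map_eq B f g) => // [|i]; first by rewrite f1 -g1.
by rewrite fg gg.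
Qed.

End FreeAlgebra.

Lemma sign_mul_self (K : fieldType) (n : nat) : (-1) ^+ n * (-1) ^+ n = 1 :> K.
Proof. by rewrite -exprMn mulrNN mulr1 expr1n. Qed.

Section Double.
Variables (K : fieldType) (A : dgdata K).

Definition is_bar (bar : A -> A) := linear bar /\ forall n x, dghom n x -> bar x = (-1) ^+ n *: x.

Variable bar : A -> A.

(** [(a, b)] stands for [a + x b], where [x] is a generator of degree one with
    [dx = 0] and [a x = x bar a]. *)
Definition dbl_mul (u v : A * A) : A * A :=
  (dgmul u.1 v.1, dgmul u.2 v.1 + dgmul (bar u.1) v.2).

(** It serves twice: an algebra map into it with first component the identity is a derivation, and
    with the differential given here it is A with a closed generator of degree one adjoined. *)
Definition dbl : dgdata K := @DGData K (A * A)%type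
  (fun n => [set u | dghom n u.1 /\ (if n is m.+1 then dghom m u.2 else u.2 = 0)])
  (dgone A, 0) dbl_mul (fun u => (dgdiff u.1, - dgdiff u.2)).

Lemma pair_comb (a : K) (x y z t : A) : (a *: x + y, a *: z + t) = a *: (x, z) + (y, t) :> A * A.
Proof. by []. Qed.

Hypotheses (aA : is_alg A) (lbar : linear bar) (barM : forall x y, bar (dgmul x y) = dgmul (bar x) (bar y))
  (bar1 : bar (dgone A) = dgone A).

Lemma dbl_alg : is_alg dbl.
Proof.
split=> [[y1 y2]|[x1 x2]|[x1 x2] [y1 y2] [z1 z2]|[x1 x2]|[x1 x2]]; rewrite /= /dbl_mul /=.
- move=> a [u1 u2] [v1 v2] /=; rewrite -pair_comb; congr pair; first exact: (alg_linl aA).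
  rewrite lbar !(alg_linl aA) scalerDr -!addrA; congr (_ + _).
  by rewrite addrCA.
- move=> a [u1 u2] [v1 v2] /=; rewrite -pair_comb; congr pair; first exact: (alg_linr aA).
  rewrite !(alg_linr aA) scalerDr -!addrA; congr (_ + _).
  by rewrite addrCA.
- congr pair; first exact: alg_assoc.
  by rewrite barM (algDr aA) (algDl aA) !(alg_assoc aA) addrA.
- by rewrite bar1 !(alg_mul1 aA) (alg0l aA) add0r.
- by rewrite !(alg_1mul aA) (alg0r aA) addr0.
Qed.

End Double.

Section BarExists.
Variables (K : fieldType) (A : dgdata K).
Hypothesis cA : is_cga A.

Lemma bar_exists : exists2 bar : A -> A, linear bar & forall n x, dghom n x -> bar x = (-1) ^+ n *: x.
Proof. exact: graded_scale (cga_graded cA) (fun n => (-1) ^+ n). Qed.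

Variable bar : A -> A.
Hypotheses (lbar : linear bar) (hbar : forall n x, dghom n x -> bar x = (-1) ^+ n *: x).

Lemma barM x y : bar (dgmul x y) = dgmul (bar x) (bar y).
Proof.
have aA := cga_alg cA.
move: x; apply: (graded_ind (cga_graded cA)) => [|p x x' hx IH].
  by rewrite (linear0E lbar) (alg0l aA) (linear0E lbar) (alg0l aA).
rewrite (algDl aA) !(linearDE _ _ lbar) (algDl aA) IH; congr (_ + _).
move: y {IH}; apply: (graded_ind (cga_graded cA)) => [|q y y' hy IH].
  by rewrite (linear0E lbar) (alg0r aA) (linear0E lbar) (alg0r aA).
rewrite (algDr aA) !(linearDE _ _ lbar) (algDr aA) IH; congr (_ + _).
rewrite (hbar (cga_mul cA hx hy)) (hbar hx) (hbar hy) (algZl aA) (algZr aA).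
by rewrite scalerA exprD.
Qed.

Lemma bar1 : bar (dgone A) = dgone A.
Proof. by rewrite (hbar (cga_one cA)) expr0 scale1r. Qed.

End BarExists.

Section Derivation.
Variables (K : realFieldType) (I : Type) (deg : I -> nat).
Local Notation F := (@free_dg K I deg).
Local Notation gen := (@fgen K I deg).
Variables (bar : F -> F) (D : I -> F).
Hypotheses (lbar : linear bar) (hbar : forall n x, dghom n x -> bar x = (-1) ^+ n *: x).
Hypothesis hD : forall i, dghom (deg i).+1 (D i).

(** A derivation d is the same as an algebra map x -> (x, d x) into the double. The freeness of F
    provides the map, since the pairs (generator, D generator) commute up to the right sign, D
    raising the degree by one. *)
Lemma derivation_exists : exists d : F -> F,
  [/\ linear d, d (dgone F) = 0,
      forall x y, d (dgmul x y) = dgmul (d x) y + dgmul (bar x) (d y),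
      forall i, d (gen i) = D i & forall n x, dghom n x -> dghom n.+1 (d x)].
Proof.
have cF := @free_cga K I deg; have aF := @free_alg K I deg.
have gF := @free_graded K I deg.
have aD := dbl_alg aF lbar (barM cF lbar hbar) (bar1 cF hbar).
have bC i j : @dgmul _ (dbl bar) (gen i, D i) (gen j, D j) =
   (-1) ^+ (deg i * deg j) *: @dgmul _ (dbl bar) (gen j, D j) (gen i, D i).
  have gi : @dghom _ F (deg i) (gen i) := @fhom_gen K I deg i.
  have gj : @dghom _ F (deg j) (gen j) := @fhom_gen K I deg j.
  set c := (-1) ^+ _.
  change ((dgmul (gen i : F) (gen j), dgmul (D i) (gen j : F) + dgmul (bar (gen i)) (D j)) =
    (c *: dgmul (gen j : F) (gen i), c *: (dgmul (D j) (gen i : F) + dgmul (bar (gen j)) (D i)))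
    :> F * F).
  congr pair; first exact: (cga_comm cF gi gj).
  rewrite (hbar gi) (hbar gj) !(algZl aF) scalerDr addrC scalerA; congr (_ + _).
    rewrite (cga_comm cF gi (hD j)) scalerA; congr (_ *: _).
    by rewrite mulnS exprD mulrA sign_mul_self mul1r.
  rewrite (cga_comm cF (hD i) gj); congr (_ *: _).
  by rewrite mulSn exprD mulrC.
have [f [lf f1 fM fg]] := @free_map_exists K I deg (dbl bar) (fun i => (gen i, D i)) aD bC.
have f_1 x : (f x).1 = x.
  apply: (@free_map_eq K I deg F (fun x => (f x).1) id aF) => // [a u v||u v|i].
  - by rewrite lf.
  - by rewrite f1.
  - by rewrite fM.
  - by rewrite fg.
have f2M x y : (f (dgmul x y)).2 = dgmul (f x).2 y + dgmul (bar x) (f y).2.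
  by rewrite fM /= !f_1.
exists (fun x => (f x).2); split=> [a x y||x y|i|n x].
- by rewrite lf.
- by rewrite f1.
- exact: f2M.
- by rewrite fg.
elim=> {n x} [n|n a x y _ IH _ IH'|i||p q x y hx IH hy IH'].
- by rewrite (linear0E lf); exact: fhom0.
- by rewrite lf; exact: fhom_lin.
- by rewrite fg; exact: hD.
- by rewrite f1; exact: fhom0.
- rewrite -[fr_mul x y]/(@dgmul _ F x y) f2M (hbar hx) (algZl aF).
  apply: (subspD (subsp_hom gF _)).
    by have := fhom_mul IH hy; rewrite addSn.
  apply: (subspZ _ (subsp_hom gF _)).
  by have := fhom_mul hx IH'; rewrite addnS.
Qed.

(** d anticommutes with [bar], so the mixed terms of d d cancel on products and it vanishes as soon
    as it does on generators. *)
Lemma derivation_sq d : linear d -> d (dgone F) = 0 ->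
  (forall x y, d (dgmul x y) = dgmul (d x) y + dgmul (bar x) (d y)) ->
  (forall i, d (gen i) = D i) -> (forall n x, dghom n x -> dghom n.+1 (d x)) ->
  (forall i, d (D i) = 0) -> forall x, d (d x) = 0.
Proof.
move=> ld d1 dM dg dh dD; have aF := @free_alg K I deg.
have barE := barM (@free_cga K I deg) lbar hbar.
have bd x : d (bar x) = - bar (d x).
  move: x; apply: (graded_ind (@free_graded K I deg)) => [|n x y hx IH].
    by rewrite (linear0E lbar) (linear0E ld) (linear0E lbar) oppr0.
  rewrite !(linearDE _ _ lbar, linearDE _ _ ld) IH opprD; congr (_ + _).
  rewrite (hbar hx) (linearZE _ _ ld) (hbar (dh _ _ hx)) exprS mulN1r scaleNr.
  by rewrite opprK.
have bb x : bar (bar x) = x.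
  move: x; apply: (graded_ind (@free_graded K I deg)) => [|n x y hx IH].
    by rewrite !(linear0E lbar).
  rewrite !(linearDE _ _ lbar) IH (hbar hx) (linearZE _ _ lbar) (hbar hx) scalerA.
  by rewrite sign_mul_self scale1r.
apply: free_ind => [i||a x y dx dy||x y dx dy].
- by rewrite dg dD.
- by rewrite d1 (linear0E ld).
- by rewrite !ld dx dy scaler0 addr0.
- by rewrite !(linear0E ld).
- rewrite dM (linearDE _ _ ld) !dM dx dy (alg0l aF) (alg0r aF) add0r addr0 bd.
  by rewrite (algNl aF) addrC addNr.
Qed.

End Derivation.

Lemma lspan_mul (K : fieldType) (A : dgdata K) (S T W : set A) x y : is_alg A ->
  (forall x y, S x -> T y -> lspan W (dgmul x y)) -> lspan S x -> lspan T y ->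
  lspan W (dgmul x y).
Proof.
move=> aA H Sx Ty; have sW := subsp_lspan W.
apply: (@lspan_sub _ _ S (fun x => lspan W (dgmul x y))) Sx.
  split=> [|a u v Wu Wv]; first by rewrite (alg0l aA); case: sW.
  by rewrite (algDl aA) (algZl aA); apply: subspD => //; exact: subspZ.
move=> u Su; apply: (@lspan_sub _ _ T (fun y => lspan W (dgmul u y))) Ty.
  split=> [|a v w Wv Ww]; first by rewrite (alg0r aA); case: sW.
  by rewrite (algDr aA) (algZr aA); apply: subspD => //; exact: subspZ.
by move=> v Tv; exact: H.
Qed.

Lemma lspan_mono (K : fieldType) (V : lmodType K) (S T : set V) :
  S `<=` T -> lspan S `<=` lspan T.
Proof.
move=> ST x; apply: lspan_sub; first exact: subsp_lspan.
by move=> y /ST; exact: lspan_gen.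
Qed.

Lemma subalg_mono (K : fieldType) (A : dgdata K) (S T : set A) :
  S `<=` T -> subalg S `<=` subalg T.
Proof.
move=> ST x; elim=> {x} [x /ST|||].
- exact: subalg_gen.
- exact: subalg_one.
- by move=> c x y _ ? _ ?; exact: subalg_lin.
- by move=> x y _ ? _ ?; exact: subalg_mul.
Qed.

Lemma subsp_subalg (K : fieldType) (A : dgdata K) (S : set A) : subsp (subalg S).
Proof.
split=> [|a x y]; last exact: subalg_lin.
have := subalg_lin (-1) (subalg_one S) (subalg_one S).
by rewrite scaleN1r addNr.
Qed.

(** [f] is a quasi-isomorphism from [M] onto the graded algebra [S], which has no
    differential; [qi_cone] says that the mapping cone of [f] is acyclic. *)
Record qi (K : fieldType) (M B : dgdata K) (S : nat -> set B) (f : M -> B) : Prop := Qi {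
  qi_lin : linear f;
  qi_one : f (dgone M) = dgone B;
  qi_mul : forall x y, f (dgmul x y) = dgmul (f x) (f y);
  qi_hom : forall n x, dghom n x -> S n (f x);
  qi_diff : forall x, f (dgdiff x) = 0;
  qi_inj0 : forall z, dghom 0 z -> f z = 0 -> z = 0;
  qi_cone : forall k z h, dghom k.+1 z -> dgdiff z = 0 -> f z = 0 -> S k h ->
    exists y, [/\ dghom k y, dgdiff y = z & f y = h]
}.

(** * Minimal model of a simply connected algebra with zero differential *)

Definition lex (i j : nat * nat) := (i.1 < j.1)%N \/ i.1 = j.1 /\ (i.2 < j.2)%N.

Lemma well_order_lex (U : nat * nat -> Prop) :
  well_order (fun i j : {i | U i} => lex (projT1 i) (projT1 j)).
Proof.
split.
- suff H n m : forall i : {i | U i}, projT1 i = (n, m) ->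
      Acc (fun i j : {i | U i} => lex (projT1 i) (projT1 j)) i.
    by move=> i; apply: (H (projT1 i).1 (projT1 i).2); rewrite -surjective_pairing.
  elim/ltn_ind: n m => n IHn m; elim/ltn_ind: m => m IHm i ie.
  split=> j; rewrite /lex ie /= => -[jn|[jn jm]].
    by apply: (IHn _ jn (projT1 j).2); rewrite -surjective_pairing.
  by apply: (IHm _ jm); rewrite -jn -surjective_pairing.
- move=> i j k; rewrite /lex => -[ij|[ij ij2]] [jk|[jk jk2]].
  + by left; exact: ltn_trans jk.
  + by left; rewrite -jk.
  + by left; rewrite ij.
  + by right; rewrite ij jk; split=> //; exact: ltn_trans jk2.
- move=> i j; rewrite /lex.
  case: (ltngtP (projT1 i).1 (projT1 j).1) => [?|?|e1]; [by constructor 1; left|by constructor 3; left|].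
  case: (ltngtP (projT1 i).2 (projT1 j).2) => [?|?|e2]; [by constructor 1; right|by constructor 3; right|].
  constructor 2; case: i j e1 e2 => [[a b] u] [[c d] v] /= ac bd.
  by move: u v; rewrite ac bd => u v; congr exist; exact: Prop_irrelevance.
Qed.

Section ModelExists.
Variables (K : realFieldType) (B : dgdata K) (S : nat -> set B) (e : nat -> B).
Hypotheses (aB : is_alg B) (sS : forall n, subsp (S n))
  (SM : forall p q x y, S p x -> S q y -> S (p + q)%N (dgmul x y))
  (SC : forall p q x y, S p x -> S q y -> dgmul x y = (-1) ^+ (p * q) *: dgmul y x)
  (S1 : S 0%N (dgone B)) (S0 : forall x, S 0%N x -> exists a, x = a *: dgone B)
  (one_neq0 : dgone B != 0) (S1_0 : forall x, S 1%N x -> x = 0)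
  (Se : forall n x, S n x -> lspan (range e) x).

Local Notation I := (nat * nat)%type.
(** A generator (n, j) is the j-th one of degree n + 2. Degrees start at two because S vanishes in
    degree one, and the lexicographic order on indices makes degrees monotone. *)
Definition mdeg (i : I) := i.1.+2.
Local Notation F := (@free_dg K I mdeg).
Local Notation gen := (@fgen K I mdeg).

Let cF : is_cga F := @free_cga K I mdeg.
Let aF : is_alg F := @free_alg K I mdeg.
Let gF : is_graded F := @free_graded K I mdeg.

Definition Fge k : set F := lspan (\bigcup_(j in [set j | (k <= j)%N]) @dghom K F j).

Lemma Fge_hom k j x : (k <= j)%N -> dghom j x -> Fge k x.
Proof. by move=> kj hx; apply: lspan_gen; exists j. Qed.

Lemma Fge_mul k l x y : Fge k x -> Fge l y -> Fge (k + l) (dgmul x y).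
Proof.
apply: lspan_mul => // {}x {}y [p kp hx] [q lq hy].
by apply: Fge_hom (cga_mul cF hx hy); exact: leq_add.
Qed.

Lemma Fge_le k l : (k <= l)%N -> Fge l `<=` Fge k.
Proof.
move=> kl; apply: lspan_mono => x [j /= lj hx]; exists j => //=; exact: leq_trans lj.
Qed.

Lemma subsp_Fge k : subsp (Fge k). Proof. exact: subsp_lspan. Qed.

Lemma free_augment (x : F) : exists c : K, exists2 y, Fge 2 y & x = c *: dgone F + y.
Proof.
move: x; apply: free_ind => [i||a x y [c [x' hx ->]] [d [y' hy ->]]||x y [c [x' hx ->]] [d [y' hy ->]]].
- exists 0, (gen i); last by rewrite scale0r add0r.
  by apply: (@Fge_hom 2 (mdeg i)); [|exact: fhom_gen].
- by exists 1, 0; [case: (subsp_Fge 2)|rewrite scale1r addr0].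
- exists (a * c + d), (a *: x' + y'); first by case: (subsp_Fge 2) => _; apply.
  by rewrite scalerDr scalerA scalerDl -!addrA; congr (_ + _); rewrite addrCA.
- by exists 0, 0; [case: (subsp_Fge 2)|rewrite scale0r addr0].
- exists (c * d), (c *: y' + d *: x' + dgmul x' y').
    apply: subspD; [exact: subsp_Fge|apply: subspD; [exact: subsp_Fge| |]|].
    + exact: subspZ (subsp_Fge 2) hy.
    + exact: subspZ (subsp_Fge 2) hx.
    + by apply: (@Fge_le 2 4) => //; exact: (@Fge_mul 2 2).
  rewrite (algDl aF) !(algDr aF) !(algZl aF) !(algZr aF) !(alg_mul1 aF) (alg_1mul aF).
  by rewrite scalerA !addrA.
Qed.

Definition word (w : seq I) : F := foldr (fun i x => @dgmul _ F (gen i) x) (dgone F) w.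

Lemma lspan_word x : lspan (range word) x.
Proof.
have [l0 lD] := subsp_lspan (range word).
move: x; apply: free_ind => //.
- by move=> i; apply: lspan_gen; exists [:: i] => //; exact: (alg_1mul aF).
- by apply: lspan_gen; exists [::].
- move=> x y; apply: lspan_mul => // _ _ [w _ <-] [w' _ <-].
  apply: lspan_gen; exists (w ++ w') => //.
  elim: w => [|i w IH]; first by rewrite (alg_mul1 aF).
  rewrite -[word ((i :: w) ++ w')]/(@dgmul _ F (gen i) (word (w ++ w'))) IH.
  exact: (alg_assoc aF).
Qed.

(** A countable family whose span contains all pairs of an element of the free algebra and an
    element of some S n; it lets [countable_basis] choose bases in the mapping cone. *)
Definition eFB (k : nat) : F * B :=
  match unpickle k : option (bool * nat) with
  | Some (true, j) => (if unpickle j : option (seq I) is Some w then word w else 0, 0)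
  | Some (false, j) => (0, e j)
  | None => 0
  end.

Lemma eFB_span n (x : F) (y : B) : S n y -> lspan (range eFB) (x, y).
Proof.
move=> Sy; have sE := subsp_lspan (range eFB).
have -> : (x, y) = (x, 0) + (0, y) :> F * B.
  by rewrite -[RHS]/(x + 0, 0 + y) addr0 add0r.
apply: subspD => //.
  apply: (@lspan_sub _ _ (range word) (fun x => lspan (range eFB) (x, 0))) (lspan_word x).
    split=> [|a u v Hu Hv]; first by case: sE.
    have -> : (a *: u + v, 0) = a *: (u, 0) + (v, 0) :> F * B.
      by rewrite -[RHS]/(a *: u + v, a *: 0 + 0) scaler0 addr0.
    by case: sE => _; apply.
  move=> _ [w _ <-]; apply: lspan_gen; exists (pickle (true, pickle w)) => //.
  by rewrite /eFB pickleK; cbv iota; rewrite pickleK.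
apply: (@lspan_sub _ _ (range e) (fun y => lspan (range eFB) (0, y))) (Se Sy).
  split=> [|a u v Hu Hv]; first by case: sE.
  have -> : (0, a *: u + v) = a *: (0, u) + (0, v) :> F * B.
    by rewrite -[RHS]/(a *: 0 + 0, a *: u + v) scaler0 addr0.
  by case: sE => _; apply.
move=> _ [j _ <-]; apply: lspan_gen; exists (pickle (false, j)) => //.
by rewrite /eFB pickleK.
Qed.

Let bar : F -> F := s2val (cid2 (bar_exists cF)).
Let lbar : linear bar := s2valP (cid2 (bar_exists cF)).
Let hbar : forall n x, dghom n x -> bar x = (-1) ^+ n *: x := s2valP' (cid2 (bar_exists cF)).

Definition isder (D : I -> F) (d : F -> F) :=
  [/\ linear d, d (dgone F) = 0,
      forall x y, d (dgmul x y) = dgmul (d x) y + dgmul (bar x) (d y),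
      forall i, d (gen i) = D i & forall n x, dghom n x -> dghom n.+1 (d x)].

Definition ismap (H : I -> B) (f : F -> B) :=
  [/\ linear f, f (dgone F) = dgone B,
      forall x y, f (dgmul x y) = dgmul (f x) (f y) & forall i, f (gen i) = H i].

Definition Msub (U : I -> Prop) : set F := @subalg K F (gen @` [set i | U i]).

Lemma subsp_Msub U : subsp (Msub U). Proof. exact: subsp_subalg. Qed.

Lemma isder_eq (U : I -> Prop) D D' d d' : isder D d -> isder D' d' ->
  (forall i, U i -> D i = D' i) -> forall x, Msub U x -> d x = d' x.
Proof.
move=> [ld d1 dM dg _] [ld' d1' dM' dg' _] DD' x; elim=> {x}.
- by move=> _ [i Ui <-]; rewrite dg dg' DD'.
- by rewrite d1 d1'.
- by move=> c x y _ IH _ IH'; rewrite ld ld' IH IH'.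
- by move=> x y _ IH _ IH'; rewrite dM dM' IH IH'.
Qed.

Lemma ismap_eq (U : I -> Prop) H H' f f' : ismap H f -> ismap H' f' ->
  (forall i, U i -> H i = H' i) -> forall x, Msub U x -> f x = f' x.
Proof.
move=> [ld d1 dM dg] [ld' d1' dM' dg'] DD' x; elim=> {x}.
- by move=> _ [i Ui <-]; rewrite dg dg' DD'.
- by rewrite d1 d1'.
- by move=> c x y _ IH _ IH'; rewrite ld ld' IH IH'.
- by move=> x y _ IH _ IH'; rewrite dM dM' IH IH'.
Qed.

Lemma isder_exists D : (forall i, dghom (mdeg i).+1 (D i)) -> exists d, isder D d.
Proof. exact: derivation_exists lbar hbar. Qed.

Lemma ismap_exists H : (forall i, S (mdeg i) (H i)) -> exists f, ismap H f.
Proof.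
move=> hH; apply: (@free_map_exists K I mdeg B H aB) => i j.
exact: SC.
Qed.

Lemma ismap_hom H f : (forall i, S (mdeg i) (H i)) -> ismap H f ->
  forall n x, dghom n x -> S n (f x).
Proof.
move=> hH [lf f1 fM fg] n x; elim=> {n x} [n|n a x y _ IH _ IH'|i||p q x y hx IH hy IH'].
- by rewrite (linear0E lf); case: (sS n).
- by rewrite lf; case: (sS n) => _; apply.
- by rewrite fg.
- by rewrite f1.
- by rewrite fM; exact: SM.
Qed.

Lemma der_Msub U D d : isder D d -> (forall i, U i -> Msub U (D i)) ->
  forall x, Msub U x -> Msub U (d x) /\ Msub U (bar x).
Proof.
move=> [ld d1 dM dg _] UD x; elim=> {x}.
- move=> _ [i Ui <-]; rewrite dg; split; first exact: UD.
  rewrite (hbar (fhom_gen K mdeg i)); apply: subspZ; first exact: subsp_Msub.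
  by apply: subalg_gen; exists i.
- rewrite d1; split; first by case: (subsp_Msub U).
  by rewrite (bar1 cF hbar); exact: subalg_one.
- move=> c x y _ [IH1 IH2] _ [IH1' IH2']; rewrite ld lbar.
  by split; exact: subalg_lin.
- move=> x y xU [IH1 IH2] yU [IH1' IH2']; rewrite dM (barM cF lbar hbar).
  split; last exact: subalg_mul.
  by apply: subspD; [exact: subsp_Msub|exact: subalg_mul|exact: subalg_mul].
Qed.

Let prj := projT1 (cid (graded_proj gF)).
Let prjP : [/\ forall k, linear (prj k), forall k (x : F), @dghom K F k (prj k x),
      forall k (x : F), @dghom K F k x -> prj k x = x,
      forall j k (x : F), @dghom K F j x -> j != k -> prj k x = 0 &
      forall x : F, exists n, x = \sum_(i < n) prj i x] := projT2 (cid (graded_proj gF)).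

Lemma hom_disj p q (x : F) : dghom p x -> dghom q x -> p != q -> x = 0.
Proof. by case: prjP => _ _ P1 P2 _ hp hq pq; rewrite -(P1 q x hq) (P2 p q). Qed.

Lemma prj_Fge k j x : (j < k)%N -> Fge k x -> prj j x = 0.
Proof.
case: prjP => lp _ _ P2 _ jk; elim=> [|a y z [i /= ki hy] _ IH].
  exact: linear0E (lp j).
by rewrite (lp j) IH addr0 (P2 i) ?scaler0 // gt_eqF //; exact: leq_trans ki.
Qed.

Lemma prj_Msub U k x : Msub U x -> Msub U (prj k x).
Proof.
case: prjP => lp _ P1 P2 _ Ux.
have sM := subsp_Msub U.
have : lspan [set y | Msub U y /\ exists n, dghom n y] x.
  elim: Ux => {x}.
  - move=> _ [i Ui <-]; apply: lspan_gen; split; first by apply: subalg_gen; exists i.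
    by exists (mdeg i); exact: fhom_gen.
  - by apply: lspan_gen; split; [exact: subalg_one|exists 0%N; exact: fhom_one].
  - by move=> c x y _ IH _ IH'; case: (subsp_lspan [set y | Msub U y /\ exists n, dghom n y]) => _; apply.
  - move=> x y _ + _; apply: lspan_mul => // {}x {}y [xU [p hx]] [yU [q hy]].
    apply: lspan_gen; split; first exact: subalg_mul.
    by exists (p + q)%N; exact: (cga_mul cF).
elim=> [|a y z [Uy [n hy]] _ IH]; first by rewrite (linear0E (lp k)); case: sM.
rewrite (lp k); case: sM => s0; apply=> //.
by have [kn|nk] := eqVneq n k; [rewrite -kn P1|rewrite (P2 n)].
Qed.

(** Acyclicity of the mapping cone of f in one degree, over the subalgebra generated by U: z = 0
    gives surjectivity on classes and h = 0 injectivity. *)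
Definition Cprop (U : I -> Prop) (d : F -> F) (f : F -> B) k :=
  forall z h, Msub U z -> dghom k.+1 z -> d z = 0 -> f z = 0 -> S k h ->
    exists y, [/\ Msub U y, dghom k y, d y = z & f y = h].

(** The generators chosen so far have degree at most n + 1, and they make the cone acyclic up to
    index n + 1. D and H are total functions, zero at the indices not chosen; each D i involves only
    generators of smaller degree, as minimality requires. *)
Definition stage n (st : (I -> Prop) * (I -> F) * (I -> B)) :=
  let: (U, D, H) := st in
  [/\ forall i, U i -> (i.1 < n)%N,
      forall i, ~ U i -> D i = 0 /\ H i = 0,
      forall i, [/\ dghom (mdeg i).+1 (D i), S (mdeg i) (H i) &
                    Msub (fun j => U j /\ (j.1 < i.1)%N) (D i)] &
      exists d f, [/\ isder D d, ismap H f, forall i, d (D i) = 0 /\ f (D i) = 0 &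
        forall k, (k <= n.+1)%N -> Cprop U d f k]].

Lemma stage0 : stage 0 ((fun=> False), (fun=> 0), (fun=> 0)).
Proof.
split=> // [i|].
  by split; [exact: hom0|case: (sS (mdeg i))|case: (subsp_Msub (fun j => False /\ (j.1 < i.1)%N))].
have [d dd] := @isder_exists (fun=> 0) (fun i => hom0 gF _).
have [f ff] : exists f, ismap (fun=> 0) f.
  by apply: ismap_exists => i; case: (sS (mdeg i)).
exists d, f; split=> // [i|k k1 z h zM hz dz fz Sh].
  by case: dd ff => ld _ _ _ _ [lf _ _ _]; rewrite (linear0E ld) (linear0E lf).
have z0 : z = 0.
  suff [c zc] : exists c : K, z = c *: dgone F.
    apply: hom_disj hz _ (isT : k.+1 != 0%N).
    by rewrite zc; apply: subspZ; [exact: subsp_hom|exact: fhom_one].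
  elim: zM => {z hz dz fz}.
  - by move=> _ [i []].
  - by exists 1; rewrite scale1r.
  - by move=> c x y _ [a ->] _ [b ->]; exists (c * a + b); rewrite scalerA scalerDl.
  - move=> x y _ [a ->] _ [b ->]; exists (a * b).
    by rewrite (algZl aF) (algZr aF) (alg_mul1 aF) scalerA.
have [ld d1 _ _ _] := dd; have [lf f1 _ _] := ff.
rewrite {z zM hz dz fz}z0.
(* The two degrees to treat are settled by S 0 being the scalars and by S 1 = 0. *)
case: k k1 Sh => [|[|//]] _ Sh.
  have [a ->] := S0 Sh; exists (a *: dgone F); split.
  - by apply: subspZ; [exact: subsp_Msub|exact: subalg_one].
  - by apply: subspZ; [exact: subsp_hom|exact: fhom_one].
  - by rewrite (linearZE _ _ ld) d1 scaler0.
  - by rewrite (linearZE _ _ lf) f1.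
exists 0; split; [by case: (subsp_Msub (fun=> False))|exact: hom0|exact: linear0E|].
by rewrite (linear0E lf) (S1_0 Sh).
Qed.

Section Step.
Variables (n : nat) (U : I -> Prop) (U0 : nat -> Prop).

Let U' i := U i \/ (i.1 = n /\ U0 i.2).
Let V : set F := lspan [set gen (n, j) | j in [set j | U0 j]].

(** All generators have degree at least two, so a product of a new generator with another generator
    has degree at least n + 4. In degrees up to n + 3 the new generators therefore enter linearly,
    with scalar coefficients. *)
Lemma step_decomp x : Msub U' x -> exists m v r, [/\ Msub U m, V v, Fge n.+4 r & x = m + v + r].
Proof.
have sV : subsp V := subsp_lspan _.
have sM := subsp_Msub U; have sG k := subsp_Fge k.
have [M0 V0 G0] : [/\ Msub U 0, V 0 & Fge n.+4 0].
  by split; [case: sM|case: sV|case: (sG n.+4)].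
have VG v : V v -> Fge n.+2 v.
  by apply: lspan_mono => _ [j _ <-]; exists n.+2 => /=; [exact: leqnn|exact: (fhom_gen K mdeg (n, j))].
have GT (a y : F) : Fge n.+4 a -> Fge n.+4 (dgmul a y) /\ Fge n.+4 (dgmul y a).
  have y0 : Fge 0 y.
    have [c [y' hy' ->]] := free_augment y; apply: subspD => //; last exact: Fge_le hy'.
    by apply: subspZ => //; apply: (@Fge_hom 0 0) => //; exact: fhom_one.
  by move=> aG; split; [rewrite -[n.+4]addn0|rewrite -[n.+4]add0n]; exact: Fge_mul.
elim=> {x}.
- move=> _ [i [Ui|[in_ Ui]] <-].
    by exists (gen i), 0, 0; rewrite !addr0; split=> //; apply: subalg_gen; exists i.
  exists 0, (gen i), 0; rewrite addr0 add0r; split=> //; apply: lspan_gen.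
  by exists i.2 => //; case: i in_ Ui => a b /= ->.
- by exists (dgone F), 0, 0; rewrite !addr0; split=> //; exact: subalg_one.
- move=> c _ _ _ [m [v [r [Mm Vv Gr ->]]]] _ [m' [v' [r' [Mm' Vv' Gr' ->]]]].
  exists (c *: m + m'), (c *: v + v'), (c *: r + r'); split.
  + exact: subalg_lin.
  + by case: sV => _; apply.
  + by case: (sG n.+4) => _; apply.
  + by rewrite !scalerDr addrACA; congr (_ + _); rewrite addrACA.
- move=> _ _ _ [m [v [r [Mm Vv Gr ->]]]] _ [m' [v' [r' [Mm' Vv' Gr' ->]]]].
  (* c and c' are the augmentations of m and m'; only these scalar parts keep a new generator in
     degree n + 2. *)
  have [c [k hk mE]] := free_augment m; have [c' [k' hk' mE']] := free_augment m'.
  exists (dgmul m m'), (c *: v' + c' *: v),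
    (dgmul k v' + dgmul v k' + dgmul v v' + dgmul (m + v) r' + dgmul r (m' + v' + r')).
  split; first exact: subalg_mul.
  + by apply: subspD => //; exact: subspZ.
  + apply: subspD; [exact: sG| |by case: (GT r (m' + v' + r') Gr)].
    apply: subspD; [exact: sG| |by case: (GT r' (m + v) Gr')].
    apply: subspD; [exact: sG|apply: subspD; [exact: sG| |]|].
    * by apply: (@Fge_le _ (2 + n.+2)); [|apply: Fge_mul => //; exact: VG].
    * by apply: (@Fge_le _ (n.+2 + 2)); [rewrite addnC|apply: Fge_mul => //; exact: VG].
    * apply: (@Fge_le _ (n.+2 + n.+2)); first by rewrite !addSn !addnS !ltnS leq_addr.
      by apply: Fge_mul; exact: VG.
  + have E1 : dgmul m v' = c *: v' + dgmul k v' :> F.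
      by rewrite {1}mE (algDl aF) (algZl aF) (alg_mul1 aF).
    have E2 : dgmul v m' = c' *: v + dgmul v k' :> F.
      by rewrite {1}mE' (algDr aF) (algZr aF) (alg_1mul aF).
    rewrite (algDl aF (m + v) r) (algDr aF (m + v) (m' + v') r').
    rewrite (algDl aF m v (m' + v')) (algDr aF m) (algDr aF v) E1 E2.
    by rewrite -!addrA; congr (_ + (_ + _)); rewrite addrCA.
Qed.

Lemma step_hom k x : Msub U' x -> dghom k x -> (k <= n.+3)%N ->
  exists m v, [/\ Msub U m, dghom k m, V v, (k != n.+2 -> v = 0) & x = m + v].
Proof.
move=> /step_decomp[m [v [r [Mm Vv Gr xE]]]] hx kn.
have [lp pk p1 p2 _] := prjP.
have sV : subsp V := subsp_lspan _.
have hv : dghom n.+2 v.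
  apply: (lspan_sub (subsp_hom gF n.+2) _ Vv) => _ [j _ <-].
  exact: (fhom_gen K mdeg (n, j)).
exists (prj k m), (if k == n.+2 then v else 0); split.
- exact: prj_Msub.
- exact: pk.
- by case: ifP => // _; case: sV.
- by move/negbTE->.
- rewrite -(p1 k x hx) xE !(linearDE _ _ (lp k)) (@prj_Fge n.+4 k r) // addr0.
  by congr (_ + _); case: eqP => [->|/eqP kn2]; [exact: p1|rewrite (p2 n.+2) // eq_sym].
Qed.

End Step.

(** The new generators, of degree n + 2, come from a basis of the cohomology of the cone: pairs (z,
    h) with z a cocycle killed by f and h in S, modulo the pairs (d y, f y). A generator with
    differential z and image h makes the pair a coboundary, and independence ensures that no new
    cocycle arises in degree n + 2. *)
Lemma stage_step n st : stage n st -> exists2 st', stage n.+1 st' &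
  forall i, (i.1 < n)%N -> [/\ st'.1.1 i = st.1.1 i, st'.1.2 i = st.1.2 i & st'.2 i = st.2 i].
Proof.
case: st => [[U D] H] [Un U0 DH [d [f [dd ff dfD Ck]]]].
have [ld d1 dM dg dh] := dd; have [lf f1 fM fg] := ff.
have hD i : dghom (mdeg i).+1 (D i) by case: (DH i).
have hH i : S (mdeg i) (H i) by case: (DH i).
have fh := ismap_hom hH ff.
have sM := subsp_Msub U.
(* Z is the space of cocycles of the cone and N that of its coboundaries; b j will prescribe the
   differential and the image of the j-th new generator. *)
pose Z : set (F * B) := [set u | [/\ Msub U u.1, dghom n.+3 u.1, d u.1 = 0, f u.1 = 0 & S n.+2 u.2]].
pose N : set (F * B) := [set u | exists y, [/\ Msub U y, dghom n.+2 y & u = (d y, f y)]].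
have sZ : subsp Z.
  split=> [|a u v [u1 u2 u3 u4 u5] [v1 v2 v3 v4 v5]]; split=> /=.
  - by case: sM.
  - exact: (hom0 gF).
  - exact: linear0E.
  - exact: linear0E.
  - by case: (sS n.+2).
  - exact: subalg_lin.
  - exact: (homD gF).
  - by rewrite ld u3 v3 scaler0 addr0.
  - by rewrite lf u4 v4 scaler0 addr0.
  - by case: (sS n.+2) => _; apply.
have sN : subsp N.
  split=> [|a _ _ [y [My hy ->]] [z [Mz hz ->]]].
    exists 0; split; [by case: sM|exact: (hom0 gF)|].
    by rewrite (linear0E ld) (linear0E lf).
  exists (a *: y + z); split; [exact: subalg_lin|exact: (homD gF)|].
  by rewrite ld lf.
have [|V0 [b [Zb b0 indep spanb]]] := @countable_basis _ _ eFB Z N sZ sN.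
  by move=> [z h] [_ _ _ _ Sh]; apply: lspan_range; exact: eFB_span Sh.
pose U' i := U i \/ (i.1 = n /\ V0 i.2).
pose D' (i : I) := if i.1 == n then (b i.2).1 else D i.
pose H' (i : I) := if i.1 == n then (b i.2).2 else H i.
have hD' i : dghom (mdeg i).+1 (D' i).
  by rewrite /D' /mdeg; case: eqP => [->|_]; [case: (Zb i.2)|exact: hD].
have hH' i : S (mdeg i) (H' i).
  by rewrite /H' /mdeg; case: eqP => [->|_]; [case: (Zb i.2)|exact: hH].
have Ulow i : U i -> (i.1 == n) = false by move/Un => in_; rewrite ltn_eqF.
have DD' i : U i -> D i = D' i by move=> /Ulow E; rewrite /D' E.
have HH' i : U i -> H i = H' i by move=> /Ulow E; rewrite /H' E.
have [d' dd'] := isder_exists hD'; have [f' ff'] := ismap_exists hH'.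
have dE x : Msub U x -> d x = d' x by exact: (isder_eq dd dd' DD').
have fE x : Msub U x -> f x = f' x by exact: (ismap_eq ff ff' HH').
have [ld' d1' dM' dg' dh'] := dd'; have [lf' f1' fM' fg'] := ff'.
have MU x : Msub U x -> Msub U' x.
  by apply: subalg_mono => _ [i Ui <-]; exists i => //; left.
exists (U', D', H'); last first.
  move=> i in_ /=; rewrite /D' /H' (ltn_eqF in_); split=> //.
  apply/propext; split=> [[//|[E _]]|]; last by left.
  by move: in_; rewrite E ltnn.
have b1M j : Msub U (b j).1 by case: (Zb j).
split.
- by move=> i [/Un/ltnW //|[-> _]]; rewrite ltnS.
- move=> i nU; rewrite /D' /H'; case: eqP => [in_|_].
    by rewrite b0 //= => Vi; apply: nU; right.
  by apply: U0 => Ui; apply: nU; left.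
- move=> i; split=> //; rewrite /D'; case: eqP => [in_|_].
    apply: subalg_mono (b1M i.2) => _ [j Uj <-]; exists j => //; split; first by left.
    by rewrite in_; exact: Un.
  case: (DH i) => _ _; apply: subalg_mono => _ [j [Uj ji] <-]; exists j => //.
  by split=> //; left.
exists d', f'; split=> // [i|].
  rewrite /D'; case: eqP => [in_|/eqP in_].
    by rewrite -dE -?fE //; case: (Zb i.2).
  have [Ui|/U0[-> _]] := pselect (U i); last by rewrite (linear0E ld') (linear0E lf').
  have MDi : Msub U (D i).
    by case: (DH i) => _ _; apply: subalg_mono => _ [j [Uj _] <-]; exists j.
  by rewrite -dE -?fE.
pose vg j : F := if pselect (V0 j) is left _ then gen (n, j) else 0.
have vgE j : d' (vg j) = (b j).1 /\ f' (vg j) = (b j).2.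
  rewrite /vg; case: pselect => [V0j|/b0->].
    by rewrite dg' fg' /D' /H' /= eqxx.
  by rewrite (linear0E ld') (linear0E lf').
have vgU j : Msub U' (vg j) /\ dghom n.+2 (vg j).
  rewrite /vg; case: pselect => [V0j|_]; last by split; [case: (subsp_Msub U')|exact: (hom0 gF)].
  split; last exact: (fhom_gen K mdeg (n, j)).
  by apply: subalg_gen; exists (n, j) => //; right.
have Vspan v : lspan [set gen (n, j) | j in [set j | V0 j]] v ->
    exists N (a : nat -> K), v = \sum_(j < N) a j *: vg j.
  move=> Vv; apply: lspan_range; apply: lspan_mono Vv => _ [j V0j <-]; exists j => //.
  by rewrite /vg; case: pselect.
have sumE m (a : nat -> K) : (d' (\sum_(j < m) a j *: vg j), f' (\sum_(j < m) a j *: vg j)) =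
    \sum_(j < m) a j *: b j :> F * B.
  elim: m => [|m IH]; first by rewrite !big_ord0 (linear0E ld') (linear0E lf').
  rewrite !big_ord_recr /= -IH (linearDE _ _ ld') (linearDE _ _ lf').
  rewrite (linearZE _ _ ld') (linearZE _ _ lf').
  by have [-> ->] := vgE m; rewrite [b m]surjective_pairing.
move=> k kn z h Mz hz dz fz Sh.
(* Outside degree n + 2 the cocycle z contains no new generator. For smaller k the old statement
   then applies; for k = n + 2 the new generators were chosen to provide y. *)
have [zM|zk] := eqVneq k n.+1; last first.
  have [m [v [Mm hm Vv v0 zE]]] := step_hom Mz hz (kn : (k.+1 <= n.+3)%N).
  move: (v0 zk) zE => ->; rewrite addr0 => zE; rewrite {}zE in Mz hz dz fz *.
  move: kn; rewrite leq_eqVlt => /orP[/eqP kE|kn]; last first.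
    have [||y [My hy dy fy]] := Ck k kn m h Mm hz _ _ Sh.
    - by rewrite dE.
    - by rewrite fE.
    by exists y; rewrite -dE // -fE //; split=> //; exact: MU.
  rewrite kE in hz Sh *.
  have Zmh : Z (m, h) by split=> //=; rewrite ?dE ?fE.
  have [M [a [y [My hy E]]]] := spanb _ Zmh.
  have yM := MU _ My.
  exists (\sum_(j < M) a j *: vg j + y); split.
  - apply: subspD; [exact: subsp_Msub| |exact: yM].
    apply: subsp_sum => [|j _]; first exact: subsp_Msub.
    by apply: subspZ; [exact: subsp_Msub|case: (vgU j)].
  - apply: subspD; [exact: subsp_hom| |exact: hy].
    apply: subsp_sum => [|j _]; first exact: subsp_hom.
    by apply: subspZ; [exact: subsp_hom|case: (vgU j)].
  - move/eqP: E; rewrite subr_eq addrC -sumE dE // fE // => /eqP[-> _].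
    by rewrite (linearDE _ _ ld').
  - move/eqP: E; rewrite subr_eq addrC -sumE dE // fE // => /eqP[_ ->].
    by rewrite (linearDE _ _ lf').
rewrite zM in kn hz Sh *.
have [m [v [Mm hm Vv _ zE]]] := step_hom Mz hz (leqnSn n.+2).
have [M [a vE]] := Vspan _ Vv.
(* New generators occurring in z would give a relation modulo N between the b j, so independence
   removes them. *)
have Nv : N (\sum_(j < M) a j *: b j).
  exists (- m); split; [exact: subspN|exact: (subspN (subsp_hom gF _))|].
  rewrite -sumE -vE (linearNE _ ld) (linearNE _ lf) dE // fE //.
  move: dz fz; rewrite zE (linearDE _ _ ld') (linearDE _ _ lf').
  by move=> /eqP; rewrite addr_eq0 => /eqP-> /eqP; rewrite addr_eq0 => /eqP->; rewrite !opprK.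
have v0 : v = 0.
  rewrite vE big1 // => j _; rewrite /vg; case: pselect => [V0j|_]; last by rewrite scaler0.
  by rewrite (indep _ _ Nv j (ltn_ord j) V0j) scale0r.
rewrite v0 addr0 in zE; rewrite {}zE in Mz hz dz fz *.
have [||y [My hy dy fy]] := Ck n.+1 (leqnn _) m h Mm hz _ _ Sh.
- by rewrite dE.
- by rewrite fE.
by exists y; rewrite -dE // -fE //; split=> //; exact: MU.
Qed.

Let stages : forall n, {st | stage n st} :=
  fix rec n := if n is m.+1 then
      let s := cid2 (stage_step (projT2 (rec m))) in exist _ (s2val s) (s2valP s)
    else exist _ _ stage0.

Let UU n := (projT1 (stages n)).1.1.
Let DD n := (projT1 (stages n)).1.2.
Let HH n := (projT1 (stages n)).2.

Lemma stages_eq n i : (i.1 < n)%N ->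
  [/\ UU n i = UU i.1.+1 i, DD n i = DD i.1.+1 i & HH n i = HH i.1.+1 i].
Proof.
elim: n => [//|n IH]; rewrite ltnS leq_eqVlt => /orP[/eqP <- //|in_].
have [E1 E2 E3] := s2valP' (cid2 (stage_step (projT2 (stages n)))) i in_.
by have [<- <- <-] := IH in_; split; [rewrite /UU /= E1|rewrite /DD /= E2|rewrite /HH /= E3].
Qed.

Lemma hom0_scalar (x : F) : dghom 0 x -> exists c : K, x = c *: dgone F.
Proof.
move=> hx; have [lp _ p1 _ _] := prjP; have [c [y hy E]] := free_augment x.
exists c; rewrite -(p1 0%N x hx) E (linearDE _ _ (lp 0%N)) (@prj_Fge 2 0 y) // addr0.
by rewrite p1 //; apply: subspZ; [exact: subsp_hom|exact: fhom_one].
Qed.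

(** The union of the stages. The data at an index i are final from stage i.1 + 1 on, and an element
    of the subalgebra involves generators of bounded degree, so each assertion is checked at one
    finite stage. *)
Lemma model_ambient : exists (U : I -> Prop) (D : I -> F) (H : I -> B) (d : F -> F) (f : F -> B),
  [/\ forall i, U i -> Msub (fun j => U j /\ (j.1 < i.1)%N) (D i),
      isder D d, ismap H f /\ (forall n x, dghom n x -> S n (f x)),
      forall i, d (D i) = 0 /\ f (D i) = 0 & forall k, Cprop U d f k].
Proof.
pose U i := UU i.1.+1 i; pose D i := DD i.1.+1 i; pose H i := HH i.1.+1 i.
have stP n : stage n (UU n, DD n, HH n).
  by have := projT2 (stages n); rewrite /UU /DD /HH; case: (projT1 _) => [[]].
have hD i : dghom (mdeg i).+1 (D i) by have [_ _ /(_ i)[]] := stP i.1.+1.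
have hH i : S (mdeg i) (H i) by have [_ _ /(_ i)[]] := stP i.1.+1.
have [d dd] := isder_exists hD; have [f ff] := ismap_exists hH.
have UD i : Msub (fun j => U j /\ (j.1 < i.1)%N) (D i).
  have [_ _ /(_ i)[_ _ + ] _] := stP i.1.+1.
  apply: subalg_mono => _ [j [Uj ji] <-]; exists j => //; split=> //.
  by have [E _ _] := @stages_eq i.1.+1 j (leqW ji); rewrite /U -E.
pose Un n i := U i /\ (i.1 < n)%N.
have UnE n i : Un n i -> [/\ UU n i, D i = DD n i & H i = HH n i].
  by move=> [Ui in_]; have [-> -> ->] := stages_eq in_.
have UUn n i : UU n i -> Un n i.
  have [/(_ i) Hn _ _ _] := stP n => Ui; have in_ := Hn Ui; split=> //.
  by have [E _ _] := stages_eq in_; rewrite /U -E.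
exists U, D, H, d, f; split=> //.
- by split=> //; exact: (ismap_hom hH ff).
- move=> i; have [_ _ _ [dn [fn [ddn ffn dfn _]]]] := stP i.1.+1.
  have [dDi fDi] := dfn i.
  have Mi : Msub (Un i.1.+1) (D i).
    by apply: subalg_mono (UD i) => _ [j [Uj ji] <-]; exists j => //; split=> //; exact: leqW.
  split.
    rewrite (isder_eq dd ddn _ Mi) // => j /UnE[] //.
  by rewrite (ismap_eq ff ffn _ Mi) // => j /UnE[].
move=> k z h Mz hz dz fz Sh.
have [n zn] : exists n, Msub (Un n) z.
  have mono m m' : (m <= m')%N -> Msub (Un m) `<=` Msub (Un m').
    by move=> mm; apply: subalg_mono => _ [j [Uj ji] <-]; exists j => //; split=> //; exact: leq_trans mm.
  elim: Mz => {z hz dz fz}.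
  - by move=> _ [i Ui <-]; exists i.1.+1; apply: subalg_gen; exists i.
  - by exists 0%N; exact: subalg_one.
  - move=> c x y _ [n xn] _ [m ym]; exists (maxn n m).
    by apply: subalg_lin; [apply: mono xn|apply: mono ym]; rewrite leq_max leqnn ?orbT.
  - move=> x y _ [n xn] _ [m ym]; exists (maxn n m).
    by apply: subalg_mul; [apply: mono xn|apply: mono ym]; rewrite leq_max leqnn ?orbT.
pose N := maxn n k.
have zN : Msub (Un N) z.
  by apply: subalg_mono zn => _ [j [Uj ji] <-]; exists j => //; split=> //; rewrite leq_max ji.
have [_ _ _ [dn [fn [ddn ffn _ Ck]]]] := stP N.
have dE x : Msub (Un N) x -> d x = dn x by apply: (isder_eq dd ddn) => j /UnE[].
have fE x : Msub (Un N) x -> f x = fn x by apply: (ismap_eq ff ffn) => j /UnE[].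
have MUE x : Msub (UU N) x -> Msub (Un N) x.
  by apply: subalg_mono => _ [j Uj <-]; exists j => //; exact: UUn.
have MUE' x : Msub (Un N) x -> Msub (UU N) x.
  by apply: subalg_mono => _ [j Uj <-]; exists j => //; case: (UnE _ _ Uj).
have [|||y [My hy dy fy]] := Ck k _ z h (MUE' _ zN) hz _ _ Sh.
- by rewrite leqW // leq_maxr.
- by rewrite -dE.
- by rewrite -fE.
have yN := MUE _ My.
exists y; rewrite dE // fE //; split=> //.
by apply: subalg_mono yN => _ [j [Uj _] <-]; exists j.
Qed.

(** The stages live in the free algebra on all indices. The model is the free algebra on the subtype
    of chosen ones; [io] and [rho] identify it with the subalgebra they generate and transport the
    differential. *)
Theorem minimal_model_exists : exists (M : dgdata K) (f : M -> B), minimal_cdga M /\ qi S f.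
Proof.
have [U [D [H [d [f [UD dd [ff fh] dfD Ck]]]]]] := model_ambient.
have [ld d1 dM dg dh] := dd; have [lf f1 fM fg] := ff.
pose J := {i | U i}; pose jdeg (i : J) := mdeg (projT1 i).
pose F' := @free_dg K J jdeg.
have aF' : is_alg F' := @free_alg K J jdeg.
pose jg (i : J) : F' := @fgen K J jdeg i.
have [|io [lio io1 ioM iog]] := @free_map_exists K J jdeg F (fun i => gen (projT1 i)) aF.
  by move=> i j; apply: (cga_comm cF); exact: fhom_gen.
pose rg (i : I) : F' := if pselect (U i) is left h then jg (exist _ i h) else 0.
have rgh i : dghom (mdeg i) (rg i).
  rewrite /rg; case: pselect => [Ui|_]; last exact: fhom0.
  exact: (@fhom_gen K J jdeg (exist _ i Ui)).
have [|rho [lrho rho1 rhoM rhog]] := @free_map_exists K I mdeg F' rg aF'.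
  by move=> i j; apply: (cga_comm (@free_cga K J jdeg)); exact: rgh.
have rhoio x : rho (io x) = x.
  apply: (@free_map_eq K J jdeg F' (fun x => rho (io x)) id aF') => // [a u v||u v|i].
  - by rewrite lio lrho.
  - by rewrite io1.
  - by rewrite ioM rhoM.
  - rewrite iog rhog /rg; case: pselect => [h|[]]; last exact: (projT2 i).
    by congr (jg _); case: i h => i u h; congr exist; exact: Prop_irrelevance.
have ioU x : Msub U (io x).
  move: x; apply: free_ind => [i||a x y||x y].
  - by rewrite iog; apply: subalg_gen; exists (projT1 i) => //; exact: (projT2 i).
  - by rewrite io1; exact: subalg_one.
  - by rewrite lio; exact: subalg_lin.
  - by rewrite (linear0E lio); case: (subsp_Msub U).
  - by rewrite ioM; exact: subalg_mul.
have iorho x : Msub U x -> io (rho x) = x.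
  elim=> {x} [_ [i Ui <-]||c x y _ IH _ IH'|x y _ IH _ IH'].
  - by rewrite rhog /rg; case: pselect => // h; rewrite iog.
  - by rewrite rho1 io1.
  - by rewrite lrho lio IH IH'.
  - by rewrite rhoM ioM IH IH'.
have ioh n x : dghom n x -> dghom n (io x).
  elim=> {n x} [n|n a x y _ IH _ IH'|i||p q x y _ IH _ IH'].
  - by rewrite (linear0E lio); exact: fhom0.
  - by rewrite lio; exact: fhom_lin.
  - by rewrite iog; exact: (fhom_gen K mdeg).
  - by rewrite io1; exact: fhom_one.
  - by rewrite ioM; exact: (cga_mul cF).
have rhoh n x : dghom n x -> dghom n (rho x).
  elim=> {n x} [n|n a x y _ IH _ IH'|i||p q x y _ IH _ IH'].
  - by rewrite (linear0E lrho); exact: fhom0.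
  - by rewrite lrho; exact: fhom_lin.
  - by rewrite rhog; exact: rgh.
  - by rewrite rho1; exact: fhom_one.
  - by rewrite rhoM; exact: fhom_mul.
pose d' (x : F') : F' := rho (d (io x)).
have UDM i : U i -> Msub U (D i).
  by move=> /UD; apply: subalg_mono => _ [j [Uj _] <-]; exists j.
have iod' x : io (d' x) = d (io x).
  by rewrite /d' iorho //; case: (der_Msub dd UDM (ioU x)).
have dd0 : forall x, d (d x) = 0.
  by apply: (derivation_sq lbar hbar ld d1 dM dg dh) => i; case: (dfD i).
have fd x : f (d x) = 0.
  move: x; apply: free_ind => [i||a x y fx fy||x y fx fy].
  - by rewrite dg; case: (dfD i).
  - by rewrite d1 (linear0E lf).
  - by rewrite ld lf fx fy scaler0 addr0.
  - by rewrite (linear0E ld) (linear0E lf).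
  - by rewrite dM (linearDE _ _ lf) !fM fx fy (alg0l aB) (alg0r aB) addr0.
pose M := @DGData K (fr K jdeg) (@fhom K J jdeg) (cl jdeg (One K J)) (@fr_mul K J jdeg) d'.
have [cM hjg univ] := @free_cga_onP K J jdeg d'.
exists M, (fun x => f (io x)); split; last first.
  split.
  - by move=> a x y; rewrite lio lf.
  - by rewrite -f1 -io1.
  - by move=> x y; rewrite -fM -ioM.
  - by move=> n x hx; apply: fh; exact: ioh.
  - by move=> x; rewrite -[LHS]/(f (io (d' x))) iod' fd.
  - move=> z hz fz; have [c zc] := hom0_scalar (ioh 0%N z hz).
    have : c *: dgone B = 0 by rewrite -fz zc (linearZE _ _ lf) f1.
    move/eqP; rewrite scaler_eq0 (negbTE one_neq0) orbF => /eqP c0.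
    by rewrite -(rhoio z) zc c0 scale0r (linear0E lrho).
  - move=> k z h hz dz fz Sh.
    have [|y [My hy dy fy]] := Ck k (io z) h (ioU z) (ioh _ _ hz) _ fz Sh.
      by rewrite -iod' [d' z]dz (linear0E lio).
    exists (rho y); split.
    + exact: rhoh.
    + by rewrite -[LHS]/(rho (d (io (rho y)))) iorho // dy rhoio.
    + by rewrite iorho.
split.
  split=> //.
  - by move=> a x y; rewrite -[LHS]/(rho (d (io (a *: (x : F') + y)))) lio ld lrho.
  - move=> n x hx; apply: rhoh; apply: dh; exact: ioh.
  - by move=> x; rewrite -[LHS]/(rho (d (io (d' x)))) iod' dd0 (linear0E lrho).
  - move=> p x y hx; rewrite -[LHS]/(rho (d (io (@dgmul _ F' x y)))) ioM dM.
    rewrite (linearDE _ _ lrho) !rhoM (hbar (ioh _ _ hx)) (linearZE _ _ lrho) rhoio.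
    by rewrite rhoio (algZl aF').
exists J, (fun i j => lex (projT1 i) (projT1 j)), jdeg, jg; split.
- exact: well_order_lex.
- by move=> i; rewrite /jdeg.
- by move=> i j; rewrite /jdeg /mdeg => -[ij|[-> _]] //; rewrite !ltnS ltnW.
- by split; [exact: cM|exact: hjg|exact: univ].
- move=> i; have -> : @dgdiff _ M (jg i) = rho (D (projT1 i)).
    by rewrite -[LHS]/(rho (d (io (jg i)))) iog dg.
  elim: (UD _ (projT2 i)) => {univ} [_ [j [Uj ji] <-]||c x y _ IH _ IH'|x y _ IH _ IH'].
  - rewrite rhog /rg; case: pselect => // h; apply: subalg_gen.
    by exists (exist _ j h) => //; left.
  - by rewrite rho1; exact: (@subalg_one _ M).
  - by rewrite lrho; exact: (@subalg_lin _ M).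
  - by rewrite rhoM; exact: (@subalg_mul _ M).
Qed.

End ModelExists.

(** * Adjoining a closed generator of degree one *)

Section Adjoin.
Variables (K : realFieldType) (M B : dgdata K) (S : nat -> set B) (f : M -> B) (eta : B).
Hypotheses (aB : is_alg B) (mM : minimal_cdga M) (qf : qi S f).
Hypotheses (eta2 : dgmul eta eta = 0)
  (etaC : forall n s, S n s -> dgmul s eta = (-1) ^+ n *: dgmul eta s).

(** S + eta S with eta of degree one; in degree zero the second component has to vanish, as there is
    nothing in degree -1. *)
Definition S_adj n : set B := [set b | exists s s', [/\ S n s,
  (if n is m.+1 then S m s' else s' = 0) & b = s + dgmul eta s']].

Hypothesis (eta_free : forall n s s', S n s -> (if n is m.+1 then S m s' else s' = 0) ->
  s + dgmul eta s' = 0 -> s = 0 /\ s' = 0).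

Let dM : is_cdga M := proj1 mM.
Let cM : is_cga M := cdga_cga dM.
Let aM : is_alg M := cga_alg cM.
Let gM : is_graded M := cga_graded cM.
Let bar : M -> M := s2val (cid2 (bar_exists cM)).
Let lbar : linear bar := s2valP (cid2 (bar_exists cM)).
Let hbar : forall n x, dghom n x -> bar x = (-1) ^+ n *: x := s2valP' (cid2 (bar_exists cM)).

Definition adj : dgdata K := dbl bar.

Let f' (u : adj) : B := f u.1 + dgmul eta (f u.2).

Lemma adj_alg : is_alg adj.
Proof. exact: dbl_alg aM lbar (barM cM lbar hbar) (bar1 cM hbar). Qed.

Lemma adj_homP n (u : adj) : dghom n u <->
  dghom n u.1 /\ (if n is m.+1 then dghom m u.2 else u.2 = 0).
Proof. by []. Qed.

Lemma subsp_adj_hom n : subsp (@dghom K adj n).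
Proof.
split=> [|a x y [x1 x2] [y1 y2]]; split=> /=; try exact: (hom0 gM).
- by case: n => [//|n]; exact: (hom0 gM).
- exact: (homD gM).
- case: n x1 x2 y1 y2 => [|n] _ x2 _ y2; last exact: (homD gM).
  by rewrite x2 y2 scaler0 addr0.
Qed.

Lemma adj_graded : is_graded adj.
Proof.
have l0 := hom0 gM.
split.
- by move=> n; case: (subsp_adj_hom n).
- by move=> n a x y; case: (subsp_adj_hom n) => _; apply.
- move=> [x y]; have [n [c [hc xc]]] := hom_span gM x; have [m [d [hd yd]]] := hom_span gM y.
  pose N := maxn n m.
  have wd k (g : nat -> M) : (k <= N)%N ->
      \sum_(i < k) g i = \sum_(i < N) (if (i < k)%N then g i else 0).
    by move=> kN; rewrite (big_ord_widen_cond N (fun=> true) g kN) /= big_mkcond.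
  pose c' (i : nat) : M * M := (if (i < n)%N then c i else 0,
     if i is j.+1 then if (j < m)%N then d j else 0 else 0).
  exists N.+1, c'.
  split=> [i|].
    split=> /=; first by case: ifP => _; [exact: hc|exact: l0].
    by case: i => // i; case: ifP => _; [exact: hd|exact: l0].
  have E k (g : nat -> M * M) : \sum_(i < k) g i = (\sum_(i < k) (g i).1, \sum_(i < k) (g i).2).
    elim: k => [|k IH]; first by rewrite !big_ord0.
    by rewrite !big_ord_recr /= IH.
  apply: (etrans _ (esym (E N.+1 c'))); congr pair; rewrite /c' /=.
    rewrite big_ord_recr /= (_ : (N < n)%N = false) ?addr0; last first.
      by apply/negbTE; rewrite -leqNgt leq_maxl.
    by rewrite -wd ?leq_maxl.
  by rewrite big_ord_recl /= add0r -(wd m d) ?leq_maxr.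
- move=> n c hc Sc i i_n.
  have E k (g : nat -> M * M) : \sum_(i < k) g i = (\sum_(i < k) (g i).1, \sum_(i < k) (g i).2).
    elim: k => [|k IH]; first by rewrite !big_ord0.
    by rewrite !big_ord_recr /= IH.
  have [s1 s2] : (\sum_(j < n) (c j).1, \sum_(j < n) (c j).2) = (0, 0) :> M * M by rewrite -(E n c).
  rewrite [c i]surjective_pairing; congr pair.
    by apply: (hom_direct gM (c := fun j => (c j).1) _ s1 i_n) => j; case: (hc j).
  case: i i_n => [|i] i_n; first by case: (hc 0%N).
  case: n i_n s2 {s1 Sc} => // n i_n; rewrite big_ord_recl /=.
  have [_ ->] := hc 0%N; rewrite add0r => s2.
  by apply: (hom_direct gM (c := fun j => (c j.+1).2) _ s2 i_n) => j; case: (hc j.+1).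
Qed.

Lemma adj_cga : is_cga adj.
Proof.
have aA := adj_alg; split; try by case: aA.
- exact: adj_graded.
- by split=> //; exact: cga_one.
- move=> p q [x1 x2] [y1 y2] [/= hx1 hx2] [/= hy1 hy2]; split=> /=; first exact: (cga_mul cM).
  have -> : bar x1 = (-1) ^+ p *: x1 by exact: hbar.
  case: p hx1 hx2 => [|p] hx1 hx2; case: q hy1 hy2 => [|q] hy1 hy2.
  + by rewrite /= hx2 hy2 (alg0l aM) (alg0r aM) addr0.
  + rewrite add0n hx2 (alg0l aM) add0r (algZl aM); apply: subspZ; first exact: subsp_hom.
    exact: (cga_mul cM hx1 hy2).
  + by rewrite addn0 hy2 (alg0r aM) addr0; rewrite -[p]addn0; exact: (cga_mul cM hx2 hy1).
  + rewrite addSn; apply: subspD; [exact: subsp_hom| |].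
      exact: (cga_mul cM hx2 hy1).
    rewrite (algZl aM); apply: subspZ; first exact: subsp_hom.
    by rewrite addnS -addSn; exact: (cga_mul cM hx1 hy2).
- move=> p q [x1 x2] [y1 y2] [/= hx1 hx2] [/= hy1 hy2].
  have b1 : bar x1 = (-1) ^+ p *: x1 by exact: hbar.
  have b2 : bar y1 = (-1) ^+ q *: y1 by exact: hbar.
  set c := (-1) ^+ (p * q).
  change ((dgmul x1 y1, dgmul x2 y1 + dgmul (bar x1) y2) =
    (c *: dgmul y1 x1, c *: (dgmul y2 x1 + dgmul (bar y1) x2)) :> M * M).
  congr pair; first exact: (cga_comm cM hx1 hy1).
  rewrite b1 b2 !(algZl aM) scalerDr addrC scalerA; congr (_ + _).
    case: q hy1 hy2 @c {b2} => [|q] hy1 hy2 c.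
      by rewrite hy2 (alg0l aM) (alg0r aM) !scaler0.
    rewrite (cga_comm cM hx1 hy2) scalerA; congr (_ *: _).
    by rewrite /c mulnS exprD.
  case: p hx1 hx2 @c {b1} => [|p] hx1 hx2 c.
    by rewrite hx2 (alg0l aM) (alg0r aM) scaler0.
  rewrite (cga_comm cM hx2 hy1); congr (_ *: _).
  by rewrite /c mulSn exprD mulrAC sign_mul_self mul1r.
Qed.

Lemma bar_diff x : bar (dgdiff x) = - dgdiff (bar x).
Proof.
have ld := cdga_lin dM.
move: x; apply: (graded_ind gM) => [|n x y hx IH].
  by rewrite (linear0E ld) (linear0E lbar) (linear0E ld) oppr0.
rewrite !(linearDE _ _ lbar, linearDE _ _ ld) IH opprD; congr (_ + _).
rewrite (hbar hx) (linearZE _ _ ld) (hbar (cdga_deg dM hx)) exprS mulN1r scaleNr.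
by [].
Qed.

Lemma adj_cdga : is_cdga adj.
Proof.
have ld := cdga_lin dM.
split; first exact: adj_cga.
- move=> a [x1 x2] [y1 y2].
  change ((dgdiff (a *: x1 + y1), - dgdiff (a *: x2 + y2)) =
     (a *: dgdiff x1 + dgdiff y1, a *: (- dgdiff x2) + (- dgdiff y2)) :> M * M).
  by rewrite !ld scalerN opprD.
- move=> n [x1 x2] [/= h1 h2]; split=> /=; first exact: (cdga_deg dM).
  case: n h1 h2 => [|n] _ h2; last by apply: subspN; [exact: subsp_hom|exact: (cdga_deg dM)].
  by rewrite h2 (linear0E ld) oppr0; exact: (hom0 gM).
- move=> [x1 x2]; change ((dgdiff (dgdiff x1), - dgdiff (- dgdiff x2)) = (0, 0) :> M * M).
  by rewrite (linearNE _ ld) !(cdga_dd dM) !oppr0.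
- move=> p [x1 x2] [y1 y2] [/= h1 h2].
  have b1 : bar x1 = (-1) ^+ p *: x1 by exact: hbar.
  have b2 : bar (dgdiff x1) = (-1) ^+ p.+1 *: dgdiff x1.
    by apply: hbar; exact: (cdga_deg dM).
  set c := (-1) ^+ p.
  change ((dgdiff (dgmul x1 y1), - dgdiff (dgmul x2 y1 + dgmul (bar x1) y2)) =
    (dgmul (dgdiff x1) y1 + c *: dgmul x1 (dgdiff y1),
     dgmul (- dgdiff x2) y1 + dgmul (bar (dgdiff x1)) y2 +
       c *: (dgmul x2 (dgdiff y1) + dgmul (bar x1) (- dgdiff y2))) :> M * M).
  congr pair; first exact: (cdga_leibniz dM _ h1).
  have E2 : dgdiff (dgmul x2 y1) = dgmul (dgdiff x2) y1 - c *: dgmul x2 (dgdiff y1).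
    case: p h1 h2 @c {b1 b2} => [|p] h1 h2 c.
      by rewrite h2 !(alg0l aM) (linear0E ld) (alg0l aM) scaler0 subr0.
    by rewrite (cdga_leibniz dM _ h2) /c exprS mulN1r scaleNr opprK.
  rewrite (linearDE _ _ ld) E2 b1 b2 (algZl aM) (linearZE _ _ ld) (cdga_leibniz dM _ h1).
  rewrite !(algNl aM) !(algNr aM) !(algZl aM) exprS -/c mulN1r.
  move: (dgmul (dgdiff x2) y1) (dgmul x2 (dgdiff y1)) (dgmul (dgdiff x1) y2)
    (dgmul x1 (dgdiff y2)) => u v w z.
  rewrite !scalerDr !scalerN !scaleNr !opprD opprK -!addrA; congr (_ + _).
  by rewrite addrCA.
Qed.

(** The new generator is closed of degree one and is placed below all others: its differential 0 is
    trivially decomposable, and degrees stay monotone because the old ones are positive. *)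
Lemma minimal_adj : minimal_cdga adj.
Proof.
have [_ [I [lt [deg [a [wo d0 mono [_ ha univ] dec]]]]]] := mM.
split; first exact: adj_cdga.
pose lt' (i j : option I) := match i, j with
  | None, Some _ => True | Some i, Some j => lt i j | _, None => False end.
pose deg' (i : option I) := if i is Some i then deg i else 1%N.
pose a' (i : option I) : adj := if i is Some i then (a i, 0) else (0, dgone M).
exists (option I), lt', deg', a'; split.
- case: wo => wf tr tot; split.
  + have AN : Acc lt' None by split=> -[].
    case=> [i|//]; elim/(well_founded_ind wf): i => i IH.
    by split=> -[j|//] ji; exact: IH.
  + by move=> [i|] [j|] [k|] //=; exact: tr.
  + move=> [i|] [j|] /=; [|by constructor 3|by constructor 1|by constructor 2].
    case: (tot i j) => [h|->|h]; [by constructor 1|by constructor 2|by constructor 3].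
- by case=> [i|] //=.
- by case=> [i|] [j|] //=; exact: mono.
- split; first exact: adj_cga.
    case=> [i|] /=; split=> //=; first by case: (deg i) => [//|m]; exact: (hom0 gM).
      exact: (hom0 gM).
    exact: (cga_one cM).
  move=> C cC b hb; have aC := cga_alg cC.
  have [f0 [[[lf0 hf0 f01 f0M] f0a] f0u]] := univ C cC (fun i => b (Some i)) (fun i => hb (Some i)).
  pose bx := b None; have hbx : dghom 1 bx := hb None.
  have bx2 : dgmul bx bx = 0.
    have := cga_comm cC hbx hbx; rewrite expr1 scaleN1r => /eqP.
    by rewrite -subr_eq0 opprK -mulr2n -scaler_nat scaler_eq0 pnatr_eq0 => /eqP.
  have bxC x : dgmul (f0 x) bx = dgmul bx (f0 (bar x)).
    move: x; apply: (graded_ind gM) => [|n x y hx IH].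
      by rewrite (linear0E lbar) (linear0E lf0) (alg0l aC) (alg0r aC).
    rewrite (linearDE _ _ lbar) !(linearDE _ _ lf0) (algDl aC) (algDr aC) IH; congr (_ + _).
    rewrite (hbar hx) (linearZE _ _ lf0) (algZr aC) (cga_comm cC (hf0 _ _ hx) hbx).
    by rewrite muln1.
  exists (fun u : adj => f0 u.1 + dgmul bx (f0 u.2)); split.
    split; last first.
      case=> [i|] /=; first by rewrite f0a (linear0E lf0) (alg0r aC) addr0.
      by rewrite (linear0E lf0) add0r f01 (alg_1mul aC).
    split.
    + move=> c [x1 x2] [y1 y2].
      rewrite -[LHS]/(f0 (c *: x1 + y1) + dgmul bx (f0 (c *: x2 + y2))) /=.
      by rewrite !lf0 (algDr aC) (algZr aC) scalerDr addrACA.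
    + move=> n [x1 x2] [/= h1 h2]; apply: (subspD (subsp_hom (cga_graded cC) n)).
        exact: hf0.
      case: n h1 h2 => [|n] _ h2.
        by rewrite h2 (linear0E lf0) (alg0r aC); exact: (hom0 (cga_graded cC)).
      exact: (cga_mul cC hbx (hf0 _ _ h2)).
    + by rewrite /= f01 (linear0E lf0) (alg0r aC) addr0.
    + move=> [x1 x2] [y1 y2].
      rewrite -[LHS]/(f0 (dgmul x1 y1) + dgmul bx (f0 (dgmul x2 y1 + dgmul (bar x1) y2))) /=.
      rewrite (algDl aC) !(algDr aC) (linearDE _ _ lf0) !f0M (algDr aC) -!addrA; congr (_ + _).
      rewrite [dgmul (dgmul bx (f0 x2)) (dgmul bx _)](alg_assoc aC) -(alg_assoc aC bx _ bx) bxC.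
      rewrite (alg_assoc aC bx bx) bx2 !(alg0l aC) addr0 addrC; congr (_ + _).
        by rewrite (alg_assoc aC).
      by rewrite [LHS](alg_assoc aC) -bxC -(alg_assoc aC).
  move=> g [[lg hg g1 gMul] ga]; apply/funext => -[x1 x2] /=.
  have E : f0 = fun x => g (x, 0).
    apply: f0u; split; last by move=> i; exact: (ga (Some i)).
    split.
    + move=> c x y; rewrite -lg; congr g.
      by rewrite -[RHS]/(c *: x + y, c *: 0 + 0) scaler0 addr0.
    + by move=> n x hx; apply: hg; split=> //=; case: n {hx} => [//|n]; exact: (hom0 gM).
    + exact: g1.
    + move=> x y; rewrite -gMul; congr g.
      rewrite -[RHS]/(dgmul x y, dgmul 0 y + dgmul (bar x) 0).
      by rewrite (alg0l aM) (alg0r aM) addr0.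
  rewrite E /bx -(ga None) -gMul -(linearDE _ _ lg); congr g.
  rewrite -[LHS]/(x1 + dgmul 0 x2, 0 + (dgmul (dgone M) x2 + dgmul (bar 0) 0)).
  by rewrite (alg0l aM) (alg0r aM) (alg_mul1 aM) !addr0 add0r.
- have sub_pair (T : set M) (T' : set adj) : (forall x, T x -> T' (x, 0)) ->
      forall x, subalg T x -> subalg T' (x, 0).
    move=> TT' x; elim=> {x} [x /TT'|||].
    + exact: subalg_gen.
    + exact: (@subalg_one _ adj).
    + move=> c x y _ IH _ IH'; have := subalg_lin c IH IH'.
      by rewrite -[c *: _ + _]/(c *: x + y, c *: 0 + 0) scaler0 addr0.
    + move=> x y _ IH _ IH'; have := subalg_mul IH IH'.
      rewrite -[dgmul _ _]/(dgmul x y, dgmul 0 y + dgmul (bar x) 0).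
      by rewrite (alg0l aM) (alg0r aM) addr0.
  have ld := cdga_lin dM.
  case=> [i|].
    have -> : @dgdiff _ adj (a' (Some i)) = (dgdiff (a i), 0).
      by rewrite -[LHS]/(dgdiff (a i), - dgdiff (0 : M)) (linear0E ld) oppr0.
    apply: sub_pair (dec i) => _ [j ji <-]; by exists (Some j).
  have d1 : dgdiff (dgone M) = 0.
    have := cdga_leibniz dM (dgone M) (cga_one cM).
    rewrite expr0 scale1r !(alg_1mul aM) !(alg_mul1 aM) => /eqP.
    by rewrite -subr_eq0 opprD addrA subrr sub0r oppr_eq0 => /eqP.
  have -> : @dgdiff _ adj (a' None) = 0.
    by rewrite -[LHS]/(dgdiff (0 : M), - dgdiff (dgone M)) (linear0E ld) d1 oppr0.
  by case: (@subsp_subalg _ adj (a' @` [set j | lt' j None])).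
Qed.

(** S + eta S is free on 1 and eta, so each condition splits into two conditions on f, the second
    one degree lower and with the sign of the differential of the double. *)
Lemma qi_adj : qi S_adj f'.
Proof.
have [lf f1 fM fh fd f0 fC] := qf.
have fbar x : dgmul (f x) eta = dgmul eta (f (bar x)).
  move: x; apply: (graded_ind gM) => [|n x y hx IH].
    by rewrite (linear0E lbar) (linear0E lf) (alg0l aB) (alg0r aB).
  rewrite (linearDE _ _ lbar) !(linearDE _ _ lf) (algDl aB) (algDr aB) IH; congr (_ + _).
  by rewrite (hbar hx) (linearZE _ _ lf) (algZr aB) (etaC (fh _ _ hx)).
have f'0 n u : dghom n u -> f' u = 0 -> f u.1 = 0 /\ f u.2 = 0.
  case: u => x1 x2 [/= h1 h2] E; apply: (@eta_free n) => //; first exact: fh.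
  case: n h1 h2 => [|n] _ h2; last exact: fh.
  by rewrite h2 (linear0E lf).
split.
- move=> c [x1 x2] [y1 y2].
  rewrite -[LHS]/(f (c *: x1 + y1) + dgmul eta (f (c *: x2 + y2))) /f' /=.
  by rewrite !lf (algDr aB) (algZr aB) scalerDr addrACA.
- by rewrite /f' /= f1 (linear0E lf) (alg0r aB) addr0.
- move=> [x1 x2] [y1 y2].
  rewrite -[LHS]/(f (dgmul x1 y1) + dgmul eta (f (dgmul x2 y1 + dgmul (bar x1) y2))) /f' /=.
  rewrite (algDl aB) !(algDr aB) (linearDE _ _ lf) !fM (algDr aB) -!addrA; congr (_ + _).
  rewrite [dgmul (dgmul eta (f x2)) (dgmul eta _)](alg_assoc aB) -(alg_assoc aB eta _ eta) fbar.
  rewrite (alg_assoc aB eta eta) eta2 !(alg0l aB) addr0 addrC; congr (_ + _).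
    by rewrite (alg_assoc aB).
  by rewrite [LHS](alg_assoc aB) -fbar -(alg_assoc aB).
- move=> n [x1 x2] [/= h1 h2]; exists (f x1), (f x2); split=> //; first exact: fh.
  by case: n h1 h2 => [|n] _ h2; [rewrite h2 (linear0E lf)|exact: fh].
- move=> [x1 x2]; rewrite -[LHS]/(f (dgdiff x1) + dgmul eta (f (- dgdiff x2))).
  by rewrite (linearNE _ lf) !fd oppr0 (alg0r aB) addr0.
- move=> [x1 x2] hz fz; have [/= fz1 _] := f'0 _ _ hz fz; case: hz => /= h1 ->.
  by rewrite (f0 _ h1 fz1).
- move=> k [z1 z2] h hz dz fz [s [s' [Ss Ss' ->]]].
  have [/= fz1 fz2] := f'0 _ _ hz fz; case: hz => /= h1 h2.
  have dz1 : dgdiff z1 = 0 by exact: (congr1 fst dz).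
  have dz2 : dgdiff z2 = 0.
    have E : - dgdiff z2 = 0 := congr1 snd dz.
    by apply/eqP; rewrite -oppr_eq0 E.
  have [y1 [hy1 dy1 fy1]] := fC _ _ _ h1 dz1 fz1 Ss.
  have [y2 [hy2 dy2 fy2]] : exists y2, [/\ (if k is m.+1 then dghom m y2 else y2 = 0),
      - dgdiff y2 = z2 & f y2 = s'].
    case: k h1 h2 Ss Ss' hy1 => [|k] _ h2 _ Ss' _.
      exists 0; rewrite (linear0E (cdga_lin dM)) (linear0E lf) oppr0 Ss'; split=> //.
      by rewrite (f0 _ h2 fz2).
    have [|||y [hy dy fy]] := fC k (- z2) s' _ _ _ Ss'.
    - exact: subspN (subsp_hom gM _) h2.
    - by rewrite (linearNE _ (cdga_lin dM)) dz2 oppr0.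
    - by rewrite (linearNE _ lf) fz2 oppr0.
    by exists y; rewrite dy opprK.
  exists (y1, y2); split; first by [].
    by rewrite -[LHS]/(dgdiff y1, - dgdiff y2) dy1 dy2.
  by rewrite /f' /= fy1 fy2.
Qed.

Theorem adjoin_odd : exists (M' : dgdata K) (g : M' -> B), minimal_cdga M' /\ qi S_adj g.
Proof. by exists adj, f'; split; [exact: minimal_adj|exact: qi_adj]. Qed.

End Adjoin.

(** * The cohomology algebra and a criterion for formality *)

Lemma lspan_bigcup (K : fieldType) (V : lmodType K) (T : nat -> set V) x :
  (forall n, subsp (T n)) -> lspan (\bigcup_n T n) x ->
  exists n (c : nat -> V), (forall i, T i (c i)) /\ x = \sum_(i < n) c i.
Proof.
move=> sT; elim=> [|a y z [k _ ky] _ [n [c [hc zc]]]].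
  by exists 0%N, (fun=> 0); split=> [i|]; [case: (sT i)|rewrite big_ord0].
exists (maxn n k.+1), (fun i => (if i == k then a else 0) *: y + (if (i < n)%N then c i else 0)).
split=> [i|].
  apply: (subspD (sT i)).
    by case: eqP => [->|_]; [exact: subspZ|rewrite scale0r; case: (sT i)].
  by case: ifP => _ //; case: (sT i).
rewrite big_split /=; congr (_ + _).
  have kn : (k < maxn n k.+1)%N by rewrite leq_max ltnSn orbT.
  rewrite (bigD1 (Ordinal kn)) //= eqxx big1 ?addr0 // => i ik.
  rewrite (_ : (i == k :> nat) = false) ?scale0r //.
  by apply: contraNF ik => /eqP ik; apply/eqP/val_inj.
rewrite zc (big_ord_widen_cond _ (fun=> true) c (leq_maxl n k.+1)) /=.
by rewrite big_mkcond.
Qed.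

Section Cocycles.
Variables (K : realFieldType) (M : dgdata K).
Hypothesis dM : is_cdga M.
Let cM : is_cga M := cdga_cga dM.
Let aM : is_alg M := cga_alg cM.
Let gM : is_graded M := cga_graded cM.

Lemma subsp_cocycle n : subsp (@cocycle K M n).
Proof.
have ld := cdga_lin dM; split=> [|a x y [hx dx] [hy dy]].
  by split; [exact: hom0|exact: linear0E].
by split; [exact: homD|rewrite ld dx dy scaler0 addr0].
Qed.

Lemma subsp_coboundary n : subsp (@coboundary K M n).
Proof.
have ld := cdga_lin dM; case: n => [|n] /=.
  by split=> // a x y -> ->; rewrite scaler0 addr0.
split=> [|a _ _ [x hx <-] [y hy <-]]; first by exists 0; [exact: hom0|exact: linear0E].
by exists (a *: x + y); [exact: homD|rewrite ld].
Qed.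

Lemma coboundary_cocycle n (x : M) : coboundary n x -> cocycle n x.
Proof.
case: n => [->|n [y hy <-]]; first by case: (subsp_cocycle 0).
by split; [exact: cdga_deg|exact: cdga_dd].
Qed.

Local Notation Bd := (lspan (\bigcup_n @coboundary K M n)).
Local Notation Cy := (lspan (\bigcup_n @cocycle K M n)).

(** The quotient defining [cohomology] is by coboundaries of all degrees at once; projecting onto
    degree n recovers a coboundary of that degree. *)
Lemma lspan_coboundary n (x : M) : dghom n x -> Bd x -> coboundary n x.
Proof.
move=> hx /(lspan_bigcup subsp_coboundary)[m [c [hc xc]]].
have [p [lp hp pid pj _]] := graded_proj gM.
rewrite -(pid n x hx) xc (linear_sumE _ _ _ (lp n)).
apply: subsp_sum => [|i _]; first exact: subsp_coboundary.
have [hci _] := coboundary_cocycle (hc i).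
have [E|ne] := eqVneq (nat_of_ord i) n.
  by move: (hc i) hci; rewrite E => H hci; rewrite pid.
by rewrite (pj _ _ _ hci ne); case: (subsp_coboundary n).
Qed.

Lemma coboundary_mul (x y : M) : Bd x -> Cy y -> Bd (dgmul x y).
Proof.
move=> Bx Cy_; apply: (lspan_mul aM _ Bx Cy_) => {Bx Cy_}x {}y.
move=> [[_ ->|n _ [w hw <-]]] [m _ [hy dy]].
  by rewrite (alg0l aM); exact: lspan0.
apply: lspan_gen; exists (n + m).+1 => //=; exists (dgmul w y); first exact: (cga_mul cM).
by rewrite (cdga_leibniz dM _ hw) dy (alg0r aM) scaler0 addr0.
Qed.

Lemma mul_coboundary (x y : M) : Cy x -> Bd y -> Bd (dgmul x y).
Proof.
move=> Cx By; apply: (lspan_mul aM _ Cx By) => {Cx By}x {}y.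
move=> [m _ [hx dx]] [[_ ->|n _ [w hw <-]]].
  by rewrite (alg0r aM); exact: lspan0.
apply: lspan_gen; exists (m + n).+1 => //=; exists ((-1) ^+ m *: dgmul x w).
  by apply: subspZ; [exact: subsp_hom|exact: (cga_mul cM)].
rewrite (linearZE _ _ (cdga_lin dM)) (cdga_leibniz dM _ hx) dx (alg0l aM) add0r.
by rewrite scalerA sign_mul_self scale1r.
Qed.

Lemma lspan_cocycle_mul (x y : M) : Cy x -> Cy y -> Cy (dgmul x y).
Proof.
move=> Cx Cy_; apply: (lspan_mul aM _ Cx Cy_) => {Cx Cy_}x {}y [m _ [hx dx]] [n _ [hy dy]].
apply: lspan_gen; exists (m + n)%N => //; split; first exact: (cga_mul cM).
by rewrite (cdga_leibniz dM _ hx) dx dy (alg0l aM) (alg0r aM) scaler0 addr0.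
Qed.

Lemma lspan_Bd_Cy (x : M) : Bd x -> Cy x.
Proof.
apply: lspan_mono => y [n _ hy]; exists n => //; exact: coboundary_cocycle.
Qed.

(** The product in [cohomology] multiplies chosen representatives; a change of representatives
    contributes a coboundary times a cocycle and a cocycle times a coboundary. *)
Lemma coh_mul (x y : M) : Cy x -> Cy y ->
  dgmul (coh_class x) (coh_class y) = coh_class (dgmul x y).
Proof.
move=> Cx Cy_.
have R z : Bd (repr (coh_class z) - z).
  by apply/class_ofE; rewrite /class_of reprK.
apply/class_ofE; set x' := repr _; set y' := repr _.
have -> : dgmul x' y' - dgmul x y = dgmul (x' - x) y' + dgmul x (y' - y).
  by rewrite (algBl aM) (algBr aM) addrA subrK.
apply: (subspD (subsp_lspan _)).
  apply: coboundary_mul; first exact: R.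
  rewrite -(subrK y y'); apply: (subspD (subsp_lspan _)) => //.
  by apply: lspan_Bd_Cy; exact: R.
by apply: mul_coboundary => //; exact: R.
Qed.

End Cocycles.

Section FormalFromModel.
Variables (K : realFieldType) (M A : dgdata K) (S : nat -> set A) (f : M -> A).
Hypotheses (aA : is_alg A) (sS : forall n, subsp (S n)) (mM : minimal_cdga M) (qf : qi S f).
Hypotheses (Shom : forall n s, S n s -> dghom n s)
  (Sdir : forall n (c : nat -> A), (forall i, S i (c i)) -> \sum_(i < n) c i = 0 ->
    forall i, (i < n)%N -> c i = 0)
  (Sd : forall s, lspan (\bigcup_n S n) s -> dgdiff s = 0)
  (Sinj : forall n s, S n s -> coboundary n s -> s = 0)
  (Ssurj : forall n w, cocycle n w -> exists2 s, S n s & coboundary n (w - s)).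

Let dM : is_cdga M := proj1 mM.
Let cM : is_cga M := cdga_cga dM.
Let aM : is_alg M := cga_alg cM.
Let gM : is_graded M := cga_graded cM.
Let ld := cdga_lin dM.

Local Notation Bd := (lspan (\bigcup_n @coboundary K M n)).
Local Notation Cy := (lspan (\bigcup_n @cocycle K M n)).

Let Sf x : lspan (\bigcup_n S n) (f x).
Proof.
move: x; apply: (graded_ind gM) => [|n x y hx IH].
  by rewrite (linear0E (qi_lin qf)); exact: lspan0.
rewrite (linearDE _ _ (qi_lin qf)); apply: (subspD (subsp_lspan _)) => //.
by apply: lspan_gen; exists n => //; exact: (qi_hom qf).
Qed.

Let lift n s : S n s -> exists2 z : M, cocycle n z & f z = s.
Proof.
move=> Ss; have [|||y [hy dy fy]] := qi_cone qf (k := n) (z := 0) _ _ _ Ss.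
- exact: hom0.
- exact: linear0E.
- exact: linear0E (qi_lin qf).
by exists y.
Qed.

Let kill n (z : M) : cocycle n z -> f z = 0 -> coboundary n z.
Proof.
move=> [hz dz] fz; case: n hz => [|n] hz; first exact: (qi_inj0 qf).
have [|y [hy dy _]] := qi_cone qf hz dz fz (h := 0); first by case: (sS n).
by exists y.
Qed.

Lemma qi_quasi_iso : dg_morphism f /\ quasi_iso f.
Proof.
split.
  split; last by move=> x; rewrite (qi_diff qf) Sd.
  split; [exact: (qi_lin qf)| |exact: (qi_one qf)|exact: (qi_mul qf)].
  by move=> n x hx; apply/Shom/(qi_hom qf).
move=> n; split=> [z zc fz|w /Ssurj[s Ss sw]].
  apply: kill => //; apply: Sinj fz; apply: (qi_hom qf); by case: zc.
by have [z zc zs] := lift Ss; exists z; rewrite ?zs.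
Qed.

Let psi_ex x : exists z, Cy z /\ f z = f x.
Proof.
move: x; apply: (graded_ind gM) => [|n x y hx [z [zC zf]]].
  by exists 0; split=> //; exact: lspan0.
have [w wc wf] := lift (qi_hom qf hx).
exists (w + z); split; last by rewrite !(linearDE _ _ (qi_lin qf)) wf zf.
by apply: (subspD (subsp_lspan _)) => //; apply: lspan_gen; exists n.
Qed.

Let psi_ker z : Cy z -> f z = 0 -> Bd z.
Proof.
move=> /(lspan_bigcup (subsp_cocycle dM))[n [c [hc ->]]].
rewrite (linear_sumE _ _ _ (qi_lin qf)) => fc.
have fc0 : forall i, (i < n)%N -> f (c i) = 0.
  by apply: (Sdir (c := fun i => f (c i))) => // i; apply: (qi_hom qf); case: (hc i).
apply: subsp_sum => [|i _]; first exact: subsp_lspan.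
by apply: lspan_gen; exists i => //; apply: kill; [exact: hc|exact: fc0].
Qed.

(** psi x is the class of any sum of cocycles z with f z = f x. Such a z exists because f maps
    cocycles onto S, and its class is unique because a cocycle killed by f is a coboundary. *)
Lemma qi_formal_cdga : formal_cdga M.
Proof.
have lf := qi_lin qf; have sC := subsp_lspan (\bigcup_n @cocycle K M n).
pose zz x := projT1 (cid (psi_ex x)).
have zC x : Cy (zz x) by case: (projT2 (cid (psi_ex x))).
have zf x : f (zz x) = f x by case: (projT2 (cid (psi_ex x))).
pose psi x := coh_class (zz x).
have psiE x z : Cy z -> f z = f x -> psi x = coh_class z.
  move=> Cz fz; apply/class_ofE; apply: psi_ker; first exact: subspB.
  by rewrite (linearBE _ _ lf) zf fz subrr.
exists psi; split; last first.
  by move=> n z zc; apply: psiE => //; apply: lspan_gen; exists n.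
split; last first.
  move=> x; rewrite (psiE _ 0); last 2 first.
  - exact: lspan0.
  - by rewrite (qi_diff qf) (linear0E lf).
  exact: (linear0E (@class_of_linear _ _ _)).
split.
- move=> a x y; rewrite (psiE _ (a *: zz x + zz y)); first exact: class_of_linear.
    by apply: (subspD sC) => //; exact: subspZ.
  by rewrite !lf !zf.
- move=> n x hx; have [w wc wf] := lift (qi_hom qf hx).
  rewrite (psiE _ w) //; first by exists w.
  by apply: lspan_gen; exists n.
- apply: psiE => //; apply: lspan_gen; exists 0%N => //; split; first exact: (cga_one cM).
  have := cdga_leibniz dM (dgone M) (cga_one cM).
  rewrite expr0 scale1r !(alg_1mul aM) !(alg_mul1 aM) => /eqP.
  by rewrite -subr_eq0 opprD addrA subrr sub0r oppr_eq0 => /eqP.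
- move=> x y; rewrite /psi (coh_mul dM) //; apply: psiE; first exact: lspan_cocycle_mul.
  by rewrite !(qi_mul qf) !zf.
Qed.

Theorem qi_formal : formal A.
Proof.
exists M; split; last exact: qi_formal_cdga.
by split=> //; exists f; exact: qi_quasi_iso.
Qed.

End FormalFromModel.

(** * Massey-type obstructions to formality *)

Section Massey.
Variables (K : realFieldType) (M : dgdata K) (psi : M -> cohomology M).
Hypotheses (dM : is_cdga M) (mpsi : dg_morphism psi)
  (psiE : forall n (z : M), cocycle n z -> psi z = coh_class z).
Let cM : is_cga M := cdga_cga dM.
Let aM : is_alg M := cga_alg cM.
Let gM : is_graded M := cga_graded cM.
Let ld := cdga_lin dM.
Let lpsi := mor_lin (proj1 mpsi).

Let psi_mul (x y : M) n m (u v : M) : cocycle n u -> cocycle m v ->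
  psi x = coh_class u -> psi y = coh_class v -> psi (dgmul x y) = coh_class (dgmul u v).
Proof.
move=> uc vc xu yv; rewrite (mor_mul (proj1 mpsi)) xu yv (coh_mul dM) //.
- by apply: lspan_gen; exists n.
- by apply: lspan_gen; exists m.
Qed.

Let psi_hom n x : dghom n x -> exists2 u, cocycle n u & psi x = coh_class u.
Proof. by move=> /(mor_hom (proj1 mpsi))[u uc <-]; exists u. Qed.

Let psi_exact n x : cocycle n x -> psi x = 0 -> coboundary n x.
Proof.
move=> xc; rewrite (psiE xc) => H; apply: (lspan_coboundary dM); first by case: xc.
rewrite -[x]subr0; apply/class_ofE; rewrite -[LHS]/(coh_class x) H.
by rewrite (linear0E (@class_of_linear _ _ _)).
Qed.

(** With u a cocycle representing psi x, psi kills x - u and hence a (x - u), which is closed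
    because a a = 0. As psi is the identity on classes, this product is exact. *)
Lemma massey_deg1 (a t x : M) : cocycle 1 a -> cocycle 1 t -> dghom 1 x -> dgdiff x = dgmul a t ->
  exists2 u, cocycle 1 u & coboundary 2 (dgmul a (x - u)).
Proof.
move=> ac tc hx dx; have [u uc xu] := psi_hom hx; exists u => //.
have [[ha da] [hu du]] := (ac, uc).
have aa : dgmul a a = 0.
  have := cga_comm cM ha ha; rewrite expr1 scaleN1r => /eqP.
  by rewrite -subr_eq0 opprK -mulr2n -scaler_nat scaler_eq0 pnatr_eq0 => /eqP.
apply: psi_exact.
  split; first by apply: (cga_mul cM ha (_ : dghom 1 _)); exact: subspB (subsp_hom gM _) hx hu.
  rewrite (cdga_leibniz dM _ ha) da (alg0l aM) add0r (linearBE _ _ ld) dx du subr0.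
  by rewrite (alg_assoc aM) aa (alg0l aM) scaler0.
have c0 : cocycle 1 (0 : M) by case: (subsp_cocycle dM 1).
have cls0 : coh_class (0 : M) = 0 by exact: (linear0E (@class_of_linear _ _ _)).
rewrite (psi_mul ac c0 (psiE ac)) ?(alg0r aM) //.
by rewrite (linearBE _ _ lpsi) (psiE uc) xu subrr cls0.
Qed.

(** Corrections by cocycles, and by a primitive that restores the equation for y, make psi vanish on
    x' and y'. Then psi kills x' x' - 2 a y', which is closed because both terms have differential 2
    a x' t. *)
Lemma massey_deg2 (a t x y : M) : cocycle 2 a -> cocycle 1 t -> dghom 2 x -> dghom 2 y ->
  dgdiff x = dgmul a t -> dgdiff y = dgmul x t ->
  exists x' y' : M, [/\ cocycle 2 (x - x'), dghom 2 y', dgdiff x' = dgmul a t,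
    dgdiff y' = dgmul x' t & coboundary 4 (dgmul x' x' - 2 *: dgmul a y')].
Proof.
move=> ac tc hx hy dx dy; have sH n := subsp_hom gM n.
have [u uc xu] := psi_hom hx; have [v vc yv] := psi_hom hy.
have [[ha da] [hu du] [hv dv] [ht dt]] := And4 ac uc vc tc.
have c0 n : cocycle n (0 : M) by case: (subsp_cocycle dM n).
have cls0 : coh_class (0 : M) = 0 by exact: (linear0E (@class_of_linear _ _ _)).
(* u t is exact because psi (u t) = psi (x t) = psi (d y) = 0. Its primitive q absorbs the change of
   x in the equation for y; the cocycles v and q' then bring y into the kernel of psi. *)
have : coboundary 3 (dgmul u t).
  apply: psi_exact.
    split; first exact: (cga_mul cM hu ht).
    by rewrite (cdga_leibniz dM _ hu) du dt (alg0l aM) (alg0r aM) scaler0 addr0.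
  rewrite (psi_mul uc tc (psiE uc) (psiE tc)) -(psi_mul uc tc xu (psiE tc)) -dy.
  by rewrite (proj2 mpsi).
move=> [q hq dq]; have [q' qc qq'] := psi_hom hq; have [hq' dq'] := qc.
pose x' := x - u; pose y' := y - q - v + q'.
have hx' : dghom 2 x' by exact: subspB (sH _) hx hu.
have hy' : dghom 2 y' by apply: (subspD (sH _)) => //; do 2!apply: (subspB (sH _)) => //.
have dx' : dgdiff x' = dgmul a t by rewrite (linearBE _ _ ld) dx du subr0.
have dy' : dgdiff y' = dgmul x' t.
  rewrite (linearDE _ _ ld) !(linearBE _ _ ld) dy dq dv dq' subr0 addr0.
  by rewrite (algBl aM).
have ps x0 : psi x0 = 0 -> psi x0 = coh_class (0 : M) by rewrite cls0.
have px' : psi x' = coh_class (0 : M).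
  by apply: ps; rewrite (linearBE _ _ lpsi) xu (psiE uc) subrr.
have py' : psi y' = coh_class (0 : M).
  apply: ps; rewrite (linearDE _ _ lpsi) !(linearBE _ _ lpsi) yv qq' (psiE vc) (psiE qc).
  by rewrite addrAC subrK subrr.
exists x', y'; split=> //.
  by rewrite /x' opprB addrC subrK.
apply: psi_exact; last first.
  rewrite (linearBE _ _ lpsi) (linearZE _ _ lpsi) (psi_mul (c0 2) (c0 2) px' px').
  by rewrite (psi_mul ac (c0 2) (psiE ac) py') !(alg0r aM) cls0 scaler0 subrr.
have hm i j (r s : M) : dghom i r -> dghom j s -> dghom (i + j) (dgmul r s) by exact: (cga_mul cM).
split; first by apply: (subspB (sH _)); [exact: (hm _ _ _ _ hx' hx')|apply: subspZ => //; exact: (hm _ _ _ _ ha hy')].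
rewrite (linearBE _ _ ld) (linearZE _ _ ld) (cdga_leibniz dM _ hx') (cdga_leibniz dM _ ha).
rewrite da (alg0l aM) add0r dx' dy' expr2 mulrNN !mulr1 !scale1r.
have tx : dgmul t x' = dgmul x' t by rewrite (cga_comm cM ht hx') expr2 mulrNN mulr1 scale1r.
have xa : dgmul x' a = dgmul a x'.
  by rewrite (cga_comm cM hx' ha) exprM sqrrN !expr1n scale1r.
rewrite (alg_assoc aM x' a t) xa -!(alg_assoc aM) tx -mulr2n -scaler_nat.
by rewrite subrr.
Qed.

End Massey.

Section MasseyModel.
Variables (K : realFieldType) (A : dgdata K).
Hypotheses (fA : formal A) (sA : forall n, subsp (@dghom K A n))
  (dA : forall n (a : K) (x y : A), dghom n x -> dghom n y ->
     dgdiff (a *: x + y) = a *: dgdiff x + dgdiff y).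

Let dB n (x y : A) : dghom n x -> dghom n y -> dgdiff (x - y) = dgdiff x - dgdiff y.
Proof. by move=> hx hy; rewrite addrC -scaleN1r (dA _ hy hx) scaleN1r addrC. Qed.

(** The vanishing is moved from the model to A. A quasi-isomorphism controls representatives only up
    to coboundaries, so the hypothesis covers all representatives and the conclusion speaks of
    some. *)
Theorem formal_massey1 (a0 t0 : A) : cocycle 1 a0 -> cocycle 1 t0 ->
  (forall a t : A, cocycle 1 a -> cocycle 1 t -> coboundary 1 (a0 - a) ->
     coboundary 1 (t0 - t) -> coboundary 2 (dgmul a t)) ->
  exists a t x : A, [/\ cocycle 1 a /\ coboundary 1 (a0 - a), cocycle 1 t /\ coboundary 1 (t0 - t), dghom 1 x,
    dgdiff x = dgmul a t & coboundary 2 (dgmul a x)].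
Proof.
move=> ac0 tc0 H; have [M [[[dM _] [f [[[lf fh _ fM] fd] qf]]] [psi [mpsi psiE]]]] := fA.
have [_ S1] := qf 1%N; have [I2 _] := qf 2%N.
have [a ac aa] := S1 _ ac0; have [t tc tt] := S1 _ tc0.
have fc n z : cocycle n z -> cocycle n (f z).
  by move=> [hz dz]; split; [exact: fh|rewrite -fd dz (linear0E lf)].
have cM := cdga_cga dM; have [[ha da] [ht dt]] := (ac, tc).
have [||x hx dx] := I2 (dgmul a t).
- split; first exact: (cga_mul cM ha ht).
  rewrite (cdga_leibniz dM _ ha) da dt (alg0l (cga_alg cM)) (alg0r (cga_alg cM)).
  by rewrite scaler0 addr0.
- by rewrite fM; apply: H => //; exact: fc.
have [u [hu du] [y hy dy]] := massey_deg1 dM mpsi psiE ac tc hx dx.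
exists (f a), (f t), (f (x - u)); split=> //; try by split=> //; exact: fc.
- by apply: fh; exact: subspB (subsp_hom (cga_graded cM) _) hx hu.
- by rewrite -fd -fM (linearBE _ _ (cdga_lin dM)) du subr0 dx.
- by exists (f y); [exact: fh|rewrite -fd dy fM].
Qed.

(** As for one-forms, with one more step: the primitive found in the model is adjusted by a cocycle
    until its image is cohomologous to the prescribed x, since only then is the product with t known
    to be exact. *)
Theorem formal_massey2 (a0 t0 : A) : cocycle 2 a0 -> cocycle 1 t0 ->
  (forall a t : A, cocycle 2 a -> cocycle 1 t -> coboundary 2 (a0 - a) ->
     coboundary 1 (t0 - t) ->
     exists x : A, [/\ dghom 2 x, dgdiff x = dgmul a t &
       forall x', dghom 2 x' -> coboundary 2 (x - x') -> coboundary 3 (dgmul x' t)]) ->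
  exists a t x y : A, [/\ cocycle 2 a /\ coboundary 2 (a0 - a), cocycle 1 t /\ coboundary 1 (t0 - t), dghom 2 x, dghom 2 y &
    [/\ dgdiff x = dgmul a t, dgdiff y = dgmul x t &
      coboundary 4 (dgmul x x - 2 *: dgmul a y)]].
Proof.
move=> ac0 tc0 H; have [M [[[dM _] [f [[[lf fh _ fM] fd] qf]]] [psi [mpsi psiE]]]] := fA.
have [_ S1] := qf 1%N; have [_ S2] := qf 2%N; have [I3 _] := qf 3%N.
have [a ac aa] := S2 _ ac0; have [t tc tt] := S1 _ tc0.
have fc n z : cocycle n z -> cocycle n (f z).
  by move=> [hz dz]; split; [exact: fh|rewrite -fd dz (linear0E lf)].
have cM := cdga_cga dM; have aM := cga_alg cM; have ld := cdga_lin dM.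
have sH n := subsp_hom (cga_graded cM) n.
have [[ha da] [ht dt]] := (ac, tc).
have [xA [hxA dxA HxA]] := H (f a) (f t) (fc _ _ ac) (fc _ _ tc) aa tt.
have dat : dgdiff (dgmul a t) = 0.
  by rewrite (cdga_leibniz dM _ ha) da dt (alg0l aM) (alg0r aM) scaler0 addr0.
have [||x0 hx0 dx0] := I3 (dgmul a t).
- by split=> //; exact: (cga_mul cM ha ht).
- by exists xA => //; rewrite dxA fM.
have [|z [hz dz] xz] := S2 (f x0 - xA).
  split; first by apply: (subspB (sA 2)) => //; exact: fh.
  by rewrite (dB (fh _ _ hx0) hxA) -fd dx0 fM dxA subrr.
pose x := x0 - z.
have hx : dghom 2 x by exact: subspB (sH _) hx0 hz.
have dx : dgdiff x = dgmul a t by rewrite (linearBE _ _ ld) dz subr0.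
have [||y hy dy] := I3 (dgmul x t).
- split; first exact: (cga_mul cM hx ht).
  rewrite (cdga_leibniz dM _ hx) dt (alg0r aM) scaler0 addr0 dx -(alg_assoc aM).
  have := cga_comm cM ht ht; rewrite expr1 scaleN1r => /eqP.
  rewrite -subr_eq0 opprK -mulr2n -scaler_nat scaler_eq0 pnatr_eq0 => /eqP ->.
  by rewrite (alg0r aM).
- rewrite fM; apply: HxA; first exact: fh.
  have [w hw dw] := xz; exists (- w); first exact: (subspN (sA 1)).
  have w0 : dghom 1 (0 : A) by case: (sA 1).
  have d0 : dgdiff (0 : A) = 0 by have := dB w0 w0; rewrite subr0 subrr.
  by rewrite -sub0r (dB w0 hw) d0 sub0r dw (linearBE _ _ lf) !opprB addrCA.
have [x' [y' [[hxx dxx] hy' dx' dy' [w hw dw]]]] := massey_deg2 dM mpsi psiE ac tc hx hy dx dy.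
have hx' : dghom 2 x'.
  by rewrite -(subKr x x'); exact: subspB (sH _) hx hxx.
exists (f a), (f t), (f x'), (f y'); split; try exact: fh; try by split=> //; exact: fc.
split.
- by rewrite -fd -fM dx'.
- by rewrite -fd -fM dy'.
- by exists (f w); [exact: fh|rewrite -fd dw (linearBE _ _ lf) (linearZE _ _ lf) !fM].
Qed.

End MasseyModel.

(** * Averaging forms along vectors *)

Section Qop.
Variables (R : realType) (V : normedModType R).
Local Notation dform := (dform V).
Implicit Types (w : dform) (p v l : V) (s : seq V).

Definition Qop (th : R -> R) l w : dform := fun p s => pint th l (fun q => w q s) p.

Section Theta.
Variables (th : R -> R) (l : V).
Hypothesis cth : continuous th.
Local Notation Q := (Qop th l).

Lemma sform_Q w : sform w -> sform (Q w).
Proof. by move=> sw s; exact: smooth_pint. Qed.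

Lemma dird_Q v w : sform w -> dird v (Q w) = Q (dird v w).
Proof.
move=> sw; apply: dform_eqP => p s.
exact: (derive_val (is_derive := @is_derive_pint _ _ th l cth _ p v (sw s))).
Qed.

Lemma Q_lin (a : R) w1 w2 : sform w1 -> sform w2 -> Q (a *: w1 + w2) = a *: Q w1 + Q w2.
Proof.
move=> s1 s2; apply: dform_eqP => p s; rewrite dformDE dformZE /Qop /pint.
have c1 := @continuous_pint_integrand _ _ th l cth _ p (smooth_continuous (s1 s)).
have c2 := @continuous_pint_integrand _ _ th l cth _ p (smooth_continuous (s2 s)).
rewrite -(int01Z a c1) -int01D //; last by move=> x; apply: cvgM; [exact: cvg_cst|exact: c1].
by congr int01; apply/funext => x; rewrite dformDE dformZE mulrDr mulrCA.
Qed.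

Lemma Q0 : Q 0 = 0.
Proof.
apply: dform_eqP => p s; rewrite /Qop /pint -[RHS](int01_cst (0 : R)).
by congr int01; apply/funext => x; rewrite mulr0.
Qed.

Lemma QD w1 w2 : sform w1 -> sform w2 -> Q (w1 + w2) = Q w1 + Q w2.
Proof. by move=> s1 s2; have := Q_lin 1 s1 s2; rewrite !scale1r. Qed.

Lemma QZ (a : R) w : sform w -> Q (a *: w) = a *: Q w.
Proof.
by move=> sw; have := Q_lin a sw (@sform0 _ _); rewrite Q0 !addr0.
Qed.

Lemma QB w1 w2 : sform w1 -> sform w2 -> Q (w1 - w2) = Q w1 - Q w2.
Proof.
move=> s1 s2; rewrite addrC -(scaleN1r w2) (Q_lin (-1) s2 s1).
by rewrite scaleN1r addrC.
Qed.

Lemma extd_Q w : sform w -> extd (Q w) = Q (extd w).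
Proof.
move=> sw; apply: dform_eqP => p s; elim: s w sw => [|v s IH] w sw.
  rewrite extd_nil; transitivity (Q 0 p [::]); first by rewrite Q0.
  by rewrite /Qop; congr (pint _ _ _ _); apply/funext => q; rewrite extd_nil.
rewrite extd_cons (dird_Q _ sw); transitivity (Q (dird v w) p s - Q (extd (ins v w)) p s).
  by rewrite -(IH _ (sform_ins v sw)).
have sd := sform_dird v sw; have se := sform_extd (sform_ins v sw).
transitivity (Q (dird v w - extd (ins v w)) p s); first by rewrite (QB sd se).
by rewrite -ins_extd.
Qed.

Lemma altf_Q k w : altf k w -> sform w -> altf k (Q w).
Proof.
elim: k w => [|k IH] w.
  move=> dw _ p s sk; transitivity (Q 0 p s); last by rewrite Q0.
  by rewrite /Qop; congr (pint _ _ _ _); apply/funext => q; rewrite dw.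
move=> [w0 lw iw aw] sw; split=> [p|a u v|v|v].
- transitivity (Q 0 p [::]); last by rewrite Q0.
  by rewrite /Qop; congr (pint _ _ _ _); apply/funext => q; rewrite w0.
- rewrite -[LHS]/(Q (ins (a *: u + v) w)) lw Q_lin //; exact: sform_ins.
- by rewrite -[LHS]/(Q (ins v (ins v w))) iw Q0.
- by apply: (IH (ins v w)); [exact: aw|exact: sform_ins].
Qed.

Lemma wedge_Q c w : (forall p q, c p = c q) -> sform w -> c ∧ Q w = Q (c ∧ w).
Proof.
move=> cc sw; apply: dform_eqP => p s; elim: s c w cc sw => [|v s IH] c w cc sw.
  rewrite wedge_nil; transitivity (Q (c p [::] *: w) p [::]); first by rewrite QZ.
  rewrite /Qop; congr (pint _ _ _ _); apply/funext => q.
  by rewrite wedge_nil (cc q p).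
have cs : forall p q, sgn c p = sgn c q.
  by move=> p' q'; apply/funext => s'; rewrite /sgn (cc p' q').
have ci : forall p q, ins v c p = ins v c q.
  by move=> p' q'; apply/funext => s'; rewrite /ins (cc p' q').
have sc : sform c.
  by move=> s'; rewrite (_ : (fun p => _) = fun=> c p s') ?(cc _ p); [exact: smooth_cst|
    apply/funext => q; rewrite (cc q p)].
rewrite wedge_cons (IH _ _ ci sw).
rewrite (IH _ _ cs (sform_ins v sw) : (sgn c ∧ ins v (Q w)) p s = _).
rewrite -[RHS]/(Q (ins v (c ∧ w)) p s) ins_wedge QD //.
  by apply: sform_wedge => //; exact: sform_ins.
by apply: sform_wedge; [exact: sform_sgn|exact: sform_ins].
Qed.

Lemma pullback_Q A F l' w : affine_with A F -> A l' = l ->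
  pullback F (Q w) = Qop th l' (pullback F w).
Proof.
move=> FA Al; apply: dform_eqP => p s; rewrite (pullback_affineE FA) /Qop /pint.
congr int01; apply/funext => u.
by rewrite (pullback_affineE FA) FA Al.
Qed.

End Theta.

Definition avg l := Qop (fun=> 1) l.
(** The homotopy from the identity to the average along l. The weight 1 - u is 1 at u = 0 and 0 at u
    = 1, so that integrating the Lie derivative by parts leaves average minus identity. *)
Definition hK l w := Qop (fun u : R => 1 - u) l (ins l w).

Lemma continuous_1 : continuous (fun _ : R => 1 : R).
Proof. by move=> x; exact: cvg_cst. Qed.
Lemma continuous_1B : continuous (fun s : R => 1 - s : R).
Proof. by move=> x; apply: cvgB; [exact: cvg_cst|exact: cvg_id]. Qed.
#[local] Hint Resolve continuous_1 continuous_1B : core.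

Let is_derive_along w p l s (u : R) : sform w ->
  is_derive u (1 : R) (fun u : R => w (p + u *: l) s : R) (dird l w (p + u *: l) s).
Proof.
move=> sw; exact: (@is_derive_line R V (fun q => w q s : R^o) p l u _ (smooth_is_derive (p + u *: l) l (sw s))).
Qed.

Lemma Q_dird l w : sform w -> Qop (fun u : R => 1 - u) l (dird l w) = avg l w - w.
Proof.
move=> sw; apply: dform_eqP => p s; rewrite dformDE dformNE /avg /Qop /pint.
have D u := is_derive_along p l s u sw.
pose g (u : R) : R := w (p + u *: l) s.
have cg : continuous g by exact: continuous_line (smooth_continuous (sw s)).
have [H dH] := primitive_exists cg.
have d1 (u : R) : is_derive u (1 : R) (fun u : R => 1 - u) (-1).
  by rewrite -[X in is_derive _ _ _ X]add0r; apply: is_deriveB.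
(* Integration by parts: the boundary term vanishes at u = 1 and contributes - w at u = 0. *)
have dF (u : R) : is_derive u (1 : R) (fun u : R => (1 - u) * g u + H u)
    ((1 - u) * dird l w (p + u *: l) s).
  rewrite (_ : _ * _ = (1 - u) * dird l w (p + u *: l) s + g u * -1 + g u); last first.
    by rewrite mulrN1 subrK.
  exact: (is_deriveD (is_deriveM (d1 u) (D u)) (dH u)).
have dH' (u : R) : is_derive u (1 : R) H (1 * g u) by rewrite mul1r.
rewrite (int01E dF) (int01E dH') subrr mul0r add0r subr0 mul1r /g scale0r addr0.
by rewrite opprD addrA addrAC.
Qed.

Lemma avg_dird l w : sform w -> (forall p, w (p + l) = w p) -> avg l (dird l w) = 0.
Proof.
move=> sw wl; apply: dform_eqP => p s; rewrite /avg /Qop /pint.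
have D (u : R) : is_derive u (1 : R) (fun u : R => w (p + u *: l) s : R) (1 * dird l w (p + u *: l) s).
  by rewrite mul1r; exact: is_derive_along.
by rewrite (int01E D) scale1r scale0r addr0 wl subrr.
Qed.

Lemma sform_avg l w : sform w -> sform (avg l w).
Proof. exact: sform_Q. Qed.

Lemma sform_hK l w : sform w -> sform (hK l w).
Proof. by move=> sw; apply: sform_Q => //; exact: sform_ins. Qed.

Lemma extd_hK l w : sform w -> extd w = 0 -> extd (hK l w) = avg l w - w.
Proof.
move=> sw dw; rewrite /hK extd_Q //; last exact: sform_ins.
rewrite -Q_dird //; congr Qop.
by have := ins_extd l w; rewrite dw => /esym/eqP; rewrite subr_eq add0r => /eqP ->.
Qed.

Definition avgs (ls : seq V) w := foldr avg w ls.
(** On closed forms each summand differentiates to the difference of two successive averages, and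
    the sum telescopes in [extd_hKs]. *)
Fixpoint hKs (ls : seq V) w : dform :=
  if ls is l :: ls' then hK l (avgs ls' w) + hKs ls' w else 0.

Lemma sform_avgs ls w : sform w -> sform (avgs ls w).
Proof. by move=> sw; elim: ls => [|l ls IH] //=; exact: sform_avg. Qed.

Lemma extd_avgs ls w : sform w -> extd (avgs ls w) = avgs ls (extd w).
Proof.
move=> sw; elim: ls => [|l ls IH] //=.
by rewrite {1}/avg extd_Q //; [rewrite IH|exact: sform_avgs].
Qed.

Lemma avgs_lin ls (a : R) w1 w2 : sform w1 -> sform w2 ->
  avgs ls (a *: w1 + w2) = a *: avgs ls w1 + avgs ls w2.
Proof.
move=> s1 s2; elim: ls => [|l ls IH] //=.
by rewrite IH {1}/avg Q_lin //; exact: sform_avgs.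
Qed.

Lemma avgsD ls w1 w2 : sform w1 -> sform w2 -> avgs ls (w1 + w2) = avgs ls w1 + avgs ls w2.
Proof. by move=> s1 s2; have := avgs_lin ls 1 s1 s2; rewrite !scale1r. Qed.

Lemma avgs0 ls : avgs ls 0 = 0.
Proof. by elim: ls => [|l ls IH] //=; rewrite IH /avg Q0. Qed.

Lemma avgsN ls w : sform w -> avgs ls (- w) = - avgs ls w.
Proof.
move=> sw; have := avgs_lin ls (-1) sw (@sform0 _ _).
by rewrite avgs0 !addr0 !scaleN1r.
Qed.

Lemma dird_avgs ls v w : sform w -> dird v (avgs ls w) = avgs ls (dird v w).
Proof.
move=> sw; elim: ls => [|l ls IH] //=.
by rewrite {1}/avg dird_Q //; [rewrite IH|exact: sform_avgs].
Qed.

Lemma ins_avgs ls v w : ins v (avgs ls w) = avgs ls (ins v w).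
Proof. by elim: ls => [|l ls IH] //=; rewrite -IH. Qed.

Lemma altf_avgs k ls w : altf k w -> sform w -> altf k (avgs ls w).
Proof.
by move=> aw sw; elim: ls => [|l ls IH] //=; apply: altf_Q => //; exact: sform_avgs.
Qed.

Lemma wedge_avgs ls c w : (forall p q, c p = c q) -> sform w ->
  c ∧ avgs ls w = avgs ls (c ∧ w).
Proof.
move=> cc sw; elim: ls => [|l ls IH] //=.
by rewrite {1}/avg wedge_Q //; [rewrite IH|exact: sform_avgs].
Qed.

Lemma sform_hKs ls w : sform w -> sform (hKs ls w).
Proof.
move=> sw; elim: ls => [|l ls IH] /=; first exact: sform0.
by apply: sformD => //; apply: sform_hK; exact: sform_avgs.
Qed.

Lemma altf_hKs k ls w : altf k.+1 w -> sform w -> altf k (hKs ls w).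
Proof.
move=> aw sw; elim: ls => [|l ls IH] /=; first exact: altf0.
apply: altfD => //; apply: altf_Q => //.
  by apply: altf_ins; exact: altf_avgs.
by apply: sform_ins; exact: sform_avgs.
Qed.

Lemma extd_hKs ls w : sform w -> extd w = 0 -> extd (hKs ls w) = avgs ls w - w.
Proof.
move=> sw dw; elim: ls => [|l ls IH] /=; first by rewrite extd0 subrr.
have sa := sform_avgs ls sw.
rewrite extdD; [|exact: sform_hK|exact: sform_hKs].
by rewrite IH extd_hK // ?extd_avgs // ?dw ?avgs0 // addrA subrK.
Qed.

(** In degree zero there is nothing to contract, so the homotopy is zero and with it its
    differential, average minus form. *)
Lemma avgs_deg0 ls w : altf 0 w -> sform w -> extd w = 0 -> avgs ls w = w.
Proof.
move=> aw sw dw; have := extd_hKs ls sw dw.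
have -> : hKs ls w = 0.
  elim: ls => [|l ls IH] //=; rewrite IH addr0 /hK.
  by rewrite (ofdeg0_ins _ (altf_avgs ls aw sw)) Q0.
by rewrite extd0 => /esym/eqP; rewrite subr_eq0 => /eqP.
Qed.

(* [hKs] contracts with vectors [l] on which [c] vanishes. *)
Lemma wedge_hKs c ls w : ofdeg 1 c -> (forall p q, c p = c q) ->
  (forall l, l \in ls -> ins l c = 0) -> sform w -> c ∧ w = 0 -> c ∧ hKs ls w = 0.
Proof.
move=> dc cc + sw cw; elim: ls => [|l ls IH] H /=; first by rewrite wedge0r.
rewrite wedgeDr IH ?addr0 => [|l' l'ls]; last by apply: H; rewrite inE l'ls orbT.
have sa := sform_avgs ls sw.
rewrite /hK wedge_Q //; last exact: sform_ins.
suff -> : c ∧ ins l (avgs ls w) = 0 by rewrite Q0.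
have : ins l (c ∧ avgs ls w) = 0 by rewrite wedge_avgs // cw avgs0.
rewrite ins_wedge H ?inE ?eqxx // wedge0l add0r (ofdeg_sgn dc) expr1 scaleN1r wedgeNl.
by move/eqP; rewrite oppr_eq0 => /eqP.
Qed.

End Qop.

(** * Lattices, straightened coordinates and invariant forms *)

Section Lattice.
Variable R : realType.
Implicit Types (L : set 'rV[R]_5).

Definition spans (ls : seq 'rV[R]_5) := forall P : set 'rV[R]_5, subsp P ->
  (forall l, l \in ls -> P l) -> forall v, P v.

Lemma coord_le_norm (v : 'rV[R]_5) j : `|v 0 j| <= `|v|.
Proof.
rewrite /Num.norm /= mx_normrE; apply: le_trans (le_bigmax _ _ (0, j)) => //=.
Qed.

(* Lattice vectors close to large multiples of the unit vectors form a strictly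
   diagonally dominant matrix. *)
Lemma lattice_spans L : is_lattice L -> exists2 ls, (forall l, l \in ls -> L l) & spans ls.
Proof.
move=> [_ _ [C cC HC]].
have [M M0 HM] : exists2 M : R, 0 <= M & forall x, C x -> `|x| <= M.
  have [N [_ HN]] := compact_bounded cC.
  exists (`|N| + 1) => [|x Cx]; first by rewrite addr_ge0.
  by apply: HN Cx; rewrite (le_lt_trans (ler_norm N)) // ltrDl.
(* Each T e_i is within M of a lattice vector. At the largest coordinate v_j of a kernel vector this
   gives T |v_j| <= 5 M |v_j|, so T > 5 M leaves only v = 0. *)
pose T := 5 * M + 1.
have E (i : 'I_5) : {l | L l & C (T *: delta_mx 0 i - l)} by apply: cid2; exact: HC.
pose l i := s2val (E i); pose P := \matrix_(i < 5) l i.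
have Pij i j : `|T *+ (i == j) - P i j| <= M.
  apply: le_trans (HM _ (s2valP' (E i))).
  apply: le_trans (coord_le_norm _ j).
  by rewrite !mxE eqxx /= eq_sym mulr_natr.
have Pfree (v : 'rV[R]_5) : v *m P = 0 -> v = 0.
  move=> vP; apply: contrapT => v0.
  have [j _ Hj] : exists2 j, true & forall i, `|v 0 i| <= `|v 0 j|.
    have [j _ Hj] := @Order.TotalTheory.arg_maxP _ _ _ ord0 predT (fun j => `|v 0 j|) isT.
    by exists j => // i; exact: Hj.
  have vj : 0 < `|v 0 j|.
    rewrite lt_neqAle normr_ge0 andbT eq_sym; apply/eqP => vj; apply: v0.
    apply/rowP => i; rewrite mxE; apply/eqP; rewrite -normr_le0 -vj; exact: Hj.
  have : T * v 0 j = \sum_i v 0 i * (T *+ (i == j) - P i j).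
    under eq_bigr do rewrite mulrBr.
    rewrite sumrB; have /rowP/(_ j) := vP; rewrite !mxE => ->; rewrite subr0.
    rewrite (bigD1 j) //= eqxx mulr1n big1 ?addr0 1?mulrC // => i /negbTE ->.
    by rewrite mulr0n mulr0.
  move/(congr1 Num.norm); rewrite normrM.
  have T0 : 0 <= T by rewrite /T addr_ge0 // mulr_ge0.
  rewrite (ger0_norm T0) => H.
  have : T * `|v 0 j| <= 5 * M * `|v 0 j|.
    rewrite H; apply: le_trans (ler_norm_sum _ _ _) _.
    apply: (@le_trans _ _ (\sum_(i < 5) `|v 0 j| * M)).
      by apply: ler_sum => i _; rewrite normrM ler_pM.
    by rewrite sumr_const card_ord -[X in X <= _]mulr_natl mulrA mulrAC.
  by rewrite ler_pM2r // /T gerDl ler10.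
have Pu : P \in unitmx.
  rewrite -row_free_unit -kermx_eq0; apply/eqP/row_matrixP => i.
  rewrite row0; apply: Pfree; rewrite -row_mul mulmx_ker row0.
  by [].
exists [seq l i | i <- enum 'I_5] => [x /mapP[i _ ->]|Q sQ HQ v]; first exact: (s2valP (E i)).
rewrite -(mulmxKV Pu v) mulmx_sum_row; apply: subsp_sum => // i _.
apply: subspZ => //; rewrite rowK; apply: HQ.
by apply: map_f; rewrite mem_enum.
Qed.

End Lattice.

Section Fiber.
Variables (R : realType) (B : 'M[R]_5).
Local Notation G := (Gtype R).
Local Notation dform := (dform G).
Local Notation phi := (phi B).
Implicit Types (w : dform) (p q v : G) (s : seq G) (l : 'rV[R]_5) (ls : seq 'rV[R]_5).

Definition fb l : G := (0, l).
(** Right multiplication by (u, 0), seen in the straightened coordinates of [Psi]; [tl u] is its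
    linear part. *)
Definition tau (u : R) p : G := (p.1 + u, p.2 *m phi (- u)).
Definition tl (u : R) v : G := (v.1, v.2 *m phi (- u)).

Lemma fb_comb (a : R) l l' : fb (a *: l + l') = a *: fb l + fb l'.
Proof. by rewrite /fb; congr pair; rewrite /= scaler0 addr0. Qed.

Lemma tl_comb u (a : R) v v' : tl u (a *: v + v') = a *: tl u v + tl u v'.
Proof. by rewrite /tl; congr pair; rewrite /= mulmxDl -scalemxAl. Qed.

Lemma tau_affine u : affine_with (tl u) (tau u).
Proof.
move=> p v h; rewrite /tau /tl; congr pair; rewrite /=; first by rewrite addrAC.
by rewrite mulmxDl -scalemxAl.
Qed.

Lemma fst_fb p (h : R) l : (p + h *: fb l).1 = p.1.
Proof. by rewrite /= [_ *: _]mulr0 addr0. Qed.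

Lemma tl_fb u l : tl u (fb l) = fb (l *m phi (- u)). Proof. by []. Qed.

Lemma phi_N a b : phi (- (a + b)) = phi (- a) *m phi (- b).
Proof. by rewrite opprD phiD. Qed.

Lemma pullback_tauE u w p s : pullback (tau u) w p s = w (tau u p) (map (tl u) s).
Proof. exact: pullback_affineE (tau_affine u) _ _ _. Qed.

Lemma pullback_tau a b w : pullback (tau a) (pullback (tau b) w) = pullback (tau (a + b)) w.
Proof.
apply: dform_eqP => p s; rewrite (pullback_tauE a) (pullback_tauE b) (pullback_tauE (a + b)) -map_comp.
rewrite (_ : tau b (tau a p) = tau (a + b) p); last first.
  by rewrite /tau phi_N mulmxA addrA.
congr (w _ _); apply: eq_map => v; rewrite /comp /tl phi_N mulmxA.
by [].
Qed.

Lemma pullback_tau0 w : pullback (tau 0) w = w.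
Proof.
apply: dform_eqP => p s; rewrite pullback_tauE /tau oppr0 phi0 mulmx1 addr0.
rewrite -surjective_pairing (_ : map _ s = s) //; apply: map_id_in => v _.
by rewrite /tl oppr0 phi0 mulmx1 -surjective_pairing.
Qed.

Lemma smooth_lin (xi : G -> R) : (forall (a : R) u v, xi (a *: u + v) = a * xi u + xi v) ->
  smooth (xi : G -> R^o).
Proof.
move=> lxi.
have xi0 : xi 0 = 0 by have := lxi (-1) 0 0; rewrite scaler0 addr0 mulN1r addNr.
have xiE v : xi v = \sum_i gc i v * xi (gb R i).
  rewrite {1}(g_decomp v); elim: index_enum => [|i r IH]; first by rewrite !big_nil xi0.
  by rewrite !big_cons lxi IH.
have -> : xi = (fun v => \sum_i gc i v * xi (gb R i)) by apply/funext.
by apply: smooth_sum => i _; apply: smoothM; [exact: smooth_gc|exact: smooth_cst].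
Qed.

Lemma smooth_affine A F i : affine_with A F ->
  (forall (a : R) u v, A (a *: u + v) = a *: A u + A v) ->
  smooth (fun p : G => gc i (F p) : R^o).
Proof.
move=> FA lA.
have -> : (fun p : G => gc i (F p)) = (fun p => gc i (F 0) + gc i (A p)).
  by apply/funext => p; rewrite -gcD; have := FA 0 p 1; rewrite !scale1r add0r => ->.
apply: smoothD; first exact: smooth_cst.
by apply: (@smooth_lin (fun p => gc i (A p))) => a u v; rewrite lA gcD gcZ.
Qed.

Lemma pullback_affine_form A F k w : affine_with A F ->
  (forall (a : R) u v, A (a *: u + v) = a *: A u + A v) -> altf k w -> sform w ->
  [/\ altf k (pullback F w), sform (pullback F w) & extd (pullback F w) = pullback F (extd w)].
Proof.
by move=> FA lA; apply: pullback_form_extd => i; exact: smooth_affine FA lA.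
Qed.

Lemma tau_form u k w : altf k w -> sform w ->
  [/\ altf k (pullback (tau u) w), sform (pullback (tau u) w) &
      extd (pullback (tau u) w) = pullback (tau u) (extd w)].
Proof. by apply: pullback_affine_form (tau_affine u) _ => a v v'; exact: tl_comb. Qed.

Definition yconst w := forall p q, p.1 = q.1 -> w p = w q.

Section Invariant.
Variables (tbar : R) (L : set 'rV[R]_5).

Definition Linv w := forall l, L l -> forall p, w (p + fb l) = w p.
Definition Oinv w := Linv w /\ pullback (tau tbar) w = w.

Definition Tc (c : G) p : G := tau c.1 (p + fb c.2).
Definition Om : dgdata R := @deRham R G [set Tc c | c in Gamma tbar L].

Lemma Tc_affine c : affine_with (tl c.1) (Tc c).
Proof. by move=> p v h; rewrite /Tc addrAC tau_affine. Qed.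

Lemma Oinv_tau w (n : int) : Oinv w -> pullback (tau (tbar *~ n)) w = w.
Proof.
move=> [_ tw].
have H (m : nat) : pullback (tau (tbar *+ m)) w = w.
  elim: m => [|m IH]; first by rewrite mulr0n pullback_tau0.
  by rewrite mulrSr -pullback_tau tw.
case: n => m; first exact: H.
rewrite NegzE mulrNz; rewrite -{1}(H m.+1) pullback_tau addNr.
exact: pullback_tau0.
Qed.

Lemma Tc_pullback c w : pullback (Tc c) w =
  fun p s => pullback (tau c.1) w (p + fb c.2) s.
Proof.
by apply: dform_eqP => p s; rewrite (pullback_affineE (Tc_affine c)) pullback_tauE.
Qed.

Hypothesis L0 : L 0.

(** Gamma is generated by the translations in L and one turn of the monodromy, whose powers are the
    maps [tau] at integer multiples of tbar; invariance is tested on these. *)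
Lemma Om_homP k w : @dghom R Om k w <-> [/\ altf k w, sform w & Oinv w].
Proof.
rewrite /Om /deRham /mkset /=; split=> [[/is_formP[aw sw] H]|[aw sw iw]].
  split=> //; split=> [l Ll p|].
    have /(congr1 (fun f : dform => f p)) : pullback (Tc (fb l)) w = w.
      by apply: H; exists (fb l) => //; split=> //; exists 0; rewrite mulr0z.
    by rewrite Tc_pullback pullback_tau0.
  have <- : pullback (Tc (tbar, 0)) w = pullback (tau tbar) w.
    by rewrite Tc_pullback; apply/funext => p; rewrite /= [fb 0]/(0 : G) addr0.
  by apply: H; exists (tbar, 0) => //; split=> //; exists 1; rewrite mulr1z.
split; first exact/is_formP.
move=> _ [c [[n cn] Lc] <-]; rewrite Tc_pullback cn (Oinv_tau _ iw).
by apply/funext => p; case: iw => iw _; rewrite iw.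
Qed.

Lemma Linv_ins v w : Linv w -> Linv (ins v w).
Proof. by move=> iw l Ll p; rewrite /ins (iw l Ll). Qed.

Lemma Linv_comb (a : R) w1 w2 : Linv w1 -> Linv w2 -> Linv (a *: w1 + w2).
Proof. by move=> i1 i2 l Ll p; apply/funext => s; rewrite !dformE i1 // i2. Qed.

Lemma Linv_Q th (l' : G) w : Linv w -> Linv (Qop th l' w).
Proof.
move=> iw l Ll p; apply/funext => s; rewrite /Qop /pint; congr int01; apply/funext => u.
by rewrite addrAC iw.
Qed.

Lemma Linv_avgs ls w : Linv w -> Linv (avgs (map fb ls) w).
Proof. by move=> iw; elim: ls => [|l ls IH]; [exact: iw|exact: (@Linv_Q (fun=> 1) (fb l) _ IH)]. Qed.

Lemma Linv_hKs ls w : Linv w -> Linv (hKs (map fb ls) w).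
Proof.
move=> iw; elim: ls => [|l ls IH]; first by [].
have H := @Linv_Q (fun u => 1 - u) (fb l) _ (Linv_ins (fb l) (Linv_avgs ls iw)).
by have := Linv_comb 1 H IH; rewrite scale1r.
Qed.

Lemma yconst_dird w l : yconst w -> dird (fb l) w = 0.
Proof.
move=> yw; apply: dform_eqP => p s; rewrite /dird.
have H : is_derive p (fb l) (fun q => w q s : R^o) 0.
  apply/is_deriveP => e e0; exists 1 => // h h0 _.
  by rewrite (yw _ _ (fst_fb p h l)) subrr mulr0 subrr normr0 ltW.
exact: (derive_val (is_derive := H)).
Qed.

Lemma yconst_of_dird w : sform w -> (forall l, dird (fb l) w = 0) -> yconst w.
Proof.
move=> sw H p q pq; apply/funext => s.
have E : q = p + fb (q.2 - p.2).
  by rewrite /fb; case: p q pq => [t y] [t' y'] /= ->; congr pair; rewrite /= ?addr0 // addrC subrK.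
have [c _] := @MVT_line R _ (fun q => w q s : R^o) p (fb (q.2 - p.2))
  (fun q' => smooth_derivable (p := q') (v := fb (q.2 - p.2)) (sw s)).
rewrite -E => Hc; apply/esym/eqP; rewrite -subr_eq0; apply/eqP.
apply: (etrans Hc).
exact: (congr1 (fun f : dform => f (p + c *: fb (q.2 - p.2)) s) (H (q.2 - p.2))).
Qed.

Lemma avgs_yconst ls w : yconst w -> avgs (map fb ls) w = w.
Proof.
move=> yw; elim: ls => [|l ls IH] //=; rewrite IH.
apply: dform_eqP => p s; rewrite /avg /Qop /pint -[RHS]int01_cst; congr int01.
by apply/funext => u; rewrite mul1r (yw _ _ (fst_fb p u l)).
Qed.

Lemma dird_avgs0 ls w l : (forall l, l \in ls -> L l) -> sform w -> Linv w -> l \in ls ->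
  dird (fb l) (avgs (map fb ls) w) = 0.
Proof.
move=> + sw iw; elim: ls => [|l' ls IH] // H; rewrite inE => /orP[/eqP->|lls].
  rewrite /= {1}/avg dird_Q //; [|exact: continuous_1|exact: sform_avgs].
  apply: avg_dird; first exact: sform_avgs.
  by apply: Linv_avgs => //; apply: H; rewrite inE eqxx.
rewrite /= {1}/avg dird_Q //; [|exact: continuous_1|exact: sform_avgs].
rewrite IH ?Q0 // => x xls; apply: H.
by rewrite inE xls orbT.
Qed.

(** Averaging an L-periodic form along l in L kills its derivative along l; the vectors of the
    family span, so every fibre derivative vanishes. *)
Lemma yconst_avgs ls w : (forall l, l \in ls -> L l) -> spans ls -> sform w -> Linv w ->
  yconst (avgs (map fb ls) w).
Proof.
move=> lsL sp sw iw; have sa := sform_avgs (map fb ls) sw.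
apply: yconst_of_dird => //; apply: sp => [|l lls]; last exact: dird_avgs0.
split=> [|a l l' d d'].
  apply: dform_eqP => p s; rewrite /dird [fb 0]/(0 : G).
  exact: (derive_val (is_derive := is_derive0 _ _)).
rewrite fb_comb; apply: dform_eqP => p s; rewrite /dird.
apply: (etrans (smooth_derive_lin p a (fb l) (fb l') (sa s))).
have E := congr1 (fun f : dform => f p s) d; have E' := congr1 (fun f : dform => f p s) d'.
by apply: (etrans (congr2 (fun x y => a * x + y) E E')); rewrite !dform0E mulr0 addr0.
Qed.

Lemma avgs_avgs ls ls' w : (forall l, l \in ls -> L l) ->
  (forall l, l \in ls' -> L l) -> spans ls' -> sform w -> Linv w ->
  avgs (map fb ls') (avgs (map fb ls) w) = avgs (map fb ls') w.
Proof.
move=> + lsL' sp' sw iw; elim: ls => [|l ls IH] //= lsL.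
have lsL2 x : x \in ls -> L x by move=> xls; apply: lsL; rewrite inE xls orbT.
rewrite -IH //; set W := avgs _ w.
have sW : sform W by exact: sform_avgs.
have iW : Linv W by exact: Linv_avgs.
have cB := @continuous_1B R.
have sQ := sform_Q (fb l) cB sW.
(* One more average changes W by a fibre derivative of an L-periodic form, which the second family
   averages to zero. *)
have -> : avg (fb l) W = dird (fb l) (Qop (fun u => 1 - u) (fb l) W) + W.
  by rewrite dird_Q // Q_dird // subrK.
rewrite avgsD //; last exact: sform_dird.
rewrite -dird_avgs // yconst_dird ?add0r //.
exact: (yconst_avgs lsL' sp' sQ (@Linv_Q (fun u => 1 - u) (fb l) _ iW)).
Qed.

(** The monodromy carries the averaging vectors to other lattice vectors ([pullback_avgs]);
    independence of the family makes the average of an invariant form invariant. *)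
Lemma avgs_indep ls ls' w : (forall l, l \in ls -> L l) -> spans ls ->
  (forall l, l \in ls' -> L l) -> spans ls' -> sform w -> Linv w ->
  avgs (map fb ls') w = avgs (map fb ls) w.
Proof.
move=> lsL sp lsL' sp' sw iw; rewrite -(@avgs_avgs ls ls') //.
by apply: avgs_yconst; exact: yconst_avgs.
Qed.

Hypothesis Lflow : flow B tbar @` L = L.

Lemma L_phi l : L l -> L (l *m phi tbar).
Proof. by move=> Ll; rewrite -Lflow; exists l. Qed.

Lemma L_phiN l : L l -> L (l *m phi (- tbar)).
Proof. by rewrite -{1}Lflow => -[l' Ll' <-]; rewrite -mulmxA phiVN mulmx1. Qed.

Lemma pullback_avgs ls w : pullback (tau tbar) (avgs (map fb ls) w) =
  avgs (map fb [seq l *m phi tbar | l <- ls]) (pullback (tau tbar) w).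
Proof.
elim: ls => [|l ls IH] //=; rewrite -IH /avg.
apply: pullback_Q (tau_affine tbar) _.
by rewrite tl_fb -mulmxA phiVN mulmx1.
Qed.

Lemma Oinv_avgs ls w : (forall l, l \in ls -> L l) -> spans ls -> sform w -> Oinv w ->
  Oinv (avgs (map fb ls) w).
Proof.
move=> lsL sp sw [iw tw]; split; first exact: Linv_avgs.
rewrite pullback_avgs tw; apply: avgs_indep => // [l /mapP[l' l'ls ->]|P sP HP v].
  by apply: L_phi; exact: lsL.
suff H : P (v *m phi (- tbar) *m phi tbar) by move: H; rewrite -mulmxA phiNV mulmx1.
have H := sp [set v | P (v *m phi tbar)].
apply: H => [|l lls]; last by apply: HP; exact: map_f.
split=> [|a x y Px Py]; first by rewrite /mkset mul0mx; case: sP.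
by rewrite /mkset mulmxDl -scalemxAl; case: sP => _; apply.
Qed.

End Invariant.
End Fiber.

(** * A smooth step function and periodization in t *)

Section SmoothStep.
Variable R : realType.
Local Notation G := (Gtype R).

(** x^-n exp(-1/x), continued by 0. The span of this family in n is closed under differentiation,
    which gives smoothness at 0. *)
Definition flatg n (x : R) : R := if 0 < x then x^-1 ^+ n * expR (- x^-1) else 0.

(** With 1/x = (n + 1) z this is z^(n+1) <= exp(z)^(n+1). *)
Lemma flatg_bound n (x : R) : 0 < x -> x^-1 ^+ n * expR (- x^-1) <= n.+1%:R ^+ n.+1 * x.
Proof.
move=> x0; set y := x^-1; have y0 : 0 < y by rewrite invr_gt0.
have xy : x = y^-1 by rewrite /y invrK.
rewrite expRN ler_pdivrMr ?expR_gt0 // xy.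
rewrite mulrAC ler_pdivlMr // -exprSr.
have -> : y = n.+1%:R * (y / n.+1%:R) by rewrite mulrC divfK // pnatr_eq0.
rewrite exprMn; set z := y / _; rewrite ler_wpM2l ?exprn_ge0 //.
rewrite expRM_natl lerXn2r ?nnegrE ?expR_ge0 //; first by rewrite divr_ge0 // ltW.
by apply: le_trans (expR_ge1Dx z); rewrite lerDr.
Qed.

Lemma flatg_small n (x : R) : `|flatg n x| <= n.+1%:R ^+ n.+1 * `|x|.
Proof.
rewrite /flatg; case: ifP => [x0|_]; last by rewrite normr0 mulr_ge0 // exprn_ge0.
rewrite ger0_norm; first by rewrite (ger0_norm (ltW x0)) flatg_bound.
by rewrite mulr_ge0 ?expR_ge0 // exprn_ge0 // invr_ge0 ltW.
Qed.

Lemma flatg_derive n (x : R) :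
  is_derive x (1 : R) (flatg n) (- n%:R * flatg n.+1 x + flatg n.+2 x).
Proof.
have [x0|x0|x0] := ltgtP x 0.
- have -> : - n%:R * flatg n.+1 x + flatg n.+2 x = 0.
    by rewrite /flatg ltNge ltW // mulr0 addr0.
  apply: (@near_eq_is_derive _ R^o R^o (fun=> 0)).
  near=> y; rewrite /flatg (_ : (0 < y) = false) //.
  by apply/negbTE; rewrite -leNgt ltW //; near: y; exact: lt_nbhsl.
- pose i (y : R) := y^-1.
  have dV : is_derive x (1 : R) i (- (x ^- 2) *: (1 : R)).
    by apply: (@is_deriveV R id); rewrite ?gt_eqF.
  have dE := is_derive1_comp (f := expR) (g := - i) (is_derive_expR ((- i) x)) (is_deriveN dV).
  have dM := is_deriveM (is_deriveX n dV) dE.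
  apply: (@near_eq_is_derive _ _ _ (i ^+ n * (expR \o (- i)))).
    near=> y; rewrite /flatg ifT; last by near: y; exact: lt_nbhsr.
    by rewrite -[LHS]/((i ^+ n) y * expR (- i y)) exprfctE.
  rewrite (_ : _ + _ = (i ^+ n) x *: (expR (- i x) * - (- x ^- 2 *: (1 : R))) +
     (expR \o - i) x *: ((n%:R * i x ^+ n.-1) *: (- x ^- 2 *: (1 : R)))) //.
  rewrite /flatg x0 /GRing.scale /= fctE -exprVn -/(i x).
  case: n {dM} => [|n] /=; last by rewrite !exprS expr0; ring.
  by rewrite !exprS !expr0; ring.
- rewrite x0 /flatg ltxx mulr0 addr0 -/(flatg n).
  apply/(@is_deriveP R R^o) => e e0; set M := n.+2%:R ^+ n.+2 : R.
  have M0 : 0 < M by rewrite exprn_gt0.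
  exists (e / M); first by rewrite divr_gt0.
  move=> h h0 he; rewrite add0r [_ *: _]mulr1 subr0.
  have -> : h^-1 * (flatg n h - flatg n 0) = flatg n.+1 h.
    rewrite /flatg ltxx subr0; case: ifP => _; last by rewrite mulr0.
    by rewrite mulrA exprS.
  apply: le_trans (flatg_small _ _) _; rewrite -/M mulrC -ler_pdivlMr //.
  exact: ltW.
Unshelve. all: by end_near. Qed.

Inductive flat : (R -> R) -> Prop :=
| flat_gen n : flat (flatg n)
| flat_comb a f g : flat f -> flat g -> flat (fun x => a * f x + g x).

Lemma flat_derive f : flat f -> exists2 g, flat g & forall x : R, is_derive x (1 : R) f (g x).
Proof.
elim=> {f} [n|a f g _ [f' ff df] _ [g' fg dg]].
  exists (fun x => - n%:R * flatg n.+1 x + flatg n.+2 x); last exact: flatg_derive.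
  by apply: flat_comb; exact: flat_gen.
exists (fun x => a * f' x + g' x); first exact: flat_comb.
by move=> x; apply: is_deriveD; exact: (is_deriveZ a (df x)).
Qed.

Lemma smooth_flat f (a b : R) : flat f -> smooth (fun p : G => f (a * p.1 + b) : R^o).
Proof.
move=> ff; apply: (@smooth_coind _ _ (fun h => exists c, exists2 f, flat f &
   h = fun p : G => c * f (a * p.1 + b))); last first.
  by exists 1, f => //; apply/funext => p; rewrite mul1r.
move=> _ [c [{ff}f ff ->]]; have [f' ff' df] := flat_derive ff.
have D (p v : G) : is_derive p v (fun p : G => c * f (a * p.1 + b) : R^o)
    (c * (v.1 * (f' (a * p.1 + b) * a))).
  apply: (@is_deriveZ _ _ _ _ c); apply: (@is_derive_fst R (fun t => f (a * t + b))).
  have dl : is_derive p.1 (1 : R) (fun t : R => a * t + b) a.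
    rewrite -[X in is_derive _ _ _ X]addr0; apply: is_deriveD.
    by rewrite -[X in is_derive _ _ _ X]mulr1; exact: is_deriveZ.
  exact: (is_derive1_comp (f := f) (g := fun t => a * t + b) (df _) dl).
split=> [p|v].
  apply: cvgM; first exact: cvg_cst.
  apply: (@continuous_comp _ _ _ (fun p : G => a * p.1 + b) f).
    by apply: cvgD; [apply: cvgM; [exact: cvg_cst|exact: cvg_fst]|exact: cvg_cst].
  apply/differentiable_continuous/derivable1_diffP.
  by case: (df (a * p.1 + b)).
exists (fun p => c * v.1 * a * f' (a * p.1 + b)); first by exists (c * v.1 * a), f'.
by move=> p; apply: (is_derive_eq (D p v)); ring.
Qed.

Definition step (x : R) : R := flatg 0 x / (flatg 0 x + flatg 0 (1 - x)).

Lemma flatg0_ge0 x : 0 <= flatg 0 x.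
Proof. by rewrite /flatg; case: ifP => // _; rewrite mul1r expR_ge0. Qed.

Lemma step_den x : 0 < flatg 0 x + flatg 0 (1 - x).
Proof.
have gt0 y : 0 < y -> 0 < flatg 0 y by rewrite /flatg => ->; rewrite mul1r expR_gt0.
have [x0|x0] := ltP 0 x; first by rewrite ltr_pwDl ?gt0 // flatg0_ge0.
by rewrite ltr_wpDl ?flatg0_ge0 // gt0 // subr_gt0 (le_lt_trans x0).
Qed.

Lemma step0 x : x <= 0 -> step x = 0.
Proof. by move=> x0; rewrite /step {1}/flatg ltNge x0 mul0r. Qed.

Lemma step1 x : 1 <= x -> step x = 1.
Proof.
move=> x1; have := step_den x; rewrite /step.
have -> : flatg 0 (1 - x) = 0 by rewrite /flatg subr_gt0 ltNge x1.
by rewrite addr0 => /gt_eqF h; rewrite divff // h.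
Qed.

Lemma smooth_step (a b : R) : smooth (fun p : G => step (a * p.1 + b) : R^o).
Proof.
have s1 := smooth_flat a b (flat_gen 0).
have s2 := smooth_flat (- a) (1 - b) (flat_gen 0).
apply: smoothM => //.
apply: (@smoothV _ _ (fun p : G => flatg 0 (a * p.1 + b) + flatg 0 (1 - (a * p.1 + b)))).
  by move=> p; rewrite gt_eqF // step_den.
apply: smoothD => //.
by have -> : (fun p : G => flatg 0 (1 - (a * p.1 + b))) =
   (fun p : G => flatg 0 (- a * p.1 + (1 - b)));
  [apply/funext => p; congr flatg; ring|].
Qed.

End SmoothStep.

Section Locality.
Variables (R : realType) (V : normedModType R).
Local Notation dform := (dform V).
Implicit Types (w : dform) (p v : V) (s : seq V).

Lemma extd_local w w' p : (\forall q \near p, w q = w' q) -> forall s, extd w p s = extd w' p s.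
Proof.
move=> ww' s; elim: s w w' ww' => [|v s IH] w w' ww'; first by rewrite !extd_nil.
rewrite !extd_cons (IH (ins v w) (ins v w')); last first.
  by apply: filterS ww' => q E; rewrite /ins E.
congr (_ - _); apply: (@near_eq_derive _ _ _ (fun q => w q s : R^o) (fun q => w' q s : R^o)).
by apply: filterS ww' => q E; rewrite E.
Qed.

Lemma fun0_wedge (r : V -> R) w p s :
  ((fun p s => if s is [::] then r p else 0) ∧ w) p s = r p * w p s.
Proof.
elim: s w => [|v s IH] w; first by rewrite wedge_nil.
rewrite wedge_cons (_ : ins v _ = 0) ?wedge0l ?add0r; last by apply: dform_eqP.
rewrite (_ : sgn _ = (fun p s => if s is [::] then r p else 0)) ?IH //.
apply: dform_eqP => q [|u t]; rewrite /sgn /=; first by rewrite expr0 mul1r.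
by rewrite mulr0.
Qed.

Lemma form_sum I (r : seq I) (F : I -> dform) k :
  (forall i, altf k (F i) /\ sform (F i)) ->
  [/\ altf k (\sum_(i <- r) F i), sform (\sum_(i <- r) F i) &
      extd (\sum_(i <- r) F i) = \sum_(i <- r) extd (F i)].
Proof.
move=> H; elim: r => [|i r [a1 s1 e1]].
  by rewrite !big_nil extd0; split=> //; [exact: altf0|exact: sform0].
have [a2 s2] := H i; rewrite !big_cons extdD // e1.
by split; [exact: altfD|exact: sformD|].
Qed.

Lemma sum_dformE I (r : seq I) (F : I -> dform) p s :
  (\sum_(i <- r) F i) p s = \sum_(i <- r) F i p s.
Proof. by elim: r => [|i r IH]; rewrite ?big_nil // !big_cons dformDE IH. Qed.

End Locality.

Section Periodize.
Variables (R : realType) (B : 'M[R]_5) (tbar : R) (L : set 'rV[R]_5).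
Hypotheses (tbar0 : tbar != 0).
Local Notation G := (Gtype R).
Local Notation dform := (dform G).
Local Notation pt u := (pullback (tau B u)).
Implicit Types (w f : dform) (p q v : G) (s : seq G).

(** The sum of the translates of f by -M, ..., M periods. *)
Definition tsum M f : dform :=
  \sum_(i < M.+1) pt (tbar * i%:R) f + \sum_(i < M) pt (- (tbar * i.+1%:R)) f.

Definition suppf f := forall p, 1 < `|p.1 / tbar| -> f p = (fun=> 0).

(** Exceeds |t / tbar| + 1, so translates by that many periods or more vanish at p when f is
    supported in |t| <= |tbar|. The full sum over all periods is thus finite at each point. *)
Definition NN p := (Num.truncn `|p.1 / tbar|).+2.

Definition periodize f : dform := fun p => tsum (NN p) f p.

Lemma NN_gt p : `|p.1 / tbar| + 1 < (NN p)%:R.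
Proof. by rewrite -[(NN p)%:R]natr1 ltrD2r truncnS_gt. Qed.

Lemma pt_vanish f (c : R) p s : suppf f -> (NN p)%:R <= `|c| -> pt (tbar * c) f p s = 0.
Proof.
move=> sf Nc; rewrite pullback_tauE sf // /tau /= mulrDl [tbar * c]mulrC mulfK //.
have := lt_le_trans (NN_gt p) Nc; rewrite -ltrBrDl => H; apply: lt_le_trans H _.
by rewrite lerBlDr; have := ler_normB (p.1 / tbar + c) (p.1 / tbar); rewrite addrAC subrr add0r.
Qed.

Lemma tsumE M f p s : tsum M f p s =
  \sum_(i < M.+1) pt (tbar * i%:R) f p s + \sum_(i < M) pt (- (tbar * i.+1%:R)) f p s.
Proof. exact: (congr2 +%R (sum_dformE _ _ _ _) (sum_dformE _ _ _ _)). Qed.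

Lemma tsumS M f : tsum M.+1 f =
  tsum M f + pt (tbar * M.+1%:R) f + pt (- (tbar * M.+1%:R)) f.
Proof.
rewrite /tsum big_ord_recr [X in _ + X]big_ord_recr /=.
by rewrite -!addrA; congr (_ + _); rewrite addrCA.
Qed.

Lemma perE f M p s : suppf f -> (NN p <= M)%N -> periodize f p s = tsum M f p s.
Proof.
move=> sf; elim: M => [|M IH]; first by rewrite leqn0.
rewrite leq_eqVlt => /orP[/eqP <-//|]; rewrite ltnS => NM.
rewrite (IH NM) tsumS !dformDE -mulrN.
rewrite (pt_vanish s sf (c := M.+1%:R)) ?(pt_vanish s sf (c := - M.+1%:R)) ?addr0 //.
  by rewrite normrN ger0_norm // ler_nat ltnW.
by rewrite ger0_norm // ler_nat ltnW.
Qed.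

Lemma near_NN p : \forall q \near p, (NN q <= (NN p).+1)%N.
Proof.
have C : {for p, continuous (fun q : G => q.1 / tbar : R^o)}.
  by apply: cvgM; [exact: cvg_fst|exact: cvg_cst].
move/cvgrPdist_lt: C => /(_ 1 ltr01); apply: filterS => q Hq.
rewrite /NN !ltnS truncn_le_nat.
have H2 := truncnS_gt `|p.1 / tbar|.
rewrite -[X in _ < X]natr1.
apply: le_lt_trans (_ : _ <= `|p.1 / tbar| + 1) _; last by rewrite ltrD2r.
have := ler_normB (p.1 / tbar) (p.1 / tbar - q.1 / tbar); rewrite opprB addrC subrK => H.
by apply: le_trans H _; rewrite lerD2l ltW.
Qed.

Lemma per_near f p : suppf f -> \forall q \near p, periodize f q = tsum (NN p).+1 f q.
Proof.
by move=> sf; apply: filterS (near_NN p) => q Nq; apply/funext => s; exact: perE.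
Qed.

Lemma tsum_form k f M : altf k f -> sform f ->
  [/\ altf k (tsum M f), sform (tsum M f) & extd (tsum M f) = tsum M (extd f)].
Proof.
move=> af sf.
have H u : altf k (pt u f) /\ sform (pt u f) by have [] := tau_form B u af sf.
have He u : extd (pt u f) = pt u (extd f) by have [] := tau_form B u af sf.
have [a1 s1 e1] := form_sum (index_enum 'I_M.+1) (fun i => H (tbar * (i : nat)%:R)).
have [a2 s2 e2] := form_sum (index_enum 'I_M) (fun i : 'I_M => H (- (tbar * i.+1%:R))).
split; [exact: altfD|exact: sformD|].
by rewrite /tsum (extdD s1 s2) e1 e2; congr (_ + _); apply: eq_bigr => i _; exact: He.
Qed.

Lemma suppf_extd f : suppf f -> suppf (extd f).
Proof.
move=> sf p px; apply/funext => s; rewrite (@extd_local _ _ f 0) ?extd0 //.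
have C : {for p, continuous (fun q : G => `|q.1 / tbar| : R^o)}.
  apply: (continuous_comp (g := fun x : R => `|x|)); last exact: norm_continuous.
  by apply: cvgM; [exact: cvg_fst|exact: cvg_cst].
have H : \forall q \near p, 1 < `|q.1 / tbar| := C _ (lt_nbhsr px).
by apply: filterS H => q qx; rewrite sf.
Qed.

Lemma per_form k f : suppf f -> altf k f -> sform f ->
  [/\ altf k (periodize f), sform (periodize f) & extd (periodize f) = periodize (extd f)].
Proof.
move=> uf af sf.
have sp : sform (periodize f).
  move=> s; apply: smooth_local => p; exists (fun q => tsum (NN p).+1 f q s).
    by have [_ H _] := tsum_form (NN p).+1 af sf; exact: H.
  by apply: filterS (per_near p uf) => q ->.
have T M : is_form k (tsum M f) by apply/is_formP; have [] := tsum_form M af sf.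
split=> //.
  suff /is_formP[] : is_form k (periodize f) by [].
  split=> // [p s|p s1 s2 a u v|p s1 s2 s3 u].
  - exact: (form_deg (T (NN p))).
  - exact: (form_lin (T (NN p))).
  - exact: (form_alt (T (NN p))).
apply: dform_eqP => p s; rewrite (extd_local (per_near p uf)).
have [_ _ ->] := tsum_form (NN p).+1 af sf.
by rewrite (@perE _ (NN p).+1) //; exact: suppf_extd.
Qed.

Lemma perD f g : periodize (f + g) = periodize f + periodize g.
Proof.
apply: dform_eqP => p s; rewrite dformDE /periodize !tsumE addrACA -!big_split.
by [].
Qed.

Lemma tsum_wedge c f M : (forall u, pt u c = c) -> c ∧ tsum M f = tsum M (c ∧ f).
Proof.
move=> cu; have W u : c ∧ pt u f = pt u (c ∧ f) by rewrite pullback_wedge cu.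
rewrite /tsum wedgeDr; congr (_ + _).
  rewrite (big_morph (wedge_form c) (@wedgeDr _ _ c) (@wedge0r _ _ c)).
  by apply: eq_bigr => i _.
rewrite (big_morph (wedge_form c) (@wedgeDr _ _ c) (@wedge0r _ _ c)).
by apply: eq_bigr => i _.
Qed.

Lemma wedge_per c f : (forall u, pt u c = c) -> c ∧ periodize f = periodize (c ∧ f).
Proof.
by move=> cu; apply: dform_eqP => p s; rewrite /periodize -tsum_wedge.
Qed.

(** Translation by tbar shifts the summation index by one; the end terms gained and lost vanish by
    the choice of [NN]. *)
Lemma pt_per f : suppf f -> pt tbar (periodize f) = periodize f.
Proof.
move=> sf; apply: dform_eqP => p s; rewrite pullback_tauE.
pose M := maxn (NN p) (NN (tau B tbar p)).
rewrite (perE _ sf (leq_maxr (NN p) _)) (perE _ sf (leq_maxl _ (NN (tau B tbar p)))) -/M.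
rewrite -pullback_tauE.
have E u : pt tbar (pt u f) = pt (tbar + u) f by exact: pullback_tau.
have E1 : pt tbar (tsum M f) = \sum_(i < M.+1) pt (tbar * i.+1%:R) f +
     \sum_(i < M) pt (- (tbar * i%:R)) f.
  rewrite /tsum pullbackD; congr (_ + _).
    rewrite (big_morph (pullback (tau B tbar)) (@pullbackD _ _ _) (@pullback0 _ _ _)).
    by apply: eq_bigr => i _; rewrite E -natr1 mulrDr mulr1 addrC.
  rewrite (big_morph (pullback (tau B tbar)) (@pullbackD _ _ _) (@pullback0 _ _ _)).
  by apply: eq_bigr => i _; rewrite E -natr1 mulrDr mulr1 opprD addrCA subrr addr0.
have NM : (NN p <= M)%N by exact: leq_maxl.
have v1 : pt (tbar * M.+1%:R) f p s = 0.
  by apply: pt_vanish => //; rewrite ger0_norm // ler_nat leqW.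
have v2 : pt (- (tbar * M%:R)) f p s = 0.
  by rewrite -mulrN; apply: pt_vanish => //; rewrite normrN ger0_norm // ler_nat.
pose a (i : nat) : R := pt (tbar * i%:R) f p s.
pose b (i : nat) : R := pt (- (tbar * i%:R)) f p s.
have E2 : pt tbar (tsum M f) p s = \sum_(i < M.+1) a i.+1 + \sum_(i < M) b i.
  by rewrite E1; exact: (congr2 +%R (sum_dformE _ _ _ _) (sum_dformE _ _ _ _)).
have E3 : tsum M f p s = \sum_(i < M.+1) a i + \sum_(i < M) b i.+1 := tsumE M f p s.
apply: (etrans E2); apply: (etrans _ (esym E3)).
have ab : a 0%N = b 0%N by rewrite /a /b mulr0 oppr0.
have aM : a M.+1 = 0 := v1.
have bM : b M = 0 := v2.
move: a b M ab aM bM {NM v1 v2 E1 E2 E3} => a b M ab aM bM.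
have : \sum_(i < M.+1) b i = \sum_(i < M.+1) b i by [].
rewrite {1}big_ord_recr [RHS]big_ord_recl /= bM addr0 => ->.
by rewrite big_ord_recr [in RHS]big_ord_recl /= aM addr0 ab addrA [b 0%N + _]addrC.
Qed.

Lemma pt_mult w (m : nat) : pt tbar w = w -> pt (tbar * m%:R) w = w.
Proof.
move=> tw; elim: m => [|m IH]; first by rewrite mulr0 pullback_tau0.
by rewrite -natr1 mulrDr mulr1 -pullback_tau tw.
Qed.

Lemma pt_multN w (m : nat) : pt tbar w = w -> pt (- (tbar * m%:R)) w = w.
Proof. by move=> tw; rewrite -{1}(pt_mult m tw) pullback_tau addNr pullback_tau0. Qed.

Hypothesis Lflow : flow B tbar @` L = L.

Lemma Linv_per f : Linv L f -> Linv L (periodize f).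
Proof.
move=> lf l Ll p; apply/funext => s.
have NE : NN (p + fb l) = NN p by rewrite /NN /= addr0.
rewrite /periodize NE.
have H1 u : (forall l, L l -> L (l *m phi B (- u))) -> pt u f (p + fb l) s = pt u f p s.
  move=> Lu; rewrite !pullback_tauE -[fb l]scale1r (tau_affine B u) scale1r tl_fb lf //.
  exact: Lu.
have LP (m : nat) l' : L l' -> L (l' *m phi B (- (tbar * m%:R))).
  elim: m l' => [|m IH] l' Ll'; first by rewrite mulr0 oppr0 phi0 mulmx1.
  by rewrite -natr1 mulrDr mulr1 phi_N mulmxA; apply: (L_phiN Lflow); exact: IH.
have LN (m : nat) l' : L l' -> L (l' *m phi B (- - (tbar * m%:R))).
  elim: m l' => [|m IH] l' Ll'; first by rewrite mulr0 !oppr0 phi0 mulmx1.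
  rewrite -natr1 mulrDr mulr1 opprD phi_N mulmxA (opprK tbar).
  exact: (L_phi Lflow (IH _ Ll')).
apply: (etrans (tsumE _ _ _ _)); apply: (etrans _ (esym (tsumE _ _ _ _))).
apply: congr2; apply: eq_bigr => i _; apply: H1 => l' Ll'.
  exact: (LP i l' Ll').
exact: (LN i.+1 l' Ll').
Qed.

(** Its translates by multiples of tbar telescope to 1: a partition of unity over the base circle
    ([per_rho]). *)
Definition bump (p : G) : R := step (p.1 / tbar + 1) - step (p.1 / tbar).

Lemma smooth_rho : smooth (bump : G -> R^o).
Proof.
have H (a : R) : smooth (fun p : G => step (p.1 / tbar + a) : R^o).
  have -> : (fun p : G => step (p.1 / tbar + a)) = (fun p : G => step (tbar^-1 * p.1 + a)).
    by apply/funext => p; rewrite mulrC.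
  exact: smooth_step.
rewrite /bump; apply: smoothB; first exact: H.
by have := H 0; under eq_fun do rewrite addr0.
Qed.

Lemma rho_supp p : 1 < `|p.1 / tbar| -> bump p = 0.
Proof.
rewrite /bump lter_normr => /orP[h|h].
  by rewrite !step1 ?subrr // ?ltW // ltr_wpDr // (lt_trans _ h).
by rewrite !step0 ?subrr //; lra.
Qed.

Lemma per_rho w : pt tbar w = w -> periodize (fun0 bump ∧ w) = w.
Proof.
move=> tw; apply: dform_eqP => p s; rewrite /periodize; set x := p.1 / tbar.
have E u : pt u w = w -> pt u (fun0 bump ∧ w) p s =
    (step (x + u / tbar + 1) - step (x + u / tbar)) * w p s.
  move=> uw; rewrite pullback_wedge uw.
  have -> : pt u (fun0 bump) = fun0 (fun p => bump (tau B u p)).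
    by apply: dform_eqP => q [|v t]; rewrite pullback_tauE.
  by rewrite fun0_wedge /bump /tau /= (mulrDl p.1 u tbar^-1).
have xN := NN_gt p; rewrite -/x in xN; set M := NN p in xN *.
transitivity ((\sum_(i < M.+1) (step (x + i.+1%:R) - step (x + i%:R)) +
   \sum_(i < M) (step (x - i%:R) - step (x - i.+1%:R))) * w p s).
  rewrite tsumE mulrDl !mulr_suml; congr (_ + _); apply: eq_bigr => i _.
    apply: (etrans (E _ (pt_mult i tw))).
    have -> : tbar * i%:R / tbar = i%:R by rewrite mulrAC divff // mul1r.
    by rewrite -addrA natr1.
  apply: (etrans (E _ (pt_multN i.+1 tw))).
  have -> : - (tbar * i.+1%:R) / tbar = - i.+1%:R by rewrite mulNr mulrAC divff // mul1r.
  by congr ((step _ - _) * _); rewrite -natr1 opprD addrA subrK.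
have T1 (f : nat -> R) n : \sum_(i < n) (f i.+1 - f i) = f n - f 0%N.
  by rewrite -(big_mkord xpredT (fun i => f i.+1 - f i)) telescope_sumr.
have -> : \sum_(i < M) (step (x - i%:R) - step (x - i.+1%:R)) =
    - \sum_(i < M) (step (x - i.+1%:R) - step (x - i%:R)).
  by rewrite -sumrN; apply: eq_bigr => i _; rewrite opprB.
rewrite (T1 (fun i => step (x + i%:R))) (T1 (fun i => step (x - i%:R))) addr0 subr0 opprB.
rewrite addrA subrK.
have [h1 h2] := (ler_norm x, ler_norm (- x)); rewrite normrN in h2.
have -> : step (x + M.+1%:R) = 1 by apply: step1; rewrite -natr1; lra.
have -> : step (x - M%:R) = 0 by apply: step0; lra.
by rewrite subr0 mul1r.
Qed.

End Periodize.

(** * Reduction to forms constant along the fibre *)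

Lemma wedge_self1 (R : realType) (V : normedModType R) (c : dform V) : ofdeg 1 c -> c ∧ c = 0.
Proof.
move=> dc; have := wedgeC dc dc; rewrite expr1 scaleN1r => /eqP.
by rewrite -subr_eq0 opprK -mulr2n -scaler_nat scaler_eq0 pnatr_eq0 => /eqP.
Qed.

Section Fiberize.
Variables (R : realType) (B : 'M[R]_5) (tbar : R) (L : set 'rV[R]_5).
Hypotheses (tbar0 : tbar != 0) (lL : is_lattice L) (Lflow : flow B tbar @` L = L).
Local Notation G := (Gtype R).
Local Notation dform := (dform G).
Local Notation pt u := (pullback (tau B u)).
Local Notation Oinv := (Oinv B tbar L).
Local Notation Om := (Om B tbar L).
Implicit Types (w f : dform) (p q v : G) (s : seq G).

Definition dtf : dform := covf (gc None).

Lemma altf_dtf : altf 1 dtf. Proof. exact: (altf_covf (gc_comb None)). Qed.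
Lemma ofdeg_dtf : ofdeg 1 dtf. Proof. exact: altf_deg altf_dtf. Qed.
Lemma sform_dtf : sform dtf. Proof. exact: sform_covf. Qed.
Lemma dtf_dtf : dtf ∧ dtf = 0. Proof. exact: wedge_self1 ofdeg_dtf. Qed.
Lemma dtf_dtf_w w : dtf ∧ (dtf ∧ w) = 0. Proof. by rewrite wedgeA dtf_dtf wedge0l. Qed.
Lemma ins_fb_dtf l : ins (fb l) dtf = 0. Proof. by rewrite ins_covf scale0r. Qed.
Lemma pt_dtf u : pt u dtf = dtf.
Proof. by apply: dform_eqP => p s; rewrite pullback_tauE; case: s => [|v [|v' s]]. Qed.
Lemma sgn_dtf : sgn dtf = - dtf.
Proof. by rewrite (ofdeg_sgn ofdeg_dtf) expr1 scaleN1r. Qed.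

Lemma g_split v : v = v.1 *: gb R None + fb v.2.
Proof.
case: v => t y; rewrite /fb; congr pair; rewrite /= ?scaler0 ?add0r //.
by rewrite [_ *: _]mulr1 addr0.
Qed.

Lemma dird_split v w : sform w -> yconst w -> dird v w = v.1 *: dird (gb R None) w.
Proof.
move=> sw yw; apply: dform_eqP => p s.
have E := congr1 (fun f : dform => f p s) (yconst_dird v.2 yw).
rewrite /dird {1}(g_split v).
apply: (etrans (smooth_derive_lin p v.1 (gb R None) (fb v.2) (sw s))).
exact: (etrans (congr1 (fun x => v.1 * 'D_(gb R None) (fun q => w q s : R^o) p + x) E) (addr0 _)).
Qed.

Lemma extd_yconst w : sform w -> yconst w -> extd w = dtf ∧ dird (gb R None) w.
Proof.
move=> sw yw; apply: dform_eqP => p s; elim: s w sw yw => [|v s IH] w sw yw.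
  by rewrite extd_nil wedge_nil mul0r.
have yi : yconst (ins v w) by move=> q q' e; rewrite /ins (yw _ _ e).
rewrite extd_cons (IH _ (sform_ins v sw) yi) (dird_split v sw yw).
rewrite -[RHS]/(ins v (dtf ∧ dird (gb R None) w) p s) ins_wedge ins_covf wedgeZl wedge1l.
by rewrite sgn_dtf wedgeNl.
Qed.

Lemma extd_fun0_t (r : G -> R) : smooth (r : G -> R^o) -> (forall p q, p.1 = q.1 -> r p = r q) ->
  exists r' : G -> R, extd (fun0 r) = fun0 r' ∧ dtf.
Proof.
move=> sr yr; exists (fun p => 'D_(gb R None) (r : G -> R^o) p).
rewrite extd_yconst; last 2 first.
- exact: sform_fun0.
- by move=> p q e; apply/funext => s; rewrite /fun0 (yr _ _ e).
have -> : dird (gb R None) (fun0 r) = fun0 (fun p => 'D_(gb R None) (r : G -> R^o) p).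
  apply: dform_eqP => p [|v s] //.
  exact: (derive_val (is_derive := is_derive_cst (0 : R^o) p (gb R None))).
by rewrite (wedgeC ofdeg_dtf (@ofdeg_fun0 _ _)) muln0 expr0 scale1r.
Qed.

Lemma Oinv_comb (a : R) w1 w2 : Oinv w1 -> Oinv w2 -> Oinv (a *: w1 + w2).
Proof.
move=> [i1 t1] [i2 t2]; split; first exact: Linv_comb.
by rewrite pullbackD pullbackZ t1 t2.
Qed.

Lemma Oinv0 : Oinv 0. Proof. by split. Qed.

Lemma OinvD w1 w2 : Oinv w1 -> Oinv w2 -> Oinv (w1 + w2).
Proof. by move=> i1 i2; rewrite -(scale1r w1); exact: Oinv_comb. Qed.

Lemma OinvN w : Oinv w -> Oinv (- w).
Proof. by move=> iw; rewrite -(scaleN1r w) -[_ *: _]addr0; apply: Oinv_comb => //; exact: Oinv0. Qed.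

Lemma Linv_extd w : sform w -> Linv L w -> Linv L (extd w).
Proof.
move=> sw iw l Ll p; pose F (q : G) := q + fb l.
have FA : affine_with id F by move=> q v h; rewrite /F addrAC.
have E : pullback F w = w.
  by apply: dform_eqP => q s; rewrite (pullback_affineE FA) map_id /F (iw l Ll).
have := extd_pullback_affine FA sw; rewrite E => H; apply/funext => s.
by rewrite [in RHS]H (pullback_affineE FA) map_id.
Qed.

Lemma Oinv_extd k w : altf k w -> sform w -> Oinv w -> Oinv (extd w).
Proof.
move=> aw sw [iw tw]; split; first exact: Linv_extd.
by have [_ _ <-] := tau_form B tbar aw sw; rewrite tw.
Qed.

Lemma Linv_wedge w1 w2 : Linv L w1 -> Linv L w2 -> Linv L (w1 ∧ w2).
Proof.
move=> i1 i2 l Ll p; apply/funext => s.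
rewrite -{2}(map_id s); apply: wedge_at => t; rewrite map_id; [by rewrite (i1 l Ll)|by rewrite (i2 l Ll)].
Qed.

Lemma Oinv_wedge w1 w2 : Oinv w1 -> Oinv w2 -> Oinv (w1 ∧ w2).
Proof.
by move=> [i1 t1] [i2 t2]; split; [exact: Linv_wedge|rewrite pullback_wedge t1 t2].
Qed.

Let rho := bump tbar.
Let per := periodize B tbar.

Let rho_y p q : p.1 = q.1 -> rho p = rho q.
Proof. by rewrite /rho /bump => ->. Qed.

Lemma fun0_form k (r : G -> R) w : smooth (r : G -> R^o) -> altf k w -> sform w ->
  altf k (fun0 r ∧ w) /\ sform (fun0 r ∧ w).
Proof.
move=> sr aw sw; split; first exact: (@altf_wedge _ _ 0 k _ _ (@ofdeg_fun0 _ r) aw).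
by apply: sform_wedge => //; exact: sform_fun0.
Qed.

Let per_step k c : altf k c -> sform c -> Linv L c ->
  [/\ altf k (per (fun0 rho ∧ c)), sform (per (fun0 rho ∧ c)), Oinv (per (fun0 rho ∧ c)) &
    extd (per (fun0 rho ∧ c)) = per (extd (fun0 rho) ∧ c) + per (fun0 rho ∧ extd c)].
Proof.
move=> ac sc ic; have sr := smooth_rho tbar.
have [af sf] := fun0_form sr ac sc.
have uf w : suppf tbar (fun0 rho ∧ w).
  by move=> p px; apply/funext => s; rewrite fun0_wedge /rho rho_supp ?mul0r.
have [a1 s1 e1] := @per_form R B tbar tbar0 k _ (uf c) af sf.
split=> //.
  split; last exact: pt_per.
  apply: Linv_per => //; apply: Linv_wedge => // l Ll p; apply/funext => s.
  by rewrite /fun0 (@rho_y (p + fb l) p) //= addr0.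
rewrite [LHS]e1 extd_wedge //; last exact: sform_fun0.
by rewrite (ofdeg_sgn (@ofdeg_fun0 _ _)) expr0 scale1r perD.
Qed.

Let per0 : per 0 = 0.
Proof. by apply: (addrI (per 0)); rewrite addr0 -perD addr0. Qed.

(** Let A be the fibre average, K its homotopy and rho the bump. K does not commute with the
    monodromy, so rho K w is periodized to e0; then d e0 = A w - w + w2, where the error w2 is the
    periodization of d rho wedge K w. It is closed, invariant and divisible by dt, and a second pass
    on w2 leaves no error, so w is cohomologous to A w + A w2. *)
Theorem fiberize k w : altf k w -> sform w -> Oinv w -> extd w = 0 ->
  exists w', [/\ altf k w', sform w', Oinv w', yconst w' & extd w' = 0] /\
    @coboundary R Om k (w - w').
Proof.
move=> aw sw iw dw.
have [ls lsL sp] := lattice_spans lL; pose A w := avgs (map (@fb R) ls) w.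
have H k' u : altf k' u -> sform u -> Oinv u -> extd u = 0 ->
    [/\ altf k' (A u), sform (A u), Oinv (A u), yconst (A u) & extd (A u) = 0].
  move=> au su iu du; split.
  - exact: altf_avgs.
  - exact: sform_avgs.
  - exact: Oinv_avgs.
  - by apply: (yconst_avgs lsL) => //; case: iu.
  - by rewrite extd_avgs // du avgs0.
case: k aw => [|k] aw.
  exists w; split; last by rewrite subrr.
  by have := H _ _ aw sw iw dw; rewrite {1 2 3 4}/A avgs_deg0 // => -[].
pose K w := hKs (map (@fb R) ls) w.
have [[iL _] dK] := (iw, extd_hKs (map (@fb R) ls) sw dw).
have [a0 s0 i0 d0] := per_step (altf_hKs (map (@fb R) ls) aw sw) (sform_hKs (map (@fb R) ls) sw) (Linv_hKs ls iL).
have [aA sA iA yA dA] := H _ _ aw sw iw dw.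
set e0 := per (fun0 rho ∧ hKs (map (@fb R) ls) w) in a0 s0 i0 d0.
set w2 := per (extd (fun0 rho) ∧ _) in d0.
(* A w - w is invariant, so cutting it off with the bump and periodizing gives it back. *)
have E1 : per (fun0 rho ∧ extd (hKs (map (@fb R) ls) w)) = A w - w.
  rewrite dK; apply: per_rho => //.
  by case: iA => _ tA; case: iw => _ tw; rewrite pullbackD pullbackN tA tw.
rewrite E1 in d0.
have w2E : w2 = extd e0 - (A w - w) by rewrite d0 addrK.
have [r' rE] := extd_fun0_t (smooth_rho tbar) rho_y.
have [a2 s2 i2 d2] : [/\ altf k.+1 w2, sform w2, Oinv w2 & extd w2 = 0].
  have sk := sform_hKs (map (@fb R) ls) sw.
  have se : sform (extd (fun0 rho) ∧ hKs (map (@fb R) ls) w).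
    by apply: sform_wedge => //; apply/sform_extd/sform_fun0/smooth_rho.
  have ae : altf k.+1 (extd (fun0 rho) ∧ hKs (map (@fb R) ls) w).
    rewrite [extd (fun0 rho)]rE; apply: (@altf_wedge _ _ 1 k); last exact: altf_hKs.
    exact: (@altf_wedge _ _ 0 1 _ _ (@ofdeg_fun0 _ r') altf_dtf).
  have ue : suppf tbar (extd (fun0 rho) ∧ hKs (map (@fb R) ls) w).
    have u0 : suppf tbar (fun0 rho).
      by move=> p px; apply/funext => -[|v s] //; rewrite /fun0 /rho rho_supp.
    move=> p px; apply/funext => s; have := suppf_extd u0 px.
    set W := extd (fun0 rho) => Wp.
    set K' := hKs _ w; have Z : forall t, W p t = (0 : dform) p (map id t) by move=> t; rewrite Wp.
    by apply: (etrans (@wedge_at _ _ 0 K' W K' p p id s Z _)) => [t|]; rewrite ?map_id ?wedge0l.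
  have [H1 H2 _] := @per_form R B tbar tbar0 k.+1 _ ue ae se.
  split; [exact: H1|exact: H2| |].
    rewrite w2E; apply: OinvD; first exact: Oinv_extd a0 s0 i0.
    by apply/OinvN/OinvD => //; exact: OinvN.
  have sAw : sform (A w - w) by exact: sformB.
  rewrite w2E extdB //; last exact: sform_extd.
  by rewrite extd_extd // extdB // dA dw !subr0.
(* rho depends on t only, so the factor d rho of the error is a multiple of dt. *)
have t2 : dtf ∧ w2 = 0.
  rewrite /w2 wedge_per; last exact: pt_dtf.
  rewrite wedgeA [extd (fun0 rho)]rE wedgeA (wedgeC ofdeg_dtf (@ofdeg_fun0 _ _)) muln0 expr0 scale1r.
  by rewrite -(wedgeA (fun0 r') dtf dtf) dtf_dtf wedge0r wedge0l; exact: per0.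
have [iL2 _] := i2; have dK2 := extd_hKs (map (@fb R) ls) s2 d2.
have [a3 s3 i3 d3] := per_step (altf_hKs (map (@fb R) ls) a2 s2) (sform_hKs (map (@fb R) ls) s2) (Linv_hKs ls iL2).
have [aA2 sA2 iA2 yA2 dA2] := H _ _ a2 s2 i2 d2.
set e3 := per (fun0 rho ∧ hKs (map (@fb R) ls) w2) in a3 s3 i3 d3.
(* K contracts along the fibre only, so dt wedge w2 = 0 is inherited by K w2 and the second error
   term vanishes. *)
have E3 : extd e3 = A w2 - w2.
  rewrite d3 [extd (fun0 rho)]rE -wedgeA wedge_hKs ?wedge0r ?per0 ?add0r //.
  - rewrite dK2; apply: per_rho => //.
    by case: iA2 => _ tA; case: i2 => _ tw; rewrite pullbackD pullbackN tA tw.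
  - exact: ofdeg_dtf.
  - by move=> l /mapP[l' _ ->]; exact: ins_fb_dtf.
exists (A w + A w2); split.
  split; [exact: altfD|exact: sformD|exact: OinvD| |].
    by move=> p q e; apply/funext => s; rewrite !dformE (yA _ _ e) (yA2 _ _ e).
  by rewrite extdD // dA dA2 addr0.
exists (- (e0 + e3)); last first.
  have E : extd (- (e0 + e3)) = - (extd e0 + extd e3).
    by rewrite (extdN (sformD s0 s3)) (extdD s0 s3).
  apply: (etrans E); rewrite E3 -[extd e0](subrK (A w - w)) -w2E.
  have id4 (a b c d : dform) : - (c + (a - d) + (b - c)) = d - (a + b).
    by rewrite [c + _]addrC -addrA [c + _]addrC subrK opprD opprB opprD addrA.
  exact: id4.
have L0 : L 0 by case: lL => -[].
by apply/(Om_homP _ _ L0); split; [apply/altfN/altfD|apply/sformN/sformD|apply/OinvN/OinvD].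
Qed.

End Fiberize.

(** * Constant forms under a normal monodromy *)

Section ConstantForms.
Variable R : realType.
Local Notation G := (Gtype R).
Local Notation dform := (dform G).
Local Notation gb := (gb R).
Implicit Types (w u c : dform) (p q v : G) (s : seq G) (P : 'M[R]_5).

Definition cst c := forall p q, c p = c q.

Lemma sform_cst c : cst c -> sform c.
Proof.
move=> cc s; rewrite (_ : (fun p => _) = fun=> c 0 s); first exact: smooth_cst.
by apply/funext => q; rewrite (cc q 0).
Qed.

Lemma yconst_cst c : cst c -> yconst c.
Proof. by move=> cc p q _; exact: cc. Qed.

Lemma cst_ins v c : cst c -> cst (ins v c).
Proof. by move=> cc p q; rewrite /ins (cc p q). Qed.

Lemma cst_comb (a : R) c c' : cst c -> cst c' -> cst (a *: c + c').
Proof. by move=> cc cc' p q; apply/funext => s; rewrite !dformE (cc p q) (cc' p q). Qed.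

Lemma cst_wedge c c' : cst c -> cst c' -> cst (c ∧ c').
Proof.
move=> cc cc' p q; apply/funext => s; rewrite -{2}(map_id s); apply: wedge_at => t.
  by rewrite map_id (cc p q).
by rewrite map_id (cc' p q).
Qed.

Definition lin P v : G := (v.1, v.2 *m P).
Definition plin P w : dform := fun p s => w p (map (lin P) s).

Lemma ins_plin P v w : ins v (plin P w) = plin P (ins (lin P v) w). Proof. by []. Qed.
Lemma plin_comb P (a : R) w w' : plin P (a *: w + w') = a *: plin P w + plin P w'.
Proof. by []. Qed.

Lemma cst_plin P c : cst c -> cst (plin P c).
Proof. by move=> cc p q; apply/funext => s; rewrite /plin (cc p q). Qed.

Lemma lin_comb P (a : R) v v' : lin P (a *: v + v') = a *: lin P v + lin P v'.
Proof. by rewrite /lin; congr pair; rewrite /= mulmxDl -scalemxAl. Qed.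

Lemma altf_plin P k w : altf k w -> altf k (plin P w).
Proof.
elim: k w => [|k IH] w.
  by move=> dw p s sk; rewrite /plin dw // size_map.
move=> [w0 lw iw aw]; split=> [p|a v v'|v|v].
- exact: w0.
- by rewrite ins_plin lin_comb lw.
- by rewrite !ins_plin iw.
- by rewrite ins_plin; exact: (IH _ (aw _)).
Qed.

Lemma plin_comp P P' w : plin P (plin P' w) = plin (P *m P') w.
Proof.
apply: dform_eqP => p s; rewrite /plin -map_comp; congr (w _ _); apply: eq_map => v.
by rewrite /comp /lin mulmxA.
Qed.

(** The Euclidean inner product of tensors: products of values at the origin, summed over all
    k-tuples of basis vectors. *)
Fixpoint ip k (u v : dform) : R :=
  if k is k'.+1 then \sum_i ip k' (ins (gb i) u) (ins (gb i) v) else u 0 [::] * v 0 [::].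

Lemma ipC k (u v : dform) : ip k u v = ip k v u.
Proof.
elim: k u v => [|k IH] u v /=; first by rewrite mulrC.
by apply: eq_bigr => i _; exact: IH.
Qed.

Lemma ip_combl k (a : R) (u u' v : dform) : ip k (a *: u + u') v = a * ip k u v + ip k u' v.
Proof.
elim: k u u' v => [|k IH] u u' v /=; first by rewrite !dformE mulrDl mulrA.
rewrite mulr_sumr -big_split /=; apply: eq_bigr => i _.
by rewrite -IH.
Qed.

Lemma ip0l k (v : dform) : ip k 0 v = 0.
Proof. by have := ip_combl k (-1) 0 0 v; rewrite scaler0 addr0 mulN1r addNr. Qed.

Lemma ip_suml k I (r : seq I) (a : I -> R) (u : I -> dform) (v : dform) :
  ip k (\sum_(i <- r) a i *: u i) v = \sum_(i <- r) a i * ip k (u i) v.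
Proof.
elim: r => [|i r IH]; first by rewrite !big_nil ip0l.
by rewrite !big_cons ip_combl IH.
Qed.

Lemma ip_ge0 k u : 0 <= ip k u u.
Proof.
elim: k u => [|k IH] u /=; first by rewrite -expr2 sqr_ge0.
by apply: sumr_ge0 => i _; exact: IH.
Qed.

Lemma form_eq0 k u : altf k u -> cst u ->
  (forall t : seq (option 'I_5), size t = k -> u 0 (map gb t) = 0) -> u = 0.
Proof.
elim: k u => [|k IH] u au cu H.
  apply: dform_eqP => p [|v s]; last by rewrite au.
  by rewrite (cu p 0); exact: (H [::]).
have ui i : ins (gb i) u = 0.
  apply: (IH _ (altf_ins (gb i) au) (cst_ins (gb i) cu)) => t tk.
  by apply: (H (i :: t)); rewrite /= tk.
apply: dform_eqP => p [|v s]; first by case: au => ->.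
rewrite -[LHS]/(ins v u p s) (g_decomp v) (altf_ins_sum _ _ _ au) big1 // => i _.
by rewrite ui scaler0.
Qed.

Lemma ip_eq0 k u : altf k u -> cst u -> ip k u u = 0 -> u = 0.
Proof.
move=> au cu H; apply: (form_eq0 au cu).
elim: k u au cu H => [|k IH] u au cu /=.
  move=> H [|//] _; move/eqP: H; rewrite -expr2 sqrf_eq0 => /eqP.
  by [].
move=> H [|i t] //= [tk]; apply: (IH (ins (gb i) u)) => //.
- exact: altf_ins.
- exact: cst_ins.
- by apply: (psumr_eq0P (fun i _ => ip_ge0 k (ins (gb i) u)) H).
Qed.

Lemma ip_plin k P (u v : dform) : altf k u -> altf k v -> ip k (plin P u) v = ip k u (plin P^T v).
Proof.
elim: k u v => [|k IH] u v au av //=.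
have linT i j : gc j (lin P (gb i)) = gc i (lin P^T (gb j)).
  by case: i j => [i|] [j|] //=; rewrite ?mul0mx -?rowE !mxE.
have E P' i (w : dform) : altf k.+1 w -> ins (gb i) (plin P' w) =
    \sum_j gc j (lin P' (gb i)) *: plin P' (ins (gb j) w).
  move=> aw; rewrite ins_plin {1}(g_decomp (lin P' (gb i))) (altf_ins_sum _ _ _ aw).
  by rewrite (big_morph (plin P') (id1 := 0) (op1 := +%R)).
under eq_bigr do rewrite (E _ _ _ au) ip_suml.
under [RHS]eq_bigr do rewrite (E _ _ _ av) ipC ip_suml.
rewrite exchange_big; apply: eq_bigr => j _; apply: eq_bigr => i _.
rewrite linT; congr (_ * _); rewrite [RHS]ipC; apply: IH; exact: altf_ins.
Qed.

(** A constant k-form is determined by its values on basis tuples; taking one form more than there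
    are tuples produces a nontrivial relation. *)
Lemma form_dependent k (f : nat -> dform) : (forall i, altf k (f i) /\ cst (f i)) ->
  exists n (a : nat -> R), (exists2 i, (i < n)%N & a i != 0) /\ \sum_(i < n) a i *: f i = 0.
Proof.
move=> Hf; pose m := #|{: k.-tuple (option 'I_5)}|.
pose A := \matrix_(i < m.+1, j < m) f i 0 (map gb (enum_val j : k.-tuple _)).
pose v := nz_row (kermx A).
have v0 : v != 0.
  rewrite /v nz_row_eq0 -mxrank_eq0 mxrank_ker subn_eq0 -ltnNge.
  by apply: leq_ltn_trans (rank_leq_col A) _.
have vA : v *m A = 0 by apply/sub_kermxP; exact: nz_row_sub.
exists m.+1, (fun i => v 0 (inord i)); split.
  have /rowV0Pn[x _ _] : v != 0 by [].
  have [i vi] : exists i, v 0 i != 0.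
    apply: contrapT => H; case/negP: v0; apply/eqP/rowP => i; rewrite mxE.
    by apply/eqP; apply: contrapT => /negP vi; apply: H; exists i.
  by exists i => //; rewrite inord_val.
apply: (@form_eq0 k).
- apply: (big_ind (altf k)) => [||i _]; [exact: altf0|by move=> x y; exact: altfD|].
  by apply: altfZ; case: (Hf i).
- apply: (big_ind cst) => [//|x y cx cy|i _].
    by rewrite -(scale1r x); exact: cst_comb.
  by rewrite -[_ *: _]addr0; apply: cst_comb => //; case: (Hf i).
move=> t /eqP tk; rewrite sum_dformE.
have /rowP/(_ (enum_rank (Tuple tk))) := vA; rewrite !mxE => {2}<-.
by apply: eq_bigr => i _; rewrite !mxE enum_rankK dformE inord_val.
Qed.

End ConstantForms.

Section NormalAnalysis.
Variables (R : realType) (B : 'M[R]_5) (tbar : R) (L : set 'rV[R]_5).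
Hypotheses (tbar0 : tbar != 0) (lL : is_lattice L) (Lflow : flow B tbar @` L = L)
  (nB : B *m B^T = B^T *m B).
Local Notation G := (Gtype R).
Local Notation dform := (dform G).
Local Notation gb := (gb R).
Local Notation pt u := (pullback (tau B u)).
Local Notation Oinv := (Oinv B tbar L).
Local Notation Om := (Om B tbar L).
Local Notation dtf := (@dtf R).
Local Notation e0 := (gb None).
Implicit Types (w c : dform) (p q v : G) (s : seq G).

Let N := phi B (- tbar).

(** B^T commutes with B, hence with phi t; transposing, B commutes with the transpose of phi t, and
    [comm_phi] applies once more. *)
Lemma phi_normal t : phi B t *m (phi B t)^T = (phi B t)^T *m phi B t.
Proof.
have H1 : B^T *m phi B t = phi B t *m B^T by apply: comm_phi; rewrite nB.
have H2 : (phi B t)^T *m B = B *m (phi B t)^T.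
  by apply: trmx_inj; rewrite !trmx_mul !trmxK.
by rewrite (comm_phi t H2).
Qed.

Lemma pt_plin c : cst c -> pt tbar c = plin N c.
Proof.
by move=> cc; apply: dform_eqP => p s; rewrite pullback_tauE (cc _ p).
Qed.

Let D c := plin N c - c.
Let D' c := plin N^T c - c.

Let altf_D k c : altf k c -> altf k (D c).
Proof. by move=> ac; apply: altfD; [exact: altf_plin|exact: altfN]. Qed.
Let altf_D' k c : altf k c -> altf k (D' c).
Proof. by move=> ac; apply: altfD; [exact: altf_plin|exact: altfN]. Qed.
Let cst_D c : cst c -> cst (D c).
Proof. by move=> cc; rewrite /D -(scale1r (plin _ _)) -(scaleN1r c); apply: cst_comb; [exact: cst_plin|rewrite -[_ *: _]addr0; exact: cst_comb]. Qed.
Let cst_D' c : cst c -> cst (D' c).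
Proof. by move=> cc; rewrite /D' -(scale1r (plin _ _)) -(scaleN1r c); apply: cst_comb; [exact: cst_plin|rewrite -[_ *: _]addr0; exact: cst_comb]. Qed.

Let lin_D : linear D.
Proof. by move=> a x y; rewrite /D plin_comb scalerBr opprD addrACA. Qed.

Let ip_D k (u v : dform) : altf k u -> altf k v -> ip k (D u) v = ip k u (D' v).
Proof.
move=> au av; rewrite /D /D' addrC -scaleN1r ip_combl (ip_plin _ au av).
by rewrite [RHS]ipC [plin _ v - v]addrC -(scaleN1r v) ip_combl ![ip k _ u]ipC.
Qed.

Let DD' u : D (D' u) = D' (D u).
Proof.
rewrite /D /D'; have E P (x y : dform) : plin P (x - y) = plin P x - plin P y by [].
rewrite !E !plin_comp phi_normal -/N !opprB.
by rewrite addrACA [RHS]addrACA [X in _ = _ + X]addrC.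
Qed.

(** D and its adjoint D' commute, so the squared norm of D' u is the product of D' D u with u, which
    is zero. *)
Lemma ker_adjoint k u : altf k u -> cst u -> D u = 0 -> D' u = 0.
Proof.
move=> au cu Du; apply: (@ip_eq0 R k); [exact: altf_D'|exact: cst_D'|].
have H := ip_D (altf_D' au) au; rewrite -H DD' Du.
by rewrite /D' [plin _ 0]/(0 : dform) subr0 ip0l.
Qed.

(** D u lies in the kernel of D, hence in that of D', and the squared norm of D u is the product of
    u with D' D u. *)
Lemma ker_sq k u : altf k u -> cst u -> D (D u) = 0 -> D u = 0.
Proof.
move=> au cu DDu; apply: (@ip_eq0 R k); [exact: altf_D|exact: cst_D|].
rewrite (ip_D au (altf_D au)) (ker_adjoint (altf_D au) (cst_D cu) DDu) ipC.
exact: ip0l.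
Qed.

(* Normality gives ker D^2 = ker D; a linear relation between the iterates D^i c then splits
   off the part of c that lies in the image of D. *)
Lemma fitting k (T : set dform) c : subsp T -> (forall x, T x -> T (D x)) ->
  (forall x, T x -> altf k x /\ cst x) -> T c ->
  exists c0 c1, [/\ T c0, T c1, D c0 = 0 & c = c0 + D c1].
Proof.
move=> sT DT Tf Tc; pose f i := iter i D c.
have Tfi i : T (f i) by elim: i => //= i IH; exact: DT.
have [n [a [[i0 i0n ai0] Sa]]] := @form_dependent R k f (fun i => Tf _ (Tfi i)).
have ex : exists j, (j < n)%N && (a j != 0) by exists i0; rewrite i0n.
have [j /andP[jn aj] jmin] := ex_minnP ex.
(* j is the least index with a nonzero coefficient, so the relation reads D^j y = 0, whence D y = 0
   by [ker_sq]; and y is a_j c up to the image of D. *)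
pose y m := \sum_(i < m) a (i + j)%N *: f i.
have Ty m : T (y m) by apply: subsp_sum => // i _; exact: subspZ.
have Dj x m : iter m D x = 0 -> T x -> D x = 0.
  elim: m => [|[|m] IH] //=; first by move=> -> _; exact: (linear0E lin_D).
  move=> H Tx; apply: IH => //=; have Ti : T (iter m D x) by elim: (m) => //= ? ?; exact: DT.
  by have [ax cx] := Tf _ Ti; exact: ker_sq ax cx H.
have Dyj : iter j D (y (n - j)%N) = 0.
  have itl m : linear (iter m D) by elim: m => [|m IH] b u v //=; rewrite IH lin_D.
  rewrite (linear_sumE _ _ _ (itl j)) -[RHS]Sa.
  have -> : \sum_(i < n) a i *: f i = \sum_(j <= i < n) a i *: f i.
    rewrite -(big_mkord xpredT (fun i => a i *: f i)) (big_cat_nat _ (ltnW jn)) //=.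
    rewrite big_nat_cond big1 ?add0r // => i /andP[/andP[_ ij] _].
    have : ~~ ((i < n)%N && (a i != 0)).
      by apply: contraL ij => /jmin; rewrite -leqNgt.
    by rewrite (ltn_trans ij jn) /= negbK => /eqP ->; rewrite scale0r.
  have shift (F : nat -> dform) : \sum_(j <= i < n) F i = \sum_(i < n - j) F (i + j)%N.
    by rewrite -{1}[j]add0n big_addn big_mkord.
  rewrite shift; apply: eq_bigr => i _.
  by rewrite (linearZE _ _ (itl j)) /f -iterD addnC.
have Dy : D (y (n - j)%N) = 0 by exact: Dj Dyj (Ty _).
pose z := \sum_(i < (n - j).-1) a (i.+1 + j)%N *: f i.
have Tz : T z by apply: subsp_sum => // i _; exact: subspZ.
have yz : y (n - j)%N = a j *: c + D z.
  have : (0 < n - j)%N by rewrite subn_gt0.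
  rewrite /y /z; case: (n - j)%N => // m _; rewrite big_ord_recl add0n; congr (_ + _).
  rewrite (linear_sumE _ _ _ lin_D); apply: eq_bigr => i _.
  by rewrite (linearZE _ _ lin_D).
exists ((a j)^-1 *: y (n - j)%N), (- ((a j)^-1 *: z)); split.
- exact: subspZ.
- by apply: subspN => //; exact: subspZ.
- by rewrite (linearZE _ _ lin_D) Dy scaler0.
- rewrite (linearNE _ lin_D) (linearZE _ _ lin_D) yz scalerDr addrK scalerA mulVf //.
  by rewrite scale1r.
Qed.

End NormalAnalysis.

(** * Cohomology of [Om] by constant invariant forms *)

Section TimeAnalysis.
Variables (R : realType) (B : 'M[R]_5) (tbar : R) (L : set 'rV[R]_5).
Local Notation G := (Gtype R).
Local Notation dform := (dform G).
Local Notation gb := (gb R).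
Local Notation pt u := (pullback (tau B u)).
Local Notation Oinv := (Oinv B tbar L).
Local Notation Om := (Om B tbar L).
Local Notation dtf := (@dtf R).
Local Notation e0 := (gb None).
Implicit Types (w c : dform) (p q v : G) (s : seq G).

Lemma yconst_comb (a : R) w w' : yconst w -> yconst w' -> yconst (a *: w + w').
Proof. by move=> y y' p q e; apply/funext => s; rewrite !dformE (y _ _ e) (y' _ _ e). Qed.

Lemma yconstB w w' : yconst w -> yconst w' -> yconst (w - w').
Proof. by move=> y y' p q e; apply/funext => s; rewrite !dformE (y _ _ e) (y' _ _ e). Qed.

Lemma yconst_wedge w w' : yconst w -> yconst w' -> yconst (w ∧ w').
Proof.
move=> y y' p q e; apply/funext => s; rewrite -{2}(map_id s); apply: wedge_at => t.
  by rewrite map_id (y _ _ e).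
by rewrite map_id (y' _ _ e).
Qed.

Lemma yconst_ins v w : yconst w -> yconst (ins v w).
Proof. by move=> y p q e; rewrite /ins (y _ _ e). Qed.

Lemma yconst_pt u w : yconst w -> yconst (pt u w).
Proof.
move=> yw p q e; apply/funext => s.
apply: (etrans (pullback_tauE _ _ _ _ _)); apply: (etrans _ (esym (pullback_tauE _ _ _ _ _))).
by rewrite (yw (tau B u p) (tau B u q)) // /tau /= e.
Qed.

Lemma cst_dtf : cst dtf. Proof. by []. Qed.

Lemma Linv_yconst w : yconst w -> Linv L w.
Proof. by move=> y l _ p; apply: y; rewrite /= addr0. Qed.

Lemma cst_of_dird w : sform w -> yconst w -> dird e0 w = 0 -> cst w.
Proof.
move=> sw yw dw p q; apply/funext => s.
have [c _] := @MVT_line R _ (fun q => w q s : R^o) p (q - p)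
  (fun q' => smooth_derivable (p := q') (v := q - p) (sw s)).
rewrite [p + _]addrC subrK => Hc; apply/esym/eqP; rewrite -subr_eq0; apply/eqP.
apply: (etrans Hc).
have E := dird_split (q - p) sw yw; rewrite dw scaler0 in E.
exact: (congr1 (fun f : dform => f (p + c *: (q - p)) s) E).
Qed.

Lemma tl_e0 u : tl B u e0 = e0.
Proof. by rewrite /tl mul0mx. Qed.

Lemma ins_pt u w : ins e0 (pt u w) = pt u (ins e0 w).
Proof. by rewrite (ins_pullback_affine (tau_affine B u)) tl_e0. Qed.

Lemma dird_pt u w : sform w -> dird e0 (pt u w) = pt u (dird e0 w).
Proof. by move=> sw; rewrite (dird_pullback_affine (tau_affine B u) e0 sw) tl_e0. Qed.

Lemma zero_of_derive0 (h : R -> R) : (forall t, is_derive t (1 : R) h 0) -> h 0 = 0 ->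
  forall t, h t = 0.
Proof. by move=> dh h0 t; rewrite -h0; exact: is_derive_0_is_cst. Qed.

(** Coefficients are integrated from t = 0. Linear identities pass to the primitive because a
    function with zero derivative and value 0 at t = 0 vanishes. *)
Lemma primitive_form k w : altf k w -> sform w -> yconst w -> ins e0 w = 0 ->
  exists b, [/\ altf k b, sform b, yconst b, ins e0 b = 0 & dird e0 b = w].
Proof.
move=> aw sw yw iw.
have cw s : continuous (fun t : R => w ((t, 0) : G) s : R).
  move=> t; apply: (@continuous_comp _ _ _ (fun t : R => ((t, 0) : G)) (fun p => w p s : R^o)).
    by apply: cvg_gc => -[j|] /=; [exact: cvg_cst|exact: cvg_id].
  exact: smooth_continuous (sw s) _.
pose P s := cid (primitive_exists (cw s)).
pose F s t := projT1 (P s) t - projT1 (P s) 0.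
have dF s t : is_derive t (1 : R) (F s) (w ((t, 0) : G) s).
  by rewrite -[X in is_derive _ _ _ X]subr0; apply: is_deriveB; exact: (projT2 (P s)).
have F0 s : F s 0 = 0 by rewrite /F subrr.
pose b : dform := fun p s => F s p.1.
have db p v s : is_derive p v (fun q => b q s : R^o) (v.1 * w p s).
  rewrite (yw p ((p.1, 0) : G)) //.
  exact: (is_derive_fst v (dF s p.1)).
have sb : sform b.
  move=> s; apply/smoothP; split=> [p|v].
    apply: (@continuous_comp _ _ _ (fun p : G => p.1) (F s)); first exact: cvg_fst.
    by apply/differentiable_continuous/derivable1_diffP; case: (dF s p.1).
  split=> [p|]; first by case: (db p v s).
  have -> : (fun p => 'D_v (fun q => b q s : R^o) p) = (fun p => v.1 * w p s).
    by apply/funext => p; exact: (derive_val (is_derive := db p v s)).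
  exact: smoothZ (sw s).
have Fz s : (forall p, w p s = 0) -> forall t, F s t = 0.
  by move=> ws; apply: zero_of_derive0 => // t; rewrite -(ws ((t, 0) : G)).
have /is_formP [dw lw tw _] : altf k w /\ sform w by [].
exists b; split=> //.
- suff /is_formP[] : is_form k b by [].
  split=> // [p s sk|p s1 s2 a u v|p s1 s2 s3 u].
  + by apply: Fz => q; exact: dw.
  + apply/eqP; rewrite -subr_eq0; apply/eqP.
    pose h t := F (s1 ++ (a *: u + v) :: s2) t - (a * F (s1 ++ u :: s2) t + F (s1 ++ v :: s2) t).
    apply: (@zero_of_derive0 h _ _ p.1); last by rewrite /h !F0 mulr0 addr0 subrr.
    move=> t; have -> : 0 = w ((t, 0) : G) (s1 ++ (a *: u + v) :: s2) -
      (a * w ((t, 0) : G) (s1 ++ u :: s2) + w ((t, 0) : G) (s1 ++ v :: s2)).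
      by rewrite lw subrr.
    by apply: is_deriveB.
  + by apply: Fz => q; exact: tw.
- by move=> p q e; rewrite /b e.
- apply: dform_eqP => p s; apply: Fz => q.
  exact: (congr1 (fun f : dform => f q s) iw).
- apply: dform_eqP => p s; rewrite -[RHS]mul1r.
  exact: (derive_val (is_derive := db p e0 s)).
Qed.

Definition tmul c : dform := fun p s => p.1 * c p s.

Lemma tmulE c : tmul c = fun0 (@gc R None) ∧ c.
Proof. by apply: dform_eqP => p s; rewrite fun0_wedge. Qed.

Lemma tmul_form k c : altf k c -> cst c ->
  [/\ altf k (tmul c), sform (tmul c), yconst (tmul c) & dird e0 (tmul c) = c].
Proof.
move=> ac cc; have [a1 s1] := fun0_form (@smooth_gc R None) ac (sform_cst cc).
split; try by rewrite tmulE.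
  by move=> p q e; apply/funext => s; rewrite /tmul e (cc p q).
apply: dform_eqP => p s.
suff H : is_derive p e0 (fun q : G => tmul c q s : R^o) (c p s).
  exact: (derive_val (is_derive := H)).
apply/is_deriveP => e e0'; exists 1 => // h h0 _.
rewrite /tmul (cc (p + h *: e0) p) /= [h *: _]mulr1 -mulrBl addrAC subrr add0r.
by rewrite mulKf // subrr normr0 ltW.
Qed.

Lemma ins_tmul c : ins e0 c = 0 -> ins e0 (tmul c) = 0.
Proof.
move=> ic; apply: dform_eqP => p s; rewrite /ins /tmul.
by rewrite -[c p _]/(ins e0 c p s) ic mulr0.
Qed.

Lemma pt_tmul u c : pt u c = c -> pt u (tmul c) = tmul c + u *: c.
Proof.
move=> uc; apply: dform_eqP => p s; rewrite pullback_tauE /tmul dformDE dformZE.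
by rewrite -{2 3}uc pullback_tauE -mulrDl.
Qed.

Definition Sinv k c := [/\ altf k c, cst c & pt tbar c = c].

Lemma Oinv_cst c : cst c -> pt tbar c = c -> Oinv c.
Proof. by move=> cc tc; split=> //; apply/Linv_yconst/yconst_cst. Qed.

Hypotheses (tbar0 : tbar != 0) (lL : is_lattice L) (Lflow : flow B tbar @` L = L)
  (nB : B *m B^T = B^T *m B).

Let L0 : L 0. Proof. by case: lL => -[]. Qed.

(* [w = a + dt b] with [a] constant; [b] differs from a constant invariant form by
   the derivative of an invariant one. *)
Lemma yconst_cocycle k w : altf k w -> sform w -> Oinv w -> yconst w -> extd w = 0 ->
  exists2 c, Sinv k c & @coboundary R Om k (w - c).
Proof.
move=> aw sw [_ tw] yw dw.
pose b1 := ins e0 w; pose a0 := w - dtf ∧ b1.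
have sb1 : sform b1 by exact: sform_ins.
have yb1 : yconst b1 by exact: yconst_ins.
have ib1 : ins e0 b1 = 0 by exact: altf_insins aw.
have tb1 : pt tbar b1 = b1 by rewrite -ins_pt tw.
have sdb : sform (dtf ∧ b1) by apply: sform_wedge => //; exact: sform_dtf.
have sa0 : sform a0 by exact: sformB.
have ya0 : yconst a0 by apply: yconstB => //; apply: yconst_wedge.
have e0dtf : ins e0 dtf = @form1 R G by rewrite ins_covf scale1r.
have ia0 : ins e0 a0 = 0.
  by rewrite /a0 insD insN ins_wedge ib1 wedge0r addr0 e0dtf wedge1l -/b1 subrr.
have ta0 : pt tbar a0 = a0.
  by rewrite /a0 pullbackD pullbackN pullback_wedge pt_dtf tb1 tw.
have da0 : dird e0 a0 = 0.
  have dE : dird e0 (dtf ∧ b1) = dtf ∧ dird e0 b1.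
    rewrite dird_wedge //; last exact: sform_dtf.
    by rewrite (dird_const e0 cst_dtf) wedge0l add0r.
  have := congr1 (ins e0) (etrans (esym (extd_yconst sw yw)) dw).
  rewrite ins_wedge e0dtf wedge1l sgn_dtf wedgeNl => H.
  rewrite /a0 dirdD ?dirdN // ?dE //; last exact: sformN.
have ca0 : cst a0 by exact: cst_of_dird.
case: k aw => [|k] aw.
  exists a0.
    split=> //; rewrite /a0 /b1 (ofdeg0_ins _ aw) wedge0r subr0.
    exact: aw.
  by rewrite /a0 /b1 (ofdeg0_ins _ aw) wedge0r subr0 subrr.
have ab1 : altf k b1 by exact: altf_ins.
have [b [ab sb yb ib db]] := primitive_form ab1 sb1 yb1 ib1.
have [apt spt _] := tau_form B tbar ab sb.
(* The change of b over one period is constant in t because b1 is invariant; its class modulo the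
   image of D obstructs making b invariant by a constant correction. *)
pose kk := pt tbar b - b.
have ykk : yconst kk.
  exact: (yconstB (yconst_pt tbar yb) yb).
have skk : sform kk by exact: sformB.
have ckk : cst kk.
  apply: cst_of_dird => //; rewrite /kk dirdD ?dirdN //; last exact: sformN.
  by rewrite dird_pt // db tb1 subrr.
pose T : set dform := [set c | [/\ altf k c, cst c & ins e0 c = 0]].
have sT : subsp T.
  split=> [|a x y [x1 x2 x3] [y1 y2 y3]]; first by split=> //; exact: altf0.
  split; [exact: altf_comb|exact: cst_comb|].
  by rewrite insD insZ x3 y3 scaler0 addr0.
have [|||c0 [c1 [[ac0 cc0 ic0] [ac1 cc1 ic1] Dc0 kE]]] :=
  @fitting R B tbar nB k T kk sT.
- move=> x [x1 x2 x3]; split.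
  + by apply: altfD; [exact: altf_plin|exact: altfN].
  + rewrite -(scale1r (plin _ _)) -(scaleN1r x); apply: cst_comb; first exact: cst_plin.
    by rewrite -[_ *: _]addr0; exact: cst_comb.
  + rewrite insD insN ins_plin x3.
    have -> : lin (phi B (- tbar)) e0 = e0 by rewrite /lin mul0mx.
    by rewrite x3 subr0.
- by move=> x [].
- split=> //; first by apply: altfD => //; exact: altfN.
  by rewrite insD insN ins_pt ib [pt _ 0]/(0 : dform) subr0.
have tc0 : pt tbar c0 = c0 by rewrite pt_plin //; apply/eqP; rewrite -subr_eq0; apply/eqP.
(* t c2 grows by c0 over one period. Together with c1 it compensates kk and leaves the invariant
   form [be], whose t-derivative is b1 - c2. *)
pose c2 := tbar^-1 *: c0.
have cZ (a : R) c : cst c -> cst (a *: c).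
  by move=> cc; rewrite -[_ *: _]addr0; exact: cst_comb.
have cc2 : cst c2 by exact: cZ.
have ac2 : altf k c2 by exact: altfZ.
have tc2 : pt tbar c2 = c2 by rewrite pullbackZ tc0.
have [atm stm ytm dtm] := tmul_form ac2 cc2.
pose be := b - tmul c2 - c1.
have sc1 := sform_cst cc1.
have sbe : sform be by do !apply: sformB.
have ybe : yconst be.
  apply: yconstB; last exact: yconst_cst.
  by apply: yconstB.
have abe : altf k be by apply: altfD; [apply: altfD => //; exact: altfN|exact: altfN].
have tbe : pt tbar be = be.
  apply/eqP; rewrite -subr_eq0; apply/eqP.
  have -> : pt tbar be - be = kk - (pt tbar (tmul c2) - tmul c2) - (pt tbar c1 - c1).
    rewrite /be /kk !pullbackD !pullbackN.
    have id6 (x y z x' y' z' : dform) : x - y - z - (x' - y' - z') = x - x' - (y - y') - (z - z').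
      by apply: dform_eqP => p s; rewrite !dformE; ring.
    exact: id6.
  have E1 : pt tbar (tmul c2) - tmul c2 = c0.
    by rewrite (pt_tmul tc2) addrAC subrr add0r /c2 scalerA mulfV // scale1r.
  by rewrite E1 (pt_plin _ _ cc1) kE [c0 + _]addrC addrK subrr.
have dbe : dird e0 be = b1 - c2.
  rewrite /be -[b - _ - _]/(b - tmul c2 + - c1).
  rewrite dirdD ?dirdN //; [|exact: sformB|exact: sformN].
  rewrite dirdD ?dirdN //; last exact: sformN.
  by rewrite db dtm (dird_const e0 cc1) subr0.
exists (a0 + dtf ∧ c2).
  split.
  - apply: altfD; last exact: (altf_wedge (altf_dtf R) ac2).
    by apply: altfD => //; apply: altfN; exact: (altf_wedge (altf_dtf R) ab1).
  - by rewrite -(scale1r a0); apply: cst_comb => //; exact: cst_wedge.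
  - by rewrite pullbackD ta0 pullback_wedge pt_dtf tc2.
exists be.
  by apply/(Om_homP _ _ L0); split=> //; split=> //; exact: Linv_yconst.
rewrite -[LHS]/(extd be) extd_yconst // dbe /a0.
rewrite wedgeDr wedgeNr; apply: dform_eqP => p s; rewrite !dformE; ring.
Qed.

(** After averaging, the primitive h depends on t only and c = dt wedge h'. The fibre part b of h
    has derivative c1, the contraction of c with the time vector, so e = b - t c1 is constant and, b
    being invariant, D e = - tbar c1. This is killed by D, so [ker_sq] gives c1 = 0; then h' is
    divisible by dt and c = 0. *)
Lemma exact_const0 k c : Sinv k c -> @coboundary R Om k c -> c = 0.
Proof.
move=> [ac cc tc]; case: k ac => [|k] ac //= [eta /(Om_homP _ _ L0)[aeta seta ieta] deta].
have [ls lsL sp] := lattice_spans lL.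
pose h := avgs (map (@fb R) ls) eta.
have sh : sform h by exact: sform_avgs.
have ah : altf k h by exact: altf_avgs.
have yh : yconst h by apply: (yconst_avgs lsL) => //; case: ieta.
have [_ th] : Oinv h by exact: Oinv_avgs.
have dh : extd h = c.
  rewrite /h extd_avgs // [extd eta]deta; apply: avgs_yconst; exact: yconst_cst.
pose b := h - dtf ∧ ins e0 h.
have sih : sform (ins e0 h) by exact: sform_ins.
have sdh : sform (dtf ∧ ins e0 h) by apply: sform_wedge => //; exact: sform_dtf.
have sb : sform b by exact: sformB.
have e0dtf : ins e0 dtf = @form1 R G by rewrite ins_covf scale1r.
have cE : c = dtf ∧ dird e0 h by rewrite -dh extd_yconst.
have icE : ins e0 c = dird e0 b.
  rewrite {1}cE ins_wedge e0dtf wedge1l sgn_dtf wedgeNl /b dirdD ?dirdN //; last exact: sformN.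
  rewrite dird_wedge //; last exact: sform_dtf.
  by rewrite (dird_const e0 cst_dtf) wedge0l add0r.
set c1 := ins e0 c in icE.
have ac1 : altf k c1 by exact: altf_ins.
have cc1 : cst c1 by exact: cst_ins.
have tc1 : pt tbar c1 = c1 by rewrite -ins_pt tc.
have [atm stm ytm dtm] := tmul_form ac1 cc1.
have ab : altf k b.
  apply: altfD => //; apply: altfN; case: k ah {ac aeta ac1 atm} => [|k] ah.
    by rewrite (ofdeg0_ins _ ah) wedge0r; exact: altf0.
  exact: (altf_wedge (altf_dtf R) (altf_ins e0 ah)).
pose e := b - tmul c1.
have se : sform e by exact: sformB.
have ae : altf k e by apply: altfD => //; exact: altfN.
have ye : yconst e.
  apply: yconstB => //; apply: yconstB => //; apply: yconst_wedge => //; exact: yconst_ins.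
have ce : cst e.
  apply: cst_of_dird => //; rewrite /e dirdD ?dirdN //; last exact: sformN.
  by rewrite dtm icE subrr.
have tb : pt tbar b = b.
  by rewrite /b pullbackD pullbackN pullback_wedge pt_dtf -ins_pt th.
have De : plin (phi B (- tbar)) e - e = - (tbar *: c1).
  rewrite -(pt_plin _ _ ce) /e pullbackD pullbackN tb pt_tmul //.
  by apply: dform_eqP => p s; rewrite !dformE; ring.
have : plin (phi B (- tbar)) e - e = 0.
  apply: (ker_sq nB ae ce); rewrite De.
  have -> : plin (phi B (- tbar)) (- (tbar *: c1)) = - (tbar *: plin (phi B (- tbar)) c1) by [].
  by rewrite -(pt_plin _ _ cc1) tc1 subrr.
rewrite De => /eqP; rewrite oppr_eq0 scaler_eq0 (negbTE tbar0) /= => /eqP c10.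
have dhE : dird e0 h = dtf ∧ ins e0 (dird e0 h).
  have : ins e0 c = 0 by rewrite -/c1 c10.
  rewrite {1}cE ins_wedge e0dtf wedge1l sgn_dtf wedgeNl => /eqP.
  by rewrite subr_eq0 => /eqP.
by rewrite cE dhE dtf_dtf_w.
Qed.

End TimeAnalysis.

(** * Formality when B is normal *)

Section FormAlg.
Variables (R : realType).
Local Notation G := (Gtype R).
Local Notation dform := (dform G).
Local Notation gb := (gb R).
Implicit Types (w c : dform) (p q u v : G) (s : seq G).

Lemma Om_alg B tbar L : is_alg (@Om R B tbar L).
Proof.
split; [exact: wedge_linl|exact: wedge_linr|exact: wedgeA|exact: wedge1l|exact: wedge1r].
Qed.

Definition gdot u v : R := \sum_i gc i u * gc i v.

Lemma gdotC u v : gdot u v = gdot v u.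
Proof. by apply: eq_bigr => i _; rewrite mulrC. Qed.

Lemma gdot_combl (a : R) u v (w : G) : gdot (a *: u + v) w = a * gdot u w + gdot v w.
Proof.
rewrite /gdot mulr_sumr -big_split; apply: eq_bigr => i _.
by rewrite gc_comb mulrDl mulrA.
Qed.

Lemma gdot_eq0 v : gdot v v = 0 -> v = 0.
Proof.
move=> H; apply: gc_eqP => i; rewrite gc0; apply/eqP; rewrite -sqrf_eq0 expr2; apply/eqP.
by apply: (psumr_eq0P _ H) => // j _; rewrite -expr2 sqr_ge0.
Qed.

Lemma gdot_gb i v : gdot (gb i) v = gc i v.
Proof.
rewrite /gdot (bigD1 i) //= gc_gb eqxx mul1r big1 ?addr0 // => j ji.
by rewrite gc_gb (negbTE ji) mul0r.
Qed.

Lemma gdot_lin (P : 'M[R]_5) u v : gdot (lin P u) v = gdot u (lin P^T v).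
Proof.
have linT i j : gc j (lin P (gb i)) = gc i (lin P^T (gb j)).
  by case: i j => [i|] [j|] //=; rewrite ?mul0mx -?rowE !mxE.
have lcE P' x i : gc i (lin P' x) = \sum_j gc j x * gc i (lin P' (gb j)).
  rewrite {1}(g_decomp x); elim: index_enum => [|j r IH].
    by rewrite !big_nil /lin mul0mx; exact: gc0.
  by rewrite !big_cons lin_comb gc_comb IH.
rewrite /gdot; under eq_bigr do rewrite lcE mulr_suml.
under [RHS]eq_bigr do rewrite lcE mulr_sumr.
rewrite exchange_big; apply: eq_bigr => j _; apply: eq_bigr => i _.
by rewrite linT mulrAC mulrA.
Qed.

(** The one-form dual to e for the Euclidean product, normalised to be 1 on e. *)
Definition eta e : dform := covf (fun v => gdot v e / gdot e e).

Lemma altf_eta e : altf 1 (eta e).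
Proof. by apply: altf_covf => a u v; rewrite gdot_combl mulrDl mulrA. Qed.

Lemma ins_eta v e : ins v (eta e) = (gdot v e / gdot e e) *: @form1 R G.
Proof. exact: ins_covf. Qed.

Definition monomial (t : seq (option 'I_5)) : dform :=
  foldr (fun i w => covf (@gc R i) ∧ w) (@form1 R G) t.

(** Enumerates the products of coordinate forms, to supply the countable spanning family required by
    [minimal_model_exists]; an invalid code gives the empty product. *)
Definition monomials (m : nat) : dform := monomial (odflt [::] (unpickle m)).

Lemma cstB c c' : cst c -> cst c' -> cst (c - c').
Proof. by move=> cc cc' p q; apply/funext => s; rewrite !dformE (cc p q) (cc' p q). Qed.

Lemma const0 (x : dform) : altf 0 x -> cst x -> x = x 0 [::] *: @form1 R G.
Proof.
move=> ax cx; apply: dform_eqP => p [|v s]; rewrite dformZE /form1 /=.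
  by rewrite mulr1 (cx p 0).
by rewrite mulr0 ax.
Qed.

Lemma const_words n (x : dform) : altf n x -> cst x -> lspan (range monomials) x.
Proof.
have sW := subsp_lspan (range monomials).
have Ww t : lspan (range monomials) (monomial t).
  by apply: lspan_gen; exists (pickle t) => //; rewrite /monomials pickleK.
elim: n x => [|n IH] x ax cx.
  by rewrite (const0 ax cx); apply: subspZ => //; exact: (Ww [::]).
have -> : x = n.+1%:R^-1 *: \sum_i covf (@gc R i) ∧ ins (gb i) x.
  by rewrite -(Euler ax) scalerA mulVf ?scale1r // pnatr_eq0.
apply: subspZ => //; apply: subsp_sum => // i _.
have := IH _ (altf_ins (gb i) ax) (cst_ins (gb i) cx).
apply: (@lspan_sub _ _ _ (fun w => lspan (range monomials) (covf (@gc R i) ∧ w))).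
  split=> [|a y z hy hz]; first by rewrite wedge0r; case: sW.
  by rewrite wedgeDr wedgeZr; case: sW => _; apply.
move=> _ [m _ <-]; exact: (Ww (i :: odflt [::] (unpickle m))).
Qed.

End FormAlg.

Section Formality.
Variables (R : realType) (B : 'M[R]_5) (tbar : R) (L : set 'rV[R]_5).
Hypotheses (tbar0 : tbar != 0) (lL : is_lattice L) (Lflow : flow B tbar @` L = L)
  (nB : B *m B^T = B^T *m B).
Local Notation G := (Gtype R).
Local Notation dform := (dform G).
Local Notation gb := (gb R).
Local Notation pt u := (pullback (tau B u)).
Local Notation Om := (Om B tbar L).
Local Notation Sinv := (Sinv B tbar).
Local Notation N := (phi B (- tbar)).
Implicit Types (w c : dform) (p q u v e : G) (s : seq G) (E : seq G).

Let L0 : L 0. Proof. by case: lL => -[]. Qed.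

Definition SE E n : set Om := [set c | Sinv n c /\ forall e, e \in E -> ins e c = 0].

Lemma subsp_SE E n : subsp (SE E n).
Proof.
split=> [|a x y [[x1 x2 x3] x4] [[y1 y2 y3] y4]].
  by split=> //; split=> //; exact: altf0.
split; first split; [exact: altf_comb|exact: cst_comb|by rewrite pullbackD pullbackZ x3 y3|].
by move=> e eE; rewrite insD insZ x4 // y4 // scaler0 addr0.
Qed.

Lemma SE_mul E (p q : nat) (x y : Om) : SE E p x -> SE E q y -> SE E (p + q)%N (dgmul x y).
Proof.
move=> [[x1 x2 x3] x4] [[y1 y2 y3] y4]; split; first split.
- exact: altf_wedge.
- exact: cst_wedge.
- by rewrite -[dgmul x y]/(x ∧ y) pullback_wedge x3 y3.
- by move=> e eE; rewrite ins_wedge x4 // y4 // wedge0l wedge0r addr0.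
Qed.

(** The first condition makes contraction with e preserve invariance, the second makes the dual form
    [eta e] invariant. *)
Definition fixed e := lin N e = e /\ lin N^T e = e.

Fixpoint good E : Prop :=
  if E is e :: E' then
    [/\ fixed e, gdot e e != 0, forall e', e' \in E' -> gdot e e' = 0 & good E']
  else True.

Lemma Sinv_eta e : fixed e -> Sinv 1 (eta e).
Proof.
move=> [_ fe]; split=> //; first exact: altf_eta.
apply: dform_eqP => p [|v [|u s]]; rewrite pullback_tauE //= /eta /=.
by congr (_ / _); rewrite -[RHS](congr1 (gdot v) fe) -gdot_lin.
Qed.

Lemma Sinv_ins n e c : fixed e -> Sinv n.+1 c -> Sinv n (ins e c).
Proof.
move=> [fe _] [ac cc tc]; split; [exact: altf_ins|exact: cst_ins|].
rewrite -{2}tc (ins_pullback_affine (tau_affine B tbar)).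
by congr (pullback _ (ins _ c)); rewrite -{1}fe.
Qed.

(** A form c is (c - eta wedge its contraction with e) plus eta wedge that contraction;
    orthogonality to e keeps both pieces killed by the vectors of E. *)
Lemma SE_cons e E : good (e :: E) -> S_adj (SE (e :: E)) (eta e) = SE E.
Proof.
move=> [fe ee eE gE]; apply/funext => n; apply/seteqP.
have eta_e : ins e (eta e) = @form1 R G by rewrite ins_eta divff // scale1r.
have eta_E e' : e' \in E -> ins e' (eta e) = 0.
  by move=> e'E; rewrite ins_eta gdotC eE // mul0r scale0r.
have sgn_eta : sgn (eta e) = - eta e.
  by rewrite (ofdeg_sgn (altf_deg (altf_eta e))) expr1 scaleN1r.
have [a1 c1 t1] := Sinv_eta fe.
have H m (s' : Om) : SE (e :: E) m s' -> SE E m.+1 (eta e ∧ s').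
  move=> [[as' cs' ts'] H]; split; first split.
  - exact: (altf_wedge a1 as').
  - exact: cst_wedge.
  - by rewrite pullback_wedge t1 ts'.
  - move=> e' e'E; rewrite ins_wedge eta_E // wedge0l add0r H ?wedge0r //.
    by rewrite inE e'E orbT.
have H0 m (s' : Om) : SE (e :: E) m s' -> SE E m s'.
  by move=> [S1 S2]; split=> // e' e'E; apply: S2; rewrite inE e'E orbT.
split=> [_ [s [s' [Ss Ss' ->]]]|c [Sc cE]].
  apply: (subspD (subsp_SE E n)); first exact: H0.
  case: n Ss Ss' => [|n] Ss Ss'; last exact: H.
  by rewrite Ss' -[dgmul _ _]/(eta e ∧ 0) wedge0r; case: (subsp_SE E 0).
have ac : altf n c by case: Sc.
have swap e' : e' \in E -> ins e' (ins e c) = 0.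
  by move=> e'E; rewrite (altf_swap _ _ ac) cE // oppr0.
exists (c - eta e ∧ ins e c), (ins e c); split; last by rewrite [dgmul _ _]/(eta e ∧ ins e c) subrK.
  case: n Sc cE ac => [|n] Sc cE ac.
    rewrite (ofdeg0_ins _ ac) wedge0r subr0; split=> // e'.
    by rewrite inE => /orP[/eqP->|]; [exact: ofdeg0_ins|exact: cE].
  have Si := Sinv_ins fe Sc.
  have [ai ci ti] := Si; have [_ cc tc] := Sc; split; first split.
  - by apply: altfD => //; apply: altfN; exact: (altf_wedge a1 ai).
  - exact: (cstB cc (cst_wedge c1 ci)).
  - by rewrite pullbackD pullbackN pullback_wedge t1 ti tc.
  - move=> e'; rewrite inE insD insN ins_wedge => /orP[/eqP->|e'E].
      by rewrite eta_e wedge1l (altf_insins _ ac) wedge0r addr0 subrr.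
    by rewrite eta_E // wedge0l add0r swap // wedge0r cE // subr0.
case: n Sc cE ac => [|n] Sc cE ac; first exact: ofdeg0_ins.
split; first exact: Sinv_ins.
by move=> e'; rewrite inE => /orP[/eqP->|]; [exact: altf_insins ac|exact: swap].
Qed.

Lemma good_nth E i k : good E -> (i < size E)%N -> (k < size E)%N -> i != k ->
  gdot (nth 0 E i) (nth 0 E k) = 0.
Proof.
elim: E i k => [|e E IH] [|i] [|k] //= [_ _ eE gE] iE kE ik.
- by apply: eE; exact: mem_nth.
- by rewrite gdotC; apply: eE; exact: mem_nth.
- exact: IH.
Qed.

Lemma good_nth0 E i : good E -> (i < size E)%N -> gdot (nth 0 E i) (nth 0 E i) != 0.
Proof. by elim: E i => [|e E IH] [|i] //= [_ ee _ gE] iE //; exact: IH. Qed.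

(** Pairwise orthogonal vectors of nonzero length are the rows of a matrix of full row rank with six
    columns. *)
Lemma good_size E : good E -> (size E <= #|{: option 'I_5}|)%N.
Proof.
move=> gE; pose M := \matrix_(i < size E, j < #|{: option 'I_5}|) gc (enum_val j) (nth 0 E i).
suff /eqP <- : row_free M by exact: rank_leq_col.
rewrite -kermx_eq0; apply/eqP/row_matrixP => k; rewrite row0.
set x := row k (kermx M).
have xM : x *m M = 0 by rewrite /x -row_mul mulmx_ker row0.
clearbody x.
apply/rowP => i; rewrite [RHS]mxE; apply/eqP.
have : x 0 i * gdot (nth 0 E i) (nth 0 E i) = 0.
  transitivity (\sum_j (x *m M) 0 j * gc (enum_val j) (nth 0 E i)); last first.
    by rewrite xM big1 // => j _; rewrite mxE mul0r.
  under eq_bigr do rewrite mxE mulr_suml.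
  rewrite exchange_big /= (bigD1 i) //= [X in _ = _ + X]big1 ?addr0.
    rewrite /gdot mulr_sumr [LHS](reindex (@enum_val _ {: option 'I_5})) /=; last first.
      by apply: onW_bij; exact: enum_val_bij.
    by apply: eq_bigr => j _; rewrite mxE mulrA.
  move=> i' i'i; transitivity (x 0 i' * gdot (nth 0 E i') (nth 0 E i)).
    rewrite /gdot mulr_sumr [RHS](reindex (@enum_val _ {: option 'I_5})) /=; last first.
      by apply: onW_bij; exact: enum_val_bij.
    by apply: eq_bigr => j _; rewrite mxE mulrA.
  by rewrite good_nth // mulr0.
by move/eqP; rewrite mulf_eq0 (negbTE (good_nth0 gE (ltn_ord i))) orbF.
Qed.

(** Take E of maximal length. A one-form in [SE E] is dual to a vector v orthogonal to E. Invariance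
    of the form gives one half of [fixed v], normality through [ker_adjoint] the other, so a nonzero
    v would extend E. *)
Lemma good_max : exists2 E, good E & forall c : Om, SE E 1 c -> c = 0.
Proof.
pose P n := `[< exists2 E, good E & size E = n >].
have [||m /asboolP[E gE sE] mmax] := @ex_maxnP P #|{: option 'I_5}|.
- by exists 0%N; apply/asboolP; exists [::].
- by move=> n /asboolP[E gE <-]; exact: good_size.
exists E => // c [[ac cc tc] cE].
pose v : G := \sum_i c 0 [:: gb i] *: gb i.
have gcv i : gc i v = c 0 [:: gb i] by rewrite gc_sum.
have cv u : c 0 [:: u] = gdot u v.
  transitivity (ins (\sum_i gc i u *: gb i) c 0 [::]); first by rewrite -g_decomp.
  rewrite (altf_ins_sum _ _ _ ac) sum_dformE /gdot; apply: eq_bigr => i _.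
  by rewrite dformZE gcv.
have Dc : plin N c - c = 0 by rewrite -(pt_plin _ _ cc) tc subrr.
have D'c := ker_adjoint nB ac cc Dc.
have inj x y : (forall u, gdot u x = gdot u y) -> x = y.
  by move=> H; apply: gc_eqP => i; rewrite -!gdot_gb.
have fv : fixed v.
  split; apply: inj => u.
    rewrite -{1}(trmxK N) -gdot_lin -!cv.
    move/eqP: D'c; rewrite subr_eq0 => /eqP/(congr1 (fun f : dform => f 0 [:: u])).
    by [].
  rewrite -gdot_lin -!cv.
  move/eqP: Dc; rewrite subr_eq0 => /eqP/(congr1 (fun f : dform => f 0 [:: u])).
  by [].
have vE e : e \in E -> gdot v e = 0.
  move=> eE; rewrite gdotC -cv.
  exact: (congr1 (fun f : dform => f 0 [::]) (cE e eE)).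
have /eqP/gdot_eq0 v0 : gdot v v == 0.
  apply: contraT => vv; have : good (v :: E) by [].
  move=> gvE; have := mmax (size (v :: E)); rewrite /= sE ltnn.
  by apply; apply/asboolP; exists (v :: E) => //=; rewrite sE.
apply: dform_eqP => p [|u [|u' s]]; rewrite (cc p 0).
- by case: ac => ->.
- by rewrite cv v0 /gdot big1 // => i _; rewrite gc0 mulr0.
- exact: (altf_deg ac).
Qed.

(** Each vector of E in turn is released, and its dual form is adjoined to the model as a closed
    generator of degree one. *)
Lemma SE_model E : good E -> (exists (M : dgdata R) (f : M -> Om), minimal_cdga M /\ qi (SE E) f) ->
  exists (M : dgdata R) (f : M -> Om), minimal_cdga M /\ qi (SE [::]) f.
Proof.
elim: E => [|e E IH] // gE [M [f [mM qf]]]; apply: IH; first by case: gE.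
have [fe ee eE _] := gE.
have de : ofdeg 1 (eta e) by exact: altf_deg (altf_eta e).
have eta_e : ins e (eta e) = @form1 R G by rewrite ins_eta divff // scale1r.
rewrite -(SE_cons gE); apply: (adjoin_odd (Om_alg B tbar L) mM qf).
- exact: wedge_self1.
- move=> n s [[as_ _ _] _]; rewrite -[LHS]/(s ∧ eta e) (wedgeC (altf_deg as_) de) muln1.
  by [].
- move=> n s s' [[as_ cs _] sE] Ss' H.
  have s'0 : s' = 0.
    case: n as_ Ss' => [//|n] as_ [[as' _ _] s'E].
    have := congr1 (ins e) H; rewrite -[dgmul _ _]/(eta e ∧ s') insD ins_wedge.
    rewrite sE ?inE ?eqxx // s'E ?inE ?eqxx // wedge0r addr0 add0r eta_e wedge1l.
    by [].
  by move: H; rewrite s'0 -[dgmul _ _]/(eta e ∧ 0) wedge0r addr0.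
Qed.

Lemma Om_model : exists (M : dgdata R) (f : M -> Om), minimal_cdga M /\ qi (SE [::]) f.
Proof.
have [E gE E1] := good_max; apply: (SE_model gE).
apply: (@minimal_model_exists R Om (SE E) (@monomials R)).
- exact: Om_alg.
- exact: subsp_SE.
- exact: SE_mul.
- by move=> p q x y [[ax _ _] _] [[ay _ _] _]; exact: wedgeC (altf_deg ax) (altf_deg ay).
- by split=> //; split=> //; [exact: altf_form1|exact: pullback_form1].
- by move=> x [[ax cx _] _]; exists ((x : dform) 0 [::]); exact: const0.
- by apply/eqP => /(congr1 (fun f : dform => f 0 [::])) /eqP; rewrite /= oner_eq0.
- exact: E1.
- by move=> n x [[ax cx _] _]; exact: const_words ax cx.
Qed.

Theorem Om_formal : formal Om.
Proof.
have [M [f [mM qf]]] := Om_model.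
apply: (qi_formal (@subsp_SE [::]) mM qf).
- move=> n w [[as_ cs ts] _]; apply/(Om_homP _ _ L0); split=> //; first exact: sform_cst.
  exact: Oinv_cst.
- move=> n c Sc c0 i i_n; apply: dform_eqP => p s.
  have deg j : ofdeg j (c j) by apply: altf_deg; case: (Sc j) => -[].
  have [si|si] := eqVneq (size s) i; last by apply: deg; exact/eqP.
  have := congr1 (fun f : dform => f p s) c0; rewrite sum_dformE.
  rewrite (bigD1 (Ordinal i_n)) //= big1 ?addr0 // => j ji; apply: deg => sj.
  by case/negP: ji; apply/eqP/val_inj; rewrite /= -si.
- move=> s Ss; apply: extd_const.
  have cS : subsp (@cst R : set Om).
    by split=> // a x y; exact: cst_comb.
  by apply: (@lspan_sub _ _ _ _ s cS _ Ss) => x [n _ [[_ cx _] _]].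
- by move=> n s [Ss _]; exact: (exact_const0 tbar0 lL Lflow nB Ss).
move=> n w [/(Om_homP _ _ L0)[aw sw iw] dw].
have [w' [[aw' sw' iw' yw' dw'] ww']] := fiberize tbar0 lL Lflow aw sw iw dw.
have [c Sc w'c] := yconst_cocycle tbar0 lL nB aw' sw' iw' yw' dw'.
exists c; first by split.
have -> : w - c = (w - w') + (w' - c) by rewrite addrA subrK.
case: n {aw aw' Sc} ww' w'c => [|n] /=; first by move=> -> ->; rewrite addr0.
move=> [x /(Om_homP _ _ L0)[ax sx ix] <-] [y /(Om_homP _ _ L0)[ay sy iy] <-].
exists (x + y); last exact: extdD.
by apply/(Om_homP _ _ L0); split; [exact: altfD|exact: sformD|exact: OinvD].
Qed.

End Formality.

(** * From straightened coordinates back to the group *)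

Section Transport.
Variables (K : realFieldType) (A A' : dgdata K) (f : A' -> A) (g : A -> A').
Hypotheses (lf : linear f) (lg : linear g) (f1 : f (dgone A') = dgone A)
  (fM : forall x y, f (dgmul x y) = dgmul (f x) (f y))
  (fh : forall n x, dghom n x -> dghom n (f x))
  (gh : forall n x, dghom n x -> dghom n (g x))
  (fd : forall x, lspan (\bigcup_n @dghom K A' n) x -> f (dgdiff x) = dgdiff (f x))
  (gd : forall n x, dghom n x -> g (dgdiff x) = dgdiff (g x))
  (fg : forall n x, dghom n x -> f (g x) = x)
  (gf : forall n x, dghom n x -> g (f x) = x).

(** The model is kept and its map to A' is composed with f. Compatibility with d is asked only on
    homogeneous elements or their span, since the ambient spaces also contain non-smooth forms. *)
Lemma formal_transport : formal A' -> formal A.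
Proof.
move=> [M [[[dM mM] [h [[[lh hh h1 hM] hd] qh]]] fM_]]; exists M; split=> //; split=> //.
have cM := cdga_cga dM; have gM := cga_graded cM.
have fdh n x : dghom n x -> f (dgdiff x) = dgdiff (f x).
  by move=> hx; apply: fd; apply: lspan_gen; exists n.
exists (fun x => f (h x)); split; first split.
- split=> [a x y|n x hx||x y]; [by rewrite lh lf|by apply/fh/hh|by rewrite h1 f1|].
  by rewrite hM fM.
- move=> x; rewrite hd fd //; move: x; apply: (graded_ind gM) => [|n x y hx IH].
    by rewrite (linear0E lh); exact: lspan0.
  rewrite (linearDE _ _ lh); apply: (subspD (subsp_lspan _)) => //.
  by apply: lspan_gen; exists n => //; exact: hh.
move=> n; have [qi qs] := qh n; split=> [z zc|w [hw dw]].
  move=> H; apply: (qi z zc); have [hz _] := zc.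
  case: n {qi qs} zc hz H => [|n] zc hz /=.
    by move=> E; rewrite -(gf (hh _ _ hz)) E (linear0E lg).
  move=> [y hy dy]; exists (g y); first exact: gh.
  by rewrite -(gd hy) dy (gf (hh _ _ hz)).
have gwc : cocycle n (g w).
  by split; [exact: gh|rewrite -(gd hw) dw (linear0E lg)].
have [z zc zw] := qs _ gwc; exists z => //.
have E : w - f (h z) = f (g w - h z) by rewrite (linearBE _ _ lf) (fg hw).
rewrite E; case: n {qi qs hw dw gwc zc} zw => [|n] /=.
  by move=> ->; rewrite (linear0E lf).
by move=> [y hy <-]; exists (f y); [exact: fh|rewrite -(fdh _ _ hy)].
Qed.

End Transport.

Lemma map_chain T (f1 f2 h : T -> T) s : (forall v, f1 (h v) = f2 v) ->
  map f1 (map h s) = map f2 s.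
Proof. by move=> H; elim: s => //= v s ->; rewrite H. Qed.

Section Coordinates.
Variables (R : realType) (B : 'M[R]_5) (tbar : R) (L : set 'rV[R]_5).
Local Notation G := (Gtype R).
Local Notation dform := (dform G).
Local Notation gcoord F := (forall i, smooth (fun p : G => gc i (F p) : R^o)).
Implicit Types (w : dform) (p q u v c : G) (s : seq G).

Lemma pullback_comp (F H : G -> G) w : gcoord F -> gcoord H ->
  pullback H (pullback F w) = pullback (fun p => F (H p)) w.
Proof.
move=> sF sH; apply: dform_eqP => p s.
have sFH j : smooth (fun p : G => gc j (F (H p)) : R^o) by exact: smooth_comp (sF j) sH.
have chain v : 'D_('D_v H p) F (H p) = 'D_v (fun p => F (H p)) p.
  apply: gc_eqP => i.
  have E1 := gc_derive sF i (H p) ('D_v H p).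
  have E2 := derive_pull sH p v (sF i).
  have E3 := gc_derive sFH i p v.
  exact: (etrans E1 (etrans (esym E2) (esym E3))).
have E : [seq 'D_v F (H p) | v <- [seq 'D_v H p | v <- s]] =
    [seq 'D_v (fun p => F (H p)) p | v <- s].
  exact: (@map_chain _ (fun v => 'D_v F (H p)) (fun v => 'D_v (fun p => F (H p)) p) (fun v => 'D_v H p) s chain).
exact: (congr1 (w (F (H p))) E).
Qed.

Lemma pullback_id w : pullback id w = w.
Proof.
have FA : affine_with (id : G -> G) id by [].
by apply: dform_eqP => p s; rewrite (pullback_affineE FA) map_id.
Qed.

(** The diffeomorphism straightening the action: it conjugates the affine maps [Tc c] into right
    translations ([Psi_Tc]). *)
Definition Psi p : G := (p.1, p.2 *m phi B p.1).
Definition Psi' p : G := (p.1, p.2 *m phi B (- p.1)).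

Lemma smooth_coord2 j : smooth (fun p : G => p.2 0 j : R^o).
Proof. exact: (@smooth_gc R (Some j)). Qed.

Lemma smooth_phi1 (C : 'M[R]_5) i j : smooth (fun p : G => phi C p.1 i j : R^o).
Proof. by have := smooth_phi C 1%:M 1%:M i j; under eq_fun do rewrite mul1mx mulmx1. Qed.

Lemma smooth_row_phi (C : 'M[R]_5) (r : G -> 'rV[R]_5) j :
  (forall k, smooth (fun p => r p 0 k : R^o)) -> smooth (fun p => (r p *m phi C p.1) 0 j : R^o).
Proof.
move=> sr; under eq_fun do rewrite mxE.
by apply: smooth_sum => k _; apply: smoothM; [exact: sr|exact: smooth_phi1].
Qed.

Lemma smooth_Psi : gcoord Psi.
Proof.
case=> [j|]; last exact: (@smooth_gc R None).
exact: (smooth_row_phi B j smooth_coord2).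
Qed.

Lemma smooth_Psi' : gcoord Psi'.
Proof.
case=> [j|]; last exact: (@smooth_gc R None).
have := smooth_row_phi (- B) j smooth_coord2.
by rewrite (_ : (fun p : G => _) = (fun p => gc (Some j) (Psi' p))) //;
   apply/funext => p; rewrite /= /phi scalerN -scaleNr.
Qed.

Lemma smooth_Gmul c : gcoord (fun p => Gmul B p c).
Proof.
case=> [j|]; last by apply: smoothD; [exact: (@smooth_gc R None)|exact: smooth_cst].
under eq_fun do rewrite /gc /Gmul /flow /= mxE.
apply: smoothD; first exact: smooth_coord2.
by apply: (smooth_row_phi B j (r := fun=> c.2)) => k; exact: smooth_cst.
Qed.

Lemma smooth_Tc c : gcoord (Tc B c).
Proof. by move=> i; apply: smooth_affine (Tc_affine B c) _ => a u v; exact: tl_comb. Qed.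

Lemma PsiK p : Psi' (Psi p) = p.
Proof. by case: p => t y; rewrite /Psi /Psi' /= -mulmxA phiVN mulmx1. Qed.

Lemma Psi'K p : Psi (Psi' p) = p.
Proof. by case: p => t y; rewrite /Psi /Psi' /= -mulmxA phiNV mulmx1. Qed.

Lemma Psi_Tc c p : Psi (Tc B c p) = Gmul B (Psi p) c.
Proof.
rewrite /Psi /Tc /tau /Gmul /flow /=; congr pair; first by rewrite addr0.
rewrite -mulmxA -phiD (_ : - c.1 + (p.1 + 0 + c.1) = p.1) ?mulmxDl //.
by rewrite addr0 addrC addrK.
Qed.

Local Notation Om := (Om B tbar L).
Local Notation dR := (solvmanifold_deRham B tbar L).

Let Psi_form (F : G -> G) : gcoord F -> forall x, lspan (\bigcup_n (is_form n : set dform)) x ->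
  [/\ sform x, sform (pullback F x) & extd (pullback F x) = pullback F (extd x)].
Proof.
move=> sF x; elim=> [|a y z [n _ /is_formP[ay sy]] _ [sz spz ez]].
  by rewrite [pullback F 0]/(0 : dform) extd0; split=> //; exact: sform0.
have [_ spy ey] := pullback_form_extd sF ay sy.
split; [by apply: sformD => //; exact: sformZ| |].
  by rewrite pullbackD pullbackZ; apply: sformD => //; exact: sformZ.
have say := sformZ a sy; have spay : sform (a *: pullback F y) by exact: sformZ.
by rewrite pullbackD pullbackZ (extdD spay spz) (extdD say sz) (extdZ a spy) (extdZ a sy) ey ez.
Qed.

Let Phi_hom n w : @dghom R Om n w -> @dghom R dR n (pullback Psi' w).
Proof.
move=> [/is_formP[aw sw] H]; split.
  by apply/is_formP; have [] := pullback_form_extd smooth_Psi' aw sw.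
move=> _ [c cG <-]; rewrite pullback_comp; [|exact: smooth_Psi'|exact: smooth_Gmul].
have -> : (fun p => Psi' (Gmul B p c)) = (fun p => Tc B c (Psi' p)).
  by apply/funext => p; rewrite -{1}(Psi'K p) -Psi_Tc PsiK.
rewrite -pullback_comp; [|exact: smooth_Tc|exact: smooth_Psi'].
by rewrite H //; exists c.
Qed.

Let Phi'_hom n w : @dghom R dR n w -> @dghom R Om n (pullback Psi w).
Proof.
move=> [/is_formP[aw sw] H]; split.
  by apply/is_formP; have [] := pullback_form_extd smooth_Psi aw sw.
move=> _ [c cG <-]; rewrite pullback_comp; [|exact: smooth_Psi|exact: smooth_Tc].
have -> : (fun p => Psi (Tc B c p)) = (fun p => (fun q => Gmul B q c) (Psi p)).
  by apply/funext => p; exact: Psi_Tc.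
rewrite -(@pullback_comp (fun q => Gmul B q c) Psi w (@smooth_Gmul c) smooth_Psi).
by rewrite H //; exists c.
Qed.

Let Phi'Phi w : pullback Psi (pullback Psi' w) = w.
Proof.
rewrite pullback_comp; [|exact: smooth_Psi'|exact: smooth_Psi].
by rewrite (_ : (fun p => _) = id) ?pullback_id //; apply/funext => p; exact: PsiK.
Qed.

Let PhiPhi' w : pullback Psi' (pullback Psi w) = w.
Proof.
rewrite pullback_comp; [|exact: smooth_Psi|exact: smooth_Psi'].
by rewrite (_ : (fun p => _) = id) ?pullback_id //; apply/funext => p; exact: Psi'K.
Qed.

Let hom_lspan (T : set (G -> G)) x : lspan (\bigcup_n @dghom R (@deRham R G T) n) x ->
  lspan (\bigcup_n (is_form n : set dform)) x.
Proof. by apply: lspan_mono => y [n _ [fy _]]; exists n. Qed.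

Lemma Om_formal_iff : formal Om <-> formal dR.
Proof.
split; [apply: (@formal_transport R dR Om (pullback Psi') (pullback Psi))|
        apply: (@formal_transport R Om dR (pullback Psi) (pullback Psi'))].
- exact: pullback_lin.
- exact: pullback_lin.
- exact: pullback_form1.
- exact: pullback_wedge.
- exact: Phi_hom.
- exact: Phi'_hom.
- by move=> x /hom_lspan /(Psi_form smooth_Psi')[].
- by move=> n x [/is_formP[ax sx] _]; have [] := pullback_form_extd smooth_Psi ax sx.
- by move=> n x _; exact: PhiPhi'.
- by move=> n x _; exact: Phi'Phi.
- exact: pullback_lin.
- exact: pullback_lin.
- exact: pullback_form1.
- exact: pullback_wedge.
- exact: Phi'_hom.
- exact: Phi_hom.
- by move=> x /hom_lspan /(Psi_form smooth_Psi)[].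
- by move=> n x [/is_formP[ax sx] _]; have [] := pullback_form_extd smooth_Psi' ax sx.
- by move=> n x _; exact: Phi'Phi.
- by move=> n x _; exact: PhiPhi'.
Qed.

Theorem normal_formal : tbar != 0 -> lattice_for B tbar L -> B *m B^T = B^T *m B ->
  solvmanifold_formal B tbar L.
Proof. by move=> t0 [lL fL] nB; apply/Om_formal_iff; exact: Om_formal. Qed.

End Coordinates.

(** * Normality of the matrices in the formal cases *)

Section Matrices.
Variable R : realType.

Ltac mx5 := let i := fresh in let j := fresh in
  apply/matrixP => i j; rewrite !mxE !big_ord_recr !big_ord0 /= !mxE /=;
  case: i => [[|[|[|[|[|//]]]]] ?] /=; case: j => [[|[|[|[|[|//]]]]] ?] /=; ring.

Lemma B6_8_normal (a b c : R) : B6_8 a b c *m (B6_8 a b c)^T = (B6_8 a b c)^T *m B6_8 a b c.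
Proof. mx5. Qed.

Lemma B6_11_normal (a q s : R) : B6_11 a q s *m (B6_11 a q s)^T = (B6_11 a q s)^T *m B6_11 a q s.
Proof. mx5. Qed.

Lemma B5_17xR_normal (p r : R) : B5_17xR p r *m (B5_17xR p r)^T = (B5_17xR p r)^T *m B5_17xR p r.
Proof. mx5. Qed.

Lemma B3_5xR3_normal : B3_5xR3 R *m (B3_5xR3 R)^T = (B3_5xR3 R)^T *m B3_5xR3 R.
Proof. mx5. Qed.

Lemma listed_neq0 (t : R) : t \in listed_times R -> t != 0.
Proof.
have p0 : (pi : R) != 0 by rewrite gt_eqF // pi_gt0.
by rewrite !inE => /or4P[] /eqP ->; rewrite ?mulf_neq0 ?invr_neq0 ?pnatr_eq0.
Qed.

End Matrices.

(** * Invariant one-forms and the triple Massey product *)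

Section OmHom.
Variables (R : realType) (B : 'M[R]_5) (tbar : R) (L : set 'rV[R]_5).
Hypothesis L0 : L 0.
Local Notation G := (Gtype R).
Local Notation dform := (dform G).
Local Notation pt u := (pullback (tau B u)).
Local Notation Oinv := (Oinv B tbar L).
Local Notation Om := (Om B tbar L).
Local Notation dtf := (@dtf R).
Local Notation e0 := (gb R None).
Implicit Types (w : dform) (p q v : G) (s : seq G).

Definition hm k w : Prop := [/\ altf k w, sform w & Oinv w].

Lemma hmP k w : @dghom R Om k w <-> hm k w.
Proof. exact: Om_homP. Qed.

Lemma hm_comb k (a : R) w w' : hm k w -> hm k w' -> hm k (a *: w + w').
Proof.
move=> [a1 s1 i1] [a2 s2 i2]; split; [exact: altf_comb| |exact: Oinv_comb].
by apply: sformD => //; exact: sformZ.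
Qed.

Lemma hmD k w w' : hm k w -> hm k w' -> hm k (w + w').
Proof. by move=> h h'; rewrite -(scale1r w); exact: hm_comb. Qed.

Lemma hm0 k : hm k 0.
Proof. by split; [exact: altf0|exact: sform0|]. Qed.

Lemma hmZ k (a : R) w : hm k w -> hm k (a *: w).
Proof. by move=> h; rewrite -[_ *: _]addr0; apply: hm_comb => //; exact: hm0. Qed.

Lemma hmN k w : hm k w -> hm k (- w).
Proof. by move=> h; rewrite -(scaleN1r w); exact: hmZ. Qed.

Lemma hmB k w w' : hm k w -> hm k w' -> hm k (w - w').
Proof. by move=> h h'; apply: hmD => //; exact: hmN. Qed.

Lemma hmW k l w w' : hm k w -> hm l w' -> hm (k + l) (w ∧ w').
Proof.
by move=> [a1 s1 i1] [a2 s2 i2]; split; [exact: altf_wedge|exact: sform_wedge|exact: Oinv_wedge].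
Qed.

Lemma hm_sform k w : hm k w -> sform w. Proof. by case. Qed.
Lemma hm_deg k w : hm k w -> ofdeg k w. Proof. by case=> /altf_deg. Qed.

Lemma hm_dtf : hm 1 dtf.
Proof.
split; [exact: altf_dtf|exact: sform_dtf|].
by apply: Oinv_cst; [exact: cst_dtf|exact: pt_dtf].
Qed.

Lemma subsp_Om k : subsp (@dghom R Om k).
Proof.
split=> [|a x y /hmP hx /hmP hy]; first by apply/hmP; exact: hm0.
by apply/hmP; exact: hm_comb.
Qed.

Lemma Om_diff_lin k (a : R) (x y : Om) : dghom k x -> dghom k y ->
  dgdiff (a *: x + y) = a *: dgdiff x + dgdiff y.
Proof.
move=> /hmP[_ sx _] /hmP[_ sy _]; rewrite -[LHS]/(extd (a *: (x : dform) + y)).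
by rewrite (extdD (sformZ a sx) sy) (extdZ a sx).
Qed.

(** In straightened coordinates these are the right-invariant one-forms of G without dt part, the
    functional being the first column of D. [dird_th] turns the t-derivative into multiplication by
    B. *)
Definition liform (D : 'M[R]_5) : dform :=
  fun p s => if s is [:: v] then (v.2 *m phi B p.1 *m D) 0 0 else 0.

Lemma th_lin (a : R) D D' : liform (a *: D + D') = a *: liform D + liform D'.
Proof.
apply: dform_eqP => p [|v [|v' s]]; rewrite dformDE dformZE /liform ?mulr0 ?addr0 //.
by rewrite mulmxDr -scalemxAr !mxE.
Qed.

Lemma th0 : liform 0 = 0.
Proof. by apply: dform_eqP => p [|v [|v' s]] //; rewrite /liform mulmx0 mxE. Qed.

Lemma thN D : liform (- D) = - liform D.
Proof. by have := th_lin (-1) D 0; rewrite th0 !addr0 !scaleN1r. Qed.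

Lemma thD D D' : liform (D + D') = liform D + liform D'.
Proof. by have := th_lin 1 D D'; rewrite !scale1r. Qed.

Lemma altf_th D : altf 1 (liform D).
Proof.
split=> [p|a u v|v|v] //.
- apply: dform_eqP => p [|v' s]; rewrite !dformE /ins /liform /= ?mulr0 ?addr0 //.
  by rewrite !mulmxDl -!scalemxAl !mxE.
- by move=> p [|v' s].
Qed.

Lemma sform_th D : sform (liform D).
Proof.
move=> [|v [|v' s]]; rewrite /liform; [exact: smooth_cst| |exact: smooth_cst].
under eq_fun do rewrite mxE.
apply: smooth_sum => k _; apply: smoothM; last exact: smooth_cst.
by apply: (smooth_row_phi B k (r := fun=> v.2)) => j; exact: smooth_cst.
Qed.

Lemma yconst_th D : yconst (liform D).
Proof. by move=> p q e; rewrite /liform e. Qed.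

Lemma hm_th D : hm 1 (liform D).
Proof.
split; [exact: altf_th|exact: sform_th|split; first by apply: Linv_yconst; exact: yconst_th].
apply: dform_eqP => p s; apply: (etrans (pullback_tauE _ _ _ _ _)).
case: s => [|v [|v' s]]; [by []| |by []].
rewrite -[LHS]/((v.2 *m phi B (- tbar) *m phi B (p.1 + tbar) *m D) 0 0).
rewrite -(mulmxA v.2) -phiD (_ : - tbar + (p.1 + tbar) = p.1) //.
by rewrite addrC addrK.
Qed.

Lemma dird_th D : dird e0 (liform D) = liform (B *m D).
Proof.
apply: dform_eqP => p s; case: s => [|v [|v' s]]; rewrite /dird /liform.
- exact: (derive_val (is_derive := is_derive_cst (0 : R^o) p e0)).
- pose V := \matrix_(i < 5) v.2.
  have VE (M : 'M[R]_5) : (v.2 *m M) 0 0 = (V *m M) 0 0.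
    by rewrite !mxE; apply: eq_bigr => k _; rewrite mxE.
  have H : is_derive p e0 (fun q : G => (v.2 *m phi B q.1 *m D) 0 0 : R^o) ((V *m B *m phi B p.1 *m D) 0 0).
    have -> : (fun q : G => (v.2 *m phi B q.1 *m D) 0 0) = (fun q => (V *m phi B q.1 *m D) 0 0).
      by apply/funext => q; rewrite -!mulmxA VE.
    have := is_derive_fst e0 (is_derive_phi_mul B V D p.1 0 0).
    by rewrite mul1r.
  apply: (etrans (derive_val (is_derive := H))).
  by rewrite -!mulmxA VE !mulmxA -(mulmxA V B) -phiB !mulmxA.
- exact: (derive_val (is_derive := is_derive_cst (0 : R^o) p e0)).
Qed.

Lemma dtf_fb w p (ls : seq 'rV[R]_5) : (dtf ∧ w) p (map (@fb R) ls) = 0.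
Proof.
elim: ls w => [|l ls IH] w; first by rewrite wedge_nil mul0r.
rewrite map_cons -[LHS]/(ins (fb l) (dtf ∧ w) p (map (@fb R) ls)) ins_wedge.
by rewrite ins_fb_dtf wedge0l add0r sgn_dtf wedgeNl dformNE IH oppr0.
Qed.

(** Such a w equals dt wedge its contraction with the time vector, and dt vanishes on fibre
    vectors. *)
Lemma dtf_kernel w p (ls : seq 'rV[R]_5) : dtf ∧ w = 0 -> w p (map (@fb R) ls) = 0.
Proof.
move=> /(congr1 (ins e0)); rewrite ins_wedge ins_covf scale1r wedge1l sgn_dtf wedgeNl => /eqP.
by rewrite subr_eq0 => /eqP ->; exact: dtf_fb.
Qed.

Lemma comm0 k (g w : dform) : hm 0 g -> hm k w -> w ∧ g = g ∧ w.
Proof. by move=> hg hw; rewrite (wedgeC (hm_deg hw) (hm_deg hg)) muln0 expr0 scale1r. Qed.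

Lemma extdW k w w' : hm k w -> sform w' ->
  extd (w ∧ w') = extd w ∧ w' + (-1) ^+ k *: (w ∧ extd w').
Proof.
move=> hw sw'; rewrite (extd_wedge (hm_sform hw) sw') (ofdeg_sgn (hm_deg hw)).
by rewrite wedgeZl.
Qed.

Lemma extdW0 w w' : hm 0 w -> sform w' -> extd (w ∧ w') = extd w ∧ w' + w ∧ extd w'.
Proof. by move=> hw sw'; rewrite (extdW hw sw') expr0 scale1r. Qed.
Lemma extdW1 w w' : hm 1 w -> sform w' -> extd (w ∧ w') = extd w ∧ w' - w ∧ extd w'.
Proof. by move=> hw sw'; rewrite (extdW hw sw') expr1 scaleN1r. Qed.
Lemma extdW2 w w' : hm 2 w -> sform w' -> extd (w ∧ w') = extd w ∧ w' + w ∧ extd w'.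
Proof. by move=> hw sw'; rewrite (extdW hw sw') expr2 mulrNN mulr1 scale1r. Qed.

Lemma const_derive_periodic (f : R -> R) (k : R) : tbar != 0 ->
  (forall t, is_derive t (1 : R) f k) -> f tbar = f 0 -> k = 0.
Proof.
move=> t0 df ft; pose h t := f t - k * t.
have dh (t : R) : is_derive t (1 : R) h 0.
  have -> : 0 = k - k * 1 :> R by rewrite mulr1 subrr.
  by apply: is_deriveB; exact: (is_deriveZ k (is_derive_id t (1 : R))).
have := is_derive_0_is_cst tbar 0 dh; rewrite /h ft mulr0 subr0.
move=> /eqP; rewrite -subr_eq0 addrAC subrr add0r oppr_eq0 mulf_eq0 (negbTE t0) orbF.
by move/eqP.
Qed.

End OmHom.

Section FirstObstruction.
Variables (R : realType) (B : 'M[R]_5) (tbar : R) (L : set 'rV[R]_5).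
Hypotheses (tbar0 : tbar != 0) (lat : lattice_for B tbar L).
Variables (C1 C2 : 'M[R]_5) (l0 : 'rV[R]_5).
Hypotheses (BC1 : B *m C1 = 0) (BC2 : B *m C2 = C1) (l0C : (l0 *m C1) 0 0 = 1).
Local Notation G := (Gtype R).
Local Notation dform := (dform G).
Local Notation pt u := (pullback (tau B u)).
Local Notation Oinv := (Oinv B tbar L).
Local Notation Om := (Om B tbar L).
Local Notation dtf := (@dtf R).
Local Notation e0 := (gb R None).
Local Notation th := (liform B).
Local Notation hm := (hm B tbar L).
Implicit Types (w : dform) (p q v : G) (s : seq G).

Let lL : is_lattice L := proj1 lat.
Let Lflow : flow B tbar @` L = L := proj2 lat.
Let L0 : L 0. Proof. by case: lL => -[]. Qed.

Let a1 := th C1.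
Let a2 := th C2.

Let phiC1 t : phi B t *m C1 = C1.
Proof.
apply/matrixP => i j; pose f (x : R) := (1%:M *m phi B x *m C1) i j.
have df (x : R) : is_derive x (1 : R) f 0.
  have := is_derive_phi_mul B 1%:M C1 x i j.
  by rewrite mul1mx -phiB -mulmxA BC1 mulmx0 mxE.
by have := is_derive_0_is_cst t 0 df; rewrite /f phi0 !mul1mx.
Qed.

Let phiC2 t : phi B t *m C2 = C2 + t *: C1.
Proof.
apply/matrixP => i j; pose f (x : R) := (1%:M *m phi B x *m C2) i j - C1 i j * x.
have df (x : R) : is_derive x (1 : R) f 0.
  have := is_derive_phi_mul B 1%:M C2 x i j.
  rewrite mul1mx -phiB -mulmxA BC2 phiC1 => d.
  have -> : 0 = C1 i j - C1 i j * 1 :> R by rewrite mulr1 subrr.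
  by apply: is_deriveB; exact: (is_deriveZ _ (is_derive_id x (1 : R))).
have := is_derive_0_is_cst t 0 df; rewrite /f phi0 !mul1mx mulr0 subr0 => /eqP.
by rewrite subr_eq => /eqP ->; rewrite !mxE mulrC.
Qed.

Let ca1 : cst a1.
Proof.
move=> p q; apply/funext => -[|v [|v' s]]; [by []| |by []].
by rewrite /a1 /liform -!mulmxA !phiC1.
Qed.

Let ha1 : hm 1 a1. Proof. exact: hm_th. Qed.
Let ha2 : hm 1 a2. Proof. exact: hm_th. Qed.
Let da1 : extd a1 = 0. Proof. exact: extd_const. Qed.
Let da2 : extd a2 = dtf ∧ a1.
Proof. by rewrite (extd_yconst (sform_th B C2) (@yconst_th _ B C2)) dird_th BC2. Qed.

(** After averaging, c depends on t only and, being closed, is constant and monodromy-invariant on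
    fibre vectors. On those vectors a1 wedge (c - a2) vanishes, so c - a2 is proportional to a1 at
    each t. But a2 gains tbar a1 over one period, which a constant invariant c cannot follow. *)
Lemma massey1_contradiction c z : hm 1 c -> extd c = 0 -> hm 1 z ->
  a1 ∧ c - a1 ∧ a2 = extd z -> False.
Proof.
move=> hc dc hz E; have [ls lsL sp] := lattice_spans lL.
pose A w := avgs (map (@fb R) ls) w.
have hA k w : hm k w -> hm k (A w) /\ yconst (A w).
  move=> [aw sw iw]; split; first by split; [exact: altf_avgs|exact: sform_avgs|exact: Oinv_avgs].
  by apply: (yconst_avgs lsL) => //; case: iw.
have [hcb ycb] := hA _ _ hc; have [hzb yzb] := hA _ _ hz.
have sc := hm_sform hc; have sz := hm_sform hz.
have s1 := hm_sform ha1; have s2 := hm_sform ha2.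
have dcb : extd (A c) = 0 by rewrite /A extd_avgs // dc avgs0.
have EA : a1 ∧ A c - a1 ∧ a2 = extd (A z).
  rewrite /A extd_avgs // -E avgsD; last 2 first.
  - by apply: sform_wedge.
  - by apply/sformN/sform_wedge.
  rewrite (wedge_avgs _ ca1 sc) avgsN; last exact: sform_wedge.
  congr (_ - _); apply/esym/avgs_yconst/yconst_wedge; first exact: yconst_th.
  exact: yconst_th.
pose c0 (t : R) (l : 'rV[R]_5) : R := A c ((t, 0) : G) [:: fb l].
pose f1 (l : 'rV[R]_5) : R := (l *m C1) 0 0.
pose f2 (t : R) (l : 'rV[R]_5) : R := (l *m phi B t *m C2) 0 0.
have a1E p l : a1 p [:: fb l] = f1 l by rewrite /a1 /liform /f1 -mulmxA phiC1.
have W p (w w' : dform) l l' : (w ∧ w') p [:: fb l; fb l'] =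
    w p [:: fb l; fb l'] * w' p [::] - w p [:: fb l'] * w' p [:: fb l] +
    (w p [:: fb l] * w' p [:: fb l'] + w p [::] * w' p [:: fb l; fb l']).
  by rewrite !wedge_cons !wedge_nil /ins /sgn /=; rewrite !expr0 !expr1 ?exprS ?expr0; ring.
have rel t l l' : f1 l * (c0 t l' - f2 t l') = f1 l' * (c0 t l - f2 t l).
  have := congr1 (fun f : dform => f ((t, 0) : G) (map (@fb R) [:: l; l'])) EA.
  rewrite (extd_yconst (hm_sform hzb) yzb) dtf_fb dformDE dformNE /= !W.
  have z2 p x y : a1 p [:: x; y] = 0 by [].
  have z0 p : a1 p [::] = 0 by [].
  rewrite !z2 !z0 !a1E !mul0r !addr0 !add0r => H.
  have -> : f2 t l = a2 ((t, 0) : G) [:: fb l] by [].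
  have -> : f2 t l' = a2 ((t, 0) : G) [:: fb l'] by [].
  rewrite /c0; move: H; set u := A c _ _; set u' := A c _ _; set v := a2 _ _; set v' := a2 _ _.
  by move=> H; apply/eqP; rewrite -subr_eq0; apply/eqP; rewrite -[RHS]H; ring.
have c0t t l : c0 t l = c0 0 l.
  pose f t := c0 t l.
  have df (x : R) : is_derive x (1 : R) f 0.
    have H := smooth_is_derive ((0 + x *: e0) : G) e0 (hm_sform hcb [:: fb l]).
    have D0 : dird e0 (A c) (0 + x *: e0) [:: fb l] = 0.
      apply: (@dtf_kernel R _ _ [:: l]).
      by rewrite -(extd_yconst (hm_sform hcb) ycb).
    have := is_derive_line H; rewrite (D0 : 'D_e0 _ _ = 0).
    have -> : (fun s : R^o => A c (0 + s *: e0) [:: fb l] : R^o) = f.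
      apply/funext => s; rewrite /f /c0; congr (_ _); apply: ycb => /=.
      by rewrite add0r [_ *: _]mulr1.
    by [].
  exact: is_derive_0_is_cst t 0 df.
have c0N l : c0 0 (l *m phi B (- tbar)) = c0 0 l.
  have [_ _ [_ tc]] := hcb.
  rewrite -(c0t tbar) /c0.
  have := congr1 (fun f : dform => f ((0, 0) : G) [:: fb l]) tc.
  rewrite pullback_tauE /= => <-; congr (A c _ _).
  by rewrite /tau add0r mul0mx.
have f1N l : f1 (l *m phi B (- tbar)) = f1 l by rewrite /f1 -mulmxA phiC1.
have f2N l : f2 tbar (l *m phi B (- tbar)) = f2 0 l.
  by rewrite /f2 -(mulmxA l) phiNV mulmx1 phi0 mulmx1.
have f10 : f1 l0 = 1 by [].
have e1 := rel 0 l0 l0.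
(* The relation at t = 0, and at t = tbar on a vector transported by the monodromy, expresses c0 in
   two ways. Comparing them forces f2 to take the same value at 0 and tbar on l0, although it grows
   there by t. *)
have key l : c0 0 l = f2 0 l + (c0 0 l0 - f2 0 l0) * f1 l.
  by have := rel 0 l0 l; rewrite f10 mul1r mulrC => <-; rewrite addrC subrK.
have keyN l : c0 0 l = f2 0 l + (c0 0 l0 - f2 tbar l0) * f1 l.
  have := rel tbar l0 (l *m phi B (- tbar)).
  rewrite f10 mul1r !c0t c0N f1N f2N mulrC => <-.
  by rewrite addrC subrK.
have : f2 0 l0 = f2 tbar l0.
  have := key l0; rewrite {1}keyN f10; move: (f2 0 l0) (f2 tbar l0) (c0 0 l0) => a b d.
  by rewrite !mulr1 => /addrI /addrI /oppr_inj ->.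
rewrite /f2 -!mulmxA !phiC2 scale0r addr0 mulmxDr -scalemxAr !mxE => /eqP.
rewrite eq_sym -subr_eq0 addrAC subrr add0r.
have := l0C; rewrite mxE => ->.
by rewrite mulr1 (negbTE tbar0).
Qed.

(** - a2 is a primitive of a1 wedge dt; g and g' are the functions by which the representatives a
    and t differ from a1 and dt, and they correct it. *)
Let primitive a t g g' : hm 1 a -> hm 1 t -> extd t = 0 ->
    hm 0 g -> extd g = a1 - a -> hm 0 g' -> extd g' = dtf - t ->
  hm 1 (a1 ∧ g' - a2 - g ∧ t) /\ extd (a1 ∧ g' - a2 - g ∧ t) = a ∧ t.
Proof.
move=> ha ht dt hg dg hg' dg'.
have h1 : hm 1 (a1 ∧ g') := hmW ha1 hg'.
have h2 : hm 1 (g ∧ t) := hmW hg ht.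
split; first exact: hmB (hmB h1 ha2) h2.
rewrite (extdB (hm_sform (hmB h1 ha2)) (hm_sform h2)) (extdB (hm_sform h1) (hm_sform ha2)).
rewrite (extdW1 ha1 (hm_sform hg')) (extdW0 hg (hm_sform ht)) da1 da2 dt dg dg'.
rewrite (wedgeC (@ofdeg_dtf R) (hm_deg ha1)) expr1 scaleN1r wedge0l wedge0r.
rewrite wedgeDr wedgeNr wedgeDl wedgeNl.
by apply: dform_eqP => p s; rewrite !dformE; ring.
Qed.

Theorem massey1_not_formal : ~ solvmanifold_formal B tbar L.
Proof.
move=> /Om_formal_iff fO.
have sOm k := @subsp_Om R B tbar L L0 k.
have cdtf : @cocycle R Om 1 dtf.
  by split; [apply/(hmP _ _ L0); exact: hm_dtf|exact: extd_covf].
have ca : @cocycle R Om 1 a1 by split; [apply/(hmP _ _ L0)|].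
have [|a [t [x []]]] := formal_massey1 fO ca cdtf.
  move=> a t [/(hmP _ _ L0) ha _] [/(hmP _ _ L0) ht dt].
  move=> [g /(hmP _ _ L0) hg dg] [g' /(hmP _ _ L0) hg' dg'].
  have [h e] := primitive ha ht dt hg dg hg' dg'.
  by exists (a1 ∧ g' - a2 - g ∧ t) => //; apply/(hmP _ _ L0).
move=> [[/(hmP _ _ L0) ha da] [g /(hmP _ _ L0) hg dg]].
move=> [[/(hmP _ _ L0) ht dt] [g' /(hmP _ _ L0) hg' dg']].
move=> /(hmP _ _ L0) hx dx [y /(hmP _ _ L0) hy dy].
have [hX dX] := primitive ha ht dt hg dg hg' dg'; set X := _ - _ in hX dX.
pose c := x - X.
have hc : hm 1 c by exact: hmB.
have dc : extd c = 0 by rewrite /c (extdB (hm_sform hx) (hm_sform hX)) dX [extd x]dx subrr.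
have hgX : hm 1 (g ∧ X) := hmW hg hX.
have hgt : hm 1 (g ∧ t) := hmW hg ht.
have hggt : hm 1 (g ∧ (g ∧ t)) := hmW hg hgt.
have hgc : hm 1 (g ∧ c) := hmW hg hc.
(* This primitive undoes the change of representatives: a x and a1 c - a1 a2 differ by the
   differential of the terms added to y. *)
apply: (@massey1_contradiction c (y + g ∧ X + 2^-1 *: (g ∧ (g ∧ t)) + g ∧ c) hc dc).
  by apply: hmD => //; apply: hmD; [exact: hmD|exact: hmZ].
have hh : hm 1 (2^-1 *: (g ∧ (g ∧ t))) by exact: hmZ.
rewrite (extdD (hm_sform (hmD (hmD hy hgX) hh)) (hm_sform hgc)).
rewrite (extdD (hm_sform (hmD hy hgX)) (hm_sform hh)) (extdD (hm_sform hy) (hm_sform hgX)).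
rewrite (extdZ _ (hm_sform hggt)) [extd y]dy (extdW0 hg (hm_sform hX)) (extdW0 hg (hm_sform hc)).
rewrite (extdW0 hg (hm_sform hgt)) (extdW0 hg (hm_sform ht)) [extd g]dg dc dX [extd t]dt.
have ax : a ∧ x = a ∧ X + a ∧ c by rewrite -wedgeDr /c addrC subrK.
rewrite [@dgmul R Om a x]ax.
have gdg : (a1 - a) ∧ g = g ∧ (a1 - a) by exact: (comm0 hg (hmB ha1 ha)).
have aX : a1 ∧ X = - (a1 ∧ a2) - g ∧ (a1 ∧ t).
  rewrite /X !wedgeDr !wedgeNr (wedgeA a1 a1) (wedge_self1 (hm_deg ha1)) wedge0l add0r.
  by rewrite (wedgeA a1 g) (comm0 hg ha1) -wedgeA.
move: X c {hX dX hc dc hgX hgc hh ax} aX => X c aX.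
rewrite (wedgeA (a1 - a) g t) gdg -(wedgeA g).
rewrite !wedgeDr !wedgeDl !wedgeNl !wedgeDr !wedgeNr aX !wedge0r.
by apply: dform_eqP => p s; rewrite !dformE; field.
Qed.

End FirstObstruction.

(** * The moving frame and the obstruction in degree two *)

Section WedgeValues.
Variables (R : realType) (V : normedModType R).
Implicit Types (w u v : dform V) (p x y z t : V).

Lemma wedge11E w1 w2 p x y : ofdeg 1 w1 -> ofdeg 1 w2 ->
  (w1 ∧ w2) p [:: x; y] = w1 p [:: x] * w2 p [:: y] - w1 p [:: y] * w2 p [:: x].
Proof.
move=> d1 d2; rewrite !wedge_cons !wedge_nil /ins /sgn /=.
rewrite (d1 p [:: x; y]) // (d1 p [::]) // !expr0 !expr1.
by ring.
Qed.

Lemma wedge22E u v p x y z t : ofdeg 2 u -> ofdeg 2 v ->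
  (u ∧ v) p [:: x; y; z; t] =
    u p [:: x; y] * v p [:: z; t] - u p [:: x; z] * v p [:: y; t] +
    u p [:: x; t] * v p [:: y; z] + u p [:: y; z] * v p [:: x; t] -
    u p [:: y; t] * v p [:: x; z] + u p [:: z; t] * v p [:: x; y].
Proof.
move=> du dv; rewrite !wedge_cons !wedge_nil /ins /sgn /=.
have u0 : u p [::] = 0 by exact: du.
have u1 a : u p [:: a] = 0 by exact: du.
have u3 a b c : u p [:: a; b; c] = 0 by exact: du.
have u4 a b c d : u p [:: a; b; c; d] = 0 by exact: du.
rewrite !u0 !u1 !u3 !u4 !mulr0 !mul0r !expr0 !exprS !expr0.
by ring.
Qed.

End WedgeValues.

Section MovingFrame.
Variables (R : realType) (B : 'M[R]_5) (tbar : R) (L : set 'rV[R]_5).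
Local Notation G := (Gtype R).
Local Notation dform := (dform G).
Local Notation e0 := (gb R None).
Local Notation phi := (phi B).
Local Notation hm := (hm B tbar L).
Implicit Types (w : dform) (i j k l : 'I_5).

(** Fibre vectors dual to the right-invariant one-forms ([th_frame]). In this frame invariance under
    the monodromy becomes tbar-periodicity of coefficients ([cw_periodic]). *)
Definition frame i (t : R) : G := fb (delta_mx 0 i *m phi (- t)).

Definition cw w i j (t : R) : R := w ((t, 0) : G) [:: frame i t; frame j t].

Lemma frame_sum i t : frame i t = \sum_k phi (- t) i k *: gb R (Some k).
Proof.
rewrite /frame -rowE [row _ _]row_sum_delta.
have E (r : seq 'I_5) : fb (\sum_(k <- r) (row i (phi (- t))) 0 k *: delta_mx 0 k) =
    \sum_(k <- r) phi (- t) i k *: gb R (Some k).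
  elim: r => [|k r IH]; first by rewrite !big_nil.
  by rewrite !big_cons fb_comb IH mxE.
exact: E.
Qed.

Lemma cw_sum w i j t : altf 2 w -> cw w i j t =
  \sum_k \sum_l phi (- t) i k * (phi (- t) j l * w ((t, 0) : G) [:: gb R (Some k); gb R (Some l)]).
Proof.
move=> aw; rewrite /cw.
rewrite -[LHS]/(ins (frame i t) w ((t, 0) : G) [:: frame j t]).
rewrite {1}(frame_sum i t) (altf_ins_sum _ _ _ aw) sum_dformE; apply: eq_bigr => k _.
rewrite dformZE -mulr_sumr; congr (_ * _).
rewrite -[LHS]/(ins (frame j t) (ins (gb R (Some k)) w) ((t, 0) : G) [::]).
rewrite (frame_sum j t) (altf_ins_sum _ _ _ (altf_ins _ aw)) sum_dformE.
by apply: eq_bigr => l _; rewrite dformZE.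
Qed.

Lemma cw_swap w i j t : altf 2 w -> cw w j i t = - cw w i j t.
Proof.
move=> aw; exact: (congr1 (fun f : dform => f ((t, 0) : G) [::]) (altf_swap (frame i t) (frame j t) aw)).
Qed.

Lemma cw_diag w i t : altf 2 w -> cw w i i t = 0.
Proof.
move=> aw; exact: (congr1 (fun f : dform => f ((t, 0) : G) [::]) (altf_insins (frame i t) aw)).
Qed.

Lemma cw_periodic w i j : hm 2 w -> cw w i j tbar = cw w i j 0.
Proof.
move=> [_ _ [_ tw]]; rewrite /cw -{2}tw; apply/esym/(etrans (pullback_tauE _ _ _ _ _)).
rewrite -[LHS]/(w (tau B tbar ((0, 0) : G)) [:: tl B tbar (frame i 0); tl B tbar (frame j 0)]).
have E k : tl B tbar (frame k 0) = frame k tbar.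
  by rewrite /frame tl_fb oppr0 phi0 mulmx1.
by rewrite !E /tau add0r mul0mx.
Qed.

Lemma is_derive_phiN t i k :
  is_derive t (1 : R) (fun t => phi (- t) i k) (- \sum_m B i m * phi (- t) m k).
Proof.
have dN : is_derive t (1 : R) (fun x : R => - x) (-1) by apply: is_deriveN.
have := is_derive1_comp (f := fun x => phi x i k) (g := fun x => - x) (is_derive_phi B (- t) i k) dN.
by rewrite mulrN1 mxE.
Qed.

Lemma is_derive_time w s t : sform w -> yconst w ->
  is_derive t (1 : R) (fun t : R => w ((t, 0) : G) s : R) (dird e0 w ((t, 0) : G) s).
Proof.
move=> sw yw.
have E (x : R) (w' : dform) : yconst w' -> w' (0 + x *: e0) s = w' ((x, 0) : G) s.
  by move=> yw'; congr (_ s); apply: yw'; rewrite /= add0r [_ *: _]mulr1.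
have yd : yconst (dird e0 w).
  move=> p q pq; apply/funext => s'; rewrite /dird.
  have H := smooth_is_derive p e0 (sw s').
  have H' : is_derive q e0 (fun q => w q s' : R^o) ('D_e0 (fun q => w q s' : R^o) p).
    apply/is_deriveP => e e0'; have /is_deriveP H2 := H; have [r r0 rP] := H2 e e0'.
    exists r => // h h0 hr; have := rP h h0 hr.
    by rewrite (yw (p + h *: e0) (q + h *: e0)) ?(yw p q) //= pq.
  by apply/esym; exact: (derive_val (is_derive := H')).
have H := is_derive_line (smooth_is_derive ((0 + t *: e0) : G) e0 (sw s)).
rewrite -(E t _ yd).
have -> : (fun t : R => w ((t, 0) : G) s : R) = (fun x : R^o => w (0 + x *: e0) s : R^o).
  by apply/funext => x; rewrite E.
exact: H.
Qed.

(* The frame satisfies [frame i' = - sum_k B i k frame k]. *)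
Lemma is_derive_cw w i j t : altf 2 w -> sform w -> yconst w -> altf 2 (dird e0 w) ->
  is_derive t (1 : R) (cw w i j)
    (cw (dird e0 w) i j t - \sum_m B i m * cw w m j t - \sum_m B j m * cw w i m t).
Proof.
move=> aw sw yw adw.
pose W k l (t : R) : R := w ((t, 0) : G) [:: gb R (Some k); gb R (Some l)].
pose W' k l (t : R) : R := dird e0 w ((t, 0) : G) [:: gb R (Some k); gb R (Some l)].
pose a i k (t : R) : R := phi (- t) i k.
pose a' i k (t : R) : R := - \sum_m B i m * phi (- t) m k.
have -> : cw w i j = \sum_k \sum_l (a i k * (a j l * W k l)).
  apply/funext => x; rewrite (cw_sum _ _ _ aw) fct_sumE; apply: eq_bigr => k _.
  by rewrite fct_sumE.
have -> : cw (dird e0 w) i j t - \sum_m B i m * cw w m j t - \sum_m B j m * cw w i m t =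
   \sum_k \sum_l (a i k t *: (a j l t *: W' k l t + W k l t *: a' j l t) +
      (a j l t * W k l t) *: a' i k t).
  have S1 : \sum_m B i m * cw w m j t = - \sum_k \sum_l a' i k t * (a j l t * W k l t).
    under eq_bigr do rewrite (cw_sum _ _ _ aw) mulr_sumr.
    rewrite exchange_big -sumrN; apply: eq_bigr => k _ /=.
    rewrite -mulr_sumr mulNr opprK mulr_suml; apply: eq_bigr => m _.
    by rewrite -mulr_sumr mulrA.
  have S2 : \sum_m B j m * cw w i m t = - \sum_k \sum_l a i k t * (a' j l t * W k l t).
    under eq_bigr do rewrite (cw_sum _ _ _ aw) mulr_sumr.
    rewrite exchange_big -sumrN; apply: eq_bigr => k _ /=.
    under eq_bigr do rewrite mulr_sumr.
    rewrite exchange_big -sumrN; apply: eq_bigr => l _ /=.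
    rewrite mulNr mulrN opprK mulr_suml mulr_sumr; apply: eq_bigr => m _.
    by rewrite mulrCA !mulrA.
  rewrite S1 S2 !opprK (cw_sum _ _ _ adw) -!big_split; apply: eq_bigr => k _ /=.
  rewrite -!big_split; apply: eq_bigr => l _ /=.
  by rewrite /GRing.scale /= /W' /a; ring.
apply: is_derive_sum => k; apply: is_derive_sum => l.
have d1 : is_derive t (1 : R) (W k l) (W' k l t) by exact: is_derive_time.
have d2 m n : is_derive t (1 : R) (a m n) (a' m n t) by exact: is_derive_phiN.
exact: (is_deriveM (d2 i k) (is_deriveM (d2 j l) d1)).
Qed.

Lemma th_frame (D : 'M[R]_5) i t : liform B D ((t, 0) : G) [:: frame i t] = D i 0.
Proof.
rewrite -[LHS]/((delta_mx 0 i *m phi (- t) *m phi t *m D) 0 0).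
by rewrite -(mulmxA _ (phi (- t))) phiNV mulmx1 -rowE mxE.
Qed.

Lemma cw_th (D D' : 'M[R]_5) i j t : cw (liform B D ∧ liform B D') i j t = D i 0 * D' j 0 - D j 0 * D' i 0.
Proof.
rewrite /cw wedge11E; try exact: (altf_deg (altf_th B _)).
by rewrite !th_frame.
Qed.

End MovingFrame.

Section MasseySystem.
Variables (R : realType) (B : 'M[R]_5) (tbar : R) (L : set 'rV[R]_5).
Local Notation G := (Gtype R).
Local Notation dform := (dform G).
Local Notation hm := (hm B tbar L).
Implicit Types (w a t x y z u g xi zeta : dform) (p v : G) (s : seq G).

Lemma altf_dird k v w : altf k w -> sform w -> altf k (dird v w).
Proof.
elim: k w => [|k IH] w.
  move=> dw _ p s sk; rewrite -[RHS](congr1 (fun f : dform => f p s) (dird0 v)).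
  by rewrite /dird; congr ('D_v _ p); apply/funext => q; rewrite dw.
move=> [w0 lw iw aw] sw; split=> [p|a u u'|u|u].
- rewrite -[RHS](congr1 (fun f : dform => f p [::]) (dird0 v)).
  by rewrite /dird; congr ('D_v _ p); apply/funext => q; rewrite w0.
- rewrite ins_dird lw dirdD ?dirdZ //; try exact: sform_ins.
  by apply: sformZ; exact: sform_ins.
- by rewrite -[LHS]/(dird v (ins u (ins u w))) iw dird0.
- by rewrite ins_dird; apply: (IH (ins u w)); [exact: aw|exact: sform_ins].
Qed.

Lemma hm2C k w u : hm 2 u -> hm k w -> w ∧ u = u ∧ w.
Proof.
by move=> hu hw; rewrite (wedgeC (hm_deg hw) (hm_deg hu)) mulnC exprM sqrrN !expr1n scale1r.
Qed.

Lemma hm1C w u : hm 1 w -> hm 1 u -> w ∧ u = - (u ∧ w).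
Proof. by move=> hw hu; rewrite (wedgeC (hm_deg hw) (hm_deg hu)) expr1 scaleN1r. Qed.

Lemma hm0W k g w : hm 0 g -> hm k w -> hm k (g ∧ w).
Proof. exact: hmW. Qed.

Definition massey_system a t x y : Prop :=
  [/\ hm 2 a /\ extd a = 0, hm 1 t /\ extd t = 0, hm 2 x /\ hm 2 y,
      extd x = a ∧ t & extd y = x ∧ t].

(** Closed for a Massey system, both terms having differential 2 a x t. The shifts below change it
    at most by an exact form, so its class can be tested on convenient representatives. *)
Definition massey_class a x y : dform := x ∧ x - 2 *: (a ∧ y).

Lemma massey_shift_a a t x y xi : massey_system a t x y -> hm 1 xi -> hm 2 (extd xi) ->
  massey_system (a + extd xi) t (x + xi ∧ t) y /\
  massey_class (a + extd xi) (x + xi ∧ t) y = massey_class a x y - 2 *: extd (xi ∧ y).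
Proof.
move=> [[ha da] [ht dt] [hx hy] dx dy] hxi hdxi.
have ddxi := extd_extd (hm_sform hxi).
have hxt : hm 2 (xi ∧ t) := hmW hxi ht.
have tt : t ∧ t = 0 := wedge_self1 (hm_deg ht).
have xtt : xi ∧ t ∧ t = 0 by rewrite -wedgeA tt wedge0r.
have xt2 : xi ∧ t ∧ (xi ∧ t) = 0.
  by rewrite [X in X ∧ _ = _](hm1C hxi ht) wedgeNl -wedgeA (wedgeA xi) (wedge_self1 (hm_deg hxi)) wedge0l wedge0r oppr0.
split.
  split; [|by []| |by rewrite (extdD (hm_sform hx) (hm_sform hxt)) (extdW1 hxi (hm_sform ht)) dt wedge0r subr0 dx wedgeDl
    |by rewrite wedgeDl xtt addr0].
  - by split; [exact: hmD|rewrite (extdD (hm_sform ha) (hm_sform hdxi)) da ddxi addr0].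
  - by split; [exact: hmD|].
have sy := hm_sform hy.
rewrite /massey_class (extdW1 hxi sy) dy -(hm2C hx ht) (wedgeA xi t x).
rewrite !wedgeDl !wedgeDr xt2 (hm2C hx hxt).
by apply: dform_eqP => p s; rewrite !dformE; ring.
Qed.

Lemma massey_shift_x a t x y zeta : massey_system a t x y -> hm 1 zeta -> hm 2 (extd zeta) ->
  massey_system a t (x + extd zeta) (y + zeta ∧ t) /\
  massey_class a (x + extd zeta) (y + zeta ∧ t) =
    massey_class a x y + extd (2 *: (x ∧ zeta) + zeta ∧ extd zeta).
Proof.
move=> [[ha da] [ht dt] [hx hy] dx dy] hz hdz.
have ddz := extd_extd (hm_sform hz).
have hzt : hm 2 (zeta ∧ t) := hmW hz ht.
split.
  split; [by []|by []| | |].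
  - by split; exact: hmD.
  - by rewrite (extdD (hm_sform hx) (hm_sform hdz)) ddz addr0.
  - by rewrite (extdD (hm_sform hy) (hm_sform hzt)) (extdW1 hz (hm_sform ht)) dt wedge0r subr0 dy wedgeDl.
have hxz : hm 3 (x ∧ zeta) := hmW hx hz.
have hzz : hm 3 (zeta ∧ extd zeta) := hmW hz hdz.
rewrite /massey_class (extdD (hm_sform (hmZ 2 hxz)) (hm_sform hzz)) (extdZ _ (hm_sform hxz)).
rewrite (extdW2 hx (hm_sform hz)) (extdW1 hz (hm_sform hdz)) ddz wedge0r subr0 dx -wedgeA (hm1C ht hz).
rewrite !wedgeDl !wedgeDr wedgeNr (hm2C hx hdz).
by apply: dform_eqP => p s; rewrite !dformE; ring.
Qed.

(** The new x and y come from letting exp(g) act on the chain a, x, y: x + g a and y + g x + g^2 a /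
    2. The expression x x - 2 a y is invariant under this action. *)
Lemma massey_shift_t a t x y g : massey_system a t x y -> hm 0 g -> hm 1 (extd g) ->
  let x' := x + g ∧ a in let y' := y + g ∧ x + 2^-1 *: (g ∧ (g ∧ a)) in
  massey_system a (t + extd g) x' y' /\ massey_class a x' y' = massey_class a x y.
Proof.
move=> [[ha da] [ht dt] [hx hy] dx dy] hg hdg x' y'.
have ddg := extd_extd (hm_sform hg).
have hga := hm0W hg ha; have hgx := hm0W hg hx; have hgga := hm0W hg hga.
have dga : extd (g ∧ a) = a ∧ extd g.
  by rewrite (extdW0 hg (hm_sform ha)) da wedge0r addr0 (hm2C ha hdg).
have gC k (w : dform) : hm k w -> w ∧ g = g ∧ w by exact: comm0.
have gaC (w : dform) : a ∧ (g ∧ w) = g ∧ (a ∧ w) by rewrite wedgeA (gC _ _ ha) -wedgeA.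
split.
  split; [by []| | | |].
  - by split; [exact: hmD|rewrite (extdD (hm_sform ht) (hm_sform hdg)) dt ddg addr0].
  - by split; [exact: hmD|apply: hmD; [exact: hmD|exact: hmZ]].
  - by rewrite (extdD (hm_sform hx) (hm_sform hga)) dga dx wedgeDr.
  rewrite (extdD (hm_sform (hmD hy hgx)) (hm_sform (hmZ _ hgga))) (extdD (hm_sform hy) (hm_sform hgx)).
  rewrite (extdZ _ (hm_sform hgga)) (extdW0 hg (hm_sform hx)) (extdW0 hg (hm_sform hga)) dga dx dy.
  rewrite (wedgeA (extd g) g a) (gC _ _ hdg) -(wedgeA g (extd g) a) (hm2C ha hdg) (hm2C hx hdg).
  rewrite /x' !wedgeDl !wedgeDr -!(wedgeA g).
  by apply: dform_eqP => p s; rewrite !dformE; field.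
rewrite /massey_class /x' /y' !wedgeDl !wedgeDr wedgeZr !gaC -!(wedgeA g) !gaC (wedgeA x g a) (gC _ _ hx) -(wedgeA g x a).
rewrite (hm2C ha hx).
by apply: dform_eqP => p s; rewrite !dformE; field.
Qed.

End MasseySystem.

Section SecondObstruction.
Variables (R : realType) (tbar : R) (L : set 'rV[R]_5).
Local Notation B := (B5_18xR R).
Hypotheses (tbar0 : tbar != 0) (lat : lattice_for B tbar L).
Local Notation G := (Gtype R).
Local Notation dform := (dform G).
Local Notation pt u := (pullback (tau B u)).
Local Notation Oinv := (Oinv B tbar L).
Local Notation Om := (Om B tbar L).
Local Notation dtf := (@dtf R).
Local Notation e0 := (gb R None).
Local Notation th := (liform B).
Local Notation hm := (hm B tbar L).
Local Notation cw := (cw B).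
Implicit Types (w u Y : dform) (p q v : G) (s : seq G).

Let lL : is_lattice L := proj1 lat.
Let Lflow : flow B tbar @` L = L := proj2 lat.
Let L0 : L 0. Proof. by case: lL => -[]. Qed.

Let o0 : 'I_5 := @Ordinal 5 0 isT.
Let o1 : 'I_5 := @Ordinal 5 1 isT.
Let o2 : 'I_5 := @Ordinal 5 2 isT.
Let o3 : 'I_5 := @Ordinal 5 3 isT.
Let o4 : 'I_5 := @Ordinal 5 4 isT.

Let sum5 (F : 'I_5 -> R) : \sum_k F k = F o0 + F o1 + F o2 + F o3 + F o4.
Proof.
rewrite !big_ord_recl big_ord0 addr0 !addrA.
by congr (F _ + F _ + F _ + F _ + F _); apply: val_inj.
Qed.

Let D (i : 'I_5) : 'M[R]_5 := delta_mx i 0.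

Let BD : [/\ B *m D o0 = D o1 + D o2, B *m D o1 = D o3 - D o0, B *m D o2 = D o3 & B *m D o3 = - D o2].
Proof.
split; apply/matrixP => i j; rewrite mxE sum5 !mxE /=;
  case: i => [[|[|[|[|[|//]]]]] ?]; case: j => [[|[|[|[|[|//]]]]] ?];
  rewrite /= ?mulr0 ?mul0r ?mulr1 ?mul1r ?addr0 ?add0r ?subr0 ?sub0r ?oppr0 //; ring.
Qed.

Let t0 := th (D o0).
Let t1 := th (D o1).
Let t2 := th (D o2).
Let t3 := th (D o3).

(** Y0, X0, b1 is a Jordan chain for the action of B on right-invariant two-forms: the t-derivative
    sends Y0 to X0, X0 to b1 and b1 to 0. *)
Let b1 : dform := t2 ∧ t3.
Let X0 : dform := 2^-1 *: (t2 ∧ t1 - t3 ∧ t0).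
Let Y0 : dform := 2^-1 *: (t0 ∧ t1).

Let ht i : hm 1 (th (D i)). Proof. exact: hm_th. Qed.
Let htt i j : hm 2 (th (D i) ∧ th (D j)). Proof. exact: (hmW (ht i) (ht j)). Qed.
Let hb1 : hm 2 b1. Proof. exact: (htt o2 o3). Qed.
Let hX0 : hm 2 X0. Proof. exact: (hmZ _ (hmB (htt o2 o1) (htt o3 o0))). Qed.
Let hY0 : hm 2 Y0. Proof. exact: (hmZ _ (htt o0 o1)). Qed.
Let hdt : hm 1 dtf. Proof. exact: hm_dtf. Qed.

Let ytt i j : yconst (th (D i) ∧ th (D j)).
Proof. by apply: yconst_wedge; exact: yconst_th. Qed.
Let yb1 : yconst b1. Proof. exact: ytt. Qed.
Let ycZ (a : R) w : yconst w -> yconst (a *: w).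
Proof. by move=> h; rewrite -[_ *: _]addr0; apply: yconst_comb. Qed.
Let yX0 : yconst X0. Proof. exact: (ycZ _ (yconstB (ytt o2 o1) (ytt o3 o0))). Qed.
Let yY0 : yconst Y0. Proof. exact: (ycZ _ (ytt o0 o1)). Qed.

Let t33 : t3 ∧ t3 = 0. Proof. exact: wedge_self1 (hm_deg (ht o3)). Qed.
Let t22 : t2 ∧ t2 = 0. Proof. exact: wedge_self1 (hm_deg (ht o2)). Qed.
Let t00 : t0 ∧ t0 = 0. Proof. exact: wedge_self1 (hm_deg (ht o0)). Qed.
Let t11 : t1 ∧ t1 = 0. Proof. exact: wedge_self1 (hm_deg (ht o1)). Qed.
Let tC i j : th (D i) ∧ th (D j) = - (th (D j) ∧ th (D i)).
Proof. by rewrite (wedgeC (hm_deg (ht i)) (hm_deg (ht j))) expr1 scaleN1r. Qed.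

Let d0 : dird e0 t0 = t1 + t2. Proof. by rewrite dird_th; case: BD => -> _ _ _; rewrite thD. Qed.
Let d1 : dird e0 t1 = t3 - t0. Proof. by rewrite dird_th; case: BD => _ -> _ _; rewrite thD thN. Qed.
Let d2 : dird e0 t2 = t3. Proof. by rewrite dird_th; case: BD => _ _ -> _. Qed.
Let d3 : dird e0 t3 = - t2. Proof. by rewrite dird_th; case: BD => _ _ _ ->; rewrite thN. Qed.

Let st i : sform (th (D i)). Proof. exact: sform_th. Qed.

Let db1 : dird e0 b1 = 0.
Proof. by rewrite /b1 dird_wedge ?d2 ?d3; [|exact: st..]; rewrite t33 wedgeNr t22 add0r oppr0. Qed.

Let dX0 : dird e0 X0 = b1.
Proof.
have s21 := hm_sform (htt o2 o1); have s30 := hm_sform (htt o3 o0).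
rewrite /X0 (dirdZ _ _ (sformB s21 s30)) (dirdD _ s21 (sformN s30)) (dirdN _ s30).
rewrite (dird_wedge _ (st o2) (st o1)) (dird_wedge _ (st o3) (st o0)) d0 d1 d2 d3.
rewrite !wedgeDr !wedgeNr !wedgeNl (tC o3 o2) (tC o2 o0) (tC o3 o1) -/b1.
by apply: dform_eqP => p s; rewrite !dformE; field.
Qed.

Let dY0 : dird e0 Y0 = X0.
Proof.
rewrite /Y0 (dirdZ _ _ (hm_sform (htt o0 o1))) (dird_wedge _ (st o0) (st o1)) d0 d1 /X0.
rewrite wedgeDl wedgeDr wedgeNr t11 t00 add0r subr0 (tC o3 o0).
by rewrite opprK.
Qed.

Let cb1 : cst b1. Proof. exact: cst_of_dird (hm_sform hb1) yb1 db1. Qed.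
Let eb1 : extd b1 = 0. Proof. exact: extd_const. Qed.
Let eX0 : extd X0 = dtf ∧ b1. Proof. by rewrite (extd_yconst (hm_sform hX0) yX0) dX0. Qed.
Let eY0 : extd Y0 = dtf ∧ X0. Proof. by rewrite (extd_yconst (hm_sform hY0) yY0) dY0. Qed.

Let cw_b1 i j t : cw b1 i j t = D o2 i 0 * D o3 j 0 - D o2 j 0 * D o3 i 0.
Proof. exact: cw_th. Qed.

Let cw_X0 i j t : cw X0 i j t = 2^-1 * ((D o2 i 0 * D o1 j 0 - D o2 j 0 * D o1 i 0) -
  (D o3 i 0 * D o0 j 0 - D o3 j 0 * D o0 i 0)).
Proof. by rewrite -(cw_th B (D o2) (D o1) i j t) -(cw_th B (D o3) (D o0) i j t). Qed.

Let rowB (c : 'I_5 -> R) : [/\ \sum_k B o0 k * c k = - c o1, \sum_k B o1 k * c k = c o0,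
  \sum_k B o2 k * c k = c o0 - c o3 & \sum_k B o3 k * c k = c o1 + c o2].
Proof.
by split; rewrite sum5 !mxE /= ?mul0r ?mul1r ?mulN1r ?addr0 ?add0r.
Qed.

Let half_of (a : R) : 2 * a - 1 = 0 -> a = 2^-1.
Proof. by move=> Ha; lra. Qed.

(** u and Y are expanded in the moving frame, where coefficients are periodic. Closedness of u, the
    equation for Y and exactness of the class become linear differential equations and one quadratic
    relation, which together produce a periodic function with derivative 3/2. *)
Let final u Y Z : hm 2 u -> yconst u -> extd u = 0 ->
  hm 2 Y -> yconst Y -> extd Y = dtf ∧ (X0 + u) -> altf 2 (dird e0 u) -> altf 2 (dird e0 Y) ->
  sform Z -> yconst Z ->
  (X0 + u) ∧ (X0 + u) - 2 *: (b1 ∧ Y) = extd Z -> False.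
Proof.
move=> hu yu du hY yY dY adu adY sZ yZ E.
have [[au su _] [aY sY _]] := (hu, hY).
have zu i j t : cw (dird e0 u) i j t = 0.
  apply: (@dtf_kernel R (dird e0 u) _ [:: delta_mx 0 i *m phi B (- t); delta_mx 0 j *m phi B (- t)]).
  by rewrite -(extd_yconst su yu).
have zY i j t : cw (dird e0 Y) i j t = cw X0 i j t + cw u i j t.
  have H : dtf ∧ (dird e0 Y - (X0 + u)) = 0.
    by rewrite wedgeDr wedgeNr -(extd_yconst sY yY) dY subrr.
  have := @dtf_kernel R _ ((t, 0) : G) [:: delta_mx 0 i *m phi B (- t); delta_mx 0 j *m phi B (- t)] H.
  by rewrite dformDE dformNE => /eqP; rewrite subr_eq0 => /eqP.
have Du i j t := is_derive_cw B i j t au su yu adu.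
have DY i j t := is_derive_cw B i j t aY sY yY adY.
pose uu i j := cw u i j; pose yy i j := cw Y i j.
have sw i j t : cw u j i t = - cw u i j t by exact: cw_swap.
have swY i j t : cw Y j i t = - cw Y i j t by exact: cw_swap.
have dg i t : cw u i i t = 0 by exact: cw_diag.
have dgY i t : cw Y i i t = 0 by exact: cw_diag.
have row1 (c : 'I_5 -> R) : \sum_k B o0 k * c k = - c o1 by case: (rowB c).
have row2 (c : 'I_5 -> R) : \sum_k B o1 k * c k = c o0 by case: (rowB c).
have row3 (c : 'I_5 -> R) : \sum_k B o2 k * c k = c o0 - c o3 by case: (rowB c).
have row4 (c : 'I_5 -> R) : \sum_k B o3 k * c k = c o1 + c o2 by case: (rowB c).
have u01' t : is_derive t (1 : R) (uu o0 o1) 0.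
  apply: is_derive_eq (Du o0 o1 t) _.
  by rewrite row1 row2 zu !dg; ring.
have u23' t : is_derive t (1 : R) (uu o2 o3) (uu o1 o2 t - uu o0 o3 t).
  apply: is_derive_eq (Du o2 o3 t) _.
  by rewrite row3 row4 zu !dg (sw o1 o2) /uu; ring.
have u03' t : is_derive t (1 : R) (uu o0 o3) (uu o1 o3 t - uu o0 o1 t - uu o0 o2 t).
  apply: is_derive_eq (Du o0 o3 t) _.
  by rewrite row1 row4 zu /uu; ring.
have u12' t : is_derive t (1 : R) (uu o1 o2) (- uu o0 o2 t + uu o0 o1 t + uu o1 o3 t).
  apply: is_derive_eq (Du o1 o2 t) _.
  by rewrite row2 row3 zu (sw o0 o1) /uu; ring.
have u02' t : is_derive t (1 : R) (uu o0 o2) (uu o1 o2 t + uu o0 o3 t).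
  apply: is_derive_eq (Du o0 o2 t) _.
  by rewrite row1 row3 zu !dg /uu; ring.
have u13' t : is_derive t (1 : R) (uu o1 o3) (- uu o0 o3 t - uu o1 o2 t).
  apply: is_derive_eq (Du o1 o3 t) _.
  by rewrite row2 row4 zu !dg /uu; ring.
have x01 t : cw X0 o0 o1 t = 0 by rewrite cw_X0 /D !mxE /=; ring.
have x23 t : cw X0 o2 o3 t = 0 by rewrite cw_X0 /D !mxE /=; ring.
have x02 t : cw X0 o0 o2 t = 0 by rewrite cw_X0 /D !mxE /=; ring.
have x13 t : cw X0 o1 o3 t = 0 by rewrite cw_X0 /D !mxE /=; ring.
have x03 t : cw X0 o0 o3 t = 2^-1 by rewrite cw_X0 /D !mxE /=; ring.
have x12 t : cw X0 o1 o2 t = - 2^-1 by rewrite cw_X0 /D !mxE /=; ring.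
have y01' t : is_derive t (1 : R) (yy o0 o1) (uu o0 o1 t).
  apply: is_derive_eq (DY o0 o1 t) _.
  by rewrite row1 row2 zY x01 !dgY /uu; ring.
have y23' t : is_derive t (1 : R) (yy o2 o3) (uu o2 o3 t + yy o1 o2 t - yy o0 o3 t).
  apply: is_derive_eq (DY o2 o3 t) _.
  by rewrite row3 row4 zY x23 !dgY (swY o1 o2) /uu /yy; ring.
have y03' t : is_derive t (1 : R) (yy o0 o3)
    (2^-1 + uu o0 o3 t + (yy o1 o3 t - yy o0 o1 t - yy o0 o2 t)).
  apply: is_derive_eq (DY o0 o3 t) _.
  by rewrite row1 row4 zY x03 /uu /yy; ring.
have y12' t : is_derive t (1 : R) (yy o1 o2)
    (- 2^-1 + uu o1 o2 t + (- yy o0 o2 t + yy o0 o1 t + yy o1 o3 t)).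
  apply: is_derive_eq (DY o1 o2 t) _.
  by rewrite row2 row3 zY x12 (swY o0 o1) /uu /yy; ring.
have y02' t : is_derive t (1 : R) (yy o0 o2) (uu o0 o2 t + (yy o1 o2 t + yy o0 o3 t)).
  apply: is_derive_eq (DY o0 o2 t) _.
  by rewrite row1 row3 zY x02 !dgY /uu /yy; ring.
have y13' t : is_derive t (1 : R) (yy o1 o3) (uu o1 o3 t + (- yy o0 o3 t - yy o1 o2 t)).
  apply: is_derive_eq (DY o1 o3 t) _.
  by rewrite row2 row4 zY x13 !dgY /uu /yy; ring.
have pu i j : uu i j tbar = uu i j 0 by exact: cw_periodic hu.
have pY i j : yy i j tbar = yy i j 0 by exact: cw_periodic hY.
(* The differential of Z has a factor dt, so it vanishes on the four fibre vectors of the frame;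
   this is the other side evaluated there. *)
have rel t : 2 * ((cw X0 o0 o1 t + uu o0 o1 t) * (cw X0 o2 o3 t + uu o2 o3 t) -
    (cw X0 o0 o2 t + uu o0 o2 t) * (cw X0 o1 o3 t + uu o1 o3 t) +
    (cw X0 o0 o3 t + uu o0 o3 t) * (cw X0 o1 o2 t + uu o1 o2 t)) - 2 * yy o0 o1 t = 0.
  have h2 := hmD hX0 hu.
  pose fr : seq 'rV[R]_5 := [seq delta_mx 0 i *m phi B (- t) | i <- [:: o0; o1; o2; o3]].
  have := congr1 (fun f : dform => f ((t, 0) : G) (map (@fb R) fr)) E.
  rewrite (extd_yconst sZ yZ) dtf_fb dformDE dformNE dformZE.
  rewrite -[map _ fr]/[:: frame B o0 t; frame B o1 t; frame B o2 t; frame B o3 t].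
  rewrite (wedge22E _ _ _ _ _ (hm_deg h2) (hm_deg h2)) (wedge22E _ _ _ _ _ (hm_deg hb1) (hm_deg hY)).
  have XE i j : (X0 + u) ((t, 0) : G) [:: frame B i t; frame B j t] = cw X0 i j t + uu i j t by [].
  have YE i j : Y ((t, 0) : G) [:: frame B i t; frame B j t] = yy i j t by [].
  have bE i j : b1 ((t, 0) : G) [:: frame B i t; frame B j t] = D o2 i 0 * D o3 j 0 - D o2 j 0 * D o3 i 0.
    exact: cw_b1.
  rewrite !XE !YE !bE /D !mxE /= => H; rewrite -[RHS]H.
  by ring.
have cst_of (f : R -> R) : (forall t : R, is_derive t (1 : R) f 0) -> forall t, f t = f 0.
  by move=> df t; exact: is_derive_0_is_cst t 0 df.
have u01c := cst_of _ u01'.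
(* u01 is constant, and 2 u01 is the derivative of the periodic function u12 - u03. *)
have u010 t : uu o0 o1 t = 0.
  rewrite u01c; pose f (t : R) := uu o1 o2 t - uu o0 o3 t.
  have df (x : R) : is_derive x (1 : R) f (2 * uu o0 o1 0).
    apply: is_derive_eq (is_deriveB (u12' x) (u03' x)) _.
    by rewrite (u01c x); ring.
  have /eqP := const_derive_periodic tbar0 df (congr2 (fun x y => x - y) (pu _ _) (pu _ _)).
  by rewrite mulf_eq0 pnatr_eq0 => /eqP.
have qc t : uu o1 o2 t - uu o0 o3 t = uu o1 o2 0 - uu o0 o3 0.
  apply: (cst_of (fun t => uu o1 o2 t - uu o0 o3 t)) => x.
  apply: is_derive_eq (is_deriveB (u12' x) (u03' x)) _.
  by rewrite u010; ring.
(* u12 - u03 is constant and is the derivative of the periodic function u23. *)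
have q0 t : uu o1 o2 t = uu o0 o3 t.
  apply/eqP; rewrite -subr_eq0 qc.
  have df (x : R) : is_derive x (1 : R) (uu o2 o3) (uu o1 o2 0 - uu o0 o3 0) by rewrite -(qc x).
  by rewrite (const_derive_periodic tbar0 df (pu _ _)).
have y01c t : yy o0 o1 t = yy o0 o1 0.
  by apply: cst_of => x; have := y01' x; rewrite u010.
(* y01 is constant and 2 y01 - 1 is the derivative of the periodic function y12 - y03; the 1 comes
   from the coefficients 1/2 and -1/2 of X0. *)
have y01h t : yy o0 o1 t = 2^-1.
  rewrite y01c; pose f (t : R) := yy o1 o2 t - yy o0 o3 t.
  have df (x : R) : is_derive x (1 : R) f (2 * yy o0 o1 0 - 1).
    apply: is_derive_eq (is_deriveB (y12' x) (y03' x)) _.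
    by rewrite (y01c x) q0; field.
  have := const_derive_periodic tbar0 df (congr2 (fun x y => x - y) (pY _ _) (pY _ _)).
  exact: half_of.
(* What is left of the quadratic relation: 3/4 is 1/4 from the square of X0 plus 1/2 from y01. *)
have rel2 t : uu o0 o3 t ^+ 2 - uu o0 o2 t * uu o1 o3 t = 3 / 4.
  have := rel t; rewrite x01 x23 x02 x13 x03 x12 u010 q0 y01h.
  move: (uu o0 o2 t) (uu o1 o3 t) (uu o0 o3 t) => a b m H.
  have -> : m ^+ 2 - a * b = 3 / 4 + 2^-1 * (2 * ((0 + 0) * (0 + uu o2 o3 t) - (0 + a) * (0 + b) +
    (2^-1 + m) * (- 2^-1 + m)) - 2 * 2^-1) by field.
  by rewrite H mulr0 addr0.
(* The coefficient of u wedge Y on the frame; the equations reduce its derivative to twice the left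
   side of [rel2]. *)
pose F (t : R) := uu o0 o1 t * yy o2 o3 t - uu o0 o2 t * yy o1 o3 t + uu o0 o3 t * yy o1 o2 t +
  uu o1 o2 t * yy o0 o3 t - uu o1 o3 t * yy o0 o2 t + uu o2 o3 t * yy o0 o1 t.
have dF (x : R) : is_derive x (1 : R) F (3 / 2).
  have M (f g : R -> R) (a b : R) : is_derive x (1 : R) f a -> is_derive x (1 : R) g b ->
    is_derive x (1 : R) (f * g) (f x *: b + g x *: a) by move=> df dg'; exact: is_deriveM.
  have := is_deriveD (is_deriveB (is_deriveD (is_deriveD (is_deriveB (M _ _ _ _ (u01' x) (y23' x))
    (M _ _ _ _ (u02' x) (y13' x))) (M _ _ _ _ (u03' x) (y12' x))) (M _ _ _ _ (u12' x) (y03' x)))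
    (M _ _ _ _ (u13' x) (y02' x))) (M _ _ _ _ (u23' x) (y01' x)).
  move=> H; apply: is_derive_eq H _; rewrite /GRing.scale /=.
  have -> : 3 / 2 = 2 * (3 / 4) :> R by field.
  by rewrite -(rel2 x) (u010 x) (q0 x) (y01h x); field.
have := const_derive_periodic tbar0 dF _.
rewrite /F !pu !pY => /(_ erefl) /eqP.
by rewrite mulf_eq0 invr_eq0 !pnatr_eq0.
Qed.

Let system0 : massey_system B tbar L b1 dtf X0 Y0.
Proof.
split; [by split|by split; [|exact: extd_covf]|by split|by rewrite eX0 (hm2C hb1 hdt)|].
by rewrite eY0 (hm2C hX0 hdt).
Qed.

Let hmE k w w' : hm k w' -> w = w' -> hm k w.
Proof. by move=> ? ->. Qed.

(** Shifts the standard system to given representatives a and t of the classes of b1 and dt, as the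
    hypothesis of [formal_massey2] demands. *)
Let gauge (a t : dform) : hm 2 a -> hm 1 t ->
  (exists2 xi, hm 1 xi & extd xi = b1 - a) -> (exists2 g, hm 0 g & extd g = dtf - t) ->
  exists x y, massey_system B tbar L a t x y.
Proof.
move=> ha hT [xi hxi dxi] [g hg dg].
have dNxi : extd (- xi) = a - b1 by rewrite (extdN (hm_sform hxi)) dxi opprB.
have [|+ _] := massey_shift_a system0 (hmN hxi); rewrite dNxi; first exact: hmB.
rewrite (addrC b1) subrK => S1.
have dNg : extd (- g) = t - dtf by rewrite (extdN (hm_sform hg)) dg opprB.
have [|+ _] := massey_shift_t S1 (hmN hg); rewrite dNg; first exact: hmB.
by rewrite (addrC dtf) subrK => S2; eexists; eexists; exact: S2.
Qed.

(** Averaging over the fibre replaces Y and Z by forms depending on t only and leaves b1, dt and X0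
    + u unchanged, so [final] applies. *)
Let contradiction u Y Z : hm 2 u -> yconst u -> extd u = 0 ->
  massey_system B tbar L b1 dtf (X0 + u) Y -> hm 3 Z -> massey_class b1 (X0 + u) Y = extd Z -> False.
Proof.
move=> hu yu du [_ _ [hX hY] _ dY] hZ E; have [ls lsL sp] := lattice_spans lL.
pose A w := avgs (map (@fb R) ls) w.
have hA k w : hm k w -> hm k (A w) /\ yconst (A w).
  move=> [aw sw iw]; split; first by split; [exact: altf_avgs|exact: sform_avgs|exact: Oinv_avgs].
  by apply: (yconst_avgs lsL) => //; case: iw.
have [hAY yAY] := hA _ _ hY; have [hAZ yAZ] := hA _ _ hZ.
have sY := hm_sform hY; have sX := hm_sform hX.
have yX : yconst (X0 + u) by move=> p q e; rewrite -[LHS]/(X0 p + u p) (yX0 e) (yu _ _ e).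
have cdt : cst dtf by exact: cst_dtf.
have dAY : extd (A Y) = dtf ∧ (X0 + u).
  rewrite /A (extd_avgs _ sY) dY -(hm2C hX hdt) -(wedge_avgs _ cdt sX).
  by rewrite (avgs_yconst _ yX).
apply: (@final u (A Y) (A Z) hu yu du hAY yAY dAY) => //.
- by case: hu => au su _; exact: altf_dird.
- by case: hAY => aY sAY _; exact: altf_dird.
- exact: hm_sform hAZ.
have hXX : hm 4 ((X0 + u) ∧ (X0 + u)) := hmW hX hX.
have hbY : hm 4 (b1 ∧ Y) := hmW hb1 hY.
rewrite /A (extd_avgs _ (hm_sform hZ)) -E /massey_class.
rewrite (avgsD _ (hm_sform hXX) (sformN (hm_sform (hmZ 2 hbY)))) (avgsN _ (hm_sform (hmZ 2 hbY))).
rewrite -(wedgeZr 2 b1) -(wedge_avgs _ cb1 (sformZ 2 sY)).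
rewrite (avgs_yconst _ (yconst_wedge yX yX)) -(wedgeZr 2 b1); congr (_ - _ ∧ _).
by rewrite -[2 *: Y]addr0 (avgs_lin _ 2 sY (@sform0 R G)) avgs0 addr0.
Qed.

(** The system furnished by formality is shifted to the representatives b1 and dt. The difference x
    - X0 is then closed, [fiberize] makes it depend on t only at the price of a shift of x by an
    exact form, and [contradiction] concludes. *)
Theorem massey2_not_formal : ~ solvmanifold_formal B tbar L.
Proof.
move=> /Om_formal_iff fO.
have sOm k := @subsp_Om R B tbar L L0 k.
have cdtf : @cocycle R Om 1 dtf.
  by split; [apply/(hmP _ _ L0); exact: hm_dtf|exact: extd_covf].
have cb : @cocycle R Om 2 b1 by split; [apply/(hmP _ _ L0)|].
have [|a [t [x [y []]]]] :=
    formal_massey2 fO sOm (@Om_diff_lin R B tbar L L0) cb cdtf.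
  move=> a t [/(hmP _ _ L0) ha _] [/(hmP _ _ L0) hT _].
  move=> [xi /(hmP _ _ L0) hxi dxi] [g /(hmP _ _ L0) hg dg].
  have [|x [y S]] := gauge ha hT _ (ex_intro2 _ _ g hg dg); first by exists xi.
  have [_ _ [hx hy] dx dy] := S; exists x; split; [by apply/(hmP _ _ L0)|exact: dx|].
  move=> x' /(hmP _ _ L0) hx' [zeta /(hmP _ _ L0) hz dz].
  have dNz : extd (- zeta) = x' - x by rewrite (extdN (hm_sform hz)) [extd zeta]dz opprB.
  have [|+ _] := massey_shift_x S (hmN hz); rewrite dNz; first exact: hmB.
  rewrite (addrC x) subrK => -[_ _ [_ hy'] _ dy'].
  by eexists; [apply/(hmP _ _ L0); exact: hy'|exact: dy'].
move=> [[/(hmP _ _ L0) ha da] [xi /(hmP _ _ L0) hxi dxi]].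
move=> [[/(hmP _ _ L0) hT dT] [g /(hmP _ _ L0) hg dg]].
move=> /(hmP _ _ L0) hx /(hmP _ _ L0) hy [dx dy [z /(hmP _ _ L0) hz dz]].
have S : massey_system B tbar L a t x y by split.
have [|+ +] := massey_shift_a S hxi; rewrite [extd xi]dxi; first exact: hmB.
rewrite (addrC a) subrK; set x1 := x + _ => S1 E1.
have [|+ +] := massey_shift_t S1 hg; rewrite [extd g]dg; first exact: hmB.
rewrite (addrC t) subrK; set x2 := x1 + _; set y2 := y + _ + _ => S2 E2.
have [_ _ [hx2 hy2] dx2 dy2] := S2.
have hu : hm 2 (x2 - X0) by exact: hmB.
have [au su iu] := hu.
have du : extd (x2 - X0) = 0.
  by rewrite (extdB (hm_sform hx2) (hm_sform hX0)) dx2 eX0 (hm2C hb1 hdt) subrr.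
have [u' [[au' su' iu' yu' du'] [zeta /(hmP _ _ L0) hzeta dzeta]]] := fiberize tbar0 lL Lflow au su iu du.
have hu' : hm 2 u' by [].
have dNz : extd (- zeta) = u' - (x2 - X0) by rewrite (extdN (hm_sform hzeta)) [extd zeta]dzeta opprB.
have [|+ +] := massey_shift_x S2 (hmN hzeta); rewrite dNz; first exact: hmB.
have -> : x2 + (u' - (x2 - X0)) = X0 + u' by rewrite opprB addrA addrC addrA subrK addrC.
set w := 2 *: _ + _ => S3 E3.
have hxy : hm 3 (xi ∧ y) := hmW hxi hy.
have hw : hm 3 w.
  apply: hmD; first by apply: hmZ; exact: (hmW hx2 (hmN hzeta)).
  exact: (hmW (hmN hzeta) (hmB hu' hu)).
apply: (contradiction hu' yu' du' S3 (hmD (hmB hz (hmZ 2 hxy)) hw)).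
rewrite E3 E2 E1 (extdD (hm_sform (hmB hz (hmZ 2 hxy))) (hm_sform hw)).
rewrite (extdB (hm_sform hz) (hm_sform (hmZ 2 hxy))) (extdZ _ (hm_sform hxy)).
by rewrite [extd z]dz.
Qed.

End SecondObstruction.

(** * Jordan chains and conclusion *)

Section Nilpotent.
Variable R : realType.

Let sum5 (F : 'I_5 -> R) :
  \sum_k F k = F (inord 0) + F (inord 1) + F (inord 2) + F (inord 3) + F (inord 4).
Proof.
rewrite !big_ord_recl big_ord0 addr0 !addrA.
by congr (F _ + F _ + F _ + F _ + F _); apply: val_inj; rewrite /= inordK.
Qed.

Lemma B6_10_chain : exists (C1 C2 : 'M[R]_5) (l : 'rV[R]_5),
  [/\ B6_10 R *m C1 = 0, B6_10 R *m C2 = C1 & (l *m C1) 0 0 = 1].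
Proof.
(* Counting from 0, B sends the column e1 to e2 and e2 to 0; these are the first columns of C2 and
   C1, and l reads the coefficient of e2. *)
exists (delta_mx (inord 2) 0), (delta_mx (inord 1) 0), (delta_mx 0 (inord 2)).
by split; [apply/matrixP => i j|apply/matrixP => i j|];
  rewrite mxE sum5 !mxE -!val_eqE /= !inordK //;
  try (case: i => [[|[|[|[|[|//]]]]] ?]; case: j => [[|[|[|[|[|//]]]]] ?]);
  rewrite /= ?mulr0 ?mul0r ?mulr1 ?addr0 ?add0r.
Qed.

Lemma B5_14xR_chain : exists (C1 C2 : 'M[R]_5) (l : 'rV[R]_5),
  [/\ B5_14xR R *m C1 = 0, B5_14xR R *m C2 = C1 & (l *m C1) 0 0 = 1].
Proof.
(* Here B sends the column e0 to e1 and e1 to 0. *)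
exists (delta_mx (inord 1) 0), (delta_mx 0 0), (delta_mx 0 (inord 1)).
by split; [apply/matrixP => i j|apply/matrixP => i j|];
  rewrite mxE sum5 !mxE -!val_eqE /= !inordK //;
  try (case: i => [[|[|[|[|[|//]]]]] ?]; case: j => [[|[|[|[|[|//]]]]] ?]);
  rewrite /= ?mulr0 ?mul0r ?mulr1 ?addr0 ?add0r.
Qed.

End Nilpotent.

Theorem theorem1p1 (R : realType) :
  [/\ (forall (a b c tbar : R) (L : set 'rV[R]_5),
         a + b + c = 0 -> 0 < `|c| -> `|c| <= `|b| -> `|b| <= `|a| ->
         tbar \in listed_times R ->
         lattice_for (B6_8 a b c) tbar L ->
         solvmanifold_formal (B6_8 a b c) tbar L),
      (forall (a q s tbar : R) (L : set 'rV[R]_5),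
         a + 2 * q = 0 -> a * s != 0 -> (forall z : rat, s <> ratr z) ->
         tbar \in listed_times R ->
         lattice_for (B6_11 a q s) tbar L ->
         solvmanifold_formal (B6_11 a q s) tbar L),
      (forall (p r tbar : R) (L : set 'rV[R]_5),
         r != 0 -> (exists z : rat, r = ratr z) ->
         [\/ (exists r1 r2 : int,
                [/\ 0 < r2, r = r1%:~R / r2%:~R & tbar = 2 * pi * r2%:~R]),
             ((exists m : int, r = m%:~R) /\ tbar = pi) |
             (exists m : int,
                [/\ r = m%:~R, (2 %| m)%Z -> p = 0 & tbar = pi / 2])] ->
         lattice_for (B5_17xR p r) tbar L ->
         solvmanifold_formal (B5_17xR p r) tbar L) &
      (forall (tbar : R) (L : set 'rV[R]_5),
         tbar \in listed_times R ->
         lattice_for (B3_5xR3 R) tbar L ->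
         solvmanifold_formal (B3_5xR3 R) tbar L)]
  /\
  [/\ (forall (tbar : R) (L : set 'rV[R]_5),
         tbar \in listed_times R ->
         lattice_for (B6_10 R) tbar L ->
         ~ solvmanifold_formal (B6_10 R) tbar L),
      (forall (tbar : R) (L : set 'rV[R]_5),
         tbar \in listed_times R ->
         lattice_for (B5_14xR R) tbar L ->
         ~ solvmanifold_formal (B5_14xR R) tbar L) &
      (forall (tbar : R) (L : set 'rV[R]_5),
         tbar \in listed_times R ->
         lattice_for (B5_18xR R) tbar L ->
         ~ solvmanifold_formal (B5_18xR R) tbar L)].
Proof.
split; split.
- move=> a b c tbar L _ _ _ _ /listed_neq0 t0 lat.
  by apply: normal_formal => //; exact: B6_8_normal.
- move=> a q s tbar L _ _ _ /listed_neq0 t0 lat.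
  by apply: normal_formal => //; exact: B6_11_normal.
- move=> p r tbar L _ _ ht lat; apply: normal_formal => //; last exact: B5_17xR_normal.
  have pi0 : pi != 0 :> R by rewrite gt_eqF // pi_gt0.
  case: ht => [[r1 [r2 [r20 _ ->]]]|[_ ->] //|[m [_ _ ->]]].
    by rewrite !mulf_neq0 ?pnatr_eq0 // intr_eq0 gt_eqF.
  by rewrite mulf_neq0 // invr_eq0 pnatr_eq0.
- move=> tbar L /listed_neq0 t0 lat.
  by apply: normal_formal => //; exact: B3_5xR3_normal.
- move=> tbar L /listed_neq0 t0 lat; have [C1 [C2 [l [BC1 BC2 lC]]]] := B6_10_chain R.
  exact: (massey1_not_formal t0 lat BC1 BC2 lC).
- move=> tbar L /listed_neq0 t0 lat; have [C1 [C2 [l [BC1 BC2 lC]]]] := B5_14xR_chain R.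
  exact: (massey1_not_formal t0 lat BC1 BC2 lC).
- by move=> tbar L /listed_neq0 t0 lat; exact: massey2_not_formal.
Qed.
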